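(* Let $D\in W^{2,\infty}(U)$ be the (periodic) interaction potential and let $A\in B_{2,2}(\Omega)$ be a graphop, so that its numerical radius $n(A)$ is finite. Let $\rho_0$ be an admissible initial datum with $\hat H(\rho_0|\rho_\infty)<\infty$. Let the coupling coefficient $\kappa>0$ satisfy $$\kappa<\frac{2\pi^2}{L^2\,\|\Delta_x D\|_{L^\infty(U)}\,n(A)} .$$ Then the classical solution $\rho$ of the graphop McKean--Vlasov equation $$\partial_t\rho=\kappa\,\mathrm{div}_x\big(\rho V[A](\rho)\big)+\Delta_x\rho,\qquad \rho(0)=\rho_0,$$ satisfies $$\hat H(\rho(t)|\rho_\infty)\le e^{-\hat\alpha(A)t}\,\hat H(\rho_0|\rho_\infty),\qquad t\ge 0,$$ where $$\hat\alpha(A):=\frac{4\pi^2}{L^2}-2\kappa\,\|\Delta_xD\|_{L^\infty(U)}\,n(A)>0 .$$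
   Context: Setting. $d\ge1$, $L>0$, and $U=[-\frac L2,\frac L2]^d$ is the $d$-dimensional flat torus of side length $L$ (all functions of $x\in U$, including $D$, are periodic; Sobolev spaces on $U$ are those of the torus). $(\Omega,\mathcal A,\mu)$ is a Borel probability space with $\operatorname{supp}\mu=\Omega$, and $L^p(\Omega)=L^p(\Omega,\mu)$ is real-valued. $\mathcal P_{\rm ac}(U)$ (resp. $\mathcal P_{\rm ac}(U\times\Omega)$) denotes probability densities with respect to $dx$ (resp. $dx\times\mu$). Graphops. A $P$-operator is a linear operator $A:L^\infty(\Omega)\to L^1(\Omega)$ with $\|A\|_{\infty\to1}:=\sup_{v\in L^\infty(\Omega)}\|Av\|_{L^1(\Omega)}/\|v\|_{L^\infty(\Omega)}<\infty$. It is self-adjoint if $\int_\Omega gAf\,d\mu=\int_\Omega fAg\,d\mu$ for all $f,g\in L^\infty(\Omega)$, and positivity preserving if $f\ge0$ implies $Af\ge0$. A graphop is a positivity preserving, self-adjoint $P$-operator. $B_{p,q}(\Omega)$ is the set of $P$-operators with $\|A\|_{p\to q}:=\sup_{v\in L^\infty(\Omega)}\|Av\|_{L^q(\Omega)}/\|v\|_{L^p(\Omega)}<\infty$; such $A$ are identified with their unique bounded extension $L^p(\Omega)\to L^q(\Omega)$. For a graphop $A\in B_{2,2}(\Omega)$ the numerical radius is $n(A):=\sup\{(Af,f)_{L^2(\Omega)}: f\in L^2(\Omega),\ \|f\|_{L^2(\Omega)}=1\}$. Equation. The unknown is $\rho=\rho(t,x,\xi)$, $t\ge0$, $x\in U$,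 $\xi\in\Omega$, and $$V[A](\rho)(t,x,\xi):=\int_U\nabla_xD(x-\tilde x)\,(A\rho)(t,\tilde x,\xi)\,d\tilde x,$$ where $(A\rho)(t,\tilde x,\xi):=[A\rho(t,\tilde x,\cdot)](\xi)$, i.e. $A$ acts only on the variable $\xi$. A classical solution is one such that for a.e. $\xi\in\Omega$, $\rho(\cdot,\cdot,\xi)\in C^1(0,\infty;C^2(U))$ solves the equation with the interaction term $V[A](\rho)(\cdot,\cdot,\xi)$. Admissible data. $\rho_0$ is admissible if $\rho_0(\cdot,\xi)\in H^{3+d}(U)\cap\mathcal P_{\rm ac}(U)$ for a.e. $\xi\in\Omega$, and $\rho_0(x,\cdot)\in L^\infty(\Omega,\mu)$ for each $x\in U$. Entropy. $\rho_\infty(x,\xi):=L^{-d}$ and $\hat H(\rho|\rho_\infty):=\int_\Omega\int_U\rho\log\big(\tfrac{\rho}{\rho_\infty}\big)\,dx\,d\mu(\xi)$. Convention: the upper bound on $\kappa$ is read as $+\infty$ if its denominator vanishes. *)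

(* Defs.v *)
From HB Require Import structures.
From mathcomp Require Import all_boot all_order all_algebra.
From mathcomp Require Import all_classical all_reals all_analysis.

Set Implicit Arguments.
Unset Strict Implicit.
Unset Printing Implicit Defensive.

Import Order.TTheory GRing.Theory Num.Theory.
Import numFieldNormedType.Exports.

Local Open Scope classical_set_scope.
Local Open Scope ring_scope.

Section borel_rV.
Context (R : realType) (n : nat).

Let coord (i : 'I_n) (x : 'rV[R]_n) : measurableTypeR R := x ord0 i.

Let rV_set0 : g_sigma_preimage coord set0.
Proof. exact: sigma_algebra0. Qed.

Let rV_setC A : g_sigma_preimage coord A -> g_sigma_preimage coord (~` A).
Proof. exact: sigma_algebraC. Qed.

Let rV_bigcup (F : (set 'rV[R]_n)^nat) :
  (forall i, g_sigma_preimage coord (F i)) ->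
  g_sigma_preimage coord (\bigcup_i (F i)).
Proof. exact: sigma_algebra_bigcup. Qed.

HB.instance Definition _ := @isMeasurable.Build default_measure_display
  'rV[R]_n (g_sigma_preimage coord) rV_set0 rV_setC rV_bigcup.

Lemma measurable_coord (i : 'I_n) :
  measurable_fun [set: 'rV[R]_n] (fun x : 'rV[R]_n => x ord0 i : measurableTypeR R).
Proof.
move=> _ Y mY; rewrite setTI; apply: sub_sigma_algebra => /=.
rewrite -bigcup_seq/=; exists i => /=; first by rewrite mem_index_enum.
by exists Y => //; rewrite setTI.
Qed.

Lemma measurable_fun_rV d (T : measurableType d) (f : T -> 'rV[R]_n) :
  (forall i, measurable_fun [set: T] (fun x => f x ord0 i : measurableTypeR R)) ->
  measurable_fun [set: T] f.
Proof.
move=> mf; apply: (@measurability _ _ _ _ _ _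
  (\big[setU/set0]_(i < n) preimage_set_system setT (coord i) measurable)) => //.
move=> _ [B + <-]; rewrite -bigcup_seq => -[i _] [C mC <-].
by rewrite !setTI -comp_preimage -[X in measurable X]setTI; exact: mf.
Qed.

End borel_rV.

Section lebesgue_rV.
Context (R : realType).

Definition cons_rV n (p : measurableTypeR R * 'rV[R]_n) : 'rV[R]_n.+1 :=
  @row_mx R 1 1 n (const_mx p.1) p.2.

Definition uncons_rV n (x : 'rV[R]_n.+1) : measurableTypeR R * 'rV[R]_n :=
  (x ord0 ord0, @rsubmx R 1 1 n x).

Lemma cons_rV0 n (p : measurableTypeR R * 'rV[R]_n) :
  cons_rV p ord0 ord0 = p.1.
Proof. by rewrite mxE; case: fintype.splitP => // j _; rewrite mxE. Qed.

Lemma cons_rVS n (p : measurableTypeR R * 'rV[R]_n) (i : 'I_n) :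
  cons_rV p ord0 (lift ord0 i) = p.2 ord0 i.
Proof.
rewrite mxE; case: fintype.splitP => [[[|//] ?]//|k /= ik].
by congr (_ _ _); apply: val_inj; move: ik => /eqP; rewrite eqSS => /eqP.
Qed.

Lemma cons_rVK n : cancel (@cons_rV n) (@uncons_rV n).
Proof.
by move=> p; rewrite /uncons_rV cons_rV0 /cons_rV row_mxKr -surjective_pairing.
Qed.

Lemma measurable_cons_rV n : measurable_fun [set: _] (@cons_rV n).
Proof.
apply: measurable_fun_rV => i; case: (unliftP ord0 i) => [j ->|->].
  apply: (eq_measurable_fun
    ((fun x : 'rV[R]_n => x ord0 j : measurableTypeR R) \o snd)) => //=.
    by move=> p _; rewrite cons_rVS.
  by apply: measurableT_comp => //; exact: measurable_coord.
by apply: (eq_measurable_fun fst) => //= p _; rewrite cons_rV0.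
Qed.

Lemma measurable_uncons_rV n : measurable_fun [set: _] (@uncons_rV n).
Proof.
apply/measurable_fun_pairP; split; first exact: (@measurable_coord R n.+1 ord0).
apply: measurable_fun_rV => i /=.
apply: (eq_measurable_fun
  (fun x : 'rV[R]_n.+1 => x ord0 (rshift 1 i) : measurableTypeR R)).
  by move=> x _; rewrite mxE.
exact: (@measurable_coord R n.+1).
Qed.

Section step.
Context (n : nat) (m : {sigma_finite_measure set 'rV[R]_n -> \bar R}).

Definition lebesgue_rV_step : set 'rV[R]_n.+1 -> \bar R :=
  pushforward (@lebesgue_measure R \x m)%E (@cons_rV n).


Let mstep : {measure set 'rV[R]_n.+1 -> \bar R} :=
  measure_function_pushforward__canonical__measure_function_Measure
    (@lebesgue_measure R \x m)%E (@measurable_cons_rV n).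

Let step0 : lebesgue_rV_step set0 = 0%E.
Proof. exact: (measure0 mstep). Qed.

Let step_ge0 A : (0 <= lebesgue_rV_step A)%E.
Proof. exact: (measure_ge0 mstep). Qed.

Let step_sigma_additive : semi_sigma_additive lebesgue_rV_step.
Proof. exact: (@measure_semi_sigma_additive _ _ _ mstep). Qed.

HB.instance Definition _ :=
  isMeasure.Build _ _ _ lebesgue_rV_step step0 step_ge0 step_sigma_additive.

Let step_sigma_finite : sigma_finite [set: 'rV[R]_n.+1] lebesgue_rV_step.
Proof.
have [F TF Foo] : sigma_finite setT (@lebesgue_measure R \x m)%E.
  have /sigma_finiteP[F [TF ndF Foo]] := sigma_finiteT (@lebesgue_measure R).
  have /sigma_finiteP[G [TG ndG Goo]] := sigma_finiteT m.
  exists (fun k => F k `*` G k).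
    rewrite -setXTT TF TG predeqE => -[x y]; split.
      move=> [/= [i _ Fix] [k _ Gky]]; exists (maxn i k) => //; split.
      - by move: x Fix; exact/subsetPset/ndF/leq_maxl.
      - by move: y Gky; exact/subsetPset/ndG/leq_maxr.
    by move=> [i _ []/= ? ?]; split; exists i.
  move=> k; have [? ?] := Foo k; have [? ?] := Goo k.
  split; first exact: measurableX.
  by rewrite product_measure1E// lte_mul_pinfty// ge0_fin_numE.
exists (fun k => @uncons_rV n @^-1` F k).
  by rewrite -preimage_bigcup -TF preimage_setT.
move=> k; have [mFk Fkoo] := Foo k; split.
  by rewrite -[X in measurable X]setTI; exact: measurable_uncons_rV.
rewrite /lebesgue_rV_step /pushforward -comp_preimage.
by rewrite (_ : _ \o _ = id) //; apply/funext => p; exact: cons_rVK.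
Qed.

HB.instance Definition _ := Measure_isSigmaFinite.Build _ _ _ lebesgue_rV_step
  step_sigma_finite.

End step.

Fixpoint lebesgue_rV n : {sigma_finite_measure set 'rV[R]_n -> \bar R} :=
  match n with
  | 0 => \d_(0 : 'rV[R]_0)
  | n'.+1 => lebesgue_rV_step (lebesgue_rV n')
  end.

Lemma measurable_box n (a b : 'I_n -> R) :
  measurable [set x : 'rV[R]_n | forall i, a i <= x ord0 i <= b i].
Proof.
rewrite (_ : mkset _ = \bigcap_(i in [set: 'I_n])
    ((fun x : 'rV[R]_n => x ord0 i : measurableTypeR R) @^-1` `[a i, b i])).
  apply: fin_bigcap_measurable => // i _.
  by rewrite -[X in measurable X]setTI; apply: measurable_coord.
apply/seteqP; split => x /= H i; first by move=> _; rewrite /= in_itv; exact: H.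
by have := H i Logic.I; rewrite /= in_itv.
Qed.

Lemma lebesgue_rV_box n (a b : 'I_n -> R) : (forall i, a i <= b i) ->
  lebesgue_rV n [set x | forall i, a i <= x ord0 i <= b i] =
  (\prod_(i < n) (b i - a i))%:E.
Proof.
elim: n a b => [|n IH] a b ab /=.
  by rewrite big_ord0 diracE mem_set// => -[].
pose a' i := a (lift ord0 i); pose b' i := b (lift ord0 i).
rewrite /lebesgue_rV_step /pushforward.
set B := [set x : 'rV[R]_n | forall i, a' i <= x ord0 i <= b' i].
rewrite (_ : _ @^-1` _ = `[a ord0, b ord0] `*` B); last first.
  apply/seteqP; split => [p /= H|p /= [Hr Hx] i].
    split; first by have := H ord0; rewrite in_itv/= cons_rV0.
    by move=> i; have := H (lift ord0 i); rewrite cons_rVS.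
  case: (unliftP ord0 i) => [j ->|->].
    by have := Hx j; rewrite cons_rVS.
  by move: Hr; rewrite in_itv/= cons_rV0.
have mB : measurable B by exact: measurable_box.
rewrite product_measure1E//= lebesgue_measure_itv/= lte_fin.
rewrite /B IH => [|i]; last exact: ab.
rewrite big_ord_recl EFinM EFinB; congr (_ * _)%E.
by have := ab ord0; rewrite le_eqVlt => /predU1P[->|->//]; rewrite ltxx subee.
Qed.

End lebesgue_rV.

Section torus.
Context (R : realType) (d : nat) (L : R).
Local Notation Rd := 'rV[R]_d.
Implicit Types (u v g phi : Rd -> R) (s : seq 'I_d).

Definition unit_vec (i : 'I_d) : Rd := delta_mx ord0 i.

(* Functions on the flat torus are represented by L-periodic functions on R^d. *)
Definition periodic u := forall x i, u (x + L *: unit_vec i) = u x.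

Definition cell : set Rd := [set x | forall i, - (L / 2) <= x ord0 i <= L / 2].

Lemma measurable_cell : measurable cell.
Proof. exact: measurable_box. Qed.

Definition torus_measure : {measure set Rd -> \bar R} :=
  mrestr (lebesgue_rV R d) measurable_cell.

Definition pderiv (i : 'I_d) u : Rd -> R := fun x => 'D_(unit_vec i) u x.

Definition pderivs s u := foldr pderiv u s.

Definition classCk k u :=
  forall s, (size s <= k)%N ->
    continuous (pderivs s u) /\
    ((size s < k)%N -> forall i x, derivable (pderivs s u) x (unit_vec i)).

Definition torus_Ck k u := periodic u /\ classCk k u.

Definition torus_smooth u := forall k, torus_Ck k u.

Definition C2norm u : \bar R :=
  ereal_sup [set `|pderivs s u x|%:E | s in [set s | (size s <= 2)%N] & x in setT].

Definition weak_deriv s u g :=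
  [/\ periodic g, g \in Lfun torus_measure 1 &
    forall phi, torus_smooth phi ->
      \int[torus_measure]_x (u x * pderivs s phi x) =
      (-1) ^+ size s * \int[torus_measure]_x (g x * phi x)].

Definition sobolev k (p : \bar R) u :=
  [/\ periodic u, u \in Lfun torus_measure p &
    forall s, (size s <= k)%N ->
      exists2 g, weak_deriv s u g & g \in Lfun torus_measure p].

(* A chosen representative of the weak derivative, which is unique up to
   equality almost everywhere. *)
Definition wderiv s u : Rd -> R := xget (cst 0) [set g | weak_deriv s u g].

Definition wgrad u (i : 'I_d) := wderiv [:: i] u.

Definition wlap u : Rd -> R := fun x => \sum_(i < d) wderiv [:: i; i] u x.

Definition Linfty_norm u : R := fine 'N[torus_measure]_+oo[EFin \o u]%E.

Definition prob_density u :=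
  [/\ u \in Lfun torus_measure 1,
      {ae torus_measure, forall x, 0 <= u x} &
      \int[torus_measure]_x u x = 1].

(* t |-> w t as a map from the open half-line to the Banach space C^2 of the
   torus, continuously differentiable in norm. *)
Definition time_deriv (w : R -> Rd -> R) t : Rd -> R := fun x => derive1 (w ^~ x) t.

Definition C1C2 (w : R -> Rd -> R) :=
  forall t, 0 < t ->
    [/\ torus_Ck 2 (w t),
        torus_Ck 2 (time_deriv w t),
        C2norm (fun x => h^-1 * (w (t + h) x - w t x) - time_deriv w t x)
          @[h --> 0^'] --> 0%E &
        C2norm (fun x => time_deriv w r x - time_deriv w t x)
          @[r --> t] --> 0%E].

End torus.

Section graphop.
Context (R : realType) (d : measure_display) (T : measurableType d).
Context (mu : {measure set T -> \bar R}).
Implicit Types (A B : (T -> R) -> T -> R) (f g u v : T -> R).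

(* Operators between Lebesgue spaces are represented on functions; they respect
   equality almost everywhere and are linear up to it. *)
Definition ae_linear_op (p q : \bar R) A :=
  [/\ forall u, u \in Lfun mu p -> A u \in Lfun mu q,
      forall u v, u \in Lfun mu p -> v \in Lfun mu p ->
        u = v %[ae mu] -> A u = A v %[ae mu] &
      forall (a : R) u v, u \in Lfun mu p -> v \in Lfun mu p ->
        A (fun x => a * u x + v x) = (fun x => a * A u x + A v x) %[ae mu]].

Definition op_norm (p q : \bar R) A : \bar R :=
  ereal_sup [set ('N[mu]_q[EFin \o A v] * ((fine 'N[mu]_p[EFin \o v])^-1)%:E)%E
    | v in [set v | v \in Lfun mu +oo /\ ('N[mu]_p[EFin \o v] != 0)%E]].

Definition P_operator A := ae_linear_op +oo 1 A /\ (op_norm +oo 1 A < +oo)%E.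

Definition B_class p q A := P_operator A /\ (op_norm p q A < +oo)%E.

Definition self_adjoint_op A :=
  forall f g, f \in Lfun mu +oo -> g \in Lfun mu +oo ->
    \int[mu]_x (g x * A f x) = \int[mu]_x (f x * A g x).

Definition positivity_preserving A :=
  forall f, f \in Lfun mu +oo ->
    {ae mu, forall x, 0 <= f x} -> {ae mu, forall x, 0 <= A f x}.

Definition graphop A :=
  [/\ P_operator A, self_adjoint_op A & positivity_preserving A].

Definition is_extension p q A B :=
  [/\ ae_linear_op p q B,
      exists C : R, forall f, f \in Lfun mu p ->
        ('N[mu]_q[EFin \o B f] <= C%:E * 'N[mu]_p[EFin \o f])%E &
      forall v, v \in Lfun mu +oo -> B v = A v %[ae mu]].

(* The bounded extension to the whole L^p space, unique up to equality almost
   everywhere when it exists (p finite). *)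
Definition extension p q A : (T -> R) -> T -> R :=
  xget A [set B | is_extension p q A B].

Definition numerical_radius A : R :=
  sup [set \int[mu]_x (extension 2%:E 2%:E A f x * f x)
    | f in [set f | f \in Lfun mu 2%:E /\ ('N[mu]_2%:E[EFin \o f] = 1)%E]].

End graphop.

Section mckean_vlasov.
Context (R : realType) (d : nat) (L : R).
Context (dT : measure_display) (T : measurableType dT).
Context (mu : {measure set T -> \bar R}).
Local Notation Rd := 'rV[R]_d.
Local Notation dx := (@torus_measure R d L).

Definition admissible (rho0 : Rd -> T -> R) :=
  [/\ measurable_fun [set: Rd * T] (fun p => rho0 p.1 p.2),
      {ae mu, forall xi, sobolev L (3 + d)%N 2%:E (rho0 ^~ xi) /\
                         prob_density L (rho0 ^~ xi)} &
      forall x, cell L x -> rho0 x \in Lfun mu +oo].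

(* [Arho] is a jointly measurable representative of the function
   (t, x, xi) |-> [A rho(t, x, .)](xi), which the operator determines only up
   to a null set of xi for each (t, x); its integrability in x gives a meaning
   to the convolution in [velocity]. *)
Definition action_version (A : (T -> R) -> T -> R)
    (rho Arho : R -> Rd -> T -> R) :=
  [/\ measurable_fun [set p : measurableTypeR R * Rd * T | 0 < p.1.1]
        (fun p => Arho p.1.1 p.1.2 p.2),
      forall t x, 0 < t -> rho t x \in Lfun mu 2%:E,
      forall t x, 0 < t ->
        Arho t x = extension mu 2%:E 2%:E A (rho t x) %[ae mu] &
      {ae mu, forall xi, forall t, 0 < t ->
        (fun x => Arho t x xi) \in Lfun dx 1}].

Definition velocity (D : Rd -> R) (Arho : R -> Rd -> T -> R) (i : 'I_d)
    (t : R) (x : Rd) (xi : T) : R :=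
  \int[dx]_y (wgrad L D i (x - y) * Arho t y xi).

Definition mv_equation (D : Rd -> R) (kappa : R)
    (rho Arho : R -> Rd -> T -> R) (xi : T) :=
  forall t x, 0 < t ->
    let flux i := fun y => rho t y xi * velocity D Arho i t y xi in
    (forall i, derivable (flux i) x (unit_vec R i)) /\
    time_deriv (fun r y => rho r y xi) t x =
      kappa * \sum_(i < d) pderiv i (flux i) x +
      \sum_(i < d) pderivs [:: i; i] (fun y => rho t y xi) x.

(* The initial datum is attained literally at t = 0 and as a limit in L^2 of
   the torus when t decreases to 0. *)
Definition classical_solution (D : Rd -> R) (A : (T -> R) -> T -> R)
    (kappa : R) (rho0 : Rd -> T -> R) (rho : R -> Rd -> T -> R) :=
  [/\ measurable_fun [set p : measurableTypeR R * Rd * T | 0 <= p.1.1]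
        (fun p => rho p.1.1 p.1.2 p.2),
      exists2 Arho, action_version A rho Arho &
        {ae mu, forall xi, C1C2 L (fun t x => rho t x xi) /\
                           mv_equation D kappa rho Arho xi},
      {ae mu, forall xi, forall x, rho 0 x xi = rho0 x xi} &
      {ae mu, forall xi,
        ('N[dx]_2%:E[EFin \o (fun x => rho t x xi - rho0 x xi)%R])%E
          @[t --> 0^'+] --> 0%E}].

Definition rho_infty : R := (L ^+ d)^-1.

Definition entropy (rho : Rd -> T -> R) : \bar R :=
  (\int[mu]_xi \int[dx]_x (rho x xi * ln (rho x xi / rho_infty))%:E)%E.

End mckean_vlasov.

Definition measure_support (R : realType) (T : ptopologicalType)
    (mu : {measure set (g_sigma_algebraType (@open T)) -> \bar R}) : set T :=
  [set x | forall O : set T, open O -> O x -> (0 < mu O)%E].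

(* Main.v *)
(** For almost every [xi] the curve [t |-> rho t . xi] solves a Fokker-Planck equation with drift
    [kappa * (grad D) * (A rho)]. In its entropy balance the drift term is integrated by parts onto [D];
    as [Delta D] has mean zero, constants can be subtracted from both factors, so that the term is at most
    [kappa |Delta D|_oo l(xi) a(xi)], where [l] and [a] are the [L^1] distances of [rho(xi)] to [1 / L^d]
    and of [A rho (xi)] to [A (1 / L^d)]. Positivity and self-adjointness of [A] give
    [\int l a <= \int l A l <= n(A) \int l^2], and [l^2 <= 2 H] by Pinsker's inequality. The diffusion
    term is at least [(4 pi^2 / L^2) H] by a logarithmic Sobolev inequality on the torus, and Gronwall's
    lemma concludes. Since [rho] may vanish and is only known to be continuous in [L^2] at [t = 0], the
    balance is written for the densities [(1 - e) rho + e / L^d], and [e] tends to [0] after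
    integration over [xi]. *)

Require Import Defs.
From HB Require Import structures.
From mathcomp Require Import all_boot all_order all_algebra.
From mathcomp Require Import all_classical all_reals all_analysis.
From mathcomp Require Import measurable_realfun ess_sup_inf ring lra.

Set Implicit Arguments.
Unset Strict Implicit.
Unset Printing Implicit Defensive.

Import Order.TTheory GRing.Theory Num.Theory.
Import numFieldNormedType.Exports.

Local Open Scope classical_set_scope.
Local Open Scope ring_scope.

(** * Integration on the torus *)

(** The coupling acts across [xi], so no estimate closes at a fixed parameter: each curve only
    yields an integrated balance whose source contains the distance of [A rho] from [A (1 / L^d)],
    possibly with infinite time integral. These balances are averaged by Tonelli's theorem in the
    extended reals, for which the entropy is rewritten with a nonnegative integrand, and only the
    average obeys a Gronwall inequality. A separate crude bound, linear in time, supplies the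
    finiteness needed for subtraction and the value at time [0]. Nonnegativity and mass one at
    positive times are derived, from the decay of the [L^1] norm. As [D] has only bounded second
    derivatives, the velocity is merely Lipschitz along the axes, and integration by parts is set up
    for such functions. In the rate, the [2] before [kappa] is Pinsker's constant. The term
    [4 pi^2 / L^2] corresponds to a logarithmic Sobolev constant twice the optimal one, which leaves
    room for an elementary argument on the circle. *)

Section continuous_measurable.
Context (R : realType).

(** The sigma-algebra is generated by the coordinates; it is linked to the topology here. An open
    set is the union of those boxes inside it that have a rational centre and half-width
    [1 / (k + 1)], and these are countably many. *)
Lemma open_measurable_rV n (U : set 'rV[R]_n) : open U -> measurable U.
Proof.
move=> oU.
pose B (p : 'rV[rat]_n * nat) : set 'rV[R]_n :=
  [set x | forall i, ratr (p.1 ord0 i) - p.2.+1%:R^-1 <= x ord0 i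
                     <= ratr (p.1 ord0 i) + p.2.+1%:R^-1].
pose I := [set p | B p `<=` U].
have -> : U = \bigcup_(p in I) B p.
  apply/seteqP; split => [x Ux|x [p Ip Bx]]; last exact: Ip.
  have /nbhs_ballP[e /= e0 He] : nbhs x U by exact: open_nbhs_nbhs.
  have [k ke] : exists k, k.+1%:R^-1 < e / 2 :> R.
    have [k _ /(_ k (leqnn k))] := near_infty_natSinv_lt (PosNum (divr_gt0 e0 (ltr0n R 2))).
    by exists k.
  have hk : (0 : R) < k.+1%:R^-1 by rewrite invr_gt0.
  have Hq (i : 'I_n) : exists q : rat, ratr q \in `]x ord0 i, (x ord0 i + k.+1%:R^-1)[.
    by apply: rat_in_itvoo; rewrite ltrDl.
  pose qq : 'rV[rat]_n := \row_i sval (cid (Hq i)).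
  have Hqq i : x ord0 i < ratr (qq ord0 i) < x ord0 i + k.+1%:R^-1.
    by rewrite mxE; case: cid => /= r; rewrite in_itv.
  exists (qq, k) => /=; last first.
    by move=> i; have /andP[h1 h2] := Hqq i; rewrite lerBlDr (ltW h2)/= (le_trans (ltW h1))// lerDl ltW.
  move=> y /= By; apply: He; split => //.
    move=> a i; rewrite (_ : a = ord0); last exact: ord1.
  rewrite -ball_normE /ball_ /=.
  have aux (u v q c : R) : u < q -> q < u + c -> q - c <= v -> v <= q + c ->
    c < e / 2 -> `|u - v| < e.
    by move=> *; rewrite ltr_norml; apply/andP; split; lra.
  have := By i; have := Hqq i => /andP[h1 h2] /andP[/= h3 h4].
  exact: (aux _ _ _ _ h1 h2 h3 h4 ke).
have mB p : measurable (B p) by exact: measurable_box.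
rewrite bigcup_mkcond; apply: countable_bigcupT_measurable => // p.
by case: ifPn => // _; exact: measurable0.
Qed.

Lemma continuous_measurable_rV n (f : 'rV[R]_n -> R) :
  continuous f -> measurable_fun [set: 'rV[R]_n] f.
Proof.
move=> cf; apply: (measurability _ (measurable_realfun.RGenOInfty.measurableE R)) => //.
move=> _ [_ [a ->] <-].
rewrite setTI; apply: open_measurable_rV.
by apply: open_comp => [x _|]; [exact: cf|exact: interval_open].
Qed.
End continuous_measurable.

Section mrestr_integral.
Context d (T : measurableType d) (R : realType).
Variables (mu : {measure set T -> \bar R}) (D : set T) (mD : measurable D).

Lemma ge0_integral_mrestr (f : T -> \bar R) : measurable_fun [set: T] f ->
  (forall x, 0 <= f x)%E ->
  (\int[mrestr mu mD]_x f x = \int[mu]_(x in D) f x)%E.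
Proof.
move=> mf f0; have D0 : mrestr mu mD (~` D) = 0%E by rewrite /mrestr setICl measure0.
rewrite [LHS](@ge0_negligible_integral _ _ _ (mrestr mu mD) _ (~` D)) => //.
  2: exact: measurableC.
rewrite setTD setCK; apply: eq_measure_integral => A mA AD.
by rewrite /= /mrestr setIidl.
Qed.

Lemma integral_mrestr (f : T -> \bar R) : measurable_fun [set: T] f ->
  (\int[mrestr mu mD]_x f x = \int[mu]_(x in D) f x)%E.
Proof.
move=> mf; rewrite [LHS]integralE [RHS]integralE.
by rewrite !ge0_integral_mrestr//; [exact: measurable_funeneg|exact: measurable_funepos].
Qed.

End mrestr_integral.

(** * The circle and the reflection invariance of its integral *)

Section circle.
Context (R : realType).
Implicit Types L : R.

(** The circle is one closed period of the line with Lebesgue measure; functions on it are periodic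
    functions on the line, as for [torus_measure]. *)
Definition circle_measure L : set (measurableTypeR R) -> \bar R :=
  mrestr (@lebesgue_measure R) (measurable_itv `[- (L / 2), L / 2]).

HB.instance Definition _ L := Measure.on (circle_measure L).

Let circle_fin L : fin_num_fun (circle_measure L).
Proof.
move=> U mU; rewrite /circle_measure /mrestr ge0_fin_numE//.
apply: (@le_lt_trans _ _ (@lebesgue_measure R `[- (L / 2), L / 2])).
  by apply: le_measure; rewrite ?inE//; exact: measurableI.
by rewrite lebesgue_measure_itv/=; case: ifP => // _; rewrite -EFinD ltry.
Qed.

HB.instance Definition _ L :=
  Measure_isFinite.Build _ _ _ (circle_measure L) (@circle_fin L).

Lemma circle_measureT L : 0 <= L -> circle_measure L setT = L%:E.
Proof.
move=> L0; rewrite /circle_measure /mrestr setTI lebesgue_measure_itv/= lte_fin.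
case: ltP => [_|h]; first by rewrite -EFinD; congr EFin; lra.
by congr EFin; lra.
Qed.

Lemma ge0_integral_circle L (f : R -> \bar R) : measurable_fun [set: R] f ->
  (forall x, 0 <= f x)%E ->
  (\int[circle_measure L]_x f x =
   \int[lebesgue_measure]_(x in [set` `[- (L / 2), L / 2]%R]) f x)%E.
Proof.
move=> mf f0.
exact: (@ge0_integral_mrestr _ (measurableTypeR R) R (@lebesgue_measure R) _ _ f mf f0).
Qed.

Lemma integral_circle L (f : R -> \bar R) : measurable_fun [set: R] f ->
  (\int[circle_measure L]_x f x =
   \int[lebesgue_measure]_(x in [set` `[- (L / 2), L / 2]%R]) f x)%E.
Proof.
move=> mf.
exact: (@integral_mrestr _ (measurableTypeR R) R (@lebesgue_measure R) _ _ f mf).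
Qed.

Lemma measurable_reflect (v : R) :
  measurable_fun [set: measurableTypeR R] (fun x => v - x : measurableTypeR R).
Proof. by apply: measurable_funB. Qed.

Lemma lebesgue_measure_reflect (v : R) (A : set (measurableTypeR R)) : measurable A ->
  lebesgue_measure ((fun x : R => v - x) @^-1` A) = lebesgue_measure A.
Proof.
move=> mA; apply/esym.
have mphi := measurable_reflect v.
pose m := measure_function_pushforward__canonical__measure_function_Measure
    (@lebesgue_measure R) mphi.
suff : @lebesgue_measure R A = m A by [].
apply: lebesgue_measure_unique => // _ [[a b] /= ab <-].
rewrite /m/= /pushforward /=.
rewrite (_ : _ @^-1` _ = `[v - b, v - a[%classic).
  by rewrite !lebesgue_measure_itv/= !lte_fin; (have -> : (v - b < v - a) = (a < b) by rewrite ltrD2l ltrN2); case: ifP => // _; rewrite -!EFinB; congr EFin; lra.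
by apply/seteqP; split => x /=; rewrite !in_itv/= => /andP[h1 h2]; apply/andP; split; lra.
Qed.

Lemma ge0_integral_lebesgue_reflect (v : R) (f : R -> \bar R) :
  measurable_fun [set: R] f -> (forall x, 0 <= f x)%E ->
  (\int[lebesgue_measure]_x f (v - x)%R = \int[lebesgue_measure]_x f x)%E.
Proof.
move=> mf f0.
have := @ge0_integral_pushforward _ _ _ _ _ _ (measurable_reflect v) (@lebesgue_measure R) setT f measurableT mf.
rewrite preimage_setT => <- //.
by apply: (@eq_measure_integral _ (measurableTypeR R) R setT lebesgue_measure (measure_function_pushforward__canonical__measure_function_Measure (@lebesgue_measure R) (measurable_reflect v))) => A mA _; exact: lebesgue_measure_reflect.
Qed.

(** Reflections suffice, a translation being a product of two of them. With [v] reduced modulo [L]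
    to [w], the reflected period is [[w - L/2, w + L/2]]; it shares [[w - L/2, L/2[] with the
    original period, and what remains is the translate by [L] of the missing piece. *)
Lemma ge0_integral_circle_reflect L (v : R) (f : R -> \bar R) : 0 < L ->
  (forall x, f (x + L) = f x) -> measurable_fun [set: R] f ->
  (forall x, 0 <= f x)%E ->
  (\int[circle_measure L]_x f (v - x)%R = \int[circle_measure L]_x f x)%E.
Proof.
move=> L0 fL mf f0.
have fLn (k : nat) x : f (x + k%:R * L) = f x.
  elim: k x => [|k IH] x; first by rewrite mul0r addr0.
  by rewrite -natr1 mulrDl mul1r addrA fL IH.
have fLz (k : int) x : f (x + k%:~R * L) = f x.
  case: k => k; first exact: fLn.
  by rewrite NegzE -[LHS](fLn k.+1) rmorphN/= mulNr subrK.
pose k := Num.floor (v / L).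
pose w := v - k%:~R * L.
have w0 : 0 <= w.
  by rewrite subr_ge0 -ler_pdivlMr// floor_le_tmp.
have wL : w < L.
  have : v / L < (k + 1)%:~R by have /andP[] := floor_itv (v / L).
  by rewrite ltr_pdivrMr// intrD mulrDl mul1r /w ltrBlDl.
have -> : (fun x => f (v - x)) = (fun x => f (w - x)).
  by apply/funext => x; rewrite -(fLz k (w - x)); congr f; rewrite /w; lra.
clearbody w; clear k.
pose D := `[- (L / 2), L / 2]%classic : set R.
pose E := `[w - L / 2, w + L / 2]%classic : set R.
have mg (B : set R) : measurable B -> measurable_fun [set: R] (fun x => f x * (\1_B x)%:E)%E.
  move=> mB; apply: emeasurable_funM => //; apply/measurable_EFinP.
  exact: measurable_indic.
have mid (B : set R) : measurable B ->
    (\int[lebesgue_measure]_(x in B) f x = \int[lebesgue_measure]_x (f x * (\1_B x)%:E))%E.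
  move=> mB; rewrite integral_mkcond; apply: eq_integral => x _.
  by rewrite patchE indicE; case: ifPn => _; rewrite ?mule1 ?mule0.
(* The translation by [L] is the product of the reflections [x |-> - L - x] and [x |-> - x], both of
   which preserve Lebesgue integrals. *)
have step (a b : R) : (\int[lebesgue_measure]_(x in `[(a + L)%R, (b + L)%R[%classic) f x =
   \int[lebesgue_measure]_(x in `[a, b[%classic) f x)%E.
  rewrite !mid//.
  rewrite -[RHS](ge0_integral_lebesgue_reflect (- L)) //; last 2 first.
    by apply: mg.
    by move=> x; rewrite mule_ge0.
  rewrite -[LHS](ge0_integral_lebesgue_reflect 0) //; last 2 first.
    by apply: mg.
    by move=> x; rewrite mule_ge0.
  apply: eq_integral => x _; rewrite -(fL (- L - x)) (_ : - L - x + L = 0 - x); last by lra.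
  congr (_ * (_)%:E)%E; rewrite !indicE; congr (_%:R); congr nat_of_bool.
  apply/idP/idP; rewrite !inE/= !in_itv/= => /andP[h1 h2]; apply/andP; split; lra.
have DE (y : R) : (y \in `[- (L / 2), L / 2]%classic) = (w - y \in E).
  by apply/idP/idP; rewrite /E !inE/= !in_itv/= => /andP[h1 h2]; apply/andP; split; lra.
transitivity (\int[lebesgue_measure]_(x in E) f x)%E.
  rewrite ge0_integral_circle//; last first.
    by apply: measurableT_comp mf _; exact: measurable_reflect.
  rewrite mid; last exact: measurable_itv.
  rewrite -[RHS](ge0_integral_lebesgue_reflect w)//; last 2 first.
    by apply: mg; exact: measurable_itv.
    by move=> x; rewrite mule_ge0.
  rewrite integral_mkcond; apply: eq_integral => x _.
  rewrite patchE indicE.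
  have -> : (x \in `[- (L / 2), L / 2]%classic) = (w - x \in E) by exact: DE.
  by case: ifPn => _; rewrite ?mule1 ?mule0.
rewrite ge0_integral_circle// /E -integral_itv_bndo_bndc; last exact: measurable_funTS.
rewrite -[RHS]integral_itv_bndo_bndc; last exact: measurable_funTS.
rewrite (_ : `[w - L / 2, w + L / 2[%classic = `[w - L / 2, L / 2[%classic `|` `[L / 2, w + L / 2[%classic :> set R); last first.
  apply/seteqP; split => x /=; rewrite !in_itv/=; first by case: (ltP x (L / 2)) => h /andP[h1 h2]; [left|right]; apply/andP; split; lra.
  by case => /andP[h1 h2]; apply/andP; split; lra.
rewrite (_ : `[- (L / 2), L / 2[%classic = `[w - L / 2, L / 2[%classic `|` `[- (L / 2), w - L / 2[%classic :> set R); last first.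
  apply/seteqP; split => x /=; rewrite !in_itv/=; first by case: (ltP x (w - L / 2)) => h /andP[h1 h2]; [right|left]; apply/andP; split; lra.
  by case => /andP[h1 h2]; apply/andP; split; lra.
rewrite !ge0_integral_setU//; try exact: measurable_funTS.
- congr (_ + _)%E; rewrite -(step (- (L / 2)) (w - L / 2)).
  have e1 : L / 2 = - (L / 2) + L by lra.
  have e2 : w + L / 2 = w - L / 2 + L by lra.
  by rewrite -e1 -e2.
- apply/disj_setPS => x /= []; rewrite !in_itv/=; lra.
- apply/disj_setPS => x /= []; rewrite !in_itv/=; lra.
Qed.

End circle.

(** * The torus as an iterated product of circles *)

Section torus_integral.
Context (R : realType).
Implicit Types L : R.

Lemma lebesgue_rV_cell d L : 0 <= L -> lebesgue_rV R d (cell L) = (L ^+ d)%:E.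
Proof.
move=> L0; rewrite lebesgue_rV_box; last by move=> i; lra.
rewrite prodr_const card_ord; congr ((_ ^+ _)%:E); lra.
Qed.

(** The same measure as [torus_measure], under a name to which the structure of a finite measure is
    attached; product measures and Fubini's theorem ask for it. *)
Definition torus_fmeasure d L : set 'rV[R]_d -> \bar R :=
  mrestr (lebesgue_rV R d) (@measurable_cell R d L).

HB.instance Definition _ d L := Measure.on (@torus_fmeasure d L).

Let torus_fin d L : fin_num_fun (@torus_fmeasure d L).
Proof.
move=> U mU; rewrite /torus_fmeasure /mrestr ge0_fin_numE//.
apply: (@le_lt_trans _ _ (lebesgue_rV R d (cell L))).
  apply: le_measure; rewrite ?inE//; last exact: measurable_cell.
  by apply: measurableI => //; exact: measurable_cell.
have [L0|L0] := leP 0 L; first by rewrite lebesgue_rV_cell// ltry.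
case: d U mU => [|d] U mU.
  by rewrite /= diracE ltry.
rewrite (_ : cell L = set0) ?measure0//.
by apply/seteqP; split => x //= /(_ ord0) h; exfalso; lra.
Qed.

HB.instance Definition _ d L :=
  Measure_isFinite.Build _ _ _ (@torus_fmeasure d L) (@torus_fin d L).

Lemma torus_measureT d L : 0 <= L -> torus_measure d L setT = (L ^+ d)%:E.
Proof. by move=> L0; rewrite /= /mrestr setTI lebesgue_rV_cell. Qed.

Lemma torus_measure_fin d L : (torus_measure d L setT < +oo)%E.
Proof.
by rewrite -ge0_fin_numE//; exact: (@fin_num_measure _ _ _ (@torus_fmeasure d L)).
Qed.

Lemma uncons_rVK d : cancel (@uncons_rV R d) (@cons_rV R d).
Proof.
move=> x; apply/rowP => i; case: (unliftP ord0 i) => [j ->|->].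
  rewrite cons_rVS mxE; congr (x _ _); apply/val_inj => //=.
by rewrite cons_rV0.
Qed.

(** A measure on a product is determined by its values on rectangles, and there the cell of
    dimension [d + 1] splits into an interval and the cell of dimension [d]. *)
Lemma torus_measureS d L (A : set 'rV[R]_d.+1) : measurable A ->
  torus_measure d.+1 L A = (circle_measure L \x @torus_fmeasure d L)%E (@cons_rV R d @^-1` A).
Proof.
move=> mA.
have mu := @measurable_uncons_rV R d.
pose m := measure_function_pushforward__canonical__measure_function_Measure
  (torus_measure d.+1 L) mu.
have -> : torus_measure d.+1 L A = m (@cons_rV R d @^-1` A).
  rewrite /m /= /pushforward; congr (mrestr _ _ _).
  by apply/seteqP; split => x /=; rewrite uncons_rVK.
apply/esym; apply: product_measure_unique; last first.
  by rewrite -[X in measurable X]setTI; exact: measurable_cons_rV.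
move=> B C mB mC.
rewrite /m /= /pushforward /= /mrestr /lebesgue_rV_step /pushforward.
rewrite (_ : _ @^-1` _ = (B `&` `[- (L / 2), L / 2]%classic) `*` (C `&` cell L)); last first.
  apply/seteqP; split => [[r y]|[r y] [[/= Br rL] [Cy yL]]].
    rewrite /= cons_rV0 [rsubmx _]row_mxKr => -[[/= Br Cy] rL]; split; split => //=.
      by have := rL ord0; rewrite cons_rV0 in_itv.
    by move=> i; have := rL (lift ord0 i); rewrite cons_rVS.
  rewrite /= cons_rV0 [rsubmx _]row_mxKr; split => // i; case: (unliftP ord0 i) => [j ->|->].
    by rewrite cons_rVS; exact: yL.
  by rewrite cons_rV0; rewrite in_itv in rL.
rewrite product_measure1E//; first exact: measurableI.
by apply: measurableI => //; exact: measurable_cell.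
Qed.

Lemma ge0_integral_torusS d L (f : 'rV[R]_d.+1 -> \bar R) :
  measurable_fun [set: 'rV[R]_d.+1] f -> (forall x, 0 <= f x)%E ->
  (\int[torus_measure d.+1 L]_x f x =
   \int[circle_measure L]_r \int[torus_measure d L]_y f (cons_rV (r, y)))%E.
Proof.
move=> mf f0.
have mc := @measurable_cons_rV R d.
pose m := measure_function_pushforward__canonical__measure_function_Measure
  (circle_measure L \x @torus_fmeasure d L)%E mc.
transitivity (\int[m]_x f x)%E.
  by apply: eq_measure_integral => A mA _; exact: torus_measureS.
rewrite ge0_integral_pushforward// preimage_setT.
rewrite (fubini_tonelli1 (f \o @cons_rV R d))//.
  exact: (measurableT_comp mf mc).
by move=> x; exact: f0.
Qed.

Lemma measurable_rV_reflect d (v : 'rV[R]_d) : measurable_fun [set: 'rV[R]_d] (fun x => v - x).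
Proof.
apply: measurable_fun_rV => i.
rewrite (_ : (fun x => _) = (fun r => v ord0 i - r) \o (fun x : 'rV[R]_d => x ord0 i)).
  by apply: measurableT_comp; [exact: measurable_reflect|exact: measurable_coord].
by apply/funext => x /=; rewrite !mxE.
Qed.

Lemma unit_vecE d (i j : 'I_d) : unit_vec R i ord0 j = (j == i)%:R.
Proof. by rewrite /unit_vec mxE eqxx. Qed.

Lemma rowDE d (x y : 'rV[R]_d) i : (x + y) ord0 i = x ord0 i + y ord0 i.
Proof. by rewrite mxE. Qed.

Lemma rowBE d (x y : 'rV[R]_d) i : (x - y) ord0 i = x ord0 i - y ord0 i.
Proof. by rewrite !mxE. Qed.

Lemma rowZE d a (x : 'rV[R]_d) i : (a *: x) ord0 i = a * x ord0 i.
Proof. by rewrite !mxE. Qed.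

Lemma rV_eqP d (x y : 'rV[R]_d) : (forall i, x ord0 i = y ord0 i) -> x = y.
Proof. by move=> xy; apply/matrixP => a i; rewrite (ord1 a); exact: xy. Qed.

Lemma cons_rV_shift0 d L r (y : 'rV[R]_d) :
  cons_rV (r + L, y) = cons_rV (r, y) + L *: unit_vec R ord0.
Proof.
apply: rV_eqP => i; rewrite rowDE rowZE unit_vecE.
case: (unliftP ord0 i) => [j ->|->].
  by rewrite !cons_rVS /= mulr0 addr0.
by rewrite !cons_rV0 /= mulr1.
Qed.

Lemma cons_rV_shiftS d L r (y : 'rV[R]_d) i :
  cons_rV (r, y + L *: unit_vec R i) = cons_rV (r, y) + L *: unit_vec R (lift ord0 i).
Proof.
apply: rV_eqP => k; rewrite rowDE rowZE unit_vecE.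
case: (unliftP ord0 k) => [j ->|->].
  by rewrite !cons_rVS /= rowDE rowZE unit_vecE (inj_eq lift_inj).
by rewrite !cons_rV0 /= mulr0 addr0.
Qed.

Lemma cons_rVB d v r (w y : 'rV[R]_d) :
  cons_rV (v - r, w - y) = cons_rV (v, w) - cons_rV (r, y).
Proof.
apply: rV_eqP => k; rewrite rowBE.
case: (unliftP ord0 k) => [j ->|->].
  by rewrite !cons_rVS /= rowBE.
by rewrite !cons_rV0.
Qed.

(** Induction on the dimension: the inner integral is invariant by induction, the outer one by the
    case of the circle. *)
Lemma ge0_integral_torus_reflect d L (v : 'rV[R]_d) (f : 'rV[R]_d -> \bar R) : 0 < L ->
  (forall x i, f (x + L *: unit_vec R i)%R = f x) -> measurable_fun [set: 'rV[R]_d] f ->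
  (forall x, 0 <= f x)%E ->
  (\int[torus_measure d L]_x f (v - x)%R = \int[torus_measure d L]_x f x)%E.
Proof.
move=> L0; elim: d v f => [|d IH] v f fL mf f0.
  by apply: eq_integral => x _; congr f; apply/rowP => -[].
rewrite (ge0_integral_torusS L mf f0).
rewrite (ge0_integral_torusS (f := fun x => f (v - x)) L (measurableT_comp mf (measurable_rV_reflect v)) (fun x => f0 _)).
rewrite -(uncons_rVK v); case: (uncons_rV v) => {v} r0 w.
under eq_integral => r _.
  under eq_integral => y _ do rewrite -cons_rVB.
  rewrite (IH w (fun y => f (cons_rV (r0 - r, y))))//; last 2 first.
  - by move=> x i; rewrite cons_rV_shiftS.
  - by apply: measurableT_comp mf _; apply: measurableT_comp; [exact: measurable_cons_rV|exact: measurable_pair1].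
  over.
rewrite /=.
apply: (ge0_integral_circle_reflect r0 (f := fun r => \int[torus_measure d L]_y f (cons_rV (r, y)))%E) => //.
- by move=> x; apply: eq_integral => y _; rewrite cons_rV_shift0.
- apply: (@measurable_fun_fubini_tonelli_F _ _ _ _ R (@torus_fmeasure d L) (f \o @cons_rV R d)) => //.
    by apply: measurableT_comp mf _; exact: measurable_cons_rV.
  by move=> x; exact: f0.
- by move=> x; exact: integral_ge0.
Qed.

Lemma integral_torus_reflect d L (v : 'rV[R]_d) (f : 'rV[R]_d -> \bar R) : 0 < L ->
  (forall x i, f (x + L *: unit_vec R i)%R = f x) -> measurable_fun [set: 'rV[R]_d] f ->
  (\int[torus_measure d L]_x f (v - x)%R = \int[torus_measure d L]_x f x)%E.
Proof.
move=> L0 fL mf; rewrite [LHS]integralE [RHS]integralE.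
congr (_ - _)%E.
- rewrite -[RHS](ge0_integral_torus_reflect v L0)//; last 2 first.
  + by move=> x i; rewrite !funeposE fL.
  + exact: measurable_funepos.
  by apply: eq_integral => x _; rewrite !funeposE.
- rewrite -[RHS](ge0_integral_torus_reflect v L0)//; last 2 first.
  + by move=> x i; rewrite !funenegE fL.
  + exact: measurable_funeneg.
  by apply: eq_integral => x _; rewrite !funenegE.
Qed.

Lemma Rintegral_torus_reflect d L (v : 'rV[R]_d) (f : 'rV[R]_d -> R) : 0 < L ->
  Defs.periodic L f -> measurable_fun [set: 'rV[R]_d] f ->
  \int[torus_measure d L]_x f (v - x)%R = \int[torus_measure d L]_x f x.
Proof.
move=> L0 fL mf; congr fine.
rewrite -(integral_torus_reflect v L0 (f := EFin \o f))//.
- by move=> x i /=; rewrite fL.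
- exact/measurable_EFinP.
Qed.

End torus_integral.

(** * Integrals of real-valued functions *)

Section real_integral.
Context d (T : measurableType d) (R : realType) (mu : {measure set T -> \bar R}).
Implicit Types f g : T -> R.

Lemma Rintegrable_measurable f : mu.-integrable setT (EFin \o f) -> measurable_fun setT f.
Proof. by move=> /measurable_int/measurable_EFinP. Qed.

Lemma Rdominated_cvg (f_ : nat -> T -> R) f g :
  (forall n, measurable_fun setT (f_ n)) -> measurable_fun setT f ->
  {ae mu, forall x, f_ ^~ x @ \oo --> f x} ->
  mu.-integrable setT (EFin \o g) ->
  (forall n, {ae mu, forall x, `|f_ n x| <= g x}) ->
  \int[mu]_x f_ n x @[n --> \oo] --> \int[mu]_x f x.
Proof.
move=> mf_ mf ff ig fg.
have [] := @dominated_convergence _ T R mu setT measurableT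
  (fun n => EFin \o f_ n) (EFin \o f) (EFin \o g).
- by move=> n; apply/measurable_EFinP.
- exact/measurable_EFinP.
- apply: filterS ff => x fx _; apply: cvg_EFin; first exact: nearW.
  exact: fx.
- exact: ig.
- have : {ae mu, forall x n, `|f_ n x| <= g x} by exact: ae_foralln.
  by apply: filterS => x h n _; rewrite lee_fin.
move=> intf _ /= h; apply: fine_cvg; rewrite fineK //.
exact: integrable_fin_num.
Qed.

Lemma Rintegrable_le f g : measurable_fun setT f -> {ae mu, forall x, `|f x| <= g x} ->
  mu.-integrable setT (EFin \o g) -> mu.-integrable setT (EFin \o f).
Proof.
move=> mf fg ig; apply/integrableP; split; first exact/measurable_EFinP.
apply: le_lt_trans (_ : \int[mu]_x `|(EFin \o g) x| < +oo)%E; last by case/integrableP : ig.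
have mg := Rintegrable_measurable ig.
apply: ae_ge0_le_integral => //.
- by apply: measurableT_comp => //; exact/measurable_EFinP.
- by apply: measurableT_comp => //; exact/measurable_EFinP.
- apply: filterS fg => x h _ /=; rewrite lee_fin.
  by apply: le_trans h _; exact: ler_norm.
Qed.

Lemma Rintegrable_bounded f (M : R) : (mu setT < +oo)%E -> measurable_fun setT f ->
  {ae mu, forall x, `|f x| <= M} -> mu.-integrable setT (EFin \o f).
Proof.
move=> muoo mf fM; apply: (@Rintegrable_le _ (cst M)) => //.
by apply: measurable_bounded_integrable => //; exact: bounded_cst.
Qed.

Lemma RintegrableM_bounded f g (M : R) : measurable_fun setT f ->
  {ae mu, forall x, `|f x| <= M} ->
  mu.-integrable setT (EFin \o g) -> mu.-integrable setT (EFin \o (fun x => f x * g x)).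
Proof.
move=> mf fM ig; have mg := Rintegrable_measurable ig.
apply: (@Rintegrable_le _ (fun x => M * `|g x|)).
- exact: measurable_funM.
- by apply: filterS fM => x h; rewrite normrM ler_wpM2r.
- rewrite (_ : _ \o _ = fun x => M%:E * (abse \o (EFin \o g)) x)%E; last by apply/funext => x /=; rewrite EFinM.
  by apply: integrableZl => //; exact: integrable_abse.
Qed.

Lemma RintegrableD f g : mu.-integrable setT (EFin \o f) -> mu.-integrable setT (EFin \o g) ->
  mu.-integrable setT (EFin \o (fun x => f x + g x)).
Proof. by move=> fi gi; have := integrableD measurableT fi gi. Qed.

Lemma RintegrableB f g : mu.-integrable setT (EFin \o f) -> mu.-integrable setT (EFin \o g) ->
  mu.-integrable setT (EFin \o (fun x => f x - g x)).
Proof. by move=> fi gi; have := integrableB measurableT fi gi. Qed.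

Lemma RintegrableZ (c : R) f : mu.-integrable setT (EFin \o f) ->
  mu.-integrable setT (EFin \o (fun x => c * f x)).
Proof. by move=> fi; have := integrableZl measurableT c fi. Qed.

Lemma Rintegrable_sum (I : Type) (s : seq I) (f : I -> T -> R) :
  (forall i, mu.-integrable setT (EFin \o f i)) ->
  mu.-integrable setT (EFin \o (fun x => \sum_(i <- s) f i x)).
Proof.
move=> fi; elim: s => [|i s IH]; last first.
  by under eq_fun do rewrite big_cons; exact: RintegrableD.
by under eq_fun do rewrite big_nil; exact: integrable0.
Qed.

Lemma Rintegral_sum (I : Type) (s : seq I) (f : I -> T -> R) :
  (forall i, mu.-integrable setT (EFin \o f i)) ->
  \int[mu]_x (\sum_(i <- s) f i x) = \sum_(i <- s) \int[mu]_x f i x.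
Proof.
move=> fi; elim: s => [|i s IH].
  rewrite big_nil; under eq_Rintegral do rewrite big_nil.
  by rewrite /Rintegral integral0.
rewrite big_cons -IH; under eq_Rintegral do rewrite big_cons.
by rewrite RintegralD//; exact: Rintegrable_sum.
Qed.

Lemma Rintegrable_norm f : mu.-integrable setT (EFin \o f) ->
  mu.-integrable setT (EFin \o (fun x => `|f x|)).
Proof. by move=> fi; have := integrable_abse fi. Qed.

Lemma ae_eq_Rintegral f g : measurable_fun setT f -> measurable_fun setT g ->
  {ae mu, forall x, f x = g x} -> \int[mu]_x f x = \int[mu]_x g x.
Proof.
move=> mf mg fg; congr fine; apply: ae_eq_integral => //; try exact/measurable_EFinP.
by apply: filterS fg => x /= -> _.
Qed.

Lemma ae_le_Rintegral f g : mu.-integrable setT (EFin \o f) -> mu.-integrable setT (EFin \o g) ->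
  {ae mu, forall x, f x <= g x} -> \int[mu]_x f x <= \int[mu]_x g x.
Proof.
move=> fi gi fg.
have mf := Rintegrable_measurable fi; have mg := Rintegrable_measurable gi.
rewrite -subr_ge0 -RintegralB//.
rewrite (@ae_eq_Rintegral _ (fun x => `|g x - f x|)).
- exact: Rintegral_ge0.
- exact: measurable_funB.
- by apply: measurableT_comp => //; exact: measurable_funB.
- by apply: filterS fg => x h; rewrite ger0_norm// subr_ge0.
Qed.

Lemma RintegralE f : mu.-integrable setT (EFin \o f) ->
  (\int[mu]_x f x)%:E = (\int[mu]_x (f x)%:E)%E.
Proof. by move=> fi; rewrite fineK//; exact: integrable_fin_num. Qed.

End real_integral.

(** * Test functions and uniqueness almost everywhere *)

Section line_derivative.
Context (R : realType) (d : nat).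
Implicit Types (f : 'rV[R]_d -> R) (x v : 'rV[R]_d).

Let line_quotient f x v (s : R) :
  (fun h : R => h^-1 *: ((f \o shift (s *: v + x)) (h *: v) - f (s *: v + x))) =
  (fun h => h^-1 *: (((fun h : R => f (h *: v + x)) \o shift s) (h *: 1) - f (s *: v + x))).
Proof.
by apply/funext => h /=; congr (_ *: (f _ - _)); rewrite [h%:A]mulr1 scalerDl addrA.
Qed.

Lemma derivable_line f x v (s : R) :
  derivable f (s *: v + x) v = derivable (fun h : R => f (h *: v + x)) s 1.
Proof.
by rewrite /derivable line_quotient.
Qed.

Lemma derive_line f x v (s : R) :
  'D_v f (s *: v + x) = 'D_1 (fun h : R => f (h *: v + x)) s.
Proof.
by rewrite /derive line_quotient.
Qed.

(** A directional derivative is the derivative of a function of one variable, so that the chain rule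
    and the mean value theorem carry over from the line. *)
Lemma is_derive_line f x v (s a : R) :
  is_derive (s *: v + x) v f a <-> is_derive s 1 (fun h : R => f (h *: v + x)) a.
Proof.
split => -[df dfE].
  by split; [rewrite -derivable_line|rewrite -derive_line].
by split; [rewrite derivable_line|rewrite derive_line].
Qed.

Lemma is_derive_line0 f x v (a : R) :
  is_derive x v f a <-> is_derive (0 : R) 1 (fun h : R => f (h *: v + x)) a.
Proof. by rewrite -is_derive_line scale0r add0r. Qed.

Lemma is_derive_chain (phi : R -> R) f x v (a b : R) :
  is_derive (f x) 1 phi b -> is_derive x v f a -> is_derive x v (phi \o f) (b * a).
Proof.
move=> Hphi /is_derive_line0 Hf; apply/is_derive_line0.
by apply: (@is_derive1_comp _ phi); rewrite ?scale0r ?add0r.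
Qed.

Lemma is_derive_coord (x v : 'rV[R]_d) j : is_derive x v (fun y : 'rV[R]_d => y ord0 j) (v ord0 j).
Proof.
apply/is_derive_line0.
rewrite (_ : (fun h => _) = (fun h : R => v ord0 j * h + x ord0 j)); last first.
  by apply/funext => h; rewrite !mxE mulrC.
rewrite -[X in is_derive _ _ _ X]addr0 -[X in is_derive _ _ _ (X + _)]mulr1.
by apply: is_deriveD.
Qed.

End line_derivative.

Section test_functions.
Context (R : realType) (d : nat) (w : R).

(** A syntactic class of smooth functions, so that closure under derivatives is an induction. The
    logistic function [s = 1 / (1 + exp)] satisfies [s' = s (s - 1)], hence stays in the class; it
    turns the sign of a trigonometric polynomial into an approximate indicator. *)
Inductive test_fun : ('rV[R]_d -> R) -> Prop :=
| test_cst c : test_fun (fun=> c)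
| test_sin j : test_fun (fun x => sin (w * x ord0 j))
| test_cos j : test_fun (fun x => cos (w * x ord0 j))
| test_add f g : test_fun f -> test_fun g -> test_fun (fun x => f x + g x)
| test_mul f g : test_fun f -> test_fun g -> test_fun (fun x => f x * g x)
| test_logistic f : test_fun f -> test_fun (fun x => (1 + expR (f x))^-1).

Lemma is_derive_scale_coord (x : 'rV[R]_d) i j :
  is_derive x (unit_vec R i) (fun y : 'rV[R]_d => w * y ord0 j) (w * (j == i)%:R).
Proof. by rewrite -(unit_vecE R); apply: (is_deriveZ w); exact: is_derive_coord. Qed.

Lemma test_fun_derive f i : test_fun f ->
  exists2 g, test_fun g & forall x, is_derive x (unit_vec R i) f (g x).
Proof.
elim=> {f} [c|j|j|f g Tf [f' Tf' fE] Tg [g' Tg' gE]|f g Tf [f' Tf' fE] Tg [g' Tg' gE]|f Tf [f' Tf' fE]].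
- by exists (fun=> 0); [exact: test_cst|move=> x; exact: is_derive_cst].
- exists (fun x => cos (w * x ord0 j) * (w * (j == i)%:R)).
    by apply: test_mul; [exact: test_cos|exact: test_cst].
  by move=> x; apply: (is_derive_chain (is_derive_sin _)); exact: is_derive_scale_coord.
- exists (fun x => (-1 * sin (w * x ord0 j)) * (w * (j == i)%:R)).
    by apply: test_mul; [apply: test_mul; [exact: test_cst|exact: test_sin]|exact: test_cst].
  move=> x; rewrite mulN1r.
  by apply: (is_derive_chain (is_derive_cos _)); exact: is_derive_scale_coord.
- exists (fun x => f' x + g' x); first exact: test_add.
  by move=> x; exact: is_deriveD.
- exists (fun x => f x * g' x + g x * f' x).
    by apply: test_add; apply: test_mul.
  by move=> x; exact: is_deriveM.
- exists (fun x => f' x * ((1 + expR (f x))^-1 * ((1 + expR (f x))^-1 + -1))).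
    apply: test_mul => //; apply: test_mul; first exact: test_logistic.
    by apply: test_add; [exact: test_logistic|exact: test_cst].
  move=> x; have Hp y : 0 < 1 + expR y by rewrite addr_gt0// expR_gt0.
  pose h := fun y : R => (1 + expR y)^-1.
  have hd : is_derive (f x) 1 h (- (1 + expR (f x)) ^- 2 *: expR (f x)).
    rewrite -[X in - _ *: X]add0r; apply: is_deriveV; last by rewrite gt_eqF.
  rewrite (_ : _ * _ = (- (1 + expR (f x)) ^- 2 *: expR (f x)) * f' x).
    exact: (is_derive_chain hd).
  rewrite /GRing.scale /=; field.
  by rewrite gt_eqF.
Qed.

Lemma test_fun_continuous f : test_fun f -> continuous f.
Proof.
have Hc j : continuous (fun x : 'rV[R]_d => w * x ord0 j).
  by move=> x; apply: (continuous_comp (@coord_continuous _ _ _ ord0 j x)); exact: mulrl_continuous.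
elim=> {f} [c|j|j|f g _ fc _ gc|f g _ fc _ gc|f _ fc] x.
- exact: cst_continuous.
- by apply: (continuous_comp (Hc j x)); exact: continuous_sin.
- by apply: (continuous_comp (Hc j x)); exact: continuous_cos.
- exact: (cvgD (fc x) (gc x)).
- exact: (cvgM (fc x) (gc x)).
- have c1 : {for f x, continuous (fun y : R => 1 + expR y)}.
    by apply: (cvgD (cvg_cst _)); exact: continuous_expR.
  have c2 : {for 1 + expR (f x), continuous (@GRing.inv R)}.
    by apply: inv_continuous; rewrite gt_eqF// addr_gt0// expR_gt0.
  exact: (continuous_comp (continuous_comp (fc x) c1) c2).
Qed.

Lemma test_fun_periodic L f : w * L = pi *+ 2 -> test_fun f -> Defs.periodic L f.
Proof.
move=> wL.
have Hs x (i j : 'I_d) : w * (x + L *: unit_vec R i) ord0 j =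
    w * x ord0 j + (if j == i then pi *+ 2 else 0).
  rewrite rowDE rowZE unit_vecE mulrDr mulrA wL.
  by case: eqP; rewrite ?mulr1 ?mulr0.
elim=> {f} [c|j|j|f g _ fc _ gc|f g _ fc _ gc|f _ fc] x i //=.
- by rewrite Hs; case: eqP => _; rewrite ?addr0// sinD2pi.
- by rewrite Hs; case: eqP => _; rewrite ?addr0// cosD2pi.
- by rewrite fc gc.
- by rewrite fc gc.
- by rewrite fc.
Qed.

Lemma test_fun_pderivs f s : test_fun f -> test_fun (pderivs s f).
Proof.
move=> Tf; elim: s => //= i s IH.
have [g Tg gE] := test_fun_derive i IH.
rewrite (_ : pderiv i _ = g)//; apply/funext => x.
by rewrite /pderiv; have [_ ->] := gE x.
Qed.

Lemma test_fun_smooth L f : w * L = pi *+ 2 -> test_fun f -> torus_smooth L f.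
Proof.
move=> wL Tf k; split; first exact: test_fun_periodic.
move=> s _; have Ts := test_fun_pderivs s Tf.
split; first exact: test_fun_continuous.
by move=> _ i x; have [g _ gE] := test_fun_derive i Ts; have [] := gE x.
Qed.

Lemma test_fun_prod (F : 'I_d -> 'rV[R]_d -> R) : (forall j, test_fun (F j)) ->
  test_fun (fun x => \prod_(j < d) F j x).
Proof.
move=> TF; elim: (index_enum _) => [|a l IH].
  by rewrite (_ : (fun x => _) = fun=> 1); [exact: test_cst|apply/funext => x; rewrite big_nil].
rewrite (_ : (fun x => _) = fun x => F a x * \prod_(j <- l) F j x).
  exact: test_mul.
by apply/funext => x; rewrite big_cons.
Qed.

End test_functions.

Section test_uniqueness.
Context (R : realType) (d : nat) (L : R) (L0 : 0 < L).
Local Notation dx := (@torus_measure R d L).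
Local Notation w := (pi *+ 2 / L).

Lemma cvg_bigprod (I : Type) (s : seq I) (f : I -> nat -> R) (g : I -> R) :
  (forall i, f i n @[n --> \oo] --> g i) ->
  \prod_(i <- s) f i n @[n --> \oo] --> \prod_(i <- s) g i.
Proof.
move=> fg; elim: s => [|i s IH].
  by rewrite big_nil; under eq_fun do rewrite big_nil; exact: cvg_cst.
by rewrite big_cons; under eq_fun do rewrite big_cons; exact: cvgM.
Qed.

(** The exponent [m - m^2 q] is at least [m] when [q <= 0], and at most [- m] as soon as [m q >= 2]
    when [q > 0]; in both cases the error is at most [1 / (m + 1)]. The linear term decides the case
    [q = 0], so that the limit is the indicator of the strict inequality. *)
Lemma cvg_logistic (q : R) :
  (1 + expR (m%:R + - (m%:R * m%:R) * q))^-1 @[m --> \oo] --> ((0 < q)%R%:R : R).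
Proof.
have He (y : R) : 0 < 1 + expR y by rewrite addr_gt0// expR_gt0.
suff [K HK] : exists K : nat, forall m, (K <= m)%N ->
    `|(1 + expR (m%:R + - (m%:R * m%:R) * q))^-1 - (0 < q)%R%:R| <= m.+1%:R^-1.
  apply/cvgrPdist_lt => /= e e0.
  have [k _ Hk] := near_infty_natSinv_lt (PosNum e0).
  exists (maxn k K) => // m /=; rewrite geq_max => /andP[km Km].
  by rewrite distrC; apply: le_lt_trans (HK _ Km) _; exact: Hk.
have [q0|q0] := leP q 0.
  exists 0%N => m _; rewrite subr0 ger0_norm; last by rewrite invr_ge0 ltW.
  rewrite lef_pV2 ?posrE// -natr1 addrC lerD2l.
  apply: le_trans (expR_ge1Dx _).
  have : m%:R * m%:R * q <= 0 by rewrite mulr_ge0_le0// mulr_ge0.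
  by rewrite mulNr; lra.
exists (Num.truncn (2 / q)).+1 => m Km.
have Hm : 2 <= m%:R * q.
  rewrite -ler_pdivrMr// ltW//; apply: lt_le_trans (truncnS_gt _) _.
  by rewrite ler_nat.
set a := m%:R + _.
have am : expR a <= m.+1%:R^-1.
  have : expR a <= expR (- m%:R).
    rewrite ler_expR /a mulNr -mulrA.
    have : 0 <= m%:R * (m%:R * q - 2) by rewrite mulr_ge0// subr_ge0.
    by lra.
  move=> /le_trans; apply; rewrite expRN lef_pV2 ?posrE ?expR_gt0//.
  by rewrite -natr1 addrC expR_ge1Dx.
have -> : (1 + expR a)^-1 - true%:R = - (expR a / (1 + expR a)).
  by rewrite /=; field; rewrite gt_eqF.
rewrite normrN ger0_norm; last by rewrite divr_ge0 ?expR_ge0// ltW.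
apply: le_trans am; rewrite ler_pdivrMr//.
by rewrite ler_peMr ?expR_ge0// lerDl expR_ge0.
Qed.

(** With [t = pi x / L] and [beta = pi b / L] the expression equals [2 cos t sin (t - beta)]. Inside
    the period [cos t] is positive and [|t - beta| < pi], so its sign is that of [x - b]. *)
Lemma halfspace_sign (b x : R) : - (L / 2) < b < L / 2 -> - (L / 2) < x < L / 2 ->
  (0 < cos (pi / L * b) * sin (w * x) + - sin (pi / L * b) * (1 + cos (w * x))) = (b < x).
Proof.
move=> /andP[b1 b2] /andP[x1 x2].
set be := pi / L * b; pose t := pi / L * x.
have wx : w * x = t + t by rewrite /t; ring.
rewrite wx sinD cosD.
have c2 : cos t * cos t = 1 - sin t * sin t by rewrite -!expr2 cos2sin2.
have -> : cos be * (sin t * cos t + cos t * sin t) + - sin be * (1 + (cos t * cos t - sin t * sin t)) = 2 * cos t * sin (t - be).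
  rewrite sinB.
  have -> : 1 + (cos t * cos t - sin t * sin t) = 2 * (cos t * cos t) by rewrite c2; ring.
  by ring.
have pL : 0 < pi / L :> R by rewrite divr_gt0// pi_gt0.
have bound y : - (L / 2) < y -> y < L / 2 -> - (pi / 2) < pi / L * y < pi / 2.
  move=> y1 y2.
  have -> : pi / 2 = pi / L * (L / 2) :> R by field; rewrite gt_eqF.
  by rewrite -mulrN !ltr_pM2l// y1 y2.
have tb := bound _ x1 x2; have bb := bound _ b1 b2.
have ct : 0 < cos t by apply: cos_gt0_pihalf.
rewrite pmulr_rgt0 ?mulr_gt0//.
move: tb bb => /andP[t1 t2] /andP[e1 e2].
have bt : (b < x) = (be < t) by rewrite ltr_pM2l.
rewrite bt; case: (ltgtP be t) => h.
- by apply/idP; apply: sin_gt0_pi; rewrite subr_gt0 h/=; rewrite -/be in e1 e2; rewrite -/t in t1 t2; lra.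
- apply/negbTE; rewrite -leNgt -oppr_ge0 -sinN ltW//; apply: sin_gt0_pi.
  by rewrite -/be in e1 e2; rewrite -/t in t1 t2; lra.
- by rewrite h subrr sin0 ltxx.
Qed.

(** Corners outside the open period are covered by constants, so that the sign condition describes
    every half-line [b < x] within the period. *)
Let q (b : R) (j : 'I_d) : 'rV[R]_d -> R :=
  if b <= - (L / 2) then fun=> 1 else if L / 2 <= b then fun=> -1 else
  fun x => cos (pi / L * b) * sin (w * x ord0 j) + - sin (pi / L * b) * (1 + cos (w * x ord0 j)).

Let test_q b j : test_fun w (q b j).
Proof.
rewrite /q; case: ifP => _; first exact: test_cst.
case: ifP => _; first exact: test_cst.
apply: test_add; apply: test_mul; [exact: test_cst|exact: test_sin|exact: test_cst|].
by apply: test_add; [exact: test_cst|exact: test_cos].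
Qed.

Let q_sign b j (x : 'rV[R]_d) : - (L / 2) < x ord0 j < L / 2 -> (0 < q b j x) = (b < x ord0 j).
Proof.
move=> /andP[x1 x2]; rewrite /q; case: ifPn => [b1|]; first by rewrite ltr01 (le_lt_trans b1).
rewrite -ltNge => b1; case: ifPn => [b2|].
  by rewrite ltr0N1; apply/esym/negbTE; rewrite -leNgt (le_trans (ltW x2)).
by rewrite -ltNge => b2; apply: halfspace_sign; rewrite ?b1 ?b2 ?x1 ?x2.
Qed.

(** A face of the cell is a box with one side of length zero. *)
Lemma ae_cell_interior : {ae dx, forall x : 'rV[R]_d, forall j, - (L / 2) < x ord0 j < L / 2}.
Proof.
have ae_cell : {ae dx, forall x : 'rV[R]_d, cell L x}.
  exists (~` cell L); split; [apply: measurableC; exact: measurable_cell| |by []].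
  by rewrite /= /mrestr setICl measure0.
have ae_neq (j : 'I_d) (c : R) : - (L / 2) <= c <= L / 2 -> {ae dx, forall x : 'rV[R]_d, x ord0 j != c}.
  move=> /andP[c1 c2]; exists ((fun x : 'rV[R]_d => x ord0 j : measurableTypeR R) @^-1` [set c]); split.
  - by rewrite -[X in measurable X]setTI; apply: measurable_coord.
  - rewrite /= /mrestr.
    rewrite (_ : _ `&` _ = [set x : 'rV[R]_d | forall i, (if i == j then c else - (L / 2)) <= x ord0 i <= (if i == j then c else L / 2)]); last first.
      apply/seteqP; split => [x [/= xc xL] i|x /= H].
        by case: eqP => [->|_]; [rewrite xc lexx|exact: xL].
      split; first by have := H j; rewrite eqxx -eq_le => /eqP.
      move=> i; have := H i; case: eqP => [->|_//].
      by rewrite -eq_le => /eqP <-; rewrite c1 c2.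
    rewrite lebesgue_rV_box; last first.
      by move=> i; case: eqP => // _; lra.
    by rewrite (bigD1 j)//= eqxx subrr mul0r.
  - by move=> x /= /negP; rewrite negbK => /eqP.
have hL : - (L / 2) <= L / 2 by have := L0; lra.
have h1 : {ae dx, forall x : 'rV[R]_d, forall j : 'I_d, x ord0 j != L / 2}.
  by apply: filter_forall => j; apply: ae_neq; rewrite lexx hL.
have h2 : {ae dx, forall x : 'rV[R]_d, forall j : 'I_d, x ord0 j != - (L / 2)}.
  by apply: filter_forall => j; apply: ae_neq; rewrite lexx hL.
apply: filterS3 ae_cell h1 h2 => x xL x1 x2 j.
by have /andP[a b] := xL j; rewrite !lt_neqAle eq_sym x2 a x1 b.
Qed.

Let half (b : 'rV[R]_d) : set 'rV[R]_d := [set x | forall j, b ord0 j < x ord0 j].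

Lemma measurable_half b : measurable (half b).
Proof.
rewrite (_ : half b = \bigcap_(i in [set: 'I_d])
    ((fun x : 'rV[R]_d => x ord0 i : measurableTypeR R) @^-1` `]b ord0 i, +oo[)).
  apply: fin_bigcap_measurable => // i _.
  by rewrite -[X in measurable X]setTI; apply: measurable_coord.
apply/seteqP; split => x /= H i; first by move=> _; rewrite /= in_itv/= andbT; exact: H.
by have := H i Logic.I; rewrite /= in_itv/= andbT.
Qed.

(** A half-space in one coordinate is the union over [k] of the orthants whose corner is [- k] in
    all other coordinates. *)
Lemma measurable_half_gen : @measurable _ 'rV[R]_d = <<s range half >>.
Proof.
apply/seteqP; split; last first.
  apply: smallest_sub; first exact: sigma_algebra_measurable.
  by move=> _ [b _ <-]; exact: measurable_half.
apply: smallest_sub; first exact: smallest_sigma_algebra.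
pose T' := g_sigma_algebraType (range half).
have mcoord (j : 'I_d) : measurable_fun [set: T'] (fun x : T' => (x : 'rV[R]_d) ord0 j : R).
  apply: (measurability _ (measurable_realfun.RGenOInfty.measurableE R)) => //.
  move=> _ [_ [a ->] <-]; rewrite setTI.
  rewrite (_ : _ @^-1` _ = \bigcup_k (half (\row_i (if i == j then a else - k%:R)) : set T')).
    by apply: bigcupT_measurable => k; apply: sub_sigma_algebra; exists (\row_i (if i == j then a else - k%:R)).
  apply/seteqP; split => x /=; rewrite in_itv/= andbT; last first.
    by move=> [k _ /(_ j)]; rewrite mxE eqxx.
  move=> ax; exists (\sum_(i < d) (Num.truncn `|(x : 'rV[R]_d) ord0 i|).+1)%N => // i; rewrite mxE.
  case: eqP => [->//|_]; rewrite ltrNl.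
  apply: le_lt_trans (_ : `|(x : 'rV[R]_d) ord0 i| < _).
    by rewrite -normrN ler_norm.
  apply: lt_le_trans (truncnS_gt _) _; rewrite ler_nat.
  by rewrite (bigD1 i)//= leq_addr.
move=> B; rewrite -bigcup_seq => -[i _] [C mC <-].
by have := mcoord i measurableT C mC.
Qed.

(* Products of logistic functions of trigonometric polynomials approximate indicators of orthants,
   which form a pi-system generating the Borel sets. *)
Lemma test_fun_ae_unique (h : 'rV[R]_d -> R) : dx.-integrable setT (EFin \o h) ->
  (forall phi, torus_smooth L phi -> \int[dx]_x (h x * phi x) = 0) ->
  {ae dx, forall x, h x = 0}.
Proof.
move=> ih hphi.
have mh := Rintegrable_measurable ih.
have wL : w * L = pi *+ 2 by field; rewrite gt_eqF.
pose P (S : set 'rV[R]_d) := (\int[dx]_(x in S) (h x)%:E = 0)%E.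
have PT : P setT.
  have := hphi (fun=> 1) (test_fun_smooth wL (@test_cst R d w 1)).
  move=> e; rewrite /P -RintegralE//; congr EFin; rewrite -[RHS]e.
  by apply: eq_Rintegral => x _; rewrite mulr1.
have Phalf b : P (half b).
  rewrite /P integral_mkcond.
  rewrite (_ : (_ \_ _)%E = EFin \o (fun x => \1_(half b) x * h x)); last first.
    by apply/funext => x /=; rewrite patchE indicE; case: ifPn => _; rewrite ?mul1r ?mul0r.
  have mi : measurable_fun setT (\1_(half b) : 'rV[R]_d -> R).
    by apply: measurable_indic; exact: measurable_half.
  rewrite -RintegralE; last first.
    apply: (@RintegrableM_bounded _ _ _ _ _ _ 1) => //.
    by apply: aeW => x; rewrite indicE; case: (_ \in _); rewrite ?normr1 ?normr0.
  congr EFin.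
  pose phi (m : nat) (x : 'rV[R]_d) := \prod_(j < d) (1 + expR (m%:R + - (m%:R * m%:R) * q (b ord0 j) j x))^-1.
  have Tphi m : test_fun w (phi m).
    apply: test_fun_prod => j; apply: test_logistic; apply: test_add; first exact: test_cst.
    by apply: test_mul; [exact: test_cst|exact: test_q].
  have phi1 m x : `|phi m x| <= 1.
    rewrite /phi normr_prod; apply: prodr_ile1 => j _; rewrite normr_ge0/=.
    have e0 (y : R) : 0 < 1 + expR y by rewrite addr_gt0// expR_gt0.
    rewrite ger0_norm; last by rewrite invr_ge0 ltW.
    by rewrite invf_le1// lerDl expR_ge0.
  have mphi m : measurable_fun setT (phi m).
    by apply: continuous_measurable_rV; exact: test_fun_continuous (Tphi m).
  have : \int[dx]_x (phi m x * h x) @[m --> \oo] --> \int[dx]_x (\1_(half b) x * h x).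
    apply: (@Rdominated_cvg _ _ _ _ _ _ (fun x => `|h x|)).
    - by move=> m; apply: measurable_funM.
    - by apply: measurable_funM.
    - apply: filterS ae_cell_interior => x xi.
      apply: cvgM; last exact: cvg_cst.
      rewrite (_ : \1_(half b) x = \prod_(j < d) ((0 < q (b ord0 j) j x)%R%:R)); last first.
        rewrite indicE; have [xb|xb] := boolP (x \in half b).
          rewrite big1// => j _; rewrite q_sign//.
          by move: xb; rewrite inE => /(_ j) ->.
        have /existsP[j jb] : [exists j, ~~ (b ord0 j < x ord0 j)].
          rewrite -negb_forall; apply: contra xb => /forallP xb.
          by rewrite inE => j; exact: xb.
        by rewrite (bigD1 j)//= q_sign// (negbTE jb) mul0r.
      by apply: cvg_bigprod => j; exact: cvg_logistic.
    - exact: Rintegrable_norm.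
    - by move=> m; apply: aeW => x; rewrite normrM ler_piMl.
  have -> : (fun m => \int[dx]_x (phi m x * h x)) = fun=> 0.
    apply/funext => m; rewrite -[RHS](hphi _ (test_fun_smooth wL (Tphi m))).
    by apply: eq_Rintegral => x _; rewrite mulrC.
  by move=> c; apply/esym; apply: (cvg_unique _ (cvg_cst 0) c).
have PA A : measurable A -> P A.
  rewrite measurable_half_gen; apply: dynkin_induction => //.
  - exact: measurable_half_gen.
  - move=> _ _ [b _ <-] [c _ <-]; exists (\row_j Num.max (b ord0 j) (c ord0 j)) => //.
    apply/seteqP; split => [x /= H|x /= [H1 H2] j]; last by rewrite mxE gt_max H1 H2.
    by split => j; have := H j; rewrite mxE gt_max => /andP[].
  - by move=> _ [b _ <-]; exact: Phalf.
  - move=> S mS PS; have := PT; rewrite /P -(setUv S) integral_setU//.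
    + by rewrite PS add0e.
    + exact: measurableC.
    + by rewrite setUv; exact/measurable_EFinP.
    + by apply/disj_setPS; rewrite setICr.
  (* Countable additivity of the signed measure with density [h]. *)
  - move=> F mF tF PF; have := @charge_semi_sigma_additive _ _ _ (induced_charge ih) F mF tF (bigcupT_measurable _ mF).
    rewrite /induced_charge /P.
    rewrite (_ : (fun n => _) = fun=> 0%E); last by apply/funext => n; apply: big1 => i _; exact: PF.
    by move=> c; apply/esym; apply: (cvg_unique _ (cvg_cst 0%E) c).
have := @integral_ae_eq _ _ _ dx setT measurableT (cst 0%E) (EFin \o h) ih (measurable_cst _).
case.
  by move=> E _ mE; rewrite (PA E mE) integral0.
move=> N [mN N0 sN]; exists N; split => // x /= hx; apply: sN => /= /(_ Logic.I) [].
exact: hx.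
Qed.

End test_uniqueness.

(** * Wirtinger and logarithmic Sobolev inequalities on the circle *)

Section derivative_rules.
Context (R : realType) (V : normedModType R).
Implicit Types (f g : V -> R) (x v : V).

(** The rules for scalar functions in pointwise form, so that the derivative of an explicit formula
    is assembled as a term and then compared with the expected value through [is_derive_eq]. *)
Lemma is_derive_add f g x v (a b : R) : is_derive x v f a -> is_derive x v g b ->
  is_derive x v (fun y => f y + g y) (a + b).
Proof. exact: is_deriveD. Qed.

Lemma is_derive_sub f g x v (a b : R) : is_derive x v f a -> is_derive x v g b ->
  is_derive x v (fun y => f y - g y) (a - b).
Proof. exact: is_deriveB. Qed.

Lemma is_derive_mul f g x v (a b : R) : is_derive x v f a -> is_derive x v g b ->
  is_derive x v (fun y => f y * g y) (f x * b + g x * a).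
Proof. exact: is_deriveM. Qed.

Lemma is_derive_scale (c : R) f x v (a : R) : is_derive x v f a ->
  is_derive x v (fun y => c * f y) (c * a).
Proof. exact: is_deriveZ. Qed.

Lemma is_derive_sqr f x v (a : R) : is_derive x v f a ->
  is_derive x v (fun y => f y ^+ 2) (2 * f x * a).
Proof.
by move=> fa; apply: is_derive_eq (is_derive_mul fa fa) _; rewrite mulrC; ring.
Qed.

Lemma is_derive_chainR (phi : R -> R) (f : R -> R) (x a b : R) :
  is_derive (f x) 1 phi b -> is_derive x 1 f a -> is_derive x 1 (fun y => phi (f y)) (b * a).
Proof. by move=> h1 h2; exact: (@is_derive1_comp _ phi f x b a h1 h2). Qed.

End derivative_rules.

Section real_calculus.
Context (R : realType).
Local Notation leb := (@lebesgue_measure R).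
Implicit Types f g : R -> R.

Lemma continuous_within (A : set R) f : continuous f -> {within A, continuous f}.
Proof. by move=> cf; apply: continuous_subspaceT. Qed.

Lemma is_derive_continuous f (df : R -> R) : (forall x : R, is_derive x 1 f (df x)) -> continuous f.
Proof.
by move=> fd x; apply/differentiable_continuous/derivable1_diffP; have [] := fd x.
Qed.

Lemma continuous_shift f (s : R) : continuous f -> continuous (fun y => f (y + s)).
Proof.
move=> cf y; have c1 : {for y, continuous (fun y : R => y + s)}.
  exact: (cvgD cvg_id (cvg_cst _)).
exact: (continuous_comp c1 (cf _)).
Qed.

Lemma is_derive_shift f (s y a : R) : is_derive (y + s) 1 f a ->
  is_derive y 1 (fun y => f (y + s)) a.
Proof.
move=> fd; have H := is_derive_add (is_derive_id y 1) (is_derive_cst s y 1).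
have := @is_derive1_comp _ f (fun y => y + s) y a _ fd H.
by rewrite addr0 mulr1.
Qed.

Lemma continuous_integrable_itv f (a b : R) : {within `[a, b], continuous f} ->
  leb.-integrable `[a, b] (EFin \o f).
Proof. by move=> cf; apply: continuous_compact_integrable => //; exact: segment_compact. Qed.

Lemma Rintegral_FTC2 f (df : R -> R) (a b : R) : a < b ->
  (forall x : R, x \in `[a, b] -> is_derive x 1 f (df x)) -> {within `[a, b], continuous df} ->
  \int[leb]_(x in `[a, b]) df x = f b - f a.
Proof.
move=> ab fd cdf; rewrite /Rintegral (@continuous_FTC2 _ _ f)//.
- have fc x : x \in `[a, b] -> {for x, continuous f}.
    by move=> xab; apply/differentiable_continuous/derivable1_diffP; have [] := fd x xab.
  split.
  - move=> x xab; suff xab' : x \in `[a, b] by have [] := fd x xab'.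
    by move: xab; rewrite !in_itv/= => /andP[/ltW -> /ltW ->].
  - by apply: cvg_at_right_filter; apply: fc; rewrite in_itv/= lexx ltW.
  - by apply: cvg_at_left_filter; apply: fc; rewrite in_itv/= lexx ltW.
- move=> x xab; rewrite derive1E; suff xab' : x \in `[a, b] by have [_ ->] := fd x xab'.
  by move: xab; rewrite !in_itv/= => /andP[/ltW -> /ltW ->].
Qed.

(** The second-order term matters: the estimate [1 + 2 J + 2 J^2] of the cubic moment in
    [circle_logsobolev_sqr] is this polynomial at [2 J]. *)
Lemma expR_ge2 (x : R) : 0 <= x -> 1 + x + x ^+ 2 / 2 <= expR x.
Proof.
move=> x0.
pose f := fun y : R => expR y - (1 + y + y ^+ 2 / 2).
pose df := fun y : R => expR y - (1 + y).
have fd (y : R) : is_derive y 1 f (df y).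
  have H1 := is_derive_add (is_derive_cst (1 : R) y 1) (is_derive_id y 1).
  have H2 := is_derive_mul (is_derive_sqr (is_derive_id y 1)) (is_derive_cst (2^-1 : R) y 1).
  have H := is_derive_sub (is_derive_expR y) (is_derive_add H1 H2).
  apply: (is_derive_eq H).
  by rewrite /df /=; field.
have [|c] := @MVT_segment _ f df 0 x x0 (fun y _ => fd y).
  by apply: continuous_within; exact: is_derive_continuous fd.
rewrite in_itv/= => /andP[c0 _]; rewrite {2}/f expR0 expr0n/= mul0r !addr0 subrr subr0 => fE.
rewrite -subr_ge0 -/(f x) fE subr0 mulr_ge0//.
by rewrite subr_ge0 expR_ge1Dx.
Qed.

(* Completing the square with the Riccati solution [- la tan (la (x - (a + b) / 2))], for [la < pi / (b - a)]. *)
Lemma half_wirtinger f (df : R -> R) (a b : R) : a < b -> (forall x : R, is_derive x 1 f (df x)) ->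
  continuous df -> f a = 0 -> f b = 0 ->
  (pi / (b - a)) ^+ 2 * \int[leb]_(x in `[a, b]) (f x ^+ 2) <= \int[leb]_(x in `[a, b]) (df x ^+ 2).
Proof.
move=> ab fd cdf fa fb.
have cf := is_derive_continuous fd.
have cf2 : continuous (fun x => f x ^+ 2) by move=> x; exact: (cvgM (cf x) (cf x)).
have cdf2 : continuous (fun x => df x ^+ 2) by move=> x; exact: (cvgM (cdf x) (cdf x)).
have int_c (h : R -> R) : continuous h -> leb.-integrable `[a, b] (EFin \o h).
  by move=> ch; apply: continuous_integrable_itv; exact: continuous_within.
have step (la : R) : 0 <= la -> la < pi / (b - a) ->
    la ^+ 2 * \int[leb]_(x in `[a, b]) (f x ^+ 2) <= \int[leb]_(x in `[a, b]) (df x ^+ 2).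
  move=> la0 la1.
  pose m := (a + b) / 2.
  pose T (x : R) : R := la * (x - m).
  have Tb (x : R) : x \in `[a, b] -> 0 < cos (T x).
    rewrite in_itv/= => /andP[ax xb]; apply: cos_gt0_pihalf.
    have h : la * ((b - a) / 2) < pi / 2.
      rewrite mulrA ltr_pM2r ?invr_gt0//.
      by rewrite -ltr_pdivlMr// subr_gt0.
    have h1 : la * (x - m) <= la * ((b - a) / 2) by apply: ler_wpM2l => //; rewrite /m; lra.
    have h2 : la * (- ((b - a) / 2)) <= la * (x - m) by apply: ler_wpM2l => //; rewrite /m; lra.
    by rewrite mulrN in h2; rewrite /T; apply/andP; split; lra.
  pose wt (x : R) : R := - la * tan (T x).
  pose dwt (x : R) : R := - la * (la * (cos (T x)) ^- 2).
  have Td (x : R) : is_derive x 1 T la.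
    apply: is_derive_eq (is_derive_scale la (is_derive_sub (is_derive_id x 1) (is_derive_cst m x 1))) _.
    by rewrite subr0 mulr1.
  have wd (x : R) : x \in `[a, b] -> is_derive x 1 wt (dwt x).
    move=> xab; have ct : cos (T x) != 0 by rewrite gt_eqF// Tb.
    apply: is_derive_eq (is_derive_scale (- la) (is_derive1_comp (is_derive_tan ct) (Td x))) _.
    by rewrite /dwt; ring.
  (* [Phi] vanishes at both ends because [f] does, so its derivative integrates to zero; subtracting
     it turns [df^2 - la^2 f^2] into the square of [df + la t f], where [t] is the tangent of
     [T x]. *)
  pose Phi (x : R) : R := wt x * f x ^+ 2.
  pose dPhi (x : R) : R := wt x * (2 * f x * df x) + f x ^+ 2 * dwt x.
  have Pd (x : R) : x \in `[a, b] -> is_derive x 1 Phi (dPhi x).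
    by move=> xab; apply: is_derive_mul; [exact: wd|exact: is_derive_sqr].
  have cT : continuous T by exact: is_derive_continuous Td.
  have cwt (x : R) : x \in `[a, b] -> {for x, continuous wt}.
    by move=> /wd[/derivable1_diffP/differentiable_continuous].
  have cdw (x : R) : x \in `[a, b] -> {for x, continuous dwt}.
    move=> xab.
    have c1 : {for x, continuous (fun x => cos (T x) ^+ 2)}.
      have cc : {for x, continuous (fun x => cos (T x))} by exact: (continuous_comp (cT x) (@continuous_cos _ _)).
      exact: (cvgM cc cc).
    have c2 : {for x, continuous (fun x => (cos (T x) ^+ 2)^-1)}.
      by apply: cvgV => //; rewrite gt_eqF// exprn_gt0// Tb.
    by apply: cvgM; [exact: cvg_cst|apply: cvgM; [exact: cvg_cst|exact: c2]].
  have cdPhi : {within `[a, b], continuous dPhi}.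
    apply: continuous_in_subspaceT => x /set_mem /= xab.
    apply: cvgD; apply: cvgM.
    - exact: cwt.
    - by apply: cvgM; [apply: cvgM; [exact: cvg_cst|exact: cf]|exact: cdf].
    - exact: cf2.
    - exact: cdw.
  have Phi0 : \int[leb]_(x in `[a, b]) dPhi x = 0.
    by rewrite (Rintegral_FTC2 ab Pd cdPhi) /Phi fa fb expr0n/= !mulr0 subrr.
  rewrite -RintegralZl//; last exact: int_c.
  rewrite -subr_ge0 -RintegralB//; [|exact: int_c|]; last first.
    by apply: int_c => x; apply: cvgM; [exact: cvg_cst|exact: cf2].
  rewrite -Phi0; apply: le_Rintegral => //.
  - exact: continuous_integrable_itv.
  - by apply: int_c => x; apply: cvgB; [exact: cdf2|apply: cvgM; [exact: cvg_cst|exact: cf2]].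
  move=> x xab; have ct := Tb x xab.
  have E : (cos (T x)) ^- 2 = 1 + tan (T x) ^+ 2.
    rewrite /tan expr_div_n; apply: (@mulfI _ (cos (T x) ^+ 2)); first by rewrite expf_neq0// gt_eqF.
    rewrite mulfV ?expf_neq0 ?gt_eqF// mulrDr mulr1 mulrC mulfVK ?expf_neq0 ?gt_eqF//.
    by rewrite cos2Dsin2.
  rewrite /dPhi /dwt /wt E; set t := tan _.
  rewrite -subr_ge0 (_ : _ - _ = (df x + la * t * f x) ^+ 2) ?sqr_ge0//.
  by ring.
set A := \int[leb]_(x in `[a, b]) (f x ^+ 2) in step *.
set B := \int[leb]_(x in `[a, b]) (df x ^+ 2) in step *.
have La0 : 0 < pi / (b - a) :> R by rewrite divr_gt0 ?pi_gt0// subr_gt0.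
set La := pi / (b - a) in step La0 *.
(* The critical value [La] is approached by [La (1 - 1 / (n + 1))], where the cosine is positive on
   the whole closed interval. *)
have c : (La - La * n.+1%:R^-1) ^+ 2 * A @[n --> \oo] --> La ^+ 2 * A.
  have c0 : La - La * n.+1%:R^-1 @[n --> \oo] --> La.
    rewrite -[X in _ --> X]subr0 -[X in _ --> _ - X](mulr0 La).
    by apply: cvgB; [exact: cvg_cst|apply: cvgM; [exact: cvg_cst|exact: cvg_harmonic]].
  by apply: cvgM; [exact: (cvgM c0 c0)|exact: cvg_cst].
rewrite -(cvg_lim _ c)//; apply: limr_le; first by apply/cvg_ex; eexists; exact: c.
apply: nearW => n; apply: step; last by rewrite ltrBlDr ltrDl mulr_gt0.
rewrite subr_ge0 ler_piMr//; first exact: ltW.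
by rewrite invf_le1 ?ltr0n// ler1n.
Qed.

End real_calculus.

(** * Inequalities for periodic functions of one variable *)

Section circle_inequalities.
Context (R : realType) (L : R) (L0 : 0 < L).
Local Notation leb := (@lebesgue_measure R).
Local Notation circ := (circle_measure L).
Implicit Types f g : R -> R.

Lemma Rintegral_circle f : continuous f ->
  \int[circ]_x f x = \int[leb]_(x in `[- (L / 2), L / 2]) f x.
Proof.
move=> cf; congr fine; apply: (@integral_circle _ L (EFin \o f)).
by apply/measurable_EFinP; exact: continuous_measurable_fun.
Qed.

Lemma integrable_circle f : continuous f -> circ.-integrable setT (EFin \o f).
Proof.
move=> cf; have mf := continuous_measurable_fun cf.
have ab : - (L / 2) <= L / 2 by have := L0; lra.
have cn : {within `[- (L / 2), L / 2], continuous (fun x => `|f x|)}.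
  by apply: continuous_within => x; exact: (cvg_norm (cf x)).
have [c _ Hc] := EVT_max ab cn.
apply: (@Rintegrable_bounded _ _ _ _ _ `|f c|) => //.
  by have := circle_measureT (ltW L0) => /= ->; rewrite ltry.
exists (~` `[- (L / 2), L / 2]%classic); split => //.
- by apply: measurableC; exact: measurable_itv.
- by change (mrestr (@lebesgue_measure R) (measurable_itv `[- (L / 2), L / 2]) (~` `[- (L / 2), L / 2]%classic) = 0%E); rewrite /mrestr setICl measure0.
- by move=> x /= H xab; apply: H; apply: Hc.
Qed.

Lemma Rintegral_circle_reflect f (v : R) : continuous f -> (forall x, f (x + L) = f x) ->
  \int[circ]_x f (v - x) = \int[circ]_x f x.
Proof.
move=> cf fL; have mf := continuous_measurable_fun cf.
have mfE : measurable_fun [set: R] (EFin \o f) by exact/measurable_EFinP.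
congr fine; rewrite [LHS]integralE [RHS]integralE; congr (_ - _)%E.
- rewrite -[RHS](ge0_integral_circle_reflect v L0)//.
  + by apply: eq_integral => x _; rewrite !funeposE.
  + by move=> x; rewrite !funeposE /= fL.
  + exact: measurable_funepos.
- rewrite -[RHS](ge0_integral_circle_reflect v L0)//.
  + by apply: eq_integral => x _; rewrite !funenegE.
  + by move=> x; rewrite !funenegE /= fL.
  + exact: measurable_funeneg.
Qed.

Lemma Rintegral_circle_shift f (v : R) : continuous f -> (forall x, f (x + L) = f x) ->
  \int[circ]_x f (x + v) = \int[circ]_x f x.
Proof.
move=> cf fL; pose g x := f (- x).
have cg : continuous g.
  have cN := is_derive_continuous (fun x : R => is_deriveNid x 1).
  by move=> x; exact: (continuous_comp (cN x) (cf _)).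
have gL x : g (x + L) = g x by rewrite /g -(fL (- (x + L))); congr f; lra.
transitivity (\int[circ]_x g (- v - x)).
  by apply: eq_Rintegral => x _; rewrite /g; congr f; lra.
rewrite Rintegral_circle_reflect// -[RHS](Rintegral_circle_reflect 0)//.
by apply: eq_Rintegral => x _; rewrite /g sub0r.
Qed.

(** The mean minimizes the mean square deviation. In [wirtinger] this replaces the value [f x0] by
    the mean. *)
Lemma circle_variance f (c : R) : continuous f ->
  \int[circ]_x ((f x - (\int[circ]_y f y) / L) ^+ 2) <= \int[circ]_x ((f x - c) ^+ 2).
Proof.
move=> cf; set m := _ / L.
have cc (a : R) : continuous (fun _ : R => a) by exact: cst_continuous.
have cfB a : continuous (fun x => f x - a) by move=> x; exact: (cvgB (cf x) (cc a x)).
have cfS a : continuous (fun x => (f x - a) ^+ 2) by move=> x; exact: (cvgM (cfB a x) (cfB a x)).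
rewrite -subr_ge0 -RintegralB//; try exact: integrable_circle.
rewrite (_ : \int[circ]_x _ = \int[circ]_x ((2 * (m - c)) * (f x - m) + (m - c) ^+ 2)); last first.
  by apply: eq_Rintegral => x _; ring.
have h1 : circ.-integrable setT (EFin \o (fun x => 2 * (m - c) * (f x - m))).
  by apply: integrable_circle => x; exact: (cvgM (cc _ x) (cfB m x)).
rewrite RintegralD//; last exact: integrable_circle.
rewrite RintegralZl//; last exact: integrable_circle.
rewrite RintegralB//; [|exact: integrable_circle|exact: integrable_circle].
rewrite !Rintegral_cst// (_ : fine (circ setT) = L); last first.
  by have := circle_measureT (ltW L0) => /= ->.
have -> : \int[circ]_x f x = m * L by rewrite /m mulfVK// gt_eqF.
by rewrite subrr mulr0 add0r mulr_ge0 ?sqr_ge0// ltW.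
Qed.

(* By the intermediate value theorem [f x0 = f (x0 + L / 2)] for some [x0]; the inequality with
   vanishing end values then applies to [f - f x0] on both half circles. *)
Lemma wirtinger f (df : R -> R) : (forall x : R, is_derive x 1 f (df x)) -> continuous df ->
  (forall x, f (x + L) = f x) -> (forall x, df (x + L) = df x) ->
  (2 * pi / L) ^+ 2 * \int[circ]_x ((f x - (\int[circ]_y f y) / L) ^+ 2) <=
  \int[circ]_x (df x ^+ 2).
Proof.
move=> fd cdf fL dfL.
have cf := is_derive_continuous fd.
pose k x := f (x + L / 2) - f x.
have ck : continuous k.
  move=> x; apply: cvgB; last exact: cf.
  exact: continuous_shift.
have kL : k (L / 2) = - k 0.
  by rewrite /k add0r (_ : L / 2 + L / 2 = 0 + L) ?fL; [ring|lra].
have L20 : 0 <= L / 2 by have := L0; lra.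
have [x0 _ kx0] : exists2 c, c \in `[0, L / 2] & k c = 0.
  apply: IVT => //; first exact: continuous_within.
  rewrite kL; have [h|h] := leP (k 0) (- k 0).
    by apply/andP; split; lra.
  by apply/andP; split; lra.
pose c := f x0.
pose h x := f (x + x0) - c.
pose dh x := df (x + x0).
have hd (x : R) : is_derive x 1 h (dh x).
  have H := is_derive_sub (is_derive_shift (fd (x + x0))) (is_derive_cst c x 1).
  by apply: (is_derive_eq H); rewrite subr0.
have cdh : continuous dh.
  exact: continuous_shift.
have ch := is_derive_continuous hd.
have h0 : h 0 = 0 by rewrite /h add0r subrr.
have hp : h (L / 2) = 0 by rewrite /h (addrC (L / 2)) -[RHS]kx0.
have hm : h (- (L / 2)) = 0 by rewrite /h -fL -hp /h; congr (f _ - _); lra.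
have L2 : 0 < L / 2 by have := L0; lra.
have L2N : - (L / 2) < 0 by have := L0; lra.
have w1 := half_wirtinger L2N hd cdh hm h0.
have w2 := half_wirtinger L2 hd cdh h0 hp.
have E1 : (pi / (L / 2 - 0)) = 2 * pi / L :> R by field; have := L0; rewrite lt0r => /andP[].
have E2 : (pi / (0 - - (L / 2))) = 2 * pi / L :> R by rewrite -E1; congr (_ / _); lra.
rewrite E1 in w2; rewrite E2 in w1.
have ch2 : continuous (fun x => h x ^+ 2) by move=> x; exact: (cvgM (ch x) (ch x)).
have cdh2 : continuous (fun x => dh x ^+ 2) by move=> x; exact: (cvgM (cdh x) (cdh x)).
have split (g : R -> R) : continuous g -> \int[circ]_x g x =
    \int[leb]_(x in `[- (L / 2), 0]) g x + \int[leb]_(x in `[0, L / 2]) g x.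
  move=> cg; rewrite Rintegral_circle//.
  have ig : leb.-integrable `[- (L / 2), L / 2] (EFin \o g).
    by apply: continuous_integrable_itv; exact: continuous_within.
  have ig2 : leb.-integrable `[0, L / 2] (EFin \o g).
    by apply: continuous_integrable_itv; exact: continuous_within.
  have ig3 : leb.-integrable `]0, L / 2] (EFin \o g).
    by apply: integrableS ig2 => //; apply: subset_itvr; rewrite bnd_simp.
  rewrite -(Rintegral_itv_obnd_cbnd ig3) -(Rintegral_itvB ig)//.
    by rewrite addrC subrK.
  by rewrite bnd_simp ltW.
have key : (2 * pi / L) ^+ 2 * \int[circ]_x (h x ^+ 2) <= \int[circ]_x (dh x ^+ 2).
  by rewrite !split// mulrDr lerD.
have cfc2 : continuous (fun x => (f x - c) ^+ 2).
  have cfc : continuous (fun x => f x - c) by move=> x; exact: (cvgB (cf x) (cvg_cst _)).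
  by move=> x; exact: (cvgM (cfc x) (cfc x)).
have cdf2 : continuous (fun x => df x ^+ 2) by move=> x; exact: (cvgM (cdf x) (cdf x)).
rewrite (Rintegral_circle_shift x0 cdf2) in key; last by move=> x; rewrite dfL.
rewrite (Rintegral_circle_shift x0 cfc2) in key; last by move=> x; rewrite fL.
apply: le_trans key; rewrite ler_wpM2l ?sqr_ge0//; exact: circle_variance.
Qed.

(** The derivative of [y f (y + s)] with [s = x + L / 2] is integrated over a period. Both ends fall
    on [x] modulo [L], so the boundary terms give [L f x]; the mean of [f] is zero, and the
    remaining [y f' (y + s)] is split by Young's inequality with weight [al]. The integral of [y^2]
    is [L^3 / 12]. *)
Lemma circle_sup_bound f (df : R -> R) (al : R) : 0 < al ->
  (forall x : R, is_derive x 1 f (df x)) -> continuous df ->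
  (forall x, f (x + L) = f x) -> (forall x, df (x + L) = df x) ->
  \int[circ]_x f x = 0 ->
  forall x, L * f x <= al * L ^+ 3 / 12 + (4 * al)^-1 * \int[circ]_x (df x ^+ 2).
Proof.
move=> al0 fd cdf fL dfL f0 x.
have cf := is_derive_continuous fd.
pose s := x + L / 2.
pose G (y : R) : R := y * f (y + s).
pose dG (y : R) : R := y * df (y + s) + f (y + s).
have sd (g : R -> R) : continuous g -> continuous (fun y => g (y + s)).
  exact: continuous_shift.
have Gd (y : R) : is_derive y 1 G (dG y).
  have H := is_derive_mul (is_derive_id y 1) (is_derive_shift (fd (y + s))).
  by apply: (is_derive_eq H); rewrite /dG mulr1.
have cy1 : continuous (fun y : R => y * df (y + s)).
  by move=> y; apply: cvgM; [exact: cvg_id|exact: sd].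
have cdG : continuous dG.
  by move=> y; apply: cvgD; [exact: cy1|exact: sd].
have cdf2 : continuous (fun x => df x ^+ 2) by move=> y; exact: (cvgM (cdf y) (cdf y)).
have ab : - (L / 2) < L / 2 by have := L0; lra.
have IG : \int[circ]_y dG y = L * f x.
  rewrite Rintegral_circle// (Rintegral_FTC2 ab (fun y _ => Gd y)); last exact: continuous_within.
  rewrite /G (_ : - (L / 2) + s = x); last by rewrite /s; lra.
  rewrite (_ : L / 2 + s = x + L); last by rewrite /s; lra.
  by rewrite fL; field.
have I1 : \int[circ]_y dG y = \int[circ]_y (y * df (y + s)).
  rewrite RintegralD//; [|exact: integrable_circle|by apply: integrable_circle; exact: sd].
  by rewrite (Rintegral_circle_shift s cf)// f0 addr0.
have csq : continuous (fun y : R => y ^+ 2) by move=> y; exact: (cvgM cvg_id cvg_id).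
have c2 : continuous (fun y : R => al * y ^+ 2).
  by move=> y; apply: cvgM; [exact: cvg_cst|exact: csq].
have c3 : continuous (fun y : R => (4 * al)^-1 * df (y + s) ^+ 2).
  by move=> y; apply: cvgM; [exact: cvg_cst|exact: (sd _ cdf2 y)].
have Iy : \int[circ]_y (y ^+ 2) = L ^+ 3 / 12.
  rewrite Rintegral_circle//.
  pose F (y : R) : R := 3^-1 * (y * y ^+ 2).
  have Fd (y : R) : y \in `[- (L / 2), L / 2] -> is_derive y 1 F (y ^+ 2).
    move=> _; apply: (is_derive_eq (is_derive_scale 3^-1 (is_derive_mul (is_derive_id y 1) (is_derive_sqr (is_derive_id y 1))))).
    by rewrite /=; field.
  rewrite (Rintegral_FTC2 ab Fd); last exact: continuous_within.
  by rewrite /F; field.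
rewrite -IG I1.
have -> : al * L ^+ 3 / 12 = al * \int[circ]_y (y ^+ 2) by rewrite Iy mulrA.
rewrite -(Rintegral_circle_shift s cdf2); last by move=> y; rewrite dfL.
rewrite -!RintegralZl//; [|exact: (integrable_circle (sd _ cdf2))|exact: integrable_circle].
rewrite -RintegralD//; [|exact: integrable_circle|exact: integrable_circle].
apply: le_Rintegral => //; try exact: integrable_circle.
  by apply: integrable_circle => y; apply: cvgD; [exact: c2|exact: c3].
move=> y _; rewrite -subr_ge0.
have -> : al * y ^+ 2 + (4 * al)^-1 * df (y + s) ^+ 2 - y * df (y + s) =
  al * (y - (2 * al)^-1 * df (y + s)) ^+ 2.
  by field; rewrite gt_eqF.
by rewrite mulr_ge0 ?sqr_ge0// ltW.
Qed.

(* Jensen's inequality for the logarithm with weight [f^2] reduces the claim to a bound of [\int f^3],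
   which follows from Wirtinger's inequality and a uniform bound of [f] minus its mean. *)
Lemma circle_logsobolev_sqr f (df : R -> R) :
  (forall x : R, is_derive x 1 f (df x)) -> continuous df ->
  (forall x, f (x + L) = f x) -> (forall x, df (x + L) = df x) ->
  (forall x, 0 < f x) -> \int[circ]_x (f x ^+ 2) = L ->
  \int[circ]_x (f x ^+ 2 * ln (f x ^+ 2)) <= (L / pi) ^+ 2 * \int[circ]_x (df x ^+ 2).
Proof.
move=> fd cdf fL dfL f0 f2L.
have Ln0 : L != 0 by rewrite gt_eqF.
have pi0 : 0 < pi :> R by exact: pi_gt0.
have pin0 : pi != 0 :> R by rewrite gt_eqF.
have cf := is_derive_continuous fd.
have cc (a : R) : continuous (fun _ : R => a) by exact: cst_continuous.
have cM (h k : R -> R) : continuous h -> continuous k -> continuous (fun x => h x * k x).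
  by move=> ch ck x; exact: (cvgM (ch x) (ck x)).
have cD (h k : R -> R) : continuous h -> continuous k -> continuous (fun x => h x + k x).
  by move=> ch ck x; exact: (cvgD (ch x) (ck x)).
have iC (h : R -> R) : continuous h -> circ.-integrable setT (EFin \o h) by exact: integrable_circle.
have circT : fine (circ setT) = L by have := circle_measureT (ltW L0) => /= ->.
set D2 := \int[circ]_x (df x ^+ 2).
pose m := (\int[circ]_x f x) / L.
pose g (x : R) : R := f x - m.
pose v := (\int[circ]_x (g x ^+ 2)) / L.
(* [J] is the bound of the variance [v] by Wirtinger's inequality. In terms of it the claim is that
   the entropy is at most [4 J L]. *)
pose J := L / (2 * pi) ^+ 2 * D2.
have cg : continuous g by apply: cD => //; exact: cc.
have cg2 : continuous (fun x => g x ^+ 2) by exact: cM.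
have If : \int[circ]_x f x = m * L by rewrite /m mulfVK.
have Ig : \int[circ]_x g x = 0.
  by rewrite RintegralB ?Rintegral_cst ?circT ?If ?subrr//; apply: iC => //; exact: cc.
have Ig2 : \int[circ]_x (g x ^+ 2) = v * L by rewrite /v mulfVK.
have v0 : 0 <= v by apply: divr_ge0; [apply: Rintegral_ge0 => x _; exact: sqr_ge0|exact: ltW].
have vJ : v <= J.
  have h := wirtinger fd cdf fL dfL.
  have h1 : (2 * pi / L) ^+ 2 * (v * L) <= D2 by rewrite -Ig2; exact: h.
  have alg (q l z : R) : l != 0 -> q != 0 ->
      z = (l / (2 * q) ^+ 2) * ((2 * q / l) ^+ 2 * (z * l)).
    by move=> l0 q0; field; rewrite l0 q0.
  rewrite [leLHS](alg pi L)//.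
  by rewrite ler_wpM2l//; apply: divr_ge0; [exact: ltW|exact: sqr_ge0].
have m0 : 0 <= m by apply: divr_ge0; [apply: Rintegral_ge0 => x _; exact: ltW|exact: ltW].
have mv : m ^+ 2 = 1 - v.
  have : L = v * L + m ^+ 2 * L.
    rewrite -[LHS]f2L -Ig2.
    rewrite (_ : \int[circ]_x (f x ^+ 2) = \int[circ]_x (g x ^+ 2 + (2 * m * g x + m ^+ 2))); last first.
      by apply: eq_Rintegral => x _; rewrite /g; ring.
    rewrite RintegralD//; [|exact: iC|by apply: iC; apply: cD; [apply: cM|]; try exact: cc].
    rewrite RintegralD//; [|by apply: iC; apply: cM => //; exact: cc|by apply: iC; exact: cc].
    rewrite RintegralZl//; last exact: iC.
    by rewrite Ig mulr0 add0r Rintegral_cst// circT.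
  move=> h; apply: (@mulIf _ L) => //; rewrite mulrBl mul1r; lra.
have v1 : v <= 1 by have := sqr_ge0 m; lra.
have mle : m <= 1 - v / 2.
  rewrite -(@ler_pXn2r _ 2) ?nnegrE//; last by lra.
  rewrite mv (_ : (1 - v / 2) ^+ 2 = 1 - v + (v / 2) ^+ 2); last by field.
  by rewrite lerDl sqr_ge0.
(* The weight [6 / L^2] makes the first term of [circle_sup_bound] equal to [L / 2]. The other
   coefficient becomes [pi^2 / 6], which is below [3] since [pi < 4]. *)
have gb x : g x <= 1 / 2 + 3 * J.
  have al0 : 0 < 6 / L ^+ 2 by rewrite divr_gt0// exprn_gt0.
  have gd (y : R) : is_derive y 1 g (df y).
    by apply: (is_derive_eq (is_derive_sub (fd y) (is_derive_cst m y 1))); rewrite subr0.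
  have gL y : g (y + L) = g y by rewrite /g fL.
  have h := circle_sup_bound al0 gd cdf gL dfL Ig x.
  have : L * g x <= L * (1 / 2 + pi ^+ 2 / 6 * J).
    apply: le_trans h _; rewrite -/D2 /J le_eqVlt; apply/orP; left; apply/eqP.
    have alg (q l z : R) : l != 0 -> q != 0 -> 6 / l ^+ 2 * l ^+ 3 / 12 + (4 * (6 / l ^+ 2))^-1 * z =
        l * (1 / 2 + q ^+ 2 / 6 * (l / (2 * q) ^+ 2 * z)).
      by move=> l0 q0; field; rewrite l0 q0.
    exact: alg.
  rewrite ler_pM2l// => /le_trans; apply; rewrite lerD2l ler_wpM2r//.
    by apply: le_trans vJ.
  rewrite ler_pdivrMr//; apply: (@le_trans _ _ (4 ^+ 2)); last by lra.
  rewrite ler_pXn2r ?nnegrE//; last exact: ltW.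
  by have := @pihalf_lt2 R; lra.
pose c := (\int[circ]_x (f x ^+ 3)) / L.
have cf2 : continuous (fun x => f x ^+ 2) by exact: cM.
have cf3 : continuous (fun x => f x ^+ 3) by apply: cM => //; exact: cM.
have Ic : \int[circ]_x (f x ^+ 3) = c * L by rewrite /c mulfVK.
(* For [y >= 0], [y^3 - (3 y^2 - 1) / 2 = (y - 1)^2 (y + 1/2)] is nonnegative, and [f^2] has mean
   one. *)
have c1 : 1 <= c.
  rewrite -(ler_pM2r L0) -Ic.
  have -> : 1 * L = \int[circ]_x (3 / 2 * f x ^+ 2 - 1 / 2).
    rewrite RintegralB//; [|by apply: iC; apply: cM => //; exact: cc|by apply: iC; exact: cc].
    rewrite RintegralZl//; last exact: iC.
    by rewrite f2L Rintegral_cst// circT; field.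
  apply: le_Rintegral => //.
  - by apply: iC; apply: cD; [apply: cM => //; exact: cc|exact: cc].
  - exact: iC.
  move=> x _; rewrite -subr_ge0.
  have -> : f x ^+ 3 - (3 / 2 * f x ^+ 2 - 1 / 2) = (f x - 1) ^+ 2 * (f x + 1 / 2) by field.
  by rewrite mulr_ge0 ?sqr_ge0// addr_ge0// ltW.
have c0 : 0 < c by apply: lt_le_trans c1.
(* Expansion of [(m + g)^3] with [g] of mean zero; the cubic term is handled by the upper bound of
   [g] alone, as [g^3 <= (1/2 + 3 J) g^2]. Then [m^3 = m (1 - v)], [m <= 1 - v / 2] and [v <= J]. *)
have cJ : c <= 1 + 2 * J + 2 * J ^+ 2.
  have : c <= m ^+ 3 + 3 * m * v + (1 / 2 + 3 * J) * v.
    rewrite -(ler_pM2r L0) -Ic.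
    have -> : (m ^+ 3 + 3 * m * v + (1 / 2 + 3 * J) * v) * L =
        \int[circ]_x (m ^+ 3 + (3 * m ^+ 2 * g x + (3 * m + (1 / 2 + 3 * J)) * g x ^+ 2)).
      rewrite RintegralD//; [|by apply: iC; exact: cc|by apply: iC; apply: cD; apply: cM => //; exact: cc].
      rewrite RintegralD//; [|by apply: iC; apply: cM => //; exact: cc|by apply: iC; apply: cM => //; exact: cc].
      have e1 (b : R) : \int[circ]_x (b * g x) = b * \int[circ]_x g x.
        by rewrite RintegralZl//; exact: iC.
      have e2 (b : R) : \int[circ]_x (b * g x ^+ 2) = b * \int[circ]_x (g x ^+ 2).
        by rewrite RintegralZl//; exact: iC.
      by rewrite e1 e2 Rintegral_cst// circT Ig Ig2; ring.
    apply: le_Rintegral => //; first exact: iC.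
      exact: (RintegrableD (iC _ (cc _)) (RintegrableD (RintegrableZ _ (iC _ cg)) (RintegrableZ _ (iC _ cg2)))).
    move=> x _; rewrite -subr_ge0.
    have -> : m ^+ 3 + (3 * m ^+ 2 * g x + (3 * m + (1 / 2 + 3 * J)) * g x ^+ 2) - f x ^+ 3 =
      g x ^+ 2 * (1 / 2 + 3 * J - g x) by rewrite /g; ring.
    by rewrite mulr_ge0 ?sqr_ge0// subr_ge0.
  move=> /le_trans; apply.
  have -> : m ^+ 3 = m * (1 - v) by rewrite -mv; ring.
  have h1 : m * (1 + 2 * v) <= (1 - v / 2) * (1 + 2 * v) by rewrite ler_wpM2r// addr_ge0// mulr_ge0.
  have h2 : 0 <= (J - v) * (1 + v) by rewrite mulr_ge0 ?subr_ge0// addr_ge0.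
  have h3 : 0 <= (J - v) ^+ 2 by exact: sqr_ge0.
  have h4 : 0 <= J * (J - v) by rewrite mulr_ge0 ?subr_ge0// (le_trans v0).
  nra.
have lncJ : ln c <= 2 * J.
  have J0 : 0 <= 2 * J by rewrite mulr_ge0// (le_trans v0).
  rewrite -[leRHS]expRK ler_ln ?posrE ?expR_gt0//.
  apply: le_trans cJ _; apply: le_trans (expR_ge2 J0).
  by rewrite lerD2l; nra.
have cln : continuous (fun x => ln (f x ^+ 2)).
  by move=> x; apply: (continuous_comp (cf2 x)); apply: continuous_ln; rewrite exprn_gt0.
apply: (@le_trans _ _ (4 * J * L)); last first.
  rewrite le_eqVlt; apply/orP; left; apply/eqP; rewrite /J.
  have alg (q l z : R) : q != 0 -> 4 * (l / (2 * q) ^+ 2 * z) * l = (l / q) ^+ 2 * z.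
    by move=> q0; field.
  exact: alg.
apply: (@le_trans _ _ (2 * ln c * L)); last first.
  by rewrite ler_pM2r//; lra.
(* The tangent line [ln y <= y / c - 1 + ln c] at the mean [c] of [f^3], multiplied by [2 f^2],
   integrates to exactly [2 L ln c]. *)
have -> : 2 * ln c * L = \int[circ]_x (2 / c * f x ^+ 3 + 2 * (ln c - 1) * f x ^+ 2).
  rewrite RintegralD//; [|by apply: iC; apply: cM => //; exact: cc|by apply: iC; apply: cM => //; exact: cc].
  rewrite RintegralZl//; last exact: iC.
  rewrite RintegralZl//; last exact: iC.
  by rewrite Ic f2L; field; rewrite gt_eqF.
apply: le_Rintegral => //.
- by apply: iC; exact: cM.
- by apply: iC; apply: cD; apply: cM => //; exact: cc.
move=> x _; have fx0 := f0 x.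
rewrite (lnXn 2)// mulr2n.
have h : ln (f x) <= f x / c - 1 + ln c.
  have fc0 : 0 < f x / c by rewrite divr_gt0.
  have -> : ln (f x) = ln (f x / c) + ln c by rewrite -lnM ?posrE// divfK// gt_eqF.
  rewrite lerD2r -[in leLHS](subrKC 1 (f x / c)); apply: le_ln1Dx.
  by rewrite ltrBDl subrr.
have -> : 2 / c * f x ^+ 3 + 2 * (ln c - 1) * f x ^+ 2 = f x ^+ 2 * (2 * (f x / c - 1 + ln c)).
  by field; rewrite gt_eqF.
by rewrite ler_wpM2l ?sqr_ge0//; lra.
Qed.

(** By homogeneity: the case of [f = sqrt (a u)] with [a = L / \int u], for which [\int f^2 = L] and
    [4 f'^2 = a u'^2 / u]. The factor [4] turns [(L / pi)^2] into [(L / (2 pi))^2]. *)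
Lemma circle_logsobolev u (du : R -> R) :
  (forall x : R, is_derive x 1 u (du x)) -> continuous du ->
  (forall x, u (x + L) = u x) -> (forall x, du (x + L) = du x) -> (forall x, 0 < u x) ->
  \int[circ]_x (u x * ln (u x)) - \int[circ]_x u x * ln (\int[circ]_x u x / L) <=
  (L / (2 * pi)) ^+ 2 * \int[circ]_x (du x ^+ 2 / u x).
Proof.
move=> ud cdu uL duL u0.
have Ln0 : L != 0 by rewrite gt_eqF.
have pin0 : pi != 0 :> R by rewrite gt_eqF// pi_gt0.
have cu := is_derive_continuous ud.
have cc (a : R) : continuous (fun _ : R => a) by exact: cst_continuous.
have cM (h k : R -> R) : continuous h -> continuous k -> continuous (fun x => h x * k x).
  by move=> ch ck x; exact: (cvgM (ch x) (ck x)).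
have iC (h : R -> R) : continuous h -> circ.-integrable setT (EFin \o h) by exact: integrable_circle.
have circT : fine (circ setT) = L by have := circle_measureT (ltW L0) => /= ->.
have ab : - (L / 2) <= L / 2 by have := L0; lra.
set U := \int[circ]_x u x.
have U0 : 0 < U.
  have [c _ Hc] := EVT_min ab (continuous_within cu).
  apply: (@lt_le_trans _ _ (u c * L)); first by rewrite mulr_gt0.
  have -> : u c * L = \int[circ]_x (u c) by rewrite Rintegral_cst// circT.
  rewrite /U !Rintegral_circle//.
  apply: le_Rintegral => //; [exact/continuous_integrable_itv/continuous_within|
    exact/continuous_integrable_itv/continuous_within].
have Un0 : U != 0 by rewrite gt_eqF.
pose a := L / U; have a0 : 0 < a by rewrite divr_gt0.
pose v (x : R) : R := a * u x; have v0 x : 0 < v x by rewrite mulr_gt0.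
pose f (x : R) : R := Num.sqrt (v x).
have f0 x : 0 < f x by rewrite sqrtr_gt0.
have f2 x : f x ^+ 2 = v x by rewrite sqr_sqrtr// ltW.
pose df (x : R) : R := (2 * f x)^-1 * (a * du x).
have fd (x : R) : is_derive x 1 f (df x).
  exact: (is_derive_chainR (is_derive1_sqrt (v0 x)) (is_derive_scale a (ud x))).
have cf := is_derive_continuous fd.
have cdf : continuous df.
  move=> x; have c2 : {for x, continuous (fun x => 2 * f x)} by apply: cM => //; exact: cc.
  apply: cvgM; last exact: (cM _ _ (cc a) cdu x).
  by apply: cvgV => //; rewrite mulf_neq0// gt_eqF.
have fL x : f (x + L) = f x by rewrite /f /v uL.
have dfL x : df (x + L) = df x by rewrite /df fL duL.
have f2L : \int[circ]_x (f x ^+ 2) = L.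
  under eq_Rintegral do rewrite f2.
  by rewrite RintegralZl//; [rewrite -/U /a mulfVK|exact: iC].
have cln : continuous (fun x => ln (u x)).
  by move=> x; apply: (continuous_comp (cu x)); apply: continuous_ln.
have h := circle_logsobolev_sqr fd cdf fL dfL f0 f2L.
have E1 : \int[circ]_x (f x ^+ 2 * ln (f x ^+ 2)) = a * (\int[circ]_x (u x * ln (u x)) - U * ln (U / L)).
  have i0 : circ.-integrable setT (EFin \o (fun x => u x * ln (u x))) by exact: (iC _ (cM _ _ cu cln)).
  have i1 := RintegrableZ a i0.
  have i2 := RintegrableZ (a * ln a) (iC _ cu).
  transitivity (\int[circ]_x (a * (u x * ln (u x)) + a * ln a * u x)).
    apply: eq_Rintegral => x _; rewrite f2 /v lnM ?posrE//; ring.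
  rewrite RintegralD// RintegralZl// RintegralZl//; last exact: iC.
  rewrite -/U /a -[ln (L / U)](opprK) -lnV ?posrE ?divr_gt0// invf_div; ring.
have cdu2 : continuous (fun x => du x ^+ 2 / u x).
  move=> x; apply: cvgM; first exact: (cM _ _ cdu cdu x).
  by apply: cvgV; [rewrite gt_eqF|exact: cu].
have E2 : \int[circ]_x (df x ^+ 2) = a / 4 * \int[circ]_x (du x ^+ 2 / u x).
  rewrite -RintegralZl//; last exact: iC.
  apply: eq_Rintegral => x _; rewrite /df exprMn exprVn exprMn f2 /v.
  by field; rewrite !gt_eqF.
rewrite E1 E2 in h.
rewrite -(ler_pM2l a0); apply: le_trans h _.
have alg (q l b z : R) : q != 0 -> (l / q) ^+ 2 * (b / 4 * z) = b * ((l / (2 * q)) ^+ 2 * z).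
  by move=> q0; field.
by rewrite alg.
Qed.

End circle_inequalities.

(** * Calculus and logarithmic Sobolev inequality on the torus *)

Section torus_calculus.
Context (R : realType) (d : nat) (L : R) (L0 : 0 < L).
Local Notation dx := (@torus_measure R d L).
Local Notation Rd := 'rV[R]_d.
Local Notation e_ := (unit_vec R).
Implicit Types (F G f g : Rd -> R).

Lemma ae_cell : {ae dx, forall x : Rd, cell L x}.
Proof.
exists (~` cell L); split; [apply: measurableC; exact: measurable_cell| |by []].
by rewrite /= /mrestr setICl measure0.
Qed.

Lemma continuous_bounded_cell f : continuous f -> exists M, forall x, cell L x -> `|f x| <= M.
Proof.
move=> cf; have cn : continuous (fun x => `|f x|) by move=> x; exact: (cvg_norm (cf x)).
have cK : compact (cell L : set Rd).
  have := @rV_compact R d (fun=> `[- (L / 2), L / 2]%classic) (fun=> @segment_compact R _ _).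
  by congr compact; apply/seteqP; split => x /= H i; have := H i; rewrite in_itv.
have [|c _ Hc] := EVT_max_rV _ cK (continuous_subspaceT cn).
  by exists 0 => i; rewrite mxE; have := L0; lra.
by exists `|f c| => x xL; apply: Hc; rewrite inE.
Qed.

Lemma torus_integrable_bounded f M : measurable_fun setT f -> {ae dx, forall x, `|f x| <= M} ->
  dx.-integrable setT (EFin \o f).
Proof. by apply: Rintegrable_bounded; exact: torus_measure_fin. Qed.

Lemma torus_integrable_continuous f : continuous f -> dx.-integrable setT (EFin \o f).
Proof.
move=> cf; have [M HM] := continuous_bounded_cell cf.
apply: (@torus_integrable_bounded _ M); first exact: continuous_measurable_rV.
by apply: filterS ae_cell; exact: HM.
Qed.

(** One point of the cell serves all periodic functions at once; [k j] rounds [x j / L] to a nearest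
    integer. *)
Lemma periodic_cell (x : Rd) : exists2 y, cell L y &
  forall f, Defs.periodic L f -> f x = f y.
Proof.
pose k (j : 'I_d) := Num.floor (x ord0 j / L + 1 / 2).
pose z (s : seq 'I_d) := \sum_(j <- s) (k j)%:~R *: (L *: e_ j).
exists (x - z (index_enum _)); last first.
  move=> f fL; elim: (index_enum _) => [|j s IH]; first by rewrite /z big_nil subr0.
  have fLn (n : nat) (y : Rd) : f (y + n%:R *: (L *: e_ j)) = f y.
    elim: n y => [|n IHn] y; first by rewrite scale0r addr0.
    by rewrite -natr1 scalerDl scale1r addrA fL IHn.
  have fLz (n : int) (y : Rd) : f (y + n%:~R *: (L *: e_ j)) = f y.
    case: n => n; first exact: fLn.
    by rewrite NegzE -[LHS](fLn n.+1) rmorphN/= scaleNr subrK.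
  rewrite IH -[RHS](fLz (k j)); congr f.
  by rewrite /z big_cons opprD addrA [RHS]addrAC subrK.
move=> i; rewrite rowBE /z summxE.
rewrite (bigD1 i)//= big1 ?addr0; last first.
  move=> j ji; rewrite rowZE rowZE unit_vecE eq_sym (negbTE ji) !mulr0//.
rewrite !rowZE unit_vecE eqxx mulr1.
have /andP[h1 h2] := floor_itv (x ord0 i / L + 1 / 2).
rewrite -/(k i) intrD in h1 h2.
have e1 : (k i)%:~R * L <= (x ord0 i / L + 1 / 2) * L by rewrite ler_wpM2r// ltW.
have e2 : (x ord0 i / L + 1 / 2) * L <= ((k i)%:~R + 1) * L by rewrite ler_wpM2r// ltW.
rewrite mulrDl divfK ?gt_eqF// in e1 e2.
by apply/andP; split; lra.
Qed.

Lemma torus_bounded f : Defs.periodic L f -> continuous f -> exists2 M, 0 <= M & forall x, `|f x| <= M.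
Proof.
move=> fL cf; have [M HM] := continuous_bounded_cell cf.
have H x : `|f x| <= M by have [y yL ->//] := periodic_cell x; exact: HM.
by exists M => //; apply: le_trans (H 0).
Qed.

Lemma periodic_shift f (v : Rd) : Defs.periodic L f -> Defs.periodic L (fun x => f (x + v)).
Proof. by move=> fL x i; rewrite addrAC fL. Qed.

Lemma measurable_shift f (v : Rd) : measurable_fun setT f -> measurable_fun setT (fun x : Rd => f (x + v)).
Proof.
move=> mf; rewrite (_ : (fun x => _) = (fun x : Rd => f (- 0 - x)) \o (fun x : Rd => - v - x)); last first.
  by apply/funext => x /=; rewrite oppr0 sub0r opprB opprK addrC.
apply: (@measurableT_comp _ _ _ _ _ _ (fun x : Rd => f (- 0 - x))); last exact: measurable_rV_reflect.
exact: (measurableT_comp mf (measurable_rV_reflect _)).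
Qed.

(** A translation is the product of two reflections. *)
Lemma Rintegral_torus_shift f (v : Rd) : Defs.periodic L f -> measurable_fun setT f ->
  \int[dx]_x f (x + v) = \int[dx]_x f x.
Proof.
move=> fL mf.
have mN : measurable_fun setT (fun x : Rd => f (- x)).
  rewrite (_ : (fun x => _) = fun x : Rd => f (0 - x)).
    exact: (measurableT_comp mf (measurable_rV_reflect _)).
  by apply/funext => x; rewrite sub0r.
rewrite -[RHS](Rintegral_torus_reflect 0 L0 fL mf).
rewrite -[LHS](Rintegral_torus_reflect (- v) L0 (periodic_shift v fL) (measurable_shift v mf)).
by apply: eq_Rintegral => x _; congr f; rewrite addrAC addNr.
Qed.

Definition lipschitz_along i F := exists2 C, 0 <= C & forall x (h : R), `|F (x + h *: e_ i) - F x| <= C * `|h|.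

(** The class is dictated by the flux: the density is smooth, the velocity is only Lipschitz along
    the axis, and it is the product alone that is known to be derivable. Thus integration by parts
    is stated for derivatives that exist everywhere and are bounded, without continuity. *)
Definition ibp_fun i F := [/\ Defs.periodic L F, measurable_fun setT F,
  exists M, forall x, `|F x| <= M, lipschitz_along i F & forall x, derivable F x (e_ i)].

Lemma derivable_cvg_seq F x (v : Rd) : derivable F x v ->
  n.+1%:R * (F (x + n.+1%:R^-1 *: v) - F x) @[n --> \oo] --> 'D_v F x.
Proof.
move=> /cvg_ex[l Hl]; have -> : 'D_v F x = l by apply: cvg_lim.
have xa0 : (forall n : nat, n.+1%:R^-1 != 0 :> R) /\ n.+1%:R^-1 @[n --> \oo] --> (0 : R).
  by split; [move=> n; rewrite invr_eq0 pnatr_eq0|exact: cvg_harmonic].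
move: Hl => /cvgr_dnbhsP/(_ _ xa0).
rewrite (_ : (fun n => _) = (fun n => n.+1%:R * (F (x + n.+1%:R^-1 *: v) - F x)))//.
by apply/funext => n; rewrite invrK /=; congr (_ * (F _ - _)); rewrite addrC.
Qed.

Lemma lipschitz_pderiv i F C : (forall x (h : R), `|F (x + h *: e_ i) - F x| <= C * `|h|) ->
  (forall x, derivable F x (e_ i)) -> forall x, `|pderiv i F x| <= C.
Proof.
move=> FC Fd x.
have c : `|n.+1%:R * (F (x + n.+1%:R^-1 *: e_ i) - F x)| @[n --> \oo] --> `|pderiv i F x|.
  exact: (cvg_norm (derivable_cvg_seq (Fd x))).
rewrite -(cvg_lim _ c)//; apply: limr_le; first by apply/cvg_ex; eexists; exact: c.
apply: nearW => n; rewrite normrM ger0_norm// mulrC -ler_pdivlMr//.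
by apply: le_trans (FC _ _) _; rewrite ger0_norm.
Qed.

Lemma measurable_pderiv i F : measurable_fun setT F -> (forall x, derivable F x (e_ i)) ->
  measurable_fun setT (pderiv i F).
Proof.
move=> mF Fd.
apply: (@measurable_fun_cvg _ _ R setT (fun n (x : Rd) => n.+1%:R * (F (x + n.+1%:R^-1 *: e_ i) - F x))).
  move=> n; apply: measurable_funM => //; apply: measurable_funB => //.
  exact: measurable_shift.
by move=> x _; exact: derivable_cvg_seq.
Qed.

(** Difference quotients integrate to zero by translation invariance, and the Lipschitz constant
    dominates them in the limit. *)
Lemma Rintegral_pderiv0 i F : ibp_fun i F -> \int[dx]_x pderiv i F x = 0.
Proof.
move=> [FL mF [M FM] [C C0 FC] Fd].
pose f_ (n : nat) (x : Rd) : R := n.+1%:R * (F (x + n.+1%:R^-1 *: e_ i) - F x).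
have mf_ n : measurable_fun setT (f_ n).
  by apply: measurable_funM => //; apply: measurable_funB => //; exact: measurable_shift.
have iF : dx.-integrable setT (EFin \o F).
  by apply: (@torus_integrable_bounded _ M) => //; exact: aeW.
have iFs v : dx.-integrable setT (EFin \o (fun x => F (x + v))).
  by apply: (@torus_integrable_bounded _ M); [exact: measurable_shift|exact: aeW].
have If n : \int[dx]_x f_ n x = 0.
  rewrite RintegralZl//; last exact: RintegrableB.
  by rewrite RintegralB// Rintegral_torus_shift// subrr mulr0.
have : \int[dx]_x f_ n x @[n --> \oo] --> \int[dx]_x pderiv i F x.
  apply: (@Rdominated_cvg _ _ _ _ _ _ (cst C)) => //.
  - exact: measurable_pderiv.
  - by apply: aeW => x; exact: derivable_cvg_seq.
  - by apply: (@torus_integrable_bounded _ C) => //; apply: aeW => x; rewrite ger0_norm.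
  - move=> n; apply: aeW => x; rewrite normrM ger0_norm// mulrC -ler_pdivlMr//.
    by apply: le_trans (FC _ _) _; rewrite ger0_norm.
under eq_fun do rewrite If.
by move=> c; apply/esym; apply: (cvg_unique _ (cvg_cst 0) c).
Qed.

Lemma pderivM i F G x : derivable F x (e_ i) -> derivable G x (e_ i) ->
  pderiv i (fun x => F x * G x) x = F x * pderiv i G x + pderiv i F x * G x.
Proof.
move=> dF dG; rewrite /pderiv [LHS](deriveM dF dG) /GRing.scale /=.
by rewrite [X in _ + X]mulrC.
Qed.

Lemma lipschitz_alongM i F G M N : (forall x, `|F x| <= M) -> (forall x, `|G x| <= N) ->
  lipschitz_along i F -> lipschitz_along i G -> lipschitz_along i (fun x => F x * G x).
Proof.
move=> FM GN [C C0 FC] [K K0 GK].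
have M0 : 0 <= M by apply: le_trans (FM 0).
have N0 : 0 <= N by apply: le_trans (GN 0).
exists (M * K + C * N); first by rewrite addr_ge0// mulr_ge0.
move=> x h; set y := x + _.
have -> : F y * G y - F x * G x = F y * (G y - G x) + (F y - F x) * G x by ring.
apply: le_trans (ler_normD _ _) _; rewrite !normrM mulrDl lerD//.
  by rewrite -mulrA; apply: ler_pM => //; exact: GK.
rewrite -mulrA [N * _]mulrC mulrA; apply: ler_pM => //; exact: FC.
Qed.

Lemma ibp_funM i F G : ibp_fun i F -> ibp_fun i G -> ibp_fun i (fun x => F x * G x).
Proof.
move=> [FL mF [M FM] Fl Fd] [GL mG [N GN] Gl Gd]; split.
- by move=> x j; rewrite FL GL.
- exact: measurable_funM.
- by exists (M * N) => x; rewrite normrM ler_pM.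
- exact: lipschitz_alongM FM GN Fl Gl.
- by move=> x; exact: derivableM.
Qed.

Lemma torus_ibp i F G : ibp_fun i F -> ibp_fun i G ->
  \int[dx]_x (F x * pderiv i G x) = - \int[dx]_x (pderiv i F x * G x).
Proof.
move=> hF hG; have := Rintegral_pderiv0 (ibp_funM hF hG).
move: hF hG => [FL mF [M FM] [C C0 FC] Fd] [GL mG [N GN] [K K0 GK] Gd].
under eq_Rintegral do rewrite pderivM//.
have dF := lipschitz_pderiv FC Fd; have dG := lipschitz_pderiv GK Gd.
rewrite RintegralD//; first by move/eqP; rewrite addr_eq0 => /eqP.
- apply: (@torus_integrable_bounded _ (M * K)).
    by apply: measurable_funM => //; exact: measurable_pderiv.
  by apply: aeW => x; rewrite normrM ler_pM.
- apply: (@torus_integrable_bounded _ (C * N)).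
    by apply: measurable_funM => //; exact: measurable_pderiv.
  by apply: aeW => x; rewrite normrM ler_pM.
Qed.

Lemma is_derive_along F i x (h : R) : (forall x, derivable F x (e_ i)) ->
  is_derive h 1 (fun s : R => F (s *: e_ i + x)) (pderiv i F (h *: e_ i + x)).
Proof. by move=> Fd; apply/is_derive_line; split. Qed.

Lemma pderiv_lipschitz i F C : (forall x, derivable F x (e_ i)) ->
  (forall x, `|pderiv i F x| <= C) -> forall x (h : R), `|F (x + h *: e_ i) - F x| <= C * `|h|.
Proof.
move=> Fd FC.
have pos x (h : R) : 0 <= h -> `|F (x + h *: e_ i) - F x| <= C * `|h|.
  move=> h0; pose g (s : R) : R := F (s *: e_ i + x).
  have gd (s : R) : is_derive s 1 g (pderiv i F (s *: e_ i + x)) by exact: is_derive_along.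
  have [c _] := MVT_segment h0 (fun s _ => gd s) (continuous_within (is_derive_continuous gd)).
  rewrite /g scale0r add0r [h *: _ + x]addrC subr0 => ->.
  by rewrite normrM ler_wpM2r.
move=> x h; have [h0|h0] := leP 0 h; first exact: pos.
have := pos (x + h *: e_ i) (- h); rewrite oppr_ge0 (ltW h0) => /(_ isT).
by rewrite -addrA -scalerDl subrr scale0r addr0 normrN distrC.
Qed.

Lemma periodic_pderiv i F : Defs.periodic L F -> Defs.periodic L (pderiv i F).
Proof.
move=> FL x j; rewrite /pderiv /derive.
set f1 := (fun _ => _); set f2 := (fun _ => _); suff -> : f1 = f2 by [].
by apply/funext => h; rewrite /f1 /f2 /= FL addrA FL.
Qed.

Lemma C1_ibp_fun i F : Defs.periodic L F -> continuous F -> (forall x, derivable F x (e_ i)) ->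
  continuous (pderiv i F) -> ibp_fun i F.
Proof.
move=> FL cF Fd cdF; split => //.
- exact: continuous_measurable_rV.
- by have [M _ HM] := torus_bounded FL cF; exists M.
- have [M M0 HM] := torus_bounded (periodic_pderiv i FL) cdF.
  by exists M => //; exact: pderiv_lipschitz.
Qed.

End torus_calculus.

(** * Slicing the torus along the first coordinate *)

Section fibers.
Context (R : realType) (d : nat) (L : R) (L0 : 0 < L).
Local Notation circ := (circle_measure L).
Local Notation dy := (@torus_measure R d L).
Implicit Types (f u : 'rV[R]_d.+1 -> R).

Lemma continuous_cons_rV (r : R) : continuous (fun y : 'rV[R]_d => cons_rV (r, y)).
Proof.
move=> y A /nbhs_ballP[e /= e0 eA]; apply/nbhs_ballP; exists e => // z yz; apply: eA.
split => // i j; rewrite (ord1 i); case: (unliftP ord0 j) => [k ->|->]; last first.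
  by rewrite !cons_rV0; exact: ballxx.
by rewrite !cons_rVS; case: yz => _; exact.
Qed.

Lemma cons_rV_line (r : R) (y : 'rV[R]_d) :
  cons_rV (r, y) = r *: unit_vec R ord0 + cons_rV (0, y).
Proof. by rewrite -(add0r r) cons_rV_shift0 addrC add0r. Qed.

Lemma periodic_cons_rV f (r : R) : Defs.periodic L f -> Defs.periodic L (fun y => f (cons_rV (r, y))).
Proof. by move=> fL y i; rewrite cons_rV_shiftS fL. Qed.

Lemma continuous_fiber f (r : R) : continuous f -> continuous (fun y => f (cons_rV (r, y))).
Proof. by move=> cf y; exact: (continuous_comp (@continuous_cons_rV r y) (cf _)). Qed.

Lemma continuous_along f (y : 'rV[R]_d) : continuous f -> continuous (fun r => f (cons_rV (r, y))).
Proof.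
move=> cf r; have c1 : {for r, continuous (fun r : R => r *: unit_vec R ord0 + cons_rV (0, y))}.
  by apply: cvgD; [apply: cvgZr_tmp; exact: cvg_id|exact: cvg_cst].
have E : (fun r => f (cons_rV (r, y))) = f \o (fun r : R => r *: unit_vec R ord0 + cons_rV (0, y)).
  by apply/funext => s; rewrite /comp [in LHS]cons_rV_line.
by rewrite E; exact: (continuous_comp c1 (cf _)).
Qed.

Lemma continuous_fiber_integral f : Defs.periodic L f -> continuous f ->
  continuous (fun r => \int[dy]_y f (cons_rV (r, y))).
Proof.
move=> fL cf r; have [M M0 fM] := torus_bounded L0 fL cf.
have rI : r \in (`]r - 1, r + 1[%classic : set R).
  by rewrite inE/= in_itv/=; apply/andP; split; lra.
apply: (@continuity_under_integral _ _ _ dy (fun r y => f (cons_rV (r, y))) setT measurableT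
  (r - 1) (r + 1) _ _ (cst M)) => //.
- by move=> x _; apply: (torus_integrable_continuous L0); exact: continuous_fiber.
- by apply: aeW => y _ s _; exact: continuous_along.
- by apply: (@torus_integrable_bounded _ _ L _ M) => //; apply: aeW => x; rewrite ger0_norm.
- by move=> x _; apply: aeW => y _.
Qed.

Lemma torus_Rintegral_cst n (c : R) : \int[@torus_measure R n L]_x c = c * L ^+ n.
Proof. by rewrite Rintegral_cst//; have := torus_measureT n (ltW L0) => /= ->. Qed.

Lemma circle_Rintegral_cst (c : R) : \int[circ]_x c = c * L.
Proof. by rewrite Rintegral_cst//; have := circle_measureT (ltW L0) => /= ->. Qed.

(** Tonelli's theorem applies to the nonnegative function [f + M]; the contribution of [M] is the
    same on both sides. *)
Lemma Rintegral_torusS f : Defs.periodic L f -> continuous f ->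
  \int[@torus_measure R d.+1 L]_x f x = \int[circ]_r \int[dy]_y f (cons_rV (r, y)).
Proof.
move=> fL cf; have [M M0 fM] := torus_bounded L0 fL cf.
have cfM : continuous (fun x => f x + M) by move=> x; exact: (cvgD (cf x) (cvg_cst _)).
have fML : Defs.periodic L (fun x => f x + M) by move=> x i; rewrite fL.
have fM0 x : 0 <= f x + M by have := fM x; rewrite ler_norml => /andP[h _]; lra.
have key : \int[@torus_measure R d.+1 L]_x (f x + M) = \int[circ]_r \int[dy]_y (f (cons_rV (r, y)) + M).
  congr fine; rewrite (@ge0_integral_torusS _ _ _ (fun x => (f x + M)%:E))//; last first.
    by apply/measurable_EFinP; exact: continuous_measurable_rV.
  apply: eq_integral => r _; rewrite RintegralE//.
  exact: (torus_integrable_continuous L0 (continuous_fiber (r := r) cfM)).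
have ic n : (@torus_measure R n L).-integrable setT (EFin \o (fun=> M)).
  by apply: (@torus_integrable_bounded _ _ L _ M) => //; apply: aeW => x; rewrite ger0_norm.
move: key; rewrite RintegralD//; last exact: torus_integrable_continuous.
rewrite torus_Rintegral_cst.
rewrite [RHS](@eq_Rintegral _ _ _ _ _ (fun r => \int[dy]_y f (cons_rV (r, y)) + M * L ^+ d)); last first.
  move=> r _; rewrite RintegralD// ?torus_Rintegral_cst//.
  exact: (torus_integrable_continuous L0 (continuous_fiber (r := r) cf)).
rewrite RintegralD//.
- by rewrite circle_Rintegral_cst -mulrA -exprSr => /addIr.
- by apply: integrable_circle => //; exact: continuous_fiber_integral.
- by apply: integrable_circle => //; exact: cst_continuous.
Qed.

Lemma pderiv_fiber u (r : R) (i : 'I_d) (y : 'rV[R]_d) :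
  pderiv i (fun y => u (cons_rV (r, y))) y = pderiv (lift ord0 i) u (cons_rV (r, y)).
Proof.
rewrite /pderiv /derive.
set f1 := (fun _ => _); set f2 := (fun _ => _); suff -> : f1 = f2 by [].
by apply/funext => h; rewrite /f1 /f2 /= [h *: _ + y]addrC cons_rV_shiftS [X in u X - _]addrC.
Qed.

Lemma derivable_fiber u (r : R) (i : 'I_d) (y : 'rV[R]_d) :
  derivable u (cons_rV (r, y)) (unit_vec R (lift ord0 i)) ->
  derivable (fun y => u (cons_rV (r, y))) y (unit_vec R i).
Proof.
rewrite /derivable.
set f1 := (fun _ => _); set f2 := (fun _ => _); suff -> : f1 = f2 by [].
by apply/funext => h; rewrite /f1 /f2 /= [h *: _ + y]addrC cons_rV_shiftS [X in u X - _]addrC.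
Qed.

Lemma is_derive_fiber u (y : 'rV[R]_d) (r : R) : (forall x, derivable u x (unit_vec R ord0)) ->
  is_derive r 1 (fun r => u (cons_rV (r, y))) (pderiv ord0 u (cons_rV (r, y))).
Proof.
move=> du; rewrite (_ : (fun r => _) = (fun s => u (s *: unit_vec R ord0 + cons_rV (0, y)))); last first.
  by apply/funext => s; rewrite cons_rV_line.
by rewrite cons_rV_line; exact: is_derive_along.
Qed.

Lemma is_derive_fiber_integral u (r : R) : Defs.periodic L u -> continuous u ->
  (forall x, derivable u x (unit_vec R ord0)) -> continuous (pderiv ord0 u) ->
  is_derive r 1 (fun r => \int[dy]_y u (cons_rV (r, y))) (\int[dy]_y pderiv ord0 u (cons_rV (r, y))).
Proof.
move=> uL cu du cdu.
have [M M0 uM] := torus_bounded L0 (periodic_pderiv ord0 uL) cdu.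
have rI : (`]r - 1, r + 1[%classic : set R) r by rewrite /= in_itv/=; apply/andP; split; lra.
pose f (s : R) (y : 'rV[R]_d) := u (cons_rV (s, y)).
have fd (s : R) (y : 'rV[R]_d) : is_derive s 1 (f ^~ y) (pderiv ord0 u (cons_rV (s, y))) by exact: is_derive_fiber.
have pE (s : R) (y : 'rV[R]_d) : partial1of2 f s y = pderiv ord0 u (cons_rV (s, y)).
  by rewrite partial1of2E; have [_ ->] := fd s y.
have h1 (x : R) : (`]r - 1, r + 1[%classic : set R) x -> dy.-integrable setT (EFin \o f x).
  by move=> _; exact: (torus_integrable_continuous L0 (continuous_fiber (r := x) cu)).
have h2 (x : R) (y : 'rV[R]_d) : (`]r - 1, r + 1[%classic : set R) x -> [set: 'rV[R]_d] y -> derivable (f ^~ y) x 1.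
  by move=> _ _; have [] := fd x y.
have h3 : dy.-integrable setT (EFin \o (cst M : 'rV[R]_d -> R)).
  by apply: (@torus_integrable_bounded _ _ L _ M) => //; apply: aeW => x; rewrite ger0_norm.
have h4 (x : R) (y : 'rV[R]_d) : (`]r - 1, r + 1[%classic : set R) x -> [set: 'rV[R]_d] y -> `|partial1of2 f x y| <= (cst M : 'rV[R]_d -> R) y.
  by move=> _ _; rewrite pE.
have M0' (y : 'rV[R]_d) : 0 <= (cst M : 'rV[R]_d -> R) y by [].
split.
  exact: (derivable_under_integral measurableT rI h1 h2 M0' h3 h4).
rewrite -derive1E (differentiation_under_integral measurableT rI h1 h2 M0' h3 h4).
by apply: eq_Rintegral => y _; rewrite pE.
Qed.

End fibers.

(** * The logarithmic Sobolev inequality in every dimension *)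

Section torus_logsobolev.
Context (R : realType) (L : R) (L0 : 0 < L).

Lemma continuous_inv (T : topologicalType) (b : T -> R) : continuous b ->
  (forall x, 0 < b x) -> continuous (fun x => (b x)^-1).
Proof.
move=> cb b0 x; have bx : b x != 0 by rewrite gt_eqF.
exact: (continuous_comp (cb x) (inv_continuous bx)).
Qed.

Lemma continuous_sqr_div (T : topologicalType) (a b : T -> R) : continuous a -> continuous b ->
  (forall x, 0 < b x) -> continuous (fun x => a x ^+ 2 / b x).
Proof.
move=> ca cb b0 x.
have h1 : (fun x => a x ^+ 2) @ x --> a x ^+ 2 by exact: (cvgM (ca x) (ca x)).
have h2 : (fun x => (b x)^-1) @ x --> (b x)^-1.
  exact: (@continuous_inv _ _ cb b0).
exact: (cvgM h1 h2).
Qed.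

Lemma continuous_xlnx (T : topologicalType) (b : T -> R) : continuous b ->
  (forall x, 0 < b x) -> continuous (fun x => b x * ln (b x)).
Proof.
by move=> cb b0 x; exact: (cvgM (cb x) (continuous_comp (cb x) (continuous_ln (b0 x)))).
Qed.

(** A bound [M] of [1 / u] on the cell bounds [u] below by [1 / M]. *)
Lemma torus_Rintegral_gt0 d (u : 'rV[R]_d -> R) : continuous u -> (forall x, 0 < u x) ->
  0 < \int[@torus_measure R d L]_x u x.
Proof.
move=> cu u0; have cV : continuous (fun x => (u x)^-1).
  exact: continuous_inv.
have [M HM] := continuous_bounded_cell L0 cV.
have c0 : cell L (0 : 'rV[R]_d) by move=> i; rewrite mxE; have := L0; lra.
have M0 : 0 < M by apply: lt_le_trans (HM _ c0); rewrite normr_gt0 invr_eq0 gt_eqF.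
apply: (@lt_le_trans _ _ (M^-1 * L ^+ d)); first by rewrite mulr_gt0 ?invr_gt0// exprn_gt0.
rewrite -(torus_Rintegral_cst L0); apply: ae_le_Rintegral.
- apply: (@torus_integrable_bounded _ _ L _ M^-1) => //; apply: aeW => x.
  by rewrite ger0_norm// invr_ge0 ltW.
- exact: torus_integrable_continuous.
apply: filterS (@ae_cell R d L) => x xL.
have := HM x xL; rewrite ger0_norm; last by rewrite invr_ge0 ltW.
move=> h.
by rewrite -[leRHS]invrK lef_pV2 ?posrE ?invr_gt0.
Qed.

(* Induction on the dimension: chain rule for the entropy, with the marginal in the first variable. *)
Theorem torus_logsobolev d (u : 'rV[R]_d -> R) : Defs.periodic L u -> continuous u ->
  (forall x, 0 < u x) -> (forall i x, derivable u x (unit_vec R i)) ->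
  (forall i, continuous (pderiv i u)) ->
  \int[@torus_measure R d L]_x (u x * ln (u x)) -
    \int[@torus_measure R d L]_x u x * ln (\int[@torus_measure R d L]_x u x / L ^+ d) <=
  (L / (2 * pi)) ^+ 2 * \sum_(i < d) \int[@torus_measure R d L]_x (pderiv i u x ^+ 2 / u x).
Proof.
elim: d u => [|d IH] u uL cu u0 du cdu.
  have E (f : 'rV[R]_0 -> R) : \int[@torus_measure R 0 L]_x f x = f 0.
    rewrite (_ : f = fun=> f 0); first by rewrite torus_Rintegral_cst// expr0 mulr1.
    by apply/funext => x; congr f; apply/rowP => -[].
  by rewrite !E expr0 divr1 subrr big_ord0 mulr0.
set C := (L / (2 * pi)) ^+ 2.
pose m (r : R) : R := \int[@torus_measure R d L]_y u (cons_rV (r, y)).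
pose dm (r : R) : R := \int[@torus_measure R d L]_y pderiv ord0 u (cons_rV (r, y)).
have du0 := periodic_pderiv ord0 uL.
have cm : continuous m by exact: continuous_fiber_integral.
have cdm : continuous dm by exact: continuous_fiber_integral.
have md (r : R) : is_derive r 1 m (dm r) by exact: is_derive_fiber_integral.
have mL r : m (r + L) = m r by apply: eq_Rintegral => y _; rewrite cons_rV_shift0 uL.
have dmL r : dm (r + L) = dm r by apply: eq_Rintegral => y _; rewrite cons_rV_shift0 du0.
have m0 r : 0 < m r by apply: torus_Rintegral_gt0 => //; exact: continuous_fiber.
have iC (h : R -> R) : continuous h -> (circle_measure L).-integrable setT (EFin \o h).
  exact: integrable_circle.
pose ent x := u x * ln (u x).
have cent : continuous ent by exact: continuous_xlnx.
have entL : Defs.periodic L ent by move=> x i; rewrite /ent uL.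
pose fi i x := pderiv i u x ^+ 2 / u x.
have cfi i : continuous (fi i) by exact: continuous_sqr_div.
have fiL i : Defs.periodic L (fi i) by move=> x j; rewrite /fi uL (periodic_pderiv i uL).
have Ld0 : 0 < L ^+ d by rewrite exprn_gt0.
(* The induction hypothesis on the fibre over [r], which has mass [m r]. *)
have step1 r : \int[@torus_measure R d L]_y ent (cons_rV (r, y)) - m r * ln (m r / L ^+ d) <=
    C * \sum_(i < d) \int[@torus_measure R d L]_y fi (lift ord0 i) (cons_rV (r, y)).
  have h1 := @periodic_cons_rV R d L u r uL.
  have h2 := @continuous_fiber R d u r cu.
  have h3 (y : 'rV[R]_d) : 0 < u (cons_rV (r, y)) by exact: u0.
  have h4 (i : 'I_d) (y : 'rV[R]_d) : derivable (fun y => u (cons_rV (r, y))) y (unit_vec R i).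
    by apply: derivable_fiber; exact: du.
  have c i : continuous (pderiv i (fun y => u (cons_rV (r, y)))).
    rewrite (_ : pderiv i _ = fun y => pderiv (lift ord0 i) u (cons_rV (r, y))).
      exact: continuous_fiber.
    by apply/funext => y; exact: pderiv_fiber.
  rewrite (eq_bigr (fun i => \int[@torus_measure R d L]_y
      (pderiv i (fun y => u (cons_rV (r, y))) y ^+ 2 / u (cons_rV (r, y))))).
    exact: (IH _ h1 h2 h3 h4 c).
  by move=> i _; apply: eq_Rintegral => y _; rewrite pderiv_fiber.
have step2 := circle_logsobolev L0 md cdm mL dmL m0.
(* The Fisher information of the marginal is at most that of [u] in the first direction. In place of
   the Cauchy-Schwarz inequality, [p^2 / q >= 2 la p - la^2 q] is integrated with the value
   [la = dm / m], for which equality holds after integration. *)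
have step3 r : dm r ^+ 2 / m r <= \int[@torus_measure R d L]_y fi ord0 (cons_rV (r, y)).
  pose la := dm r / m r.
  have -> : dm r ^+ 2 / m r = 2 * la * dm r - la ^+ 2 * m r by rewrite /la; field; rewrite gt_eqF.
  have i1 : (@torus_measure R d L).-integrable setT (EFin \o (fun y => pderiv ord0 u (cons_rV (r, y)))).
    by apply: torus_integrable_continuous => //; exact: continuous_fiber.
  have i2 : (@torus_measure R d L).-integrable setT (EFin \o (fun y => u (cons_rV (r, y)))).
    by apply: torus_integrable_continuous => //; exact: continuous_fiber.
  rewrite /m /dm -RintegralZl// -RintegralZl// -RintegralB//; [|exact: RintegrableZ|exact: RintegrableZ].
  apply: le_Rintegral => //.
  - by apply: RintegrableB; exact: RintegrableZ.
  - by apply: torus_integrable_continuous => //; exact: continuous_fiber.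
  move=> y _; rewrite /fi; set p := pderiv _ _ _; set q := u _.
  have q0 : 0 < q by exact: u0.
  rewrite -subr_ge0 (_ : _ - _ = (p - la * q) ^+ 2 / q); last by field; rewrite gt_eqF.
  by rewrite divr_ge0 ?sqr_ge0// ltW.
have cM (h k : R -> R) : continuous h -> continuous k -> continuous (fun x => h x * k x).
  by move=> ch ck x; exact: (cvgM (ch x) (ck x)).
have cc (a : R) : continuous (fun _ : R => a) by exact: cst_continuous.
pose Fi i (r : R) : R := \int[@torus_measure R d L]_y fi i (cons_rV (r, y)).
have cFi i : continuous (Fi i) by exact: continuous_fiber_integral.
pose Em (r : R) : R := \int[@torus_measure R d L]_y ent (cons_rV (r, y)).
have cEm : continuous Em by exact: continuous_fiber_integral.
have cmln : continuous (fun r => m r * ln (m r)) by exact: continuous_xlnx.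
have sE : \int[circle_measure L]_r (\sum_(i < d) Fi (lift ord0 i) r) =
    \sum_(i < d) \int[circle_measure L]_r Fi (lift ord0 i) r.
  by apply: Rintegral_sum => i; exact: iC.
have isum : (circle_measure L).-integrable setT (EFin \o (fun r => \sum_(i < d) Fi (lift ord0 i) r)).
  by apply: Rintegrable_sum => i; exact: iC.
have S1 : \int[circle_measure L]_r (Em r + ln (L ^+ d) * m r - m r * ln (m r)) <=
    C * \sum_(i < d) \int[circle_measure L]_r Fi (lift ord0 i) r.
  rewrite -sE -RintegralZl//.
  apply: le_Rintegral => //.
  - apply: RintegrableB; last exact: iC.
    by apply: RintegrableD; [exact: iC|apply: RintegrableZ; exact: iC].
  - exact: RintegrableZ.
  move=> r _; apply: le_trans (step1 r).
  rewrite ln_div ?posrE// mulrBr opprB /Em le_eqVlt; apply/orP; left; apply/eqP; ring.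
rewrite RintegralB// ?RintegralD// ?RintegralZl// in S1; try exact: iC; last 2 first.
- by apply: RintegrableZ; exact: iC.
- by apply: RintegrableD; [exact: iC|apply: RintegrableZ; exact: iC].
have S3 : \int[circle_measure L]_r (dm r ^+ 2 / m r) <= \int[circle_measure L]_r Fi ord0 r.
  apply: le_Rintegral => //; [apply: iC; exact: continuous_sqr_div|exact: iC].
rewrite big_ord_recl (Rintegral_torusS L0 entL cent) (Rintegral_torusS L0 uL cu)
  (Rintegral_torusS L0 (fiL ord0) (cfi ord0)).
have sE' : \sum_(i < d) \int[@torus_measure R d.+1 L]_x (pderiv (lift ord0 i) u x ^+ 2 / u x) =
    \sum_(i < d) \int[circle_measure L]_r Fi (lift ord0 i) r.
  by apply: eq_bigr => i _; rewrite (Rintegral_torusS L0 (fiL _) (cfi _)).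
rewrite sE'.
set U := \int[circle_measure L]_r m r in S1 step2 *.
have U0 : 0 < U.
  by have := torus_Rintegral_gt0 cu u0; rewrite Rintegral_torusS.
(* The normalization by the volume splits into that of the base, [L], and that of the fibre,
   [L ^+ d]; this is the chain rule of the entropy. *)
have lnE : ln (U / L ^+ d.+1) = ln (U / L) - ln (L ^+ d).
  by rewrite -ln_div ?posrE ?divr_gt0// exprSr invfM mulrA [U / _ / _]mulrAC.
have S2 := ler_wpM2l (sqr_ge0 (L / (2 * pi))) S3.
rewrite lnE [C * (_ + _)]mulrDr; rewrite -/C in S2 step2.
have alg (e V l k cs mm dd f0 : R) : e + k * V - mm <= cs -> mm - V * l <= dd -> dd <= f0 ->
    e - V * (l - k) <= f0 + cs by clear -R; lra.
exact: alg S1 step2 S2.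
Qed.

End torus_logsobolev.

(** * Weak derivatives and the velocity field *)

Section Lfun_characterization.
Context dT (T : measurableType dT) (R : realType) (mu : {measure set T -> \bar R}).
Implicit Types f g : T -> R.

Lemma Lfun_measurable p f : f \in Lfun mu p -> measurable_fun setT f.
Proof. by move=> /sub_Lfun_mfun; rewrite inE. Qed.

Lemma Lfun_bound f : (0 < mu setT)%E -> f \in Lfun mu +oo ->
  {ae mu, forall x, `|f x| <= fine 'N[mu]_+oo[EFin \o f]%E}.
Proof.
move=> mu0 fL; have := sub_Lfun_finLfun fL; rewrite inE /= /finite_norm unlock mu0 => foo.
have := ess_sup_ge mu (fun x => `|(EFin \o f) x|%E); apply: filterS => x /= h.
move: foo h; set s := ess_sup _ _; case: s => [r _|//|_] /=.
by rewrite lee_fin.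
by [].
Qed.

Lemma Lfun_bounded f : f \in Lfun mu +oo ->
  exists2 M, 0 <= M & {ae mu, forall x, `|f x| <= M}.
Proof.
have [mu0|] := ltP 0%E (mu setT).
  move=> /(Lfun_bound mu0) h; exists (fine 'N[mu]_+oo[EFin \o f]%E) => //.
  exact/fine_ge0/Lnorm_ge0.
(* On a space of measure zero every bound holds almost everywhere. *)
move=> mu0 _; exists 0 => //; exists setT; split => //.
by apply/eqP; rewrite eq_le mu0 measure_ge0.
Qed.

Lemma bounded_Lfun f M : measurable_fun setT f -> {ae mu, forall x, `|f x| <= M} -> f \in Lfun mu +oo.
Proof.
move=> mf fM; rewrite inE; apply/andP; split; rewrite inE//= /finite_norm unlock.
case: ifP => // _; apply: le_lt_trans (ltry M); apply/ess_supP.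
by apply: filterS fM => x /=; rewrite lee_fin.
Qed.

Lemma Lnorm2E f : (('N[mu]_2%:E[EFin \o f]) `^ 2 = \int[mu]_x (f x ^+ 2)%:E)%E.
Proof.
rewrite poweR_Lnorm//; apply: eq_integral => x _.
by rewrite /= powR_mulrn// real_normK// num_real.
Qed.

Lemma Lfun2P f : f \in Lfun mu 2%:E <->
  measurable_fun setT f /\ mu.-integrable setT (EFin \o (fun x => f x ^+ 2)).
Proof.
split=> [fL|[mf fi]].
  split; first exact: Lfun_measurable fL.
  by exact: Lfun2_integrable_sqr.
rewrite inE; apply/andP; split; rewrite inE//= /finite_norm.
move/integrableP : fi => [_]; rewrite (eq_integral (fun x => (f x ^+ 2)%:E)); last first.
  by move=> x _ /=; rewrite ger0_norm// sqr_ge0.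
rewrite -Lnorm2E; by move=> /lty_poweRy; exact.
Qed.

Lemma Lfun2_lin (a : R) f g : f \in Lfun mu 2%:E -> g \in Lfun mu 2%:E ->
  (fun x => a * f x + g x) \in Lfun mu 2%:E.
Proof.
move=> /Lfun2P[mf jf] /Lfun2P[mg ig]; apply/Lfun2P.
have mh : measurable_fun setT (fun x => a * f x + g x).
  by apply: measurable_funD => //; exact: measurable_funM.
split => //.
apply: (@Rintegrable_le _ _ _ _ _ (fun x => 2 * a ^+ 2 * f x ^+ 2 + 2 * g x ^+ 2)).
- exact: measurable_funX.
- apply: aeW => x; rewrite ger0_norm ?sqr_ge0//.
  by rewrite -subr_ge0 (_ : _ - _ = (a * f x - g x) ^+ 2) ?sqr_ge0//; ring.
- by apply: RintegrableD; exact: RintegrableZ.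
Qed.

End Lfun_characterization.

(** * Fubini's theorem for real-valued integrals *)

Section real_fubini.
Context d1 d2 (X : measurableType d1) (Y : measurableType d2) (R : realType).
Variables (m1 : {sigma_finite_measure set X -> \bar R}) (m2 : {sigma_finite_measure set Y -> \bar R}).
Implicit Types F : X * Y -> R.

Lemma measurable_Rfubini1 F : (m1 \x m2)%E.-integrable setT (EFin \o F) ->
  measurable_fun setT (fun x => \int[m2]_y F (x, y)).
Proof. by move=> iF; have := measurable_fubini_F iF; exact: (measurableT_comp (fine_measurable measurableT)). Qed.

Lemma measurable_Rfubini2 F : (m1 \x m2)%E.-integrable setT (EFin \o F) ->
  measurable_fun setT (fun y => \int[m1]_x F (x, y)).
Proof. by move=> iF; have := measurable_fubini_G iF; exact: (measurableT_comp (fine_measurable measurableT)). Qed.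

(** The real inner integral can differ from the extended one only where the section is not
    integrable, and that is a null set. *)
Lemma Rfubini12 F : (m1 \x m2)%E.-integrable setT (EFin \o F) ->
  \int[m1]_x \int[m2]_y F (x, y) = \int[(m1 \x m2)%E]_z F z.
Proof.
move=> iF; rewrite /Rintegral -(integral12_prod_meas1 iF); congr fine.
apply: ae_eq_integral => //.
- by apply/measurable_EFinP; exact: measurable_Rfubini1.
- exact: (measurable_fubini_F iF).
- apply: filterS (ae_integrable1 iF) => x ix _ /=; rewrite fineK//.
  exact: integrable_fin_num.
Qed.

Lemma Rfubini21 F : (m1 \x m2)%E.-integrable setT (EFin \o F) ->
  \int[m2]_y \int[m1]_x F (x, y) = \int[(m1 \x m2)%E]_z F z.
Proof.
move=> iF; rewrite /Rintegral -(integral21_prod_meas1 iF); congr fine.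
apply: ae_eq_integral => //.
- by apply/measurable_EFinP; exact: measurable_Rfubini2.
- exact: (measurable_fubini_G iF).
- apply: filterS (ae_integrable2 iF) => x ix _ /=; rewrite fineK//.
  exact: integrable_fin_num.
Qed.

Lemma Rfubini F : (m1 \x m2)%E.-integrable setT (EFin \o F) ->
  \int[m1]_x \int[m2]_y F (x, y) = \int[m2]_y \int[m1]_x F (x, y).
Proof. by move=> iF; rewrite Rfubini12// Rfubini21. Qed.

Lemma integrable_Rfubini1 F : (m1 \x m2)%E.-integrable setT (EFin \o F) ->
  m1.-integrable setT (EFin \o (fun x => \int[m2]_y F (x, y))).
Proof.
move=> iF; have mF := measurable_Rfubini1 iF.
apply/integrableP; split; first exact/measurable_EFinP.
have /integrableP[mI] := integrable_fubini_F iF.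
apply: le_lt_trans; apply: ge0_le_integral => //.
- by apply: measurableT_comp => //; exact/measurable_EFinP.
- by apply: measurableT_comp => //; exact: measurable_fubini_F.
- move=> x _; rewrite /= /Rintegral /fubini_F /=.
  by case: (\int[_]_ _ _)%E => [r| |]//=; rewrite normr0 leey.
Qed.

Lemma Rfubini_integrable F (C : R) (a : Y -> R) : (m1 setT < +oo)%E ->
  measurable_fun setT F -> m2.-integrable setT (EFin \o a) ->
  (forall x y, `|F (x, y)| <= C * `|a y|) -> (m1 \x m2)%E.-integrable setT (EFin \o F).
Proof.
move=> m1oo mF ia FC; apply/integrable21ltyP; first exact/measurable_EFinP.
have mF2 y : measurable_fun setT (fun x => F (x, y)) by exact: (measurableT_comp mF).
have ma := Rintegrable_measurable ia.
have m1E : m1 setT = (fine (m1 setT))%:E by rewrite fineK// ge0_fin_numE.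
have h y : (\int[m1]_x `|(EFin \o F) (x, y)| <= (fine (m1 setT))%:E * (C * `|a y|)%:E)%E.
  rewrite -m1E muleC -integral_cst//; apply: ge0_le_integral => //.
  - by apply: measurableT_comp => //; exact/measurable_EFinP.
  - by move=> x _ /=; rewrite lee_fin.
have i1 : m2.-integrable setT (EFin \o (fun y => fine (m1 setT) * (C * `|a y|))).
  exact/RintegrableZ/RintegrableZ/Rintegrable_norm.
case/integrableP : i1 => mi; apply: le_lt_trans.
apply: ge0_le_integral => //.
- by move=> y _; exact: integral_ge0.
- apply: (@measurable_fun_fubini_tonelli_G _ _ _ _ _ m1 (fun z => `|(F z)%:E|%E)) => //.
  by apply: measurableT_comp => //; exact/measurable_EFinP.
- by apply: measurableT_comp.
- by move=> y _; apply: le_trans (h y) _; rewrite /= -EFinM lee_fin ler_norm.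
Qed.

End real_fubini.

(** * Functions with bounded weak derivatives *)

Section weak_derivatives.
Context (R : realType) (d : nat) (L : R) (L0 : 0 < L).
Local Notation dx := (@torus_measure R d L).
Local Notation circ := (circle_measure L).
Local Notation Rd := 'rV[R]_d.
Local Notation e_ := (unit_vec R).
Implicit Types (f g u phi psi : Rd -> R).

(** The bound holds at every point. Elements of [L^oo] are first replaced by such representatives,
    after which translates and convolutions are bounded everywhere too. *)
Definition bounded_by (M : R) f :=
  [/\ Defs.periodic L f, measurable_fun setT f & forall x, `|f x| <= M].

Lemma bounded_by_integrable M f : bounded_by M f -> dx.-integrable setT (EFin \o f).
Proof. by move=> [_ mf fM]; apply: (@torus_integrable_bounded _ _ L f M) => //; exact: aeW. Qed.

Lemma bounded_byM M N f g : bounded_by M f -> bounded_by N g -> bounded_by (M * N) (fun x => f x * g x).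
Proof.
move=> [fL mf fM] [gL mg gN]; split; first by move=> x i; rewrite fL gL.
  exact: measurable_funM.
by move=> x; rewrite normrM ler_pM.
Qed.

Lemma bounded_by_shift M f v : bounded_by M f -> bounded_by M (fun x => f (x + v)).
Proof.
move=> [fL mf fM]; split => //; [exact: periodic_shift|exact: measurable_shift].
Qed.

Lemma continuous_bounded_by f : Defs.periodic L f -> continuous f -> exists2 M, 0 <= M & bounded_by M f.
Proof.
move=> fL cf; have [M M0 fM] := torus_bounded L0 fL cf.
by exists M => //; split => //; exact: continuous_measurable_rV.
Qed.

(** Clamping to [[- M, M]] keeps the function periodic and changes it on a null set only. *)
Lemma bounded_version f : Defs.periodic L f -> f \in Lfun dx +oo ->
  exists M g, [/\ 0 <= M, bounded_by M g & {ae dx, forall x, f x = g x}].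
Proof.
move=> fL fo; have [M M0 fM] := Lfun_bounded fo; have mf := Lfun_measurable fo.
exists M, (fun x => Num.max (- M) (Num.min (f x) M)); split => //; last first.
  by apply: filterS fM => x; rewrite ler_norml => /andP[a b]; rewrite min_l// max_r.
split; first by move=> x i; rewrite fL.
  by apply: measurable_maxr => //; exact: measurable_minr.
move=> x; rewrite ler_norml le_max lexx/= ge_max ge_min lexx orbT andbT; lra.
Qed.

Lemma pderiv_shift i f (v : Rd) : pderiv i (fun x => f (x + v)) = (fun x => pderiv i f (x + v)).
Proof.
apply/funext => x; rewrite /pderiv /derive.
set f1 := (fun _ => _); set f2 := (fun _ => _); suff -> : f1 = f2 by [].
by apply/funext => h; rewrite /f1 /f2 /= addrA.
Qed.

Lemma derivable_shift i f (v x : Rd) : derivable f (x + v) (e_ i) -> derivable (fun x => f (x + v)) x (e_ i).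
Proof.
rewrite /derivable.
set f1 := (fun _ => _); set f2 := (fun _ => _); suff -> : f1 = f2 by [].
by apply/funext => h; rewrite /f1 /f2 /= addrA.
Qed.

Lemma pderivs_shift s f (v : Rd) : pderivs s (fun x => f (x + v)) = (fun x => pderivs s f (x + v)).
Proof. by elim: s => //= i s ->; rewrite pderiv_shift. Qed.

Lemma continuous_shift_rV f (v : Rd) : continuous f -> continuous (fun x : Rd => f (x + v)).
Proof.
move=> cf x; have c1 : (fun x : Rd => x + v) @ x --> x + v by exact: (cvgD cvg_id (cvg_cst _)).
exact: (@continuous_comp _ _ _ (fun x : Rd => x + v) f x c1 (cf _)).
Qed.

Lemma torus_smooth_shift f (v : Rd) : torus_smooth L f -> torus_smooth L (fun x => f (x + v)).
Proof.
move=> sf k; have [fL fk] := sf k; split; first exact: periodic_shift.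
move=> s sk; have [c1 d1] := fk s sk; rewrite pderivs_shift; split.
  exact: continuous_shift_rV.
by move=> sk' i x; apply: derivable_shift; exact: d1.
Qed.

Lemma torus_smooth_pderiv f i : torus_smooth L f -> torus_smooth L (pderiv i f).
Proof.
move=> sf k; have [fL _] := sf 0%N; split; first exact: periodic_pderiv.
have [_ fk] := sf k.+1 => s sk.
have -> : pderivs s (pderiv i f) = pderivs (rcons s i) f by rewrite /pderivs foldr_rcons.
have [|c1 d1] := fk (rcons s i); first by rewrite size_rcons ltnS.
by split => // sk'; apply: d1; rewrite size_rcons ltnS.
Qed.

Definition torus_C1 i f := [/\ Defs.periodic L f, continuous f,
  forall x, derivable f x (e_ i) & continuous (pderiv i f)].

Lemma torus_smooth_C1 f i : torus_smooth L f -> torus_C1 i f.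
Proof.
move=> sf; have [fL fk] := sf 1%N.
have [c0 d0] := fk [::] isT; have [c1 _] := fk [:: i] isT.
by split => //; move=> x; exact: d0.
Qed.

Lemma torus_C1_shift f i (v : Rd) : torus_C1 i f -> torus_C1 i (fun x => f (x + v)).
Proof.
move=> [fL cf df cdf]; split.
- exact: periodic_shift.
- exact: continuous_shift_rV.
- by move=> x; exact: derivable_shift.
- by rewrite pderiv_shift; exact: continuous_shift_rV.
Qed.

Lemma continuous_axis f (x : Rd) i (a : R) : continuous f -> continuous (fun s : R => f (x - (a * s) *: e_ i)).
Proof.
move=> cf s; have c1 : {for s, continuous (fun s : R => x - (a * s) *: e_ i)}.
  apply: cvgB; first exact: cvg_cst.
  by apply: cvgZr_tmp; apply: cvgM; [exact: cvg_cst|exact: cvg_id].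
exact: (continuous_comp c1 (cf _)).
Qed.

(** * Translates of a bounded function [g] with bounded weak derivative [w] along one axis *)

Section pairing.
Context (i : 'I_d) (M : R) (g w : Rd -> R) (M0 : 0 <= M).
Hypotheses (bg : bounded_by M g) (bw : bounded_by M w).
Hypothesis gw : forall phi, torus_smooth L phi ->
  \int[dx]_x (g x * pderiv i phi x) = - \int[dx]_x (w x * phi x).

(** The pairing of [f] with the translates of [psi]. Differentiation in [s] falls on [psi], and the
    weak derivative carries it over to [w], so that questions about [g] become calculus of one
    variable. *)
Let pair f psi (s : R) : R := \int[dx]_x (f x * psi (x - s *: e_ i)).

Lemma pairing_continuous f psi : bounded_by M f -> Defs.periodic L psi -> continuous psi ->
  continuous (pair f psi).
Proof.
move=> bf psiL cpsi r; have [N N0 bpsi] := continuous_bounded_by psiL cpsi.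
have rI : r \in (`]r - 1, r + 1[%classic : set R).
  by rewrite inE/= in_itv/=; apply/andP; split; lra.
have bs s := bounded_byM bf (bounded_by_shift (- (s *: e_ i)) bpsi).
apply: (@continuity_under_integral _ _ _ dx (fun s x => f x * psi (x - s *: e_ i)) setT measurableT
  (r - 1) (r + 1) _ _ (cst (M * N))) => //.
- by move=> s _; exact: bounded_by_integrable (bs s).
- apply: aeW => y _ s _; apply: cvgM; first exact: cvg_cst.
  have := @continuous_axis psi y i 1 cpsi s.
  by rewrite (_ : (fun s : R => psi (y - (1 * s) *: e_ i)) = (fun s : R => psi (y - s *: e_ i)))//; apply/funext => z; rewrite mul1r.
- apply: (@torus_integrable_bounded _ _ L _ (M * N)) => //; apply: aeW => x.
  by rewrite ger0_norm// mulr_ge0.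
- by move=> s _; apply: aeW => y _; have [_ _] := bs s; apply.
Qed.

Lemma pairing_derive f psi (s : R) : bounded_by M f -> torus_C1 i psi ->
  is_derive s 1 (pair f psi) (- pair f (pderiv i psi) s).
Proof.
move=> bf [psiL cpsi dpsi cdpsi]; have [N N0 bdpsi] := continuous_bounded_by (periodic_pderiv i psiL) cdpsi.
have [N' N0' bpsi] := continuous_bounded_by psiL cpsi.
have sI : (`]s - 1, s + 1[%classic : set R) s by rewrite /= in_itv/=; apply/andP; split; lra.
pose F (s : R) (y : Rd) : R := f y * psi (y - s *: e_ i).
have Fd (r : R) (y : Rd) : is_derive r 1 (F ^~ y) (f y * - pderiv i psi (y - r *: e_ i)).
  apply: is_derive_scale.
  have E : is_derive (- r) 1 (fun s : R => psi (s *: e_ i + y)) (pderiv i psi (y - r *: e_ i)).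
    by rewrite [y - _]addrC -scaleNr; exact: is_derive_along.
  have Eopp : is_derive r 1 (fun s : R => - s) (-1) by exact: is_deriveN.
  have := is_derive_chainR E Eopp.
  rewrite mulrN1 (_ : (fun x => psi (- x *: e_ i + y)) = (fun s : R => psi (y - s *: e_ i)))//.
  by apply/funext => z; rewrite scaleNr addrC.
have pE (r : R) (y : Rd) : partial1of2 F r y = f y * - pderiv i psi (y - r *: e_ i).
  by rewrite partial1of2E; have [_ ->] := Fd r y.
have bs (r : R) := bounded_byM bf (bounded_by_shift (- (r *: e_ i)) bpsi).
have bds (r : R) := bounded_byM bf (bounded_by_shift (- (r *: e_ i)) bdpsi).
have h1 (r : R) : (`]s - 1, s + 1[%classic : set R) r -> dx.-integrable setT (EFin \o F r).
  by move=> _; exact: bounded_by_integrable (bs r).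
have h2 (r : R) (y : Rd) : (`]s - 1, s + 1[%classic : set R) r -> [set: Rd] y -> derivable (F ^~ y) r 1.
  by move=> _ _; have [] := Fd r y.
have h3 : dx.-integrable setT (EFin \o (cst (M * N) : Rd -> R)).
  apply: (@torus_integrable_bounded _ _ L _ (M * N)) => //; apply: aeW => x.
  by rewrite ger0_norm// mulr_ge0.
have h4 (r : R) (y : Rd) : (`]s - 1, s + 1[%classic : set R) r -> [set: Rd] y ->
    `|partial1of2 F r y| <= (cst (M * N) : Rd -> R) y.
  by move=> _ _; rewrite pE mulrN normrN; have [_ _] := bds r; apply.
have M0' (y : Rd) : 0 <= (cst (M * N) : Rd -> R) y by rewrite mulr_ge0.
have H := derivable_under_integral measurableT sI h1 h2 M0' h3 h4.
split; first exact: H.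
rewrite -derive1E (differentiation_under_integral measurableT sI h1 h2 M0' h3 h4).
under eq_Rintegral do rewrite pE mulrN.
rewrite -mulN1r -RintegralZl//; last exact: bounded_by_integrable (bds s).
by apply: eq_Rintegral => x _; rewrite mulN1r.
Qed.

(** [sigma h] maps the period onto the segment from [0] to [h], so [avg h x] is the integral of
    [w (x + s e_i)] for [s] from [0] to [h]. Written on the circle it covers both signs of [h] and
    uses one fixed finite measure. *)
Let sigma (h r : R) : R := h * (r / L + 1 / 2).
Let avg (h : R) (x : Rd) : R := h / L * \int[circ]_r w (x + sigma h r *: e_ i).

Lemma measurable_avg_arg h : measurable_fun setT
  (fun p : Rd * measurableTypeR R => w (p.1 + sigma h p.2 *: e_ i)).
Proof.
have [_ mw _] := bw; apply: (measurableT_comp mw).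
apply: measurable_fun_rV => j.
rewrite (_ : (fun x => _) = (fun p : Rd * measurableTypeR R => p.1 ord0 j + (h * (p.2 / L + 1 / 2)) * e_ i ord0 j)); last first.
  by apply/funext => p; rewrite rowDE rowZE.
apply: measurable_funD; first exact: (measurableT_comp (measurable_coord j) measurable_fst).
apply: measurable_funM => //; apply: measurable_funM => //; apply: measurable_funD => //.
by apply: measurable_funM.
Qed.

Lemma measurable_avg_sec h (x : Rd) : measurable_fun setT
  (fun r : measurableTypeR R => w (x + sigma h r *: e_ i)).
Proof.
have [_ mw _] := bw; apply: (measurableT_comp mw).
apply: measurable_fun_rV => j.
rewrite (_ : (fun r => _) = (fun r : R => x ord0 j + (h * (r / L + 1 / 2)) * e_ i ord0 j)); last first.
  by apply/funext => r; rewrite rowDE rowZE.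
apply: measurable_funD => //; apply: measurable_funM => //; apply: measurable_funM => //.
by apply: measurable_funD => //; exact: measurable_funM.
Qed.

Lemma avg_pairing h psi : Defs.periodic L psi -> continuous psi ->
  \int[dx]_x (avg h x * psi x) = h / L * \int[circ]_r pair w psi (sigma h r).
Proof.
move=> psiL cpsi; have [N N0 bpsi] := continuous_bounded_by psiL cpsi.
have [wL mw wM] := bw; have [_ mpsi psiN] := bpsi.
pose F (p : Rd * measurableTypeR R) : R := w (p.1 + sigma h p.2 *: e_ i) * psi p.1.
have iF : (@torus_fmeasure R d L \x circ)%E.-integrable setT (EFin \o F).
  apply: (@Rfubini_integrable _ _ _ _ _ _ _ _ (M * N) (cst 1)).
  - exact: torus_measure_fin.
  - apply: measurable_funM; first exact: measurable_avg_arg.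
    exact: (measurableT_comp mpsi measurable_fst).
  - by apply: integrable_circle => //; exact: cst_continuous.
  - by move=> x y; rewrite normr1 mulr1 normrM ler_pM.
have -> : \int[dx]_x (avg h x * psi x) = h / L * \int[dx]_x \int[circ]_r F (x, r).
  rewrite -RintegralZl//; last exact: (integrable_Rfubini1 iF).
  apply: eq_Rintegral => x _; rewrite /avg -mulrA; congr (_ * _).
  rewrite mulrC -RintegralZl//; first by apply: eq_Rintegral => r _; rewrite mulrC.
  apply: (@Rintegrable_bounded _ _ _ _ _ M); last by apply: aeW => r; exact: wM.
    by have := circle_measureT (ltW L0) => /= ->; rewrite ltry.
  exact: measurable_avg_sec.
congr (_ * _); rewrite -[LHS]/(\int[@torus_fmeasure R d L]_x \int[circ]_r F (x, r)) (Rfubini iF).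
apply: eq_Rintegral => r _; rewrite /F /pair /=.
have [sL ms _] := bounded_byM bw (bounded_by_shift (- (sigma h r *: e_ i)) bpsi).
rewrite -[RHS](Rintegral_torus_shift L0 (sigma h r *: e_ i) sL ms).
by apply: eq_Rintegral => x _; rewrite addrK.
Qed.

Lemma avg_bound h x : `|avg h x| <= M * `|h|.
Proof.
have [wL mw wM] := bw.
have iw : circ.-integrable setT (EFin \o (fun r => w (x + sigma h r *: e_ i))).
  apply: (@Rintegrable_bounded _ _ _ _ _ M); last by apply: aeW => r; exact: wM.
    by have := circle_measureT (ltW L0) => /= ->; rewrite ltry.
  exact: measurable_avg_sec.
rewrite /avg normrM normrM normfV (gtr0_norm L0).
apply: (@le_trans _ _ (`|h| / L * (M * L))); last first.
  by rewrite mulrACA mulVf ?gt_eqF// mulr1 mulrC.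
apply: ler_wpM2l; first by rewrite divr_ge0// ltW.
apply: le_trans (le_normr_Rintegral _ iw) _ => //.
rewrite -(circle_Rintegral_cst L0); apply: le_Rintegral => //.
- exact: Rintegrable_norm.
- by apply: integrable_circle => //; exact: cst_continuous.
Qed.

Lemma circ_pairing_continuous h psi : Defs.periodic L psi -> continuous psi ->
  continuous (fun r => pair w psi (sigma h r)).
Proof.
move=> psiL cpsi r.
have c1 : {for r, continuous (sigma h)}.
  apply: cvgM; first exact: cvg_cst.
  by apply: cvgD; [apply: cvgM; [exact: cvg_id|exact: cvg_cst]|exact: cvg_cst].
exact: (continuous_comp c1 (@pairing_continuous w psi bw psiL cpsi _)).
Qed.

Lemma measurable_avg h : measurable_fun setT (avg h).
Proof.
apply: measurable_funM => //.
apply: (@measurable_Rfubini1 _ _ _ _ R (@torus_fmeasure R d L) circ (fun p => w (p.1 + sigma h p.2 *: e_ i))).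
apply: (@Rfubini_integrable _ _ _ _ _ _ _ _ M (cst 1)).
- exact: torus_measure_fin.
- exact: measurable_avg_arg.
- by apply: integrable_circle => //; exact: cst_continuous.
- by move=> x y; rewrite normr1 mulr1; have [_ _] := bw; apply.
Qed.

(** The fundamental theorem of calculus for weak derivatives. Tested against a smooth [phi], the
    left side is the increment over [[0, h]] of [pair g phi], whose derivative is [pair w phi];
    [test_fun_ae_unique] removes [phi]. The null set depends on [h]. *)
Lemma difference_avg h : {ae dx, forall x, g (x + h *: e_ i) - g x = avg h x}.
Proof.
have [gL mg gM] := bg; have [wL mw wM] := bw.
have bgs := bounded_by_shift (h *: e_ i) bg.
have ig := bounded_by_integrable bg; have igs := bounded_by_integrable bgs.
have iavg : dx.-integrable setT (EFin \o avg h).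
  apply: (@torus_integrable_bounded _ _ L _ (M * `|h|)); first exact: measurable_avg.
  by apply: aeW => x; exact: avg_bound.
suff : {ae dx, forall x, (g (x + h *: e_ i) - g x) - avg h x = 0}.
  by apply: filterS => x /eqP; rewrite subr_eq0 => /eqP.
apply: (@test_fun_ae_unique R d L L0).
  by apply: RintegrableB => //; exact: RintegrableB.
move=> phi sphi; have [phiL cphi dphi cdphi] := torus_smooth_C1 i sphi.
have [N N0 bphi] := continuous_bounded_by phiL cphi.
have [_ mphi phiN] := bphi.
have i1 := bounded_by_integrable (bounded_byM bgs bphi).
have i2 := bounded_by_integrable (bounded_byM bg bphi).
have i3 : dx.-integrable setT (EFin \o (fun x => avg h x * phi x)).
  have := RintegrableM_bounded mphi (aeW _ phiN) iavg.
  by under eq_fun do rewrite mulrC.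
under eq_Rintegral do rewrite mulrBl mulrBl.
rewrite RintegralB//; last exact: RintegrableB.
rewrite RintegralB// avg_pairing//.
have -> : \int[dx]_x (g x * phi x) = pair g phi 0.
  by apply: eq_Rintegral => x _; rewrite scale0r subr0.
have -> : \int[dx]_x (g (x + h *: e_ i) * phi x) = pair g phi h.
  have [sL ms _] := bounded_byM bg (bounded_by_shift (- (h *: e_ i)) bphi).
  rewrite -[RHS](Rintegral_torus_shift L0 (h *: e_ i) sL ms).
  by apply: eq_Rintegral => x _; rewrite addrK.
have E (s : R) : is_derive s 1 (pair g phi) (pair w phi s).
  have := pairing_derive s bg (torus_smooth_C1 i sphi).
  rewrite (_ : - pair g (pderiv i phi) s = pair w phi s)//.
  have := gw (torus_smooth_shift (- (s *: e_ i)) sphi).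
  by rewrite pderiv_shift /pair => ->; rewrite opprK.
pose K (r : R) : R := pair g phi (sigma h r).
have Kd (r : R) : is_derive r 1 K (pair w phi (sigma h r) * (h / L)).
  have Es : is_derive r 1 (sigma h) (h / L).
    rewrite /sigma (_ : (fun r => _) = (fun r : R => (h / L) *: r + h / 2)); last first.
      by apply/funext => z; rewrite /GRing.scale/=; ring.
    by apply: is_derive_eq; rewrite /GRing.scale/= mulr1 addr0.
  exact: (is_derive_chainR (E _) Es).
have cK := @circ_pairing_continuous h phi phiL cphi.
have ab : - (L / 2) < L / 2 by have := L0; lra.
rewrite -RintegralZl//; last exact: integrable_circle.
have cK' : continuous (fun r : R => pair w phi (sigma h r) * (h / L)).
  by move=> r; exact: (cvgM (cK r) (cvg_cst _)).
under eq_Rintegral do rewrite mulrC.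
rewrite Rintegral_circle// (Rintegral_FTC2 ab (fun r _ => Kd r)); last exact: continuous_within.
rewrite /K /sigma.
have -> : h * (L / 2 / L + 1 / 2) = h by field; rewrite gt_eqF.
have -> : h * (- (L / 2) / L + 1 / 2) = 0 by field; rewrite gt_eqF.
by rewrite subrr.
Qed.

Lemma difference_bound h : {ae dx, forall x, `|g (x + h *: e_ i) - g x| <= M * `|h|}.
Proof. by apply: filterS (difference_avg h) => x ->; exact: avg_bound. Qed.

(** Passage from smooth to [C^1] test functions without mollifiers: the difference quotient of [psi]
    is moved onto [g] by translation, becomes an average of [w] by [difference_avg], and converges
    as the step tends to [0]. *)
Lemma weak_deriv_C1 psi : torus_C1 i psi ->
  \int[dx]_x (g x * pderiv i psi x) = - \int[dx]_x (w x * psi x).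
Proof.
move=> [psiL cpsi dpsi cdpsi].
have [N N0 bdpsi] := continuous_bounded_by (periodic_pderiv i psiL) cdpsi.
have [N' N0' bpsi] := continuous_bounded_by psiL cpsi.
have [gL mg gM] := bg; have [_ _ dpsiN] := bdpsi; have [_ mpsi psiN] := bpsi.
pose a (n : nat) : R := n.+1%:R^-1.
have lip := pderiv_lipschitz dpsi dpsiN.
have c1 : \int[dx]_x (g x * (n.+1%:R * (psi (x + a n *: e_ i) - psi x))) @[n --> \oo] -->
    \int[dx]_x (g x * pderiv i psi x).
  apply: (@Rdominated_cvg _ _ _ _ _ _ (cst (M * N))).
  - move=> n; apply: measurable_funM => //; apply: measurable_funM => //.
    by apply: measurable_funB => //; exact: measurable_shift.
  - by apply: measurable_funM => //; exact: measurable_pderiv.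
  - apply: aeW => x; apply: cvgM; first exact: cvg_cst.
    exact: derivable_cvg_seq.
  - by apply: (@torus_integrable_bounded _ _ L _ (M * N)) => //; apply: aeW => x; rewrite ger0_norm// mulr_ge0.
  - move=> n; apply: aeW => x; rewrite normrM; apply: ler_pM => //.
    rewrite normrM ger0_norm// mulrC -ler_pdivlMr//.
    by apply: le_trans (lip _ _) _; rewrite /a ger0_norm.
have E n : \int[dx]_x (g x * (n.+1%:R * (psi (x + a n *: e_ i) - psi x))) =
    - (L^-1 * \int[circ]_r pair w psi (sigma (- a n) r)).
  have -> : - (L^-1 * \int[circ]_r pair w psi (sigma (- a n) r)) =
      n.+1%:R * \int[dx]_x (avg (- a n) x * psi x).
    by rewrite avg_pairing// mulrA /a mulNr mulrN mulNr; congr (- (_ * _)); rewrite mulrA divff ?mul1r.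
  have -> : \int[dx]_x (avg (- a n) x * psi x) = \int[dx]_x ((g (x + - a n *: e_ i) - g x) * psi x).
    apply: ae_eq_Rintegral.
    - by apply: measurable_funM => //; exact: measurable_avg.
    - by apply: measurable_funM => //; apply: measurable_funB => //; exact: measurable_shift.
    - by apply: filterS (difference_avg (- a n)) => x ->.
  have i1 := bounded_by_integrable (bounded_byM bg bpsi).
  have b2 := bounded_byM (bounded_by_shift (- a n *: e_ i) bg) bpsi.
  have i2 := bounded_by_integrable b2.
  have i3 := bounded_by_integrable (bounded_byM bg (bounded_by_shift (a n *: e_ i) bpsi)).
  under [in RHS]eq_Rintegral do rewrite mulrBl.
  rewrite [in RHS]RintegralB//.
  under eq_Rintegral do rewrite mulrCA mulrBr.
  rewrite RintegralZl//; last exact: RintegrableB.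
  rewrite RintegralB//; congr (_ * (_ - _)).
  have [sL ms _] := b2.
  rewrite -[RHS](Rintegral_torus_shift L0 (a n *: e_ i) sL ms).
  by apply: eq_Rintegral => x _; rewrite scaleNr addrK.
have bpair (s : R) : `|pair w psi s| <= M * N' * L ^+ d.
  have b := bounded_byM bw (bounded_by_shift (- (s *: e_ i)) bpsi).
  have ib := bounded_by_integrable b.
  apply: le_trans (le_normr_Rintegral _ ib) _ => //.
  rewrite -(torus_Rintegral_cst L0 d); apply: le_Rintegral => //.
  - exact: Rintegrable_norm.
  - apply: (@torus_integrable_bounded _ _ L _ (M * N')) => //; apply: aeW => x.
    by rewrite ger0_norm// mulr_ge0.
  - by move=> x _; have [_ _] := b; apply.
have c2 : \int[circ]_r pair w psi (sigma (- a n) r) @[n --> \oo] --> \int[circ]_r pair w psi 0.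
  apply: (@Rdominated_cvg _ _ _ _ _ _ (cst (M * N' * L ^+ d))).
  - by move=> n; apply: continuous_measurable_fun; exact: circ_pairing_continuous.
  - by [].
  - apply: aeW => r.
    have cs : sigma (- a n) r @[n --> \oo] --> (0 : R).
      rewrite -[X in _ --> X](mul0r (r / L + 1 / 2)); apply: cvgM; last exact: cvg_cst.
      by rewrite -[X in _ --> X]oppr0; apply: cvgN; exact: cvg_harmonic.
    exact: (continuous_cvg _ (@pairing_continuous w psi bw psiL cpsi 0) cs).
  - by apply: integrable_circle => //; exact: cst_continuous.
  - by move=> n; apply: aeW => r; exact: bpair.
have c3 : - (L^-1 * \int[circ]_r pair w psi (sigma (- a n) r)) @[n --> \oo] -->
    - (L^-1 * \int[circ]_r pair w psi 0).
  by apply: cvgN; apply: cvgM; [exact: cvg_cst|exact: c2].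
move: c1; under eq_fun do rewrite E.
move=> c1; rewrite (cvg_unique _ c1 c3)//; congr (- _).
rewrite circle_Rintegral_cst// mulrC mulfK ?gt_eqF//.
by apply: eq_Rintegral => x _; rewrite scale0r subr0.
Qed.

(** The test function is the constant [1]. *)
Lemma weak_deriv_Rintegral0 : \int[dx]_x w x = 0.
Proof.
have dE : pderiv i (fun _ : Rd => 1 : R) = (fun=> 0).
  by apply/funext => x; exact: derive_cst.
have C : torus_C1 i (fun _ : Rd => 1 : R).
  split => //; [exact: cst_continuous|by rewrite dE; exact: cst_continuous].
have := weak_deriv_C1 C; rewrite dE.
under eq_Rintegral do rewrite mulr0.
under [in RHS]eq_Rintegral do rewrite mulr1.
by rewrite torus_Rintegral_cst// mul0r => /eqP; rewrite eq_sym oppr_eq0 => /eqP.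
Qed.

End pairing.

Lemma weak_deriv_unique s u g f : weak_deriv L s u g -> weak_deriv L s u f ->
  {ae dx, forall x, g x = f x}.
Proof.
move=> [gL /Lfun1_integrable ig hg] [fL /Lfun1_integrable jf hf].
suff : {ae dx, forall x, g x - f x = 0}.
  by apply: filterS => x /eqP; rewrite subr_eq0 => /eqP.
apply: (@test_fun_ae_unique R d L L0); first exact: RintegrableB.
move=> phi sphi; have [phiL cphi] : Defs.periodic L phi /\ continuous phi.
  by have [pL /(_ [::] isT)[c _]] := sphi 0%N.
have [N N0 [_ mphi phiN]] := continuous_bounded_by phiL cphi.
under eq_Rintegral do rewrite mulrBl ![_ * phi _]mulrC.
rewrite RintegralB//; try exact: RintegrableM_bounded mphi (aeW _ phiN) _.
have := hg phi sphi; rewrite (hf phi sphi) => /(mulrI _) E.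
rewrite [X in X - _](@eq_Rintegral _ _ _ _ _ (fun x => g x * phi x)); last by move=> x _; rewrite mulrC.
rewrite [X in _ - X](@eq_Rintegral _ _ _ _ _ (fun x => f x * phi x)); last by move=> x _; rewrite mulrC.
by rewrite E ?subrr// unitrX// unitrN unitr1.
Qed.

Section potential.
Context (D : Rd -> R) (HD : sobolev L 2 +oo D).

Lemma wderivP s : (size s <= 2)%N ->
  weak_deriv L s D (wderiv L s D) /\ wderiv L s D \in Lfun dx +oo.
Proof.
move=> s2; have [_ _ /(_ s s2)[g wg go]] := HD.
have wd : weak_deriv L s D (wderiv L s D).
  by apply: (@xgetPex _ (cst 0) [set g | weak_deriv L s D g]); exists g.
split => //; have [M M0 gM] := Lfun_bounded go.
apply: (@bounded_Lfun _ _ _ _ _ M).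
  by have [_ /Lfun_measurable] := wd.
by apply: filterS2 gM (weak_deriv_unique wd wg) => x ? ->.
Qed.

(** Representatives bounded everywhere, with one constant for all directions. The formula linking
    first and second derivatives comes from testing [D] once through its first derivative, with
    [pderiv i phi], and once through its second derivative, with [phi]; the signs are [-1] and
    [(-1)^2]. *)
Lemma potential_regularity : exists M (g w : 'I_d -> Rd -> R),
  [/\ 0 <= M, forall i, bounded_by M (g i), forall i, bounded_by M (w i),
    forall i, {ae dx, forall x, wgrad L D i x = g i x} &
    (forall i, {ae dx, forall x, wderiv L [:: i; i] D x = w i x}) /\
    forall i phi, torus_smooth L phi ->
      \int[dx]_x (g i x * pderiv i phi x) = - \int[dx]_x (w i x * phi x)].
Proof.
have bv s : (size s <= 2)%N -> exists Mg : R * (Rd -> R), [/\ 0 <= Mg.1, bounded_by Mg.1 Mg.2 &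
    {ae dx, forall x, wderiv L s D x = Mg.2 x}].
  move=> /wderivP[[gL _ _] go]; have [M [g [M0 bg gE]]] := bounded_version gL go.
  by exists (M, g).
have /choice[G HG] : forall i : 'I_d, exists Mg : R * (Rd -> R), [/\ 0 <= Mg.1, bounded_by Mg.1 Mg.2 &
    {ae dx, forall x, wderiv L [:: i] D x = Mg.2 x}] by move=> i; exact: bv.
have /choice[W HW] : forall i : 'I_d, exists Mg : R * (Rd -> R), [/\ 0 <= Mg.1, bounded_by Mg.1 Mg.2 &
    {ae dx, forall x, wderiv L [:: i; i] D x = Mg.2 x}] by move=> i; exact: bv.
pose M := \sum_i (G i).1 + \sum_i (W i).1.
have SG : 0 <= \sum_i (G i).1 by apply: sumr_ge0 => i _; case: (HG i).
have SW : 0 <= \sum_i (W i).1 by apply: sumr_ge0 => i _; case: (HW i).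
have GM i : (G i).1 <= M.
  apply: (@le_trans _ _ (\sum_i (G i).1)); last by rewrite /M lerDl.
  by rewrite (bigD1 i)//= lerDl; apply: sumr_ge0 => j _; case: (HG j).
have WM i : (W i).1 <= M.
  apply: (@le_trans _ _ (\sum_i (W i).1)); last by rewrite /M lerDr.
  by rewrite (bigD1 i)//= lerDl; apply: sumr_ge0 => j _; case: (HW j).
have bG i : bounded_by M (G i).2.
  by have [_ [gL mg gM] _] := HG i; split => // x; exact: le_trans (gM x) (GM i).
have bW i : bounded_by M (W i).2.
  by have [_ [gL mg gM] _] := HW i; split => // x; exact: le_trans (gM x) (WM i).
exists M, (fun i => (G i).2), (fun i => (W i).2); split => //.
- by rewrite addr_ge0.
- by move=> i; case: (HG i).
split; first by move=> i; case: (HW i).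
move=> i phi sphi; have [[_ i1 h1] _] := wderivP (s := [:: i]) isT.
have [[_ i2 h2] _] := wderivP (s := [:: i; i]) isT.
have mp psi : torus_smooth L psi -> measurable_fun setT psi.
  by move=> sp; have [_ /(_ [::] isT)[c _]] := sp 0%N; exact: continuous_measurable_rV.
have [_ _ EG] := HG i; have [_ _ EW] := HW i.
have [_ mG _] := bG i; have [_ mW _] := bW i.
have sdphi := torus_smooth_pderiv i sphi.
rewrite -(@ae_eq_Rintegral _ _ _ _ (fun x => wderiv L [:: i] D x * pderiv i phi x)); first last.
- by apply: filterS EG => x ->.
- by apply: measurable_funM => //; exact: mp.
- by apply: measurable_funM; [exact: Lfun_measurable i1|exact: mp].
rewrite -[in RHS](@ae_eq_Rintegral _ _ _ _ (fun x => wderiv L [:: i; i] D x * phi x)); first last.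
- by apply: filterS EW => x ->.
- by apply: measurable_funM => //; exact: mp.
- by apply: measurable_funM; [exact: Lfun_measurable i2|exact: mp].
have := h1 _ sdphi; have := h2 _ sphi => /=.
by rewrite expr1 sqrrN expr1n mul1r mulN1r => -> /eqP; rewrite eq_sym eqr_oppLR => /eqP.
Qed.

(** [Linfty_norm] is made real by [fine], so that it bounds the Laplacian once the norm is known to
    be finite; it is, as a sum of finitely many bounded second derivatives. *)
Lemma wlap_bound : (0 < d)%N -> {ae dx, forall x, `|wlap L D x| <= Linfty_norm L (wlap L D)}.
Proof.
move=> d0; apply: Lfun_bound.
  by rewrite torus_measureT ?ltW// lte_fin exprn_gt0.
have [M [g [w [M0 _ bw _ [wE _]]]]] := potential_regularity.
apply: (@bounded_Lfun _ _ _ _ _ (\sum_(i < d) M)).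
  apply: (@measurable_sum _ _ _ _ _ _ (fun i => wderiv L [:: i; i] D)) => i.
  by have [[_ + _] _] := wderivP (s := [:: i; i]) isT; exact: Lfun_measurable.
have : {ae dx, forall x, forall i, wderiv L [:: i; i] D x = w i x} by exact: filter_forall.
apply: filterS => x E; rewrite /wlap; apply: le_trans (ler_norm_sum _ _ _) _.
by apply: ler_sum => i _; rewrite E; have [_ _] := bw i; apply.
Qed.

Lemma Linfty_norm_ge0 f : 0 <= Linfty_norm L f.
Proof. exact/fine_ge0/Lnorm_ge0. Qed.

End potential.
End weak_derivatives.

(** * The velocity as a convolution with the gradient of the potential *)

Section velocity_field.
Context (R : realType) (d : nat) (L : R) (L0 : 0 < L).
Local Notation dx := (@torus_measure R d L).
Local Notation Rd := 'rV[R]_d.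
Local Notation e_ := (unit_vec R).
Implicit Types (f g psi : Rd -> R).

(** The reflected null set is again null: the integral of the positive part of [f - c] is invariant
    under reflection. *)
Lemma ae_le_reflect f (c : R) (v : Rd) : Defs.periodic L f -> measurable_fun setT f ->
  {ae dx, forall x, f x <= c} -> {ae dx, forall x, f (v - x) <= c}.
Proof.
move=> fL mf fc; pose h x := Num.max (f x - c) 0.
have hL : Defs.periodic L h by move=> x i; rewrite /h fL.
have mh : measurable_fun setT h.
  by apply: measurable_maxr => //; exact: measurable_funB.
have h0 x : 0 <= h x by rewrite le_max lexx orbT.
have mhv : measurable_fun setT (fun x : Rd => h (v - x)).
  exact: (measurableT_comp mh (measurable_rV_reflect v)).
have I0 : (\int[dx]_x `|(EFin \o h) x| = 0)%E.
  apply/(ae_eq_integral_abs _ measurableT); first exact/measurable_EFinP.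
  apply: filterS fc => x fxc _ /=; congr EFin; rewrite /h max_r//; lra.
have Iv : (\int[dx]_x `|(EFin \o (fun x => h (v - x)))%R x| = 0)%E.
  have := @ge0_integral_torus_reflect R d L v (fun x => `|(EFin \o h) x|%E) L0.
  rewrite I0 /= => ->//; first by move=> x i; rewrite hL.
  by apply/measurable_EFinP; exact: measurableT_comp.
move/(ae_eq_integral_abs _ measurableT) : Iv => Iv.
have {}Iv := Iv ((measurable_EFinP _ _).2 mhv).
apply: filterS Iv => x /(_ Logic.I) /= [] /eqP; rewrite /h.
by rewrite eq_le ge_max => /andP[/andP[+ _] _]; rewrite subr_le0.
Qed.

Lemma measurable_rVB : measurable_fun setT (fun p : Rd * Rd => p.1 - p.2).
Proof.
apply: measurable_fun_rV => j.
rewrite (_ : (fun x => _) = (fun p : Rd * Rd => p.1 ord0 j - p.2 ord0 j)); last first.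
  by apply/funext => p; rewrite rowBE.
by apply: measurable_funB; apply: (measurableT_comp (measurable_coord j)).
Qed.

Lemma measurable_rVD : measurable_fun setT (fun p : Rd * Rd => p.1 + p.2).
Proof.
apply: measurable_fun_rV => j.
rewrite (_ : (fun x => _) = (fun p : Rd * Rd => p.1 ord0 j + p.2 ord0 j)); last first.
  by apply/funext => p; rewrite rowDE.
by apply: measurable_funD; apply: (measurableT_comp (measurable_coord j)).
Qed.

Context (D : Rd -> R) (HD : sobolev L 2 +oo D) (a : Rd -> R).
Hypothesis ia : dx.-integrable setT (EFin \o a).

Let V i (x : Rd) : R := \int[dx]_y (wgrad L D i (x - y) * a y).

Let ma : measurable_fun setT a.
Proof. exact: Rintegrable_measurable ia. Qed.

Let mgrad i : measurable_fun setT (wgrad L D i).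
Proof. by have [[_ + _] _] := wderivP L0 HD (s := [:: i]) isT; exact: Lfun_measurable. Qed.

Let gradL i : Defs.periodic L (wgrad L D i).
Proof. by have [[+ _ _] _] := wderivP L0 HD (s := [:: i]) isT. Qed.

Lemma convolution_integrable M g : 0 <= M -> bounded_by L M g ->
  (@torus_fmeasure R d L \x @torus_fmeasure R d L)%E.-integrable setT
    (EFin \o (fun p : Rd * Rd => g (p.1 - p.2) * a p.2)).
Proof.
move=> M0 [_ mg gM]; apply: (@Rfubini_integrable _ _ _ _ _ _ _ _ M a) => //.
- exact: torus_measure_fin.
- apply: measurable_funM; first exact: (measurableT_comp mg measurable_rVB).
  exact: (measurableT_comp ma measurable_snd).
- by move=> x y; rewrite normrM ler_wpM2r.
Qed.

Lemma convolution_integrable_sec M g x : 0 <= M -> bounded_by L M g ->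
  dx.-integrable setT (EFin \o (fun y => g (x - y) * a y)).
Proof.
move=> M0 [_ mg gM]; apply: (@RintegrableM_bounded _ _ _ _ _ _ M) => //.
  exact: (measurableT_comp mg (measurable_rV_reflect x)).
exact: aeW.
Qed.

(** The representative chosen by [wgrad] may be exchanged under the integral, and the outcome holds
    at every [x], since only the reflected null set matters. *)
Lemma velocity_version M g i x : 0 <= M -> bounded_by L M g ->
  {ae dx, forall x, wgrad L D i x = g x} -> V i x = \int[dx]_y (g (x - y) * a y).
Proof.
move=> M0 bg gE; have [gL mg _] := bg; apply: ae_eq_Rintegral.
- apply: measurable_funM => //.
  exact: (measurableT_comp (mgrad i) (measurable_rV_reflect x)).
- exact: Rintegrable_measurable (convolution_integrable_sec x M0 bg).
have : {ae dx, forall y, `|wgrad L D i (x - y) - g (x - y)| <= 0}.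
  apply: (@ae_le_reflect (fun z => `|wgrad L D i z - g z|)).
  - by move=> z j; rewrite gradL gL.
  - by apply: measurableT_comp => //; exact: measurable_funB.
  - by apply: filterS gE => z ->; rewrite subrr normr0.
by apply: filterS => y; rewrite normr_le0 subr_eq0 => /eqP ->.
Qed.

(** For fixed [x] and [h], [difference_bound] controls the increment of the kernel for almost every
    [y], which is enough under the integral. The velocity is thus Lipschitz along [e_i] at every
    point although the gradient of [D] is known almost everywhere only. *)
Lemma velocity_regular : exists2 K, 0 <= K & forall i, bounded_by L K (V i) /\ lipschitz_along i (V i).
Proof.
have [M [g [w [M0 bg bw gE [wE gw]]]]] := potential_regularity L0 HD.
set A := \int[dx]_y `|a y|; have A0 : 0 <= A by exact: Rintegral_ge0.
exists (M * A); first by rewrite mulr_ge0.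
move=> i; have VE x : V i x = \int[dx]_y (g i (x - y) * a y) by exact: velocity_version (bg i) (gE i).
have bound (h : Rd -> R) (K : R) : measurable_fun setT h -> 0 <= K -> {ae dx, forall y, `|h y| <= K} ->
    `|\int[dx]_y (h y * a y)| <= K * A.
  move=> mh K0 hK; have ih := RintegrableM_bounded mh hK ia.
  apply: le_trans (le_normr_Rintegral _ ih) _ => //.
  rewrite -RintegralZl//; last exact: Rintegrable_norm.
  apply: ae_le_Rintegral; [exact: Rintegrable_norm|exact/RintegrableZ/Rintegrable_norm|].
  by apply: filterS hK => y h1; rewrite normrM ler_wpM2r.
have [gL mg gM] := bg i.
have mgx (x : Rd) : measurable_fun setT (fun y : Rd => g i (x - y)).
  exact: (measurableT_comp mg (measurable_rV_reflect x)).
split; last first.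
  exists (M * A); first by rewrite mulr_ge0.
  move=> x h; set x' : Rd := x + h *: e_ i.
  have i1 := convolution_integrable_sec x' M0 (bg i).
  have i2 := convolution_integrable_sec x M0 (bg i).
  have E : V i x' - V i x = \int[dx]_y ((g i (x' - y) - g i (x - y)) * a y).
    rewrite !VE -(RintegralB measurableT i1 i2); apply: eq_Rintegral => y _.
    by rewrite mulrBl.
  have -> : M * A * `|h| = (M * `|h|) * A by rewrite mulrAC.
  rewrite E; apply: (bound (fun y : Rd => g i (x' - y) - g i (x - y))).
  - by apply: measurable_funB; exact: mgx.
  - by rewrite mulr_ge0.
  have H : {ae dx, forall y : Rd, `|g i (x - y + h *: e_ i) - g i (x - y)| <= M * `|h|}.
    apply: (@ae_le_reflect (fun z => `|g i (z + h *: e_ i) - g i z|) (M * `|h|) x).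
    - by move=> z j; rewrite gL addrAC gL.
    - apply: measurableT_comp => //; apply: measurable_funB => //; exact: measurable_shift.
    - exact: (difference_bound L0 M0 (bg i) (bw i) (gw i) h).
  by apply: filterS H => y; rewrite /x' [x + _ - y]addrAC.
split.
- by move=> x j; rewrite !VE; apply: eq_Rintegral => y _; rewrite addrAC gL.
- rewrite (_ : V i = fun x => \int[dx]_y (g i (x - y) * a y)); last by apply/funext.
  exact: (measurable_Rfubini1 (convolution_integrable M0 (bg i))).
- move=> x; rewrite VE; apply: bound => //; exact: aeW.
Qed.

(** Integrated by parts, the sum is [- \int a Q] with [Q y = \int W x psi (x + y)] and [W] a version
    of the Laplacian of [D]. Both [W] and [Q] have integral zero, so [c] may be subtracted from
    [psi] and [b] from [a]; what remains is a product of two [L^1] norms and the bound of [W]. *)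
Lemma velocity_pairing psi (b c : R) : (0 < d)%N -> (forall i, torus_C1 L i psi) ->
  `|\sum_i \int[dx]_x (pderiv i psi x * V i x)| <=
    Linfty_norm L (wlap L D) * \int[dx]_x `|psi x - c| * \int[dx]_y `|a y - b|.
Proof.
move=> d0 Cpsi; have [M [g [w [M0 bg bw gE [wE gw]]]]] := potential_regularity L0 HD.
set N := Linfty_norm _ _.
have [psiL cpsi _ _] := Cpsi (Ordinal d0).
have [P P0 bpsi] := continuous_bounded_by L0 psiL cpsi.
pose W x : R := \sum_i w i x.
have bW : bounded_by L (\sum_(i < d) M) W.
  split; first by move=> x j; apply: eq_bigr => i _; have [wL _ _] := bw i; rewrite wL.
    by apply: measurable_sum => i; have [] := bw i.
  move=> x; apply: le_trans (ler_norm_sum _ _ _) _; apply: ler_sum => i _.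
  by have [_ _] := bw i; apply.
have WN : {ae dx, forall x, `|W x| <= N}.
  have E : {ae dx, forall x, forall i, wderiv L [:: i; i] D x = w i x} by exact: filter_forall.
  apply: filterS2 E (wlap_bound L0 HD d0) => x E; rewrite /wlap.
  by under eq_bigr do rewrite E.
pose Q y : R := \int[dx]_x (W x * psi (x + y)).
have bsh y := bounded_byM bW (bounded_by_shift y bpsi).
have W0 : \int[dx]_x W x = 0.
  rewrite Rintegral_sum; last by move=> i; exact: bounded_by_integrable (bw i).
  by apply: big1 => i _; exact: (weak_deriv_Rintegral0 L0 M0 (bg i) (bw i) (gw i)).
have iW := bounded_by_integrable bW.
have [_ mW _] := bW; have [_ mpsi psiP] := bpsi.
have QE y : Q y = \int[dx]_x (W x * (psi (x + y) - c)).
  under [in RHS]eq_Rintegral do rewrite mulrBr [W _ * c]mulrC.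
  rewrite RintegralB//; [|exact: bounded_by_integrable (bsh y)|exact: RintegrableZ].
  by rewrite RintegralZl// W0 mulr0 subr0.
have bpc : bounded_by L (P + `|c|) (fun x => psi x - c).
  split; [by move=> x i; rewrite psiL|exact: measurable_funB|].
  by move=> x; apply: le_trans (ler_normB _ _) _; rewrite lerD2r.
set B := \int[dx]_x `|psi x - c|.
have QB y : `|Q y| <= N * B.
  have b2 := bounded_byM bW (bounded_by_shift y bpc).
  have ib2 := bounded_by_integrable b2.
  rewrite QE; apply: le_trans (le_normr_Rintegral _ ib2) _ => //.
  have [cL mc _] := bpc.
  have nL : Defs.periodic L (fun x => `|psi x - c|) by move=> x i; rewrite psiL.
  have mn : measurable_fun setT (fun x => `|psi x - c|) by apply: measurableT_comp.
  rewrite /B -(Rintegral_torus_shift L0 y nL mn) -RintegralZl//; last first.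
    apply: Rintegrable_norm; exact: bounded_by_integrable (bounded_by_shift y bpc).
  apply: ae_le_Rintegral; first exact: Rintegrable_norm.
    by apply: RintegrableZ; apply: Rintegrable_norm; exact: bounded_by_integrable (bounded_by_shift y bpc).
  by apply: filterS WN => x h; rewrite normrM ler_wpM2r.
pose FQ (p : Rd * Rd) : R := W p.1 * psi (p.1 + p.2).
have iFQ : (@torus_fmeasure R d L \x @torus_fmeasure R d L)%E.-integrable setT (EFin \o FQ).
  apply: (@Rfubini_integrable _ _ _ _ _ _ _ _ ((\sum_(i < d) M) * P) (cst 1)).
  - exact: torus_measure_fin.
  - apply: measurable_funM; first exact: (measurableT_comp mW measurable_fst).
    exact: (measurableT_comp mpsi measurable_rVD).
  - by apply: (torus_integrable_continuous L0); exact: cst_continuous.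
  - by move=> x y; have [_ _ h] := bsh y; rewrite normr1 mulr1; exact: h.
have mQ : measurable_fun setT Q by exact: (measurable_Rfubini2 iFQ).
(* With the order of integration reversed, the inner integral of [psi (x + y)] in [y] does not
   depend on [x], and [W] has mean zero. *)
have Q0 : \int[dx]_y Q y = 0.
  have := Rfubini iFQ; rewrite /FQ /= => <-.
  under eq_Rintegral => x _.
    under eq_Rintegral => y _ do rewrite [x + y]addrC.
    rewrite RintegralZl//; last exact: bounded_by_integrable (bounded_by_shift x bpsi).
    rewrite (Rintegral_torus_shift L0 x psiL mpsi) mulrC; over.
  by rewrite RintegralZl// W0 mulr0.
pose q i y : R := \int[dx]_x (w i x * psi (x + y)).
have iaq i : dx.-integrable setT (EFin \o (fun y => a y * q i y)).
  have [_ mw wM] := bw i.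
  have iq : (@torus_fmeasure R d L \x @torus_fmeasure R d L)%E.-integrable setT
      (EFin \o (fun p : Rd * Rd => w i p.1 * psi (p.1 + p.2))).
    apply: (@Rfubini_integrable _ _ _ _ _ _ _ _ (M * P) (cst 1)) => //.
    - exact: torus_measure_fin.
    - apply: measurable_funM; first exact: (measurableT_comp mw measurable_fst).
      exact: (measurableT_comp mpsi measurable_rVD).
    - by apply: (torus_integrable_continuous L0); exact: cst_continuous.
    - by move=> x y; rewrite normr1 mulr1 normrM ler_pM.
  have qB y : `|q i y| <= M * P * L ^+ d.
    have bs := bounded_byM (bw i) (bounded_by_shift y bpsi); have ibs := bounded_by_integrable bs.
    apply: le_trans (le_normr_Rintegral _ ibs) _ => //.
    rewrite -(torus_Rintegral_cst L0 d); apply: le_Rintegral => //.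
    - exact: Rintegrable_norm.
    - by apply: (torus_integrable_continuous L0); exact: cst_continuous.
    - by move=> x _; have [_ _] := bs; apply.
  have := RintegrableM_bounded (measurable_Rfubini2 iq) (aeW _ qB) ia.
  by under eq_fun do rewrite mulrC.
(* After Fubini's theorem the derivative of the translated [psi] meets the bounded version [g i] of
   the gradient; as [psi] is only [C^1], this is where [weak_deriv_C1] enters. *)
have step i : \int[dx]_x (pderiv i psi x * V i x) = - \int[dx]_y (a y * q i y).
  have [_ _ dpsi cdpsi] := Cpsi i.
  have [P' P'0 bdpsi] := continuous_bounded_by L0 (periodic_pderiv i psiL) cdpsi.
  have [_ mdpsi dpsiP] := bdpsi; have [gL mg gM] := bg i.
  pose F (p : Rd * Rd) : R := pderiv i psi p.1 * (g i (p.1 - p.2) * a p.2).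
  have iF : (@torus_fmeasure R d L \x @torus_fmeasure R d L)%E.-integrable setT (EFin \o F).
    apply: (@Rfubini_integrable _ _ _ _ _ _ _ _ (P' * M) a) => //.
    - exact: torus_measure_fin.
    - apply: measurable_funM; first exact: (measurableT_comp mdpsi measurable_fst).
      exact: Rintegrable_measurable (convolution_integrable M0 (bg i)).
    - by move=> x y; rewrite /F /= mulrA !normrM ler_wpM2r// ler_pM.
  have -> : \int[dx]_x (pderiv i psi x * V i x) = \int[dx]_x \int[dx]_y F (x, y).
    apply: eq_Rintegral => x _; rewrite (velocity_version x M0 (bg i) (gE i)) -RintegralZl//.
    exact: convolution_integrable_sec (bg i).
  have := Rfubini iF => /= ->.
  rewrite -[RHS]mulN1r -(RintegralZl _ _ (iaq i))//.
  apply: eq_Rintegral => y _; rewrite mulN1r /F /=.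
  have psiC := torus_C1_shift y (Cpsi i).
  have := weak_deriv_C1 L0 M0 (bg i) (bw i) (gw i) psiC; rewrite pderiv_shift => E.
  rewrite -mulrN /q -E.
  have bs2 := bounded_byM (bounded_by_shift (- y) (bg i)) bdpsi.
  transitivity (a y * \int[dx]_x (g i (x - y) * pderiv i psi x)).
    rewrite -RintegralZl//; last exact: bounded_by_integrable bs2.
    by apply: eq_Rintegral => x _; ring.
  have [tL mt _] := bs2.
  rewrite -(Rintegral_torus_shift L0 y tL mt).
  by rewrite (@eq_Rintegral _ _ _ _ _ (fun x => g i x * pderiv i psi (x + y)))// => x _; rewrite addrK.
under eq_bigr do rewrite step.
rewrite sumrN normrN -Rintegral_sum//.
have -> : \int[dx]_y (\sum_i a y * q i y) = \int[dx]_y ((a y - b) * Q y).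
  have iQ : dx.-integrable setT (EFin \o Q).
    apply: (@torus_integrable_bounded _ _ L _ (N * B)) => //; exact: aeW.
  have iaQ : dx.-integrable setT (EFin \o (fun y => a y * Q y)).
    have := RintegrableM_bounded mQ (aeW _ QB) ia.
    by under eq_fun do rewrite mulrC.
  under [in RHS]eq_Rintegral do rewrite mulrBl.
  rewrite RintegralB//; last exact: RintegrableZ.
  rewrite RintegralZl// Q0 mulr0 subr0; apply: eq_Rintegral => y _.
  rewrite -mulr_sumr; congr (_ * _); rewrite /q /Q -Rintegral_sum.
    by apply: eq_Rintegral => x _; rewrite mulr_suml.
  by move=> i; exact: bounded_by_integrable (bounded_byM (bw i) (bounded_by_shift y bpsi)).
have iab : dx.-integrable setT (EFin \o (fun y => a y - b)).
  apply: RintegrableB => //; apply: (torus_integrable_continuous L0); exact: cst_continuous.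
have iabQ := RintegrableM_bounded mQ (aeW _ QB) iab.
under eq_Rintegral do rewrite mulrC.
apply: le_trans (le_normr_Rintegral _ iabQ) _ => //.
rewrite -RintegralZl//; last exact: Rintegrable_norm.
apply: le_Rintegral => //; [exact: Rintegrable_norm|exact/RintegrableZ/Rintegrable_norm|].
by move=> y _; rewrite normrM ler_wpM2r.
Qed.

End velocity_field.

(** * Positivity and conservation of mass *)

Section smooth_curve.
Context (R : realType) (d : nat) (L : R) (L0 : 0 < L).
Local Notation dx := (@torus_measure R d L).
Local Notation Rd := 'rV[R]_d.
Local Notation e_ := (unit_vec R).
Context (w : R -> Rd -> R) (Hw : C1C2 L w).

Lemma C2norm_ge (u : Rd -> R) x : (`|u x|%:E <= C2norm u)%E.
Proof. by apply: ereal_sup_ubound; exists [::] => //; exists x. Qed.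

Lemma near_C2norm (T : Type) (F : set_system T) {FF : Filter F} (f : T -> Rd -> R) (eta : R) :
  0 < eta -> C2norm (f h) @[h --> F] --> 0%E -> \forall h \near F, forall x, `|f h x| <= eta.
Proof.
move=> eta0 f0; have : nbhs 0%E [set y : \bar R | y < eta%:E]%E.
  by apply: open_nbhs_nbhs; split; [exact: open_ereal_lt_ereal|rewrite /= lte_fin].
move=> /f0; rewrite nbhs_simpl /=; apply: filterS => h hh x; rewrite -lee_fin.
exact: (le_trans (C2norm_ge _ _) (ltW hh)).
Qed.

Lemma curve_torus_C1 t i : 0 < t -> torus_C1 L i (w t).
Proof.
move=> t0; have [[wL wk] _ _ _] := Hw t0.
have [c0 d0] := wk [::] isT; have [c1 _] := wk [:: i] isT.
by split => //; move=> x; exact: d0.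
Qed.

Lemma curve_pderiv_C1 t i j : 0 < t -> torus_C1 L j (pderiv i (w t)).
Proof.
move=> t0; have [[wL wk] _ _ _] := Hw t0.
have [c0 d0] := wk [:: i] isT; have [c1 _] := wk [:: j; i] isT.
by split; [exact: periodic_pderiv|exact: c0|move=> x; exact: d0|exact: c1].
Qed.

Lemma curve_continuous t : 0 < t -> Defs.periodic L (w t) /\ continuous (w t).
Proof. by move=> t0; have [[wL wk] _ _ _] := Hw t0; have [c0 _] := wk [::] isT. Qed.

Lemma time_deriv_continuous t : 0 < t ->
  Defs.periodic L (time_deriv w t) /\ continuous (time_deriv w t).
Proof. by move=> t0; have [_ [wL wk] _ _] := Hw t0; have [c0 _] := wk [::] isT. Qed.

Lemma curve_is_derive (t : R) (x : Rd) : 0 < t -> is_derive t 1 (w ^~ x) (time_deriv w t x).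
Proof.
move=> t0; have [_ _ H _] := Hw t0.
have c : h^-1 *: (((w ^~ x) \o shift t) (h *: (1 : R)) - w t x) @[h --> 0^'] --> time_deriv w t x.
  apply/cvgrPdist_le => /= eta eta0.
  have : \forall h \near 0^', forall x, `|h^-1 * (w (t + h) x - w t x) - time_deriv w t x| <= eta.
    exact: near_C2norm eta0 H.
  apply: filterS => h /(_ x).
  by rewrite distrC /= /GRing.scale /= mulr1 [h + t]addrC.
have dw : derivable (w ^~ x) t 1 by apply/cvg_ex; eexists; exact: c.
by split => //; rewrite /time_deriv derive1E.
Qed.

Lemma curve_continuous_time (t : R) (x : Rd) : 0 < t -> {for t, continuous (w ^~ x)}.
Proof.
move=> t0; have [dw _] := curve_is_derive x t0.
by apply/differentiable_continuous/derivable1_diffP.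
Qed.

Lemma time_deriv_continuous_time (t : R) (x : Rd) : 0 < t -> {for t, continuous (fun s => time_deriv w s x)}.
Proof.
move=> t0; have [_ _ _ H] := Hw t0.
apply/cvgrPdist_le => eta eta0.
have h : \forall r \near t, forall x, `|time_deriv w r x - time_deriv w t x| <= eta.
  exact: near_C2norm eta0 H.
by apply: filterS h => r /(_ x); rewrite distrC.
Qed.

(** The two limits in [C1C2] bound the time derivative and the difference quotients near [t],
    uniformly in [x]; the constants obtained serve as dominating functions under the integral
    sign. *)
Lemma curve_locally_bounded t : 0 < t -> exists2 a, 0 < a & exists2 M, 0 <= M &
  a < t /\ forall s x, t - a < s < t + a -> `|w s x| <= M /\ `|time_deriv w s x| <= M.
Proof.
move=> t0; have [_ _ H1 H2] := Hw t0.
have [wL cw] := curve_continuous t0; have [tL ct] := time_deriv_continuous t0.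
have [K K0 wK] := torus_bounded L0 wL cw; have [N N0 tN] := torus_bounded L0 tL ct.
have : \forall r \near t, forall x, `|time_deriv w r x - time_deriv w t x| <= 1.
  exact: near_C2norm ltr01 H2.
move=> /nbhs_ballP[a2 /= a20 h2].
have : \forall h \near 0^', forall x, `|h^-1 * (w (t + h) x - w t x) - time_deriv w t x| <= 1.
  exact: near_C2norm ltr01 H1.
move=> /nbhs_ballP[a1 /= a10 h1].
(* The bound [t / 2] keeps the times positive, and [1] absorbs the factor [|s - t|] in front of the
   difference quotient. *)
pose a := Num.min (Num.min a1 a2) (Num.min 1 (t / 2)).
have a0 : 0 < a by rewrite !lt_min a10 a20 ltr01 divr_gt0.
have [aa1 aa2 a11 at2] : [/\ a <= a1, a <= a2, a <= 1 & a <= t / 2].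
  by split; rewrite /a !ge_min lexx ?orbT.
exists a => //; exists (K + N + 1); first by lra.
split; first by lra.
move=> s x sa; have sa' : `|s - t| < a by rewrite ltr_norml; apply/andP; split; lra.
split; last first.
  have : `|time_deriv w s x - time_deriv w t x| <= 1.
    by apply: h2; rewrite /ball/= distrC; lra.
  have := tN x; rewrite !ler_norml => /andP[? ?] /andP[? ?]; apply/andP; split; lra.
have [->|st] := eqVneq s t; first by have := wK x; lra.
have s0 : s - t != 0 by rewrite subr_eq0.
have := h1 (s - t) _ s0 x.
rewrite /ball/= sub0r normrN => /(_ (lt_le_trans sa' aa1)).
have -> : t + (s - t) = s by rewrite addrC subrK.
set q := _^-1 * _ => h.
have E : w s x = w t x + (s - t) * q by rewrite /q mulrA divff// mul1r addrC subrK.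
have hq : `|q| <= N + 1.
  have := tN x; move: h; rewrite !ler_norml => /andP[? ?] /andP[? ?]; apply/andP; split; lra.
rewrite E; apply: le_trans (ler_normD _ _) _; rewrite -addrA; apply: lerD; first exact: wK.
by rewrite normrM; apply: le_trans hq; rewrite ler_piMl//; lra.
Qed.

(** * Time derivatives of functionals [\int phi (w t x)], with [phi] smooth on a set [Dm] of
    values *)

Section functional.
Context (Dm : set R) (phi phi1 : R -> R).
Hypotheses (wD : forall t x, 0 < t -> Dm (w t x))
  (dphi : forall r, Dm r -> is_derive r 1 phi (phi1 r))
  (cphi1 : forall r, Dm r -> {for r, continuous phi1})
  (bphi1 : forall M, exists K, forall r, Dm r -> `|r| <= M -> `|phi1 r| <= K).

Let E (t : R) : R := \int[dx]_x phi (w t x).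
Let dE (t : R) : R := \int[dx]_x (phi1 (w t x) * time_deriv w t x).

Lemma continuous_phi_curve t : 0 < t -> continuous (fun x => phi (w t x)).
Proof.
move=> t0 x; have [_ cw] := curve_continuous t0.
have c : {for w t x, continuous phi}.
  by have [dp _] := dphi (wD x t0); apply/differentiable_continuous/derivable1_diffP.
exact: (continuous_comp (cw x) c).
Qed.

Lemma continuous_phi1_curve t : 0 < t -> continuous (fun x => phi1 (w t x)).
Proof.
move=> t0 x; have [_ cw] := curve_continuous t0.
exact: (continuous_comp (cw x) (cphi1 (wD x t0))).
Qed.

Lemma continuous_dphi_curve t : 0 < t -> continuous (fun x => phi1 (w t x) * time_deriv w t x).
Proof.
move=> t0 x; have [_ ct] := time_deriv_continuous t0.
exact: (@cvgM _ _ (nbhs x) _ _ _ _ _ (continuous_phi1_curve t0 (x := x)) (ct x)).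
Qed.

Let loc t : 0 < t -> exists2 a, 0 < a & exists2 K, 0 <= K & a < t /\
  forall s x, t - a < s < t + a -> `|phi1 (w s x) * time_deriv w s x| <= K.
Proof.
move=> t0; have [a a0 [M M0 [at_ H]]] := curve_locally_bounded t0.
have [K HK] := bphi1 M; exists a => //; exists (`|K| * M); first by rewrite mulr_ge0.
split => // s x sa; have [h1 h2] := H s x sa; rewrite normrM; apply: ler_pM => //.
have s0 : 0 < s by case/andP : sa => ? ?; lra.
exact: le_trans (HK _ (wD x s0) h1) (ler_norm _).
Qed.

Lemma functional_derive (t : R) : 0 < t -> is_derive t 1 E (dE t).
Proof.
move=> t0; have [a a0 [K K0 [at_ HK]]] := loc t0.
have tI : (`]t - a, t + a[%classic : set R) t by rewrite /= in_itv/=; apply/andP; split; lra.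
have sI (s : R) : (`]t - a, t + a[%classic : set R) s -> t - a < s < t + a by rewrite /= in_itv.
have s0 (s : R) : (`]t - a, t + a[%classic : set R) s -> 0 < s by move=> /sI/andP[? ?]; lra.
pose F (s : R) (x : Rd) : R := phi (w s x).
have Fd (s : R) (x : Rd) : 0 < s -> is_derive s 1 (F ^~ x) (phi1 (w s x) * time_deriv w s x).
  by move=> s0'; exact: (is_derive_chainR (dphi (wD x s0')) (curve_is_derive x s0')).
have pE (s : R) (x : Rd) : 0 < s -> partial1of2 F s x = phi1 (w s x) * time_deriv w s x.
  by move=> s0'; rewrite partial1of2E; have [_ ->] := Fd s x s0'.
have h1 (s : R) : (`]t - a, t + a[%classic : set R) s -> dx.-integrable setT (EFin \o F s).
  by move=> /s0 s0'; exact: (torus_integrable_continuous L0 (continuous_phi_curve s0')).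
have h2 (s : R) (x : Rd) : (`]t - a, t + a[%classic : set R) s -> [set: Rd] x -> derivable (F ^~ x) s 1.
  by move=> /s0 s0' _; have [] := Fd s x s0'.
have h3 : dx.-integrable setT (EFin \o (cst K : Rd -> R)).
  by apply: (torus_integrable_continuous L0); exact: cst_continuous.
have h4 (s : R) (x : Rd) : (`]t - a, t + a[%classic : set R) s -> [set: Rd] x ->
    `|partial1of2 F s x| <= (cst K : Rd -> R) x.
  by move=> sa _; rewrite pE; [apply: HK; exact: sI|exact: s0].
have K0' (y : Rd) : 0 <= (cst K : Rd -> R) y by [].
have H := derivable_under_integral measurableT tI h1 h2 K0' h3 h4.
split; first exact: H.
rewrite -derive1E (differentiation_under_integral measurableT tI h1 h2 K0' h3 h4).
by apply: eq_Rintegral => x _; exact: pE.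
Qed.

Lemma functional_derive_continuous t : 0 < t -> {for t, continuous dE}.
Proof.
move=> t0; have [a a0 [K K0 [at_ HK]]] := loc t0.
have tI : t \in (`]t - a, t + a[%classic : set R) by rewrite inE/= in_itv/=; apply/andP; split; lra.
have sI (s : R) : s \in (`]t - a, t + a[%classic : set R) -> t - a < s < t + a by rewrite inE/= in_itv.
have s0 (s : R) : s \in (`]t - a, t + a[%classic : set R) -> 0 < s by move=> /sI/andP[? ?]; lra.
apply: (@continuity_under_integral _ _ _ dx (fun s x => phi1 (w s x) * time_deriv w s x) setT measurableT
  (t - a) (t + a) _ _ (cst K)) => //.
- move=> s /mem_set/s0 s0'; exact: (torus_integrable_continuous L0 (continuous_dphi_curve s0')).
- apply: aeW => x _ s /s0 s0'.
  have c1 : {for s, continuous (w ^~ x)} by exact: curve_continuous_time.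
  have c2 : {for s, continuous (fun r => phi1 (w r x))}.
    exact: (continuous_comp c1 (cphi1 (wD x s0'))).
  have c3 : {for s, continuous (fun r => time_deriv w r x)} by exact: time_deriv_continuous_time.
  exact: (cvgM c2 c3).
- by apply: (torus_integrable_continuous L0); exact: cst_continuous.
- by move=> s /mem_set/sI sa; apply: aeW => x _; exact: HK.
Qed.

Lemma functional_FTC s t : 0 < s -> s < t ->
  E t - E s = \int[lebesgue_measure]_(r in `[s, t]) dE r.
Proof.
move=> s0 st; have pos (r : R) : r \in `[s, t] -> 0 < r.
  by rewrite in_itv/= => /andP[? _]; lra.
rewrite (Rintegral_FTC2 st (fun r ri => functional_derive (pos r ri)))//.
apply: continuous_in_subspaceT => r; rewrite inE/= => /pos; exact: functional_derive_continuous.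
Qed.

End functional.
End smooth_curve.

(** * Integration by parts in the balance of a functional *)

Section dissipation.
Context (R : realType) (d : nat) (L : R) (L0 : 0 < L).
Local Notation dx := (@torus_measure R d L).
Local Notation Rd := 'rV[R]_d.
Local Notation e_ := (unit_vec R).
Context (u : Rd -> R) (Dm : set R).
Hypotheses (uL : Defs.periodic L u) (cu : continuous u) (uD : forall x, Dm (u x)).

Lemma torus_C1_comp i (phi phi1 : R -> R) : torus_C1 L i u ->
  (forall r, Dm r -> is_derive r 1 phi (phi1 r)) -> (forall r, Dm r -> {for r, continuous phi1}) ->
  torus_C1 L i (fun x => phi (u x)) /\
  pderiv i (fun x => phi (u x)) = (fun x => phi1 (u x) * pderiv i u x).
Proof.
move=> [_ _ du cdu] dphi cphi1.
have H x : is_derive x (e_ i) (fun x => phi (u x)) (phi1 (u x) * pderiv i u x).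
  by apply: is_derive_chain; [exact: dphi|split].
have E : pderiv i (fun x => phi (u x)) = (fun x => phi1 (u x) * pderiv i u x).
  by apply/funext => x; have [_] := H x.
have cphi : continuous (fun x => phi (u x)).
  move=> x; have [dp _] := dphi _ (uD x).
  have c : {for u x, continuous phi} by apply/differentiable_continuous/derivable1_diffP.
  by apply: continuous_comp; [exact: cu|exact: c].
split; last exact: E.
split.
- by move=> x j; rewrite uL.
- exact: cphi.
- by move=> x; have [] := H x.
- rewrite E => x.
  have c : {for x, continuous (fun x => phi1 (u x))}.
    by apply: continuous_comp; [exact: cu|exact: cphi1].
  exact: (cvgM c (cdu x)).
Qed.

Context (kappa : R) (ut : Rd -> R) (V : 'I_d -> Rd -> R).
Hypotheses (Cu : forall i, torus_C1 L i u) (Cdu : forall i, torus_C1 L i (pderiv i u)).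
Hypothesis VB : exists2 K, 0 <= K & forall i, bounded_by L K (V i) /\ lipschitz_along i (V i).
Hypothesis flux_derivable : forall i x, derivable (fun y => u y * V i y) x (e_ i).
Hypothesis equation : forall x, ut x = kappa * \sum_(i < d) pderiv i (fun y => u y * V i y) x +
  \sum_(i < d) pderivs [:: i; i] u x.

Lemma flux_ibp_fun i : ibp_fun L i (fun y => u y * V i y).
Proof.
have [K K0 /(_ i)[[VL mV VK] Vl]] := VB.
have [_ mu [M uM] ul _] : ibp_fun L i u.
  by have [? ? ? ?] := Cu i; exact: C1_ibp_fun.
split => //.
- by move=> x j; rewrite uL VL.
- exact: measurable_funM.
- by exists (M * K) => x; rewrite normrM ler_pM.
- exact: lipschitz_alongM uM VK ul Vl.
Qed.

Lemma ibp_fun_integrable i (F G : Rd -> R) : ibp_fun L i F -> ibp_fun L i G ->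
  dx.-integrable setT (EFin \o (fun x => F x * pderiv i G x)).
Proof.
move=> [_ mF [M FM] _ _] [_ mG _ [C _ GC] Gd].
apply: (@torus_integrable_bounded _ _ L _ (M * C)).
  by apply: measurable_funM => //; exact: measurable_pderiv.
by apply: aeW => x; rewrite normrM ler_pM//; exact: (lipschitz_pderiv GC Gd).
Qed.

(** [phi1] is the derivative of the density of the functional, and [phi2] its second derivative. The
    gradient of [phi1 (u)] is [phi2 (u)] times that of [u]; the flux enters as a whole, through
    [flux_ibp_fun]. *)
Lemma dissipation (phi1 phi2 : R -> R) :
  (forall r, Dm r -> is_derive r 1 phi1 (phi2 r)) -> (forall r, Dm r -> {for r, continuous phi2}) ->
  \int[dx]_x (phi1 (u x) * ut x) =
  - \sum_(i < d) \int[dx]_x (phi2 (u x) * pderiv i u x ^+ 2) -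
  kappa * \sum_(i < d) \int[dx]_x ((phi2 (u x) * u x * pderiv i u x) * V i x).
Proof.
move=> dphi cphi2; pose F x := phi1 (u x).
have CF i : torus_C1 L i F by have [] := torus_C1_comp (Cu i) dphi cphi2.
have FE i : pderiv i F = (fun x => phi2 (u x) * pderiv i u x).
  by have [] := torus_C1_comp (Cu i) dphi cphi2.
have ibp i (f : Rd -> R) : torus_C1 L i f -> ibp_fun L i f by move=> [? ? ? ?]; exact: C1_ibp_fun.
have iF i := ibp_fun_integrable (ibp i _ (CF i)) (flux_ibp_fun i).
have iG i := ibp_fun_integrable (ibp i _ (CF i)) (ibp i _ (Cdu i)).
rewrite (@eq_Rintegral _ _ _ _ _ (fun x => kappa * \sum_(i < d) (F x * pderiv i (fun y => u y * V i y) x) +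
  \sum_(i < d) (F x * pderiv i (pderiv i u) x))); last first.
  by move=> x _; rewrite equation mulrDr mulrCA !mulr_sumr.
rewrite RintegralD//; [|by apply: RintegrableZ; exact: Rintegrable_sum|exact: Rintegrable_sum].
rewrite RintegralZl//; last exact: Rintegrable_sum.
rewrite !Rintegral_sum// addrC; congr (_ + _).
  rewrite -sumrN; apply: eq_bigr => i _.
  rewrite (torus_ibp L0 (ibp i _ (CF i)) (ibp i _ (Cdu i))) FE; congr (- _).
  by apply: eq_Rintegral => x _; rewrite expr2 mulrA.
rewrite -mulrN -sumrN; congr (_ * _); apply: eq_bigr => i _.
rewrite (torus_ibp L0 (ibp i _ (CF i)) (flux_ibp_fun i)) FE; congr (- _).
by apply: eq_Rintegral => x _; ring.
Qed.

End dissipation.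

Lemma continuous_compR (R : realType) (T : topologicalType) (u : T -> R) (f : R -> R) :
  continuous u -> (forall x, {for u x, continuous f}) -> continuous (fun x => f (u x)).
Proof. by move=> cu cf x; apply: continuous_comp; [exact: cu|exact: cf]. Qed.

Section auxiliary.
Context (R : realType) (d : nat) (L : R) (L0 : 0 < L).
Local Notation dx := (@torus_measure R d L).
Local Notation Rd := 'rV[R]_d.

Lemma Rdominated_cvg_in dT (T : measurableType dT) (mu : {measure set T -> \bar R}) (A : set T)
    (f_ : nat -> T -> R) (f g : T -> R) : measurable A ->
  (forall n, measurable_fun A (f_ n)) -> measurable_fun A f ->
  (forall x, A x -> f_ ^~ x @ \oo --> f x) -> mu.-integrable A (EFin \o g) ->
  (forall n x, A x -> `|f_ n x| <= g x) ->
  \int[mu]_(x in A) f_ n x @[n --> \oo] --> \int[mu]_(x in A) f x.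
Proof.
move=> mA mf_ mf ff ig fg.
have [] := @dominated_convergence _ T R mu A mA
  (fun n => EFin \o f_ n) (EFin \o f) (EFin \o g).
- by move=> n; apply/measurable_EFinP.
- exact/measurable_EFinP.
- by apply: aeW => x Ax; apply: cvg_EFin; [exact: nearW|exact: ff].
- exact: ig.
- by apply: aeW => x n Ax; rewrite lee_fin fg.
move=> intf _ /= h; apply: fine_cvg; rewrite fineK //.
exact: integrable_fin_num.
Qed.

(** If [h] were positive at [x0], a translation would bring [x0] to the origin, which is the centre
    of the cell; a small box around it then lies in the cell, has positive measure, and carries a
    positive lower bound of [h]. *)
Lemma torus_integral_eq0 (h : Rd -> R) : Defs.periodic L h -> continuous h ->
  (forall x, 0 <= h x) -> \int[dx]_x h x <= 0 -> forall x, h x = 0.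
Proof.
move=> hL ch h0 ih x0; apply/eqP; rewrite eq_le h0 andbT leNgt; apply/negP => hx0.
pose g (y : Rd) := h (y + x0).
have cg : continuous g by exact: continuous_shift_rV.
have gE : g 0 = h x0 by rewrite /g add0r.
have g0 : 0 < g 0 by rewrite gE.
have [e /= e0 He] : exists2 e, 0 < e & forall y, ball (0 : Rd) e y -> g 0 / 2 <= g y.
  have /cvgrPdist_le/(_ (g 0 / 2)) := cg 0.
  rewrite divr_gt0// => /(_ isT)/nbhs_ballP[e /= e0 H]; exists e => // y /H /=.
  by rewrite ler_distlC => /andP[? _]; lra.
pose b := Num.min (e / 2) (L / 2).
have b0 : 0 < b by rewrite lt_min !divr_gt0.
have [be bL] : b <= e / 2 /\ b <= L / 2 by rewrite /b !ge_min !lexx orbT.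
pose B := [set y : Rd | forall i, - b <= y ord0 i <= b].
have mB : measurable B by exact: (@measurable_box R d (fun=> - b) (fun=> b)).
have muB : dx B = ((b *+ 2) ^+ d)%:E.
  rewrite /= /mrestr (_ : B `&` cell L = B).
    rewrite (@lebesgue_rV_box R d (fun=> - b) (fun=> b)); last by move=> i; lra.
    by rewrite prodr_const card_ord opprK mulr2n.
  apply/seteqP; split => [y []//|y By]; split => // i; have /andP[? ?] := By i.
  by apply/andP; split; lra.
have : g 0 / 2 * (b *+ 2) ^+ d <= \int[dx]_x g x.
  have -> : g 0 / 2 * (b *+ 2) ^+ d = \int[dx]_x (g 0 / 2 * \1_B x).
    have iB : dx.-integrable setT (EFin \o \1_B).
      apply: (@torus_integrable_bounded _ _ L _ 1) => //; apply: aeW => y.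
      by rewrite ger0_norm// indicE; case: (_ \in _).
    rewrite RintegralZl//; congr (_ * _).
    by rewrite /Rintegral integral_indic// setIT; have := muB => /= ->.
  apply: le_Rintegral => //.
  - apply: (@torus_integrable_bounded _ _ L _ (g 0 / 2)); first exact: measurable_funM.
    apply: aeW => y; rewrite normrM [`|\1_B y|]ger0_norm// ger0_norm; last by rewrite divr_ge0// ltW.
    by rewrite ler_piMr ?divr_ge0 ?(ltW g0)// indicE; case: (_ \in _).
  - exact: torus_integrable_continuous.
  - move=> y _; rewrite indicE; case: (boolP (y \in B)) => [|_]; last by rewrite mulr0; exact: h0.
    rewrite inE mulr1 => By; apply: He; split => // i j; rewrite (ord1 i) mxE /ball/=.
    by rewrite sub0r normrN; have := By j; rewrite -ler_norml; lra.
rewrite (Rintegral_torus_shift L0 x0 hL (continuous_measurable_rV ch)) => H.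
have : 0 < g 0 / 2 * (b *+ 2) ^+ d by rewrite mulr_gt0 ?divr_gt0// exprn_gt0// mulr2n addr_gt0.
lra.
Qed.

End auxiliary.

(** * A smooth approximation of the absolute value *)

Section sqrt_approximation.
Context (R : realType) (e : R) (e0 : 0 < e).

(** Convex, and above [|r|] by at most [e]; its second derivative [e^2 / q^3] concentrates at [0] as
    [e] decreases. *)
Definition sqrt_approx (r : R) : R := Num.sqrt (r ^+ 2 + e ^+ 2).
Local Notation q := sqrt_approx.

Let q0 r : 0 < q r.
Proof. by rewrite sqrtr_gt0 ltr_wpDl ?sqr_ge0// exprn_gt0. Qed.

Let q2 r : q r ^+ 2 = r ^+ 2 + e ^+ 2.
Proof. by rewrite sqr_sqrtr// addr_ge0 ?sqr_ge0. Qed.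

Lemma is_derive_sqrt_approx (r : R) : is_derive r 1 q (r / q r).
Proof.
have p0 : 0 < r ^+ 2 + e ^+ 2 by rewrite ltr_wpDl ?sqr_ge0// exprn_gt0.
have d1 : is_derive r 1 (fun r : R => r ^+ 2 + e ^+ 2) (2 * r).
  have E := is_derive_add (is_derive_sqr (is_derive_id r 1)) (is_derive_cst (e ^+ 2) r 1).
  by apply: (is_derive_eq E); rewrite addr0 mulr1.
have E := @is_derive_chainR R Num.sqrt (fun r : R => r ^+ 2 + e ^+ 2) r (2 * r) _ (is_derive1_sqrt p0) d1.
apply: (is_derive_eq E); have qn : q r != 0 by rewrite gt_eqF.
by rewrite -/(q r); move: (q r) qn => z zn; field.
Qed.

Lemma is_derive_sqrt_approx1 (r : R) : is_derive r 1 (fun r : R => r / q r) (e ^+ 2 / q r ^+ 3).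
Proof.
have qn : q r != 0 by rewrite gt_eqF.
have dq := is_derive_sqrt_approx r.
have dV : is_derive r 1 (fun r : R => (q r)^-1) (- (q r) ^- 2 * (r / q r)).
  exact: (is_deriveV qn).
have E := is_derive_mul (is_derive_id r 1) dV.
apply: (is_derive_eq E).
have := q2 r; move: (q r) qn => z zn z2.
have -> : e ^+ 2 = z ^+ 2 - r ^+ 2 by rewrite z2; ring.
by field.
Qed.

Lemma continuous_sqrt_approx1 (r : R) : {for r, continuous (fun r : R => r / q r)}.
Proof.
have [dp _] := is_derive_sqrt_approx1 r.
by apply/differentiable_continuous/derivable1_diffP.
Qed.

Lemma continuous_sqrt_approx2 (r : R) : {for r, continuous (fun r : R => e ^+ 2 / q r ^+ 3)}.
Proof.
have [dq _] := is_derive_sqrt_approx r.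
have cq : {for r, continuous q} by apply/differentiable_continuous/derivable1_diffP.
have c3 : {for r, continuous (fun r : R => q r ^+ 3)} by exact: (cvgM cq (cvgM cq cq)).
have qn : q r ^+ 3 != 0 by rewrite gt_eqF// exprn_gt0.
exact: (cvgM (cvg_cst _) (cvgV qn c3)).
Qed.

Lemma sqrt_approx_bound (r : R) : `|r| <= q r /\ q r <= `|r| + e.
Proof.
split; first by rewrite -sqrtr_sqr ler_wsqrtr// lerDl sqr_ge0.
have h : 0 <= `|r| + e by rewrite addr_ge0// ltW.
rewrite -[leRHS](ger0_norm h) -sqrtr_sqr ler_wsqrtr//.
rewrite sqrrD real_normK ?num_real// -addrA lerD2l lerDr.
by apply: mulrn_wge0; apply: mulr_ge0 => //; exact: ltW.
Qed.

Lemma sqrt_approx_derive_bound (r : R) : `|r / q r| <= 1.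
Proof.
rewrite normrM normfV (gtr0_norm (q0 r)) ler_pdivrMr// mul1r.
by have [] := sqrt_approx_bound r.
Qed.

(** The gradient [p] is absorbed by completing the square, at the price of [f r^2 (kappa v)^2] with
    [f = e^2 / q^3]. As [|r| <= q] and [e <= q], [f r^2 <= e], so the drift contributes nothing in
    the limit. *)
Lemma sqrt_approx_young (kappa r p v : R) :
  - (e ^+ 2 / q r ^+ 3 * p ^+ 2) - kappa * (e ^+ 2 / q r ^+ 3 * r * p * v) <=
  e * (kappa ^+ 2 * v ^+ 2).
Proof.
have [rq _] := sqrt_approx_bound r; have qr0 := q0 r; have Q2 := q2 r.
set f := e ^+ 2 / q r ^+ 3; have f0 : 0 <= f by rewrite divr_ge0 ?sqr_ge0// exprn_ge0// ltW.
have alg (g : R) : g * r ^+ 2 * (kappa ^+ 2 * v ^+ 2) - (- (g * p ^+ 2) - kappa * (g * r * p * v)) =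
  g * ((p + kappa * r * v / 2) ^+ 2 + (kappa * r * v) ^+ 2 * (3 / 4)) by field.
have h1 : - (f * p ^+ 2) - kappa * (f * r * p * v) <= f * r ^+ 2 * (kappa ^+ 2 * v ^+ 2).
  rewrite -subr_ge0 alg.
  by rewrite mulr_ge0// addr_ge0 ?sqr_ge0// mulr_ge0 ?sqr_ge0// divr_ge0.
apply: le_trans h1 _; apply: ler_wpM2r; first by rewrite mulr_ge0 ?sqr_ge0.
have eq : e <= q r.
  by rewrite -[e in leLHS](gtr0_norm e0) -sqrtr_sqr ler_wsqrtr// lerDr sqr_ge0.
rewrite /f mulrAC ler_pdivrMr ?exprn_gt0//.
have r2 : r ^+ 2 <= q r ^+ 2 by rewrite Q2 lerDl sqr_ge0.
have -> : e * q r ^+ 3 = (e * q r) * q r ^+ 2 by ring.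
apply: ler_pM => //; rewrite ?sqr_ge0//.
by rewrite expr2; apply: ler_wpM2l => //; exact: ltW.
Qed.

End sqrt_approximation.

(** * Sign and mass of a single curve *)

Section positivity.
Context (R : realType) (d : nat) (L : R) (L0 : 0 < L) (d0 : (0 < d)%N).
Local Notation dx := (@torus_measure R d L).
Local Notation Rd := 'rV[R]_d.
Local Notation e_ := (unit_vec R).
Local Notation leb := (@lebesgue_measure R).
Context (w a : R -> Rd -> R) (D u0 : Rd -> R) (kappa : R).
Hypotheses (Hw : C1C2 L w) (HD : sobolev L 2 +oo D).
Hypothesis ia : forall t, 0 < t -> dx.-integrable setT (EFin \o a t).
Let V t i (x : Rd) : R := \int[dx]_y (wgrad L D i (x - y) * a t y).
Hypothesis flux_derivable : forall t x, 0 < t ->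
  forall i, derivable (fun y => w t y * V t i y) x (e_ i).
Hypothesis equation : forall t x, 0 < t ->
  time_deriv w t x = kappa * \sum_(i < d) pderiv i (fun y => w t y * V t i y) x +
  \sum_(i < d) pderivs [:: i; i] (w t) x.
Hypotheses (u0_prob : prob_density L u0) (u0_L2 : u0 \in Lfun dx 2%:E).
Hypothesis w0 : ('N[dx]_2%:E[EFin \o (fun x => w t x - u0 x)%R])%E @[t --> 0^'+] --> 0%E.

Let iu0 : dx.-integrable setT (EFin \o u0).
Proof. by have [/Lfun1_integrable] := u0_prob. Qed.

Let iw t : 0 < t -> dx.-integrable setT (EFin \o w t).
Proof. by move=> t0; have [_ cw] := curve_continuous Hw t0; exact: torus_integrable_continuous. Qed.

Lemma initial_L2 (eta delta : R) : 0 < eta -> 0 < delta -> exists t, [/\ 0 < t, t < delta &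
  \int[dx]_x ((w t x - u0 x) ^+ 2) <= eta].
Proof.
move=> eta0 delta0; pose s := Num.sqrt eta; have s0 : 0 < s by rewrite sqrtr_gt0.
have N0 : nbhs 0%E [set y : \bar R | y < s%:E]%E.
  by apply: open_nbhs_nbhs; split; [exact: open_ereal_lt_ereal|rewrite /= lte_fin].
near (0 : R)^'+ => t.
have h2 : 0 < t by [].
have h3 : t < delta by near: t; exact: nbhs_right_lt.
have h1 : ('N[dx]_2%:E[EFin \o (fun x => w t x - u0 x)%R] < s%:E)%E by near: t; exact: (w0 N0).
exists t; split => //; rewrite -lee_fin.
have mf : measurable_fun setT (fun x => w t x - u0 x).
  apply: measurable_funB; [exact: Rintegrable_measurable (iw h2)|exact: Rintegrable_measurable iu0].
have E := Lnorm2E dx (fun x => w t x - u0 x).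
have N1 := Lnorm_ge0 dx 2%:E (EFin \o (fun x => w t x - u0 x)).
move: h1 N1 E; case: ('N[_]_ _ [_])%E => [r| |]//=.
rewrite lte_fin lee_fin => rs r0 E.
rewrite /Rintegral -E /= lee_fin powR_mulrn// -(sqr_sqrtr (ltW eta0)).
have h4 : r <= Num.sqrt eta by exact: ltW.
by rewrite ler_sqr// nnegrE sqrtr_ge0.
Unshelve. all: by end_near. Qed.

(** From [L^2] to [L^1] through [|z| <= c + z^2 / c], with [c] such that [c L^d] is half of
    [eta]. *)
Lemma initial_L1 (eta delta : R) : 0 < eta -> 0 < delta -> exists t, [/\ 0 < t, t < delta &
  \int[dx]_x `|w t x - u0 x| <= eta].
Proof.
move=> eta0 delta0; pose c := eta / (2 * L ^+ d).
have Ld0 : 0 < L ^+ d by rewrite exprn_gt0.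
have c0 : 0 < c by rewrite divr_gt0// mulr_gt0.
have ce0 : 0 < c * eta / 2 by rewrite divr_gt0// mulr_gt0.
have [t [t0 td H]] := initial_L2 ce0 delta0.
exists t; split => //.
have i1 : dx.-integrable setT (EFin \o (fun x => w t x - u0 x)) by apply: RintegrableB => //; exact: iw.
have wL2 : w t \in Lfun dx 2%:E.
  apply/Lfun2P; have [_ cw] := curve_continuous Hw t0; split; first exact: continuous_measurable_rV.
  by apply: torus_integrable_continuous => // x; exact: (cvgM (cw x) (cw x)).
have i2 : dx.-integrable setT (EFin \o (fun x => (w t x - u0 x) ^+ 2)).
  have /Lfun2P[_] := Lfun2_lin (- 1) u0_L2 wL2.
  by under eq_fun do rewrite mulN1r addrC.
have ic : dx.-integrable setT (EFin \o (fun=> c : R)).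
  by apply: (torus_integrable_continuous L0); exact: cst_continuous.
apply: (@le_trans _ _ (\int[dx]_x (c + c^-1 * (w t x - u0 x) ^+ 2))).
  apply: le_Rintegral => //.
  - exact: Rintegrable_norm.
  - by apply: RintegrableD => //; exact: RintegrableZ.
  - move=> x _; set z := w t x - u0 x.
    have [h|h] := leP `|z| c.
      by apply: le_trans h _; rewrite lerDl mulr_ge0 ?sqr_ge0// invr_ge0 ltW.
    apply: (@le_trans _ _ (c^-1 * z ^+ 2)); last by rewrite lerDr ltW.
    by rewrite mulrC ler_pdivlMr// -real_normK ?num_real// expr2 ler_wpM2l// ltW.
rewrite RintegralD//; last exact: RintegrableZ.
rewrite (RintegralZl _ _ i2)// torus_Rintegral_cst//.
have e1 : c * L ^+ d = eta / 2 by rewrite /c; field; rewrite gt_eqF.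
have := ler_wpM2l (_ : 0 <= c^-1) H; rewrite invr_ge0 (ltW c0) => /(_ isT).
have -> : c^-1 * (c * eta / 2) = eta / 2 by field; rewrite gt_eqF.
lra.
Qed.

Let VB t : 0 < t -> exists2 K, 0 <= K & forall i, bounded_by L K (V t i) /\ lipschitz_along i (V t i).
Proof. by move=> t0; exact: (velocity_regular L0 HD (ia t0)). Qed.

Lemma curve_dissipation t (Dm : set R) (phi1 phi2 : R -> R) : 0 < t -> (forall x, Dm (w t x)) ->
  (forall r, Dm r -> is_derive r 1 phi1 (phi2 r)) -> (forall r, Dm r -> {for r, continuous phi2}) ->
  \int[dx]_x (phi1 (w t x) * time_deriv w t x) =
  - \sum_(i < d) \int[dx]_x (phi2 (w t x) * pderiv i (w t) x ^+ 2) -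
  kappa * \sum_(i < d) \int[dx]_x ((phi2 (w t x) * w t x * pderiv i (w t) x) * V t i x).
Proof.
move=> t0 wD dphi cphi2; have [wL cw] := curve_continuous Hw t0.
apply: (@dissipation _ _ _ L0 (w t) Dm) => //.
- by move=> i; exact: curve_torus_C1.
- by move=> i; exact: curve_pderiv_C1.
- exact: VB.
- by move=> i x; exact: flux_derivable.
- by move=> x; exact: equation.
Qed.

(** The functional with [phi = id]: its second derivative is zero, and both terms of [dissipation]
    vanish. *)
Lemma curve_mass_constant s t : 0 < s -> s < t -> \int[dx]_x w t x = \int[dx]_x w s x.
Proof.
move=> s0 st; apply/eqP; rewrite -subr_eq0; apply/eqP.
have := @functional_FTC _ _ _ L0 w Hw setT id (fun=> 1) _ _ _ _ s t s0 st.
move=> ->//.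
- rewrite (@eq_Rintegral _ _ _ _ _ (fun=> 0)); first by rewrite Rintegral_cst// mul0r.
  move=> r; rewrite inE/= in_itv/= => /andP[sr _].
  have r0 : 0 < r by lra.
  rewrite (@curve_dissipation r setT (fun=> 1) (fun=> 0))//.
  - rewrite !big1 ?mulr0 ?oppr0 ?addr0//.
    + move=> i _; under eq_Rintegral do rewrite !mul0r.
      by rewrite Rintegral_cst// mul0r.
    + move=> i _; under eq_Rintegral do rewrite !mul0r.
      by rewrite Rintegral_cst// mul0r.
  - by move=> ? _; exact: cst_continuous.
- by move=> ? _; exact: cst_continuous.
- by move=> M; exists 1 => r _ _; rewrite normr1.
Qed.

Lemma curve_mass t : 0 < t -> \int[dx]_x w t x = 1.
Proof.
move=> t0; apply/eqP; rewrite -subr_eq0 -normr_le0; apply/ler_addgt0Pr => eta eta0.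
have [s [s0 st H]] := initial_L1 eta0 t0; rewrite add0r; apply: le_trans H.
have [_ _ <-] := u0_prob.
rewrite (curve_mass_constant s0 st) -RintegralB//; last exact: iw.
apply: le_normr_Rintegral => //; apply: RintegrableB => //; exact: iw.
Qed.

(** This function of time dominates the derivatives of all regularized [L^1] norms, whatever the
    value of [e]. *)
Lemma time_deriv_L1_continuous t : 0 < t ->
  {for t, continuous (fun s => \int[dx]_x `|time_deriv w s x|)}.
Proof.
move=> t0; have [b b0 [M M0 [bt HM]]] := curve_locally_bounded L0 Hw t0.
have tI : t \in (`]t - b, t + b[%classic : set R) by rewrite inE/= in_itv/=; apply/andP; split; lra.
have sI (s : R) : s \in (`]t - b, t + b[%classic : set R) -> t - b < s < t + b by rewrite inE/= in_itv.
have s0 (s : R) : s \in (`]t - b, t + b[%classic : set R) -> 0 < s by move=> /sI/andP[? ?]; lra.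
apply: (@continuity_under_integral _ _ _ dx (fun s x => `|time_deriv w s x|) setT measurableT
  (t - b) (t + b) _ _ (cst M)) => //.
- move=> s /mem_set/s0 s0'; have [_ ct] := time_deriv_continuous Hw s0'.
  by apply: (torus_integrable_continuous L0) => x; exact: (cvg_norm (ct x)).
- apply: aeW => x _ s /s0 s0'.
  have c3 : {for s, continuous (fun r => time_deriv w r x)} by exact: (time_deriv_continuous_time Hw).
  exact: (cvg_norm c3).
- by apply: (torus_integrable_continuous L0); exact: cst_continuous.
- move=> s /mem_set/sI sa; apply: aeW => x _; rewrite normr_id.
  by have [] := HM s x sa.
Qed.

Section L1_contraction.
Context (e : R) (e0 : 0 < e).
Local Notation q := (sqrt_approx e).

Let dE (t : R) : R := \int[dx]_x (w t x / q (w t x) * time_deriv w t x).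

Lemma sqrt_approx_FTC s t : 0 < s -> s < t ->
  \int[dx]_x q (w t x) - \int[dx]_x q (w s x) = \int[leb]_(r in `[s, t]) dE r.
Proof.
move=> s0 st.
apply: (@functional_FTC _ _ _ L0 w Hw setT q (fun r => r / q r)) => //.
- by move=> r _; exact: is_derive_sqrt_approx.
- by move=> r _; exact: continuous_sqrt_approx1.
- by move=> M; exists 1 => r _ _; exact: sqrt_approx_derive_bound.
Qed.

Lemma sqrt_approx_dE_continuous t : 0 < t -> {for t, continuous dE}.
Proof.
move=> t0; apply: (@functional_derive_continuous _ _ _ L0 w Hw setT (fun r : R => r / q r)) => //.
- by move=> r _; exact: continuous_sqrt_approx1.
- by move=> M; exists 1 => r _ _; exact: sqrt_approx_derive_bound.
Qed.

Lemma sqrt_approx_dE_bound t : 0 < t -> `|dE t| <= \int[dx]_x `|time_deriv w t x|.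
Proof.
move=> t0; have [_ ct] := time_deriv_continuous Hw t0.
have it : dx.-integrable setT (EFin \o time_deriv w t) by exact: torus_integrable_continuous.
have [_ cw] := curve_continuous Hw t0.
have mq : measurable_fun setT (fun x => w t x / q (w t x)).
  apply: continuous_measurable_rV.
  by apply: (@continuous_compR _ _ (w t) (fun r : R => r / q r)) => // x; exact: continuous_sqrt_approx1.
have h : {ae dx, forall x, `|w t x / q (w t x)| <= 1}.
  by apply: aeW => x; exact: sqrt_approx_derive_bound.
have i1 := RintegrableM_bounded mq h it.
apply: le_trans (le_normr_Rintegral _ i1) _ => //.
apply: le_Rintegral => //; [exact: Rintegrable_norm|exact: Rintegrable_norm|].
by move=> x _; rewrite normrM ler_piMl// sqrt_approx_derive_bound.
Qed.

Lemma sqrt_approx_dE_le t (K : R) : 0 < t -> (forall i, bounded_by L K (V t i)) ->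
  dE t <= e * (d%:R * (kappa ^+ 2 * K ^+ 2) * L ^+ d).
Proof.
move=> t0 VK; have [wL cw] := curve_continuous Hw t0.
rewrite /dE (curve_dissipation t0 (Dm := setT) (fun=> Logic.I) (fun r _ => is_derive_sqrt_approx1 e0 r)
  (fun r _ => continuous_sqrt_approx2 e0 (r := r))).
have cdw i : continuous (pderiv i (w t)) by have [] := curve_torus_C1 Hw i t0.
have c2 : continuous (fun x => e ^+ 2 / q (w t x) ^+ 3).
  by apply: (@continuous_compR _ _ (w t) (fun r : R => e ^+ 2 / q r ^+ 3)) => // x; exact: continuous_sqrt_approx2.
have i1 i : dx.-integrable setT (EFin \o (fun x => e ^+ 2 / q (w t x) ^+ 3 * pderiv i (w t) x ^+ 2)).
  apply: torus_integrable_continuous => // x.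
  exact: (cvgM (c2 x) (cvgM (cdw i x) (cdw i x))).
have i2 i : dx.-integrable setT (EFin \o (fun x => e ^+ 2 / q (w t x) ^+ 3 * w t x * pderiv i (w t) x * V t i x)).
  have [_ mV VK'] := VK i.
  have : dx.-integrable setT (EFin \o (fun x => e ^+ 2 / q (w t x) ^+ 3 * w t x * pderiv i (w t) x)).
    apply: torus_integrable_continuous => // x.
    exact: (cvgM (cvgM (c2 x) (cw x)) (cdw i x)).
  move=> /(RintegrableM_bounded mV (aeW _ VK')).
  by under eq_fun do rewrite mulrC.
rewrite -sumrN mulr_sumr -sumrB.
have -> : e * (d%:R * (kappa ^+ 2 * K ^+ 2) * L ^+ d) = \sum_(i < d) (e * (kappa ^+ 2 * K ^+ 2) * L ^+ d).
  by rewrite sumr_const card_ord -mulr_natl; ring.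
apply: ler_sum => i _.
have [_ mV VK'] := VK i.
rewrite -RintegralZl// -[X in X - _]mulN1r -RintegralZl// -RintegralB//; [|exact: RintegrableZ|exact: RintegrableZ].
rewrite -(torus_Rintegral_cst L0 d); apply: le_Rintegral => //.
- by apply: RintegrableB; exact: RintegrableZ.
- by apply: (torus_integrable_continuous L0); exact: cst_continuous.
move=> x _; rewrite mulN1r; apply: le_trans (sqrt_approx_young e0 kappa (w t x) (pderiv i (w t) x) (V t i x)) _.
rewrite ler_wpM2l ?(ltW e0)// ler_wpM2l ?sqr_ge0//.
by rewrite -[V t i x ^+ 2]ger0_norm ?sqr_ge0// normrX lerXn2r ?nnegrE//; apply: le_trans (VK' 0).
Qed.

End L1_contraction.

(* With mass conservation, this yields nonnegativity: [\int |w t| <= \int |u0| = 1 = \int w t]. *)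
Lemma curve_L1_nonincreasing s t : 0 < s -> s < t ->
  \int[dx]_x `|w t x| <= \int[dx]_x `|w s x|.
Proof.
move=> s0 st; pose ep (n : nat) : R := n.+1%:R^-1.
have ep0 n : 0 < ep n by rewrite invr_gt0.
pose dE n (r : R) : R := \int[dx]_x (w r x / sqrt_approx (ep n) (w r x) * time_deriv w r x).
pose G (r : R) : R := \int[dx]_x `|time_deriv w r x|.
have pos (r : R) : (`[s, t]%classic : set R) r -> 0 < r by rewrite /= in_itv/= => /andP[? _]; lra.
have cdE n : {within `[s, t], continuous (dE n)}.
  apply: continuous_in_subspaceT => r; rewrite inE => /pos r0; exact: sqrt_approx_dE_continuous.
have cG : {within `[s, t], continuous G}.
  apply: continuous_in_subspaceT => r; rewrite inE => /pos r0; exact: time_deriv_L1_continuous.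
have idE n : leb.-integrable `[s, t] (EFin \o dE n) by exact: continuous_integrable_itv.
have mdE n : measurable_fun (`[s, t]%classic : set R) (dE n).
  by have /measurable_int/measurable_EFinP := idE n.
(* At each time the upper bound of [dE n] tends to [0], but its constant involves the bound of the
   velocity at that time, which is not controlled uniformly. Hence dominated convergence is used,
   for the positive part and with dominating function [G]. *)
pose f n (r : R) : R := Num.max (dE n r) 0.
have mf n : measurable_fun (`[s, t]%classic : set R) (f n) by apply: measurable_maxr.
have iG : leb.-integrable `[s, t] (EFin \o G) by exact: continuous_integrable_itv.
have fG n r : (`[s, t]%classic : set R) r -> `|f n r| <= G r.
  move=> /pos r0; have := sqrt_approx_dE_bound (ep0 n) r0; rewrite -/(dE n r) -/(G r) /f => h.
  rewrite ger0_norm; last by rewrite le_max lexx orbT.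
  by rewrite ge_max (le_trans (ler_norm _) h)/= (le_trans _ h).
have f0 r : (`[s, t]%classic : set R) r -> f ^~ r @ \oo --> (0 : R).
  move=> /pos r0; have [K K0 VK] := VB r0.
  set C := d%:R * (kappa ^+ 2 * K ^+ 2) * L ^+ d.
  have C0 : 0 <= C.
    have LD : 0 <= L ^+ d by apply: exprn_ge0; exact: ltW.
    by apply: mulr_ge0 => //; apply: mulr_ge0 => //; apply: mulr_ge0; exact: sqr_ge0.
  apply: (@squeeze_cvgr _ _ _ _ (cst 0) (fun n => ep n * C)).
  - apply: nearW => n; rewrite /f le_max lexx orbT/= ge_max mulr_ge0 ?(ltW (ep0 n))// andbT.
    by apply: sqrt_approx_dE_le => // i; have [] := VK i.
  - exact: cvg_cst.
  - rewrite -[X in _ --> X](mul0r C); apply: cvgM; last exact: cvg_cst.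
    exact: cvg_harmonic.
have lim0 := @Rdominated_cvg_in _ _ _ leb `[s, t]%classic f (cst 0) G (measurable_itv _) mf
  (measurable_cst _) f0 iG fG.
rewrite Rintegral_cst// mul0r in lim0.
have key n : \int[dx]_x `|w t x| - \int[dx]_x `|w s x| <= \int[leb]_(r in `[s, t]) f n r + ep n * L ^+ d.
  have t0 : 0 < t by lra.
  have iq (r : R) : 0 < r -> dx.-integrable setT (EFin \o (fun x => sqrt_approx (ep n) (w r x))).
    move=> r0; apply: torus_integrable_continuous => //; have [_ cw] := curve_continuous Hw r0.
    apply: (@continuous_compR _ _ (w r) (sqrt_approx (ep n))) => // x.
    have [dp _] := is_derive_sqrt_approx (ep0 n) (w r x).
    by apply/differentiable_continuous/derivable1_diffP.
  have h1 : \int[dx]_x `|w t x| <= \int[dx]_x sqrt_approx (ep n) (w t x).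
    apply: le_Rintegral => //; [exact: Rintegrable_norm (iw t0)|exact: iq|].
    by move=> x _; have [] := sqrt_approx_bound (ep0 n) (w t x).
  have ie : dx.-integrable setT (EFin \o (fun=> ep n)).
    by apply: (torus_integrable_continuous L0); exact: cst_continuous.
  have h2 : \int[dx]_x sqrt_approx (ep n) (w s x) <= \int[dx]_x `|w s x| + ep n * L ^+ d.
    rewrite -(torus_Rintegral_cst L0 d) -RintegralD//; last exact: Rintegrable_norm (iw s0).
    apply: le_Rintegral => //; [exact: iq|by apply: RintegrableD => //; exact: Rintegrable_norm (iw s0)|].
    by move=> x _; have [] := sqrt_approx_bound (ep0 n) (w s x).
  have h3 := sqrt_approx_FTC (ep0 n) s0 st.
  have h4 : \int[leb]_(r in `[s, t]) dE n r <= \int[leb]_(r in `[s, t]) f n r.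
    apply: le_Rintegral => //.
    - apply: (@le_integrable _ _ _ leb _ (measurable_itv _) (EFin \o f n) (EFin \o G)) => //.
        by apply/measurable_EFinP; exact: mf.
      move=> r rI /=; rewrite lee_fin; apply: le_trans (fG n r rI) _; exact: ler_norm.
    - by move=> r _; rewrite /f le_max lexx.
  rewrite -/(dE n) in h3; move: h1 h2 h3 h4; rewrite /dE; lra.
rewrite -subr_le0.
have : \int[leb]_(r in `[s, t]) f n r + ep n * L ^+ d @[n --> \oo] --> 0 + 0 * L ^+ d.
  apply: cvgD; first exact: lim0.
  by apply: cvgM; [exact: cvg_harmonic|exact: cvg_cst].
rewrite mul0r addr0 => c.
rewrite -(cvg_lim _ c)//; apply: limr_ge; first by apply/cvg_ex; eexists; exact: c.
exact: nearW.
Qed.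

(** [|w t| - w t] is continuous and nonnegative, and its integral is at most [1 - 1]. *)
Lemma curve_nonnegative t x : 0 < t -> 0 <= w t x.
Proof.
move=> t0; have [wL cw] := curve_continuous Hw t0.
have L1 : \int[dx]_x `|w t x| <= 1.
  apply/ler_addgt0Pr => eta eta0; have [s [s0 st H]] := initial_L1 eta0 t0.
  apply: le_trans (curve_L1_nonincreasing s0 st) _.
  have [_ u00 I1] := u0_prob.
  have iB : dx.-integrable setT (EFin \o (fun x => w s x - u0 x)) by apply: RintegrableB => //; exact: iw.
  apply: (@le_trans _ _ (\int[dx]_x (u0 x + `|w s x - u0 x|))).
    apply: ae_le_Rintegral; first exact: Rintegrable_norm (iw s0).
      by apply: RintegrableD => //; exact: Rintegrable_norm.
    apply: filterS u00 => y y0; rewrite -[X in `|X|](subrK (u0 y)) addrC.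
    by apply: le_trans (ler_normD _ _) _; rewrite (ger0_norm y0).
  by rewrite RintegralD//; [rewrite I1 lerD2l|exact: Rintegrable_norm].
have cn : continuous (fun x => `|w t x|) by move=> y; exact: (cvg_norm (cw y)).
have ch : continuous (fun x => `|w t x| - w t x) by move=> y; exact: (cvgB (cn y) (cw y)).
have := @torus_integral_eq0 _ _ _ L0 (fun x => `|w t x| - w t x) _ ch _ _ x.
move=> H; have : `|w t x| - w t x = 0.
  apply: H.
  - by move=> y i; rewrite wL.
  - by move=> y; rewrite subr_ge0 ler_norm.
  - rewrite RintegralB//; [|exact: Rintegrable_norm (iw t0)|exact: iw].
    by rewrite curve_mass// subr_le0.
by move/eqP; rewrite subr_eq0 => /eqP <-.
Qed.

End positivity.

(** * Entropy dissipation at a fixed parameter *)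

Section entropy_function.
Context (R : realType).
Implicit Types v z e : R.

(** The nonnegative convex version of [v ln v], with minimum [0] at [v = 1]. The convention
    [ln 0 = 0] gives the correct value [1] at [v = 0]. *)
Definition entropy_fun v : R := v * ln v - v + 1.

Lemma ln_le_sub1 v : 0 < v -> ln v <= v - 1.
Proof.
by move=> v0; have := @le_ln1Dx _ (v - 1); rewrite [1 + _]addrC subrK; apply; lra.
Qed.

Lemma is_derive_ln v : 0 < v -> is_derive v 1 (@ln R) v^-1.
Proof. exact: is_derive1_ln. Qed.

(** [v ln v] lies above its tangent at [z]; the point of contact must be positive, while [v] may
    vanish. *)
Lemma mulr_ln_ge v z : 0 <= v -> 0 < z -> v + v * ln z - z <= v * ln v.
Proof.
rewrite le_eqVlt => /predU1P[<- z0|v0 z0]; first by rewrite !mul0r add0r; lra.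
have := ln_le_sub1 (divr_gt0 z0 v0); rewrite ln_div ?posrE// => H.
have := ler_wpM2l (ltW v0) H; rewrite mulrBr mulrBr mulr1 mulrCA divff ?gt_eqF// mulr1; lra.
Qed.

Lemma entropy_fun_ge0 v : 0 <= entropy_fun v.
Proof.
rewrite /entropy_fun; have [v0|v0] := leP v 0; first by rewrite ln0//; lra.
by have := mulr_ln_ge (ltW v0) (@ltr01 R); rewrite ln1; lra.
Qed.

(** Convexity between [v] and [1], where the function vanishes; the tangent at the intermediate
    point is compared with both ends. *)
Lemma entropy_fun_convex e v : 0 < e < 1 -> 0 <= v ->
  entropy_fun ((1 - e) * v + e) <= (1 - e) * entropy_fun v.
Proof.
move=> /andP[e0 e1] v0; set z := (1 - e) * v + e.
have z0 : 0 < z by rewrite /z ltr_wpDl// mulr_ge0//; lra.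
have h1 := mulr_ln_ge v0 z0; have h2 := mulr_ln_ge (@ler01 R) z0; rewrite ln1 mulr0 in h2.
have e1' : 0 <= 1 - e by lra.
have := ler_wpM2l e1' h1; have := ler_wpM2l (ltW e0) h2.
rewrite /entropy_fun.
have -> : z * ln z = (1 - e) * v * ln z + e * ln z by rewrite /z; ring.
rewrite /z; lra.
Qed.

Lemma ln_interp e v : 0 < e < 1 -> 0 < v -> (1 - e) * ln v <= ln ((1 - e) * v + e).
Proof.
move=> /andP[e0 e1] v0; set z := (1 - e) * v + e.
have z0 : 0 < z by rewrite /z ltr_wpDl// mulr_ge0//; lra.
have zn : z != 0 by rewrite gt_eqF.
have h1 := ln_le_sub1 (divr_gt0 v0 z0); have h2 := ln_le_sub1 (divr_gt0 (@ltr01 R) z0).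
rewrite ln_div ?posrE// in h1; rewrite ln_div ?posrE// ln1 in h2.
have e1' : 0 <= 1 - e by lra.
have := lerD (ler_wpM2l e1' h1) (ler_wpM2l (ltW e0) h2).
have -> : (1 - e) * (v / z - 1) + e * (1 / z - 1) = z / z - 1 by rewrite {3}/z; field.
rewrite divff//; lra.
Qed.

(** Converse comparison: [ln z] is bounded below by [(1 - e) ln v] on the part [(1 - e) v] of [z],
    and by [ln e] on the part [e]. The losses, a factor [(1 - e)^2] and the term [e ln e], disappear
    with [e]. *)
Lemma entropy_interp_ge e v : 0 < e < 1 -> 0 <= v ->
  (1 - e) ^+ 2 * (v * ln v) + e * ln e <= ((1 - e) * v + e) * ln ((1 - e) * v + e).
Proof.
move=> e01; have /andP[e0 e1] := e01; rewrite le_eqVlt => /predU1P[<-|v0].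
  by rewrite mul0r mulr0 !mulr0 !add0r.
set z := (1 - e) * v + e.
have z0 : 0 < z by rewrite /z ltr_wpDl// mulr_ge0//; lra.
have h1 := ln_interp e01 v0; rewrite -/z in h1.
have h2 : ln e <= ln z by rewrite ler_ln ?posrE// /z lerDr mulr_ge0//; lra.
have e1' : 0 <= (1 - e) * v by rewrite mulr_ge0//; lra.
have := lerD (ler_wpM2l e1' h1) (ler_wpM2l (ltW e0) h2).
by rewrite -mulrDl -/z; apply: le_trans; rewrite lerD2r le_eqVlt; apply/orP; left; apply/eqP; ring.
Qed.

Lemma abs_ln_bound e v : 0 < e < 1 -> e <= v -> `|ln v| <= v - ln e.
Proof.
move=> /andP[e0 e1] ev; have v0 : 0 < v by lra.
have h1 : ln e <= ln v by rewrite ler_ln ?posrE.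
have h2 : ln e <= 0 by apply: ln_le0; exact: ltW.
have h3 := ln_sublinear v0.
by rewrite ler_norml; apply/andP; split; lra.
Qed.

(** Comparison of [ln v] with its Pade approximation [2 (v - 1) / (v + 1)]. The difference,
    multiplied by [v + 1], has derivative [ln v + 1 / v - 1 >= 0] and vanishes at [1]. *)
Lemma ln_pade_sign v : 0 < v ->
  (1 <= v -> 0 <= (v + 1) * ln v - 2 * (v - 1)) /\
  (v <= 1 -> (v + 1) * ln v - 2 * (v - 1) <= 0).
Proof.
move=> v0; pose k (x : R) : R := (x + 1) * ln x - 2 * (x - 1).
have kd (x : R) : 0 < x -> is_derive x 1 k (ln x + x^-1 - 1).
  move=> x0; have xn : x != 0 by rewrite gt_eqF.
  have d1 := is_derive_add (is_derive_id x 1) (is_derive_cst (1 : R) x 1).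
  have d2 := is_derive_sub (is_derive_id x 1) (is_derive_cst (1 : R) x 1).
  have E := is_derive_sub (is_derive_mul d1 (is_derive_ln x0)) (is_derive_scale 2 d2).
  by apply: (is_derive_eq E); rewrite /cst; field.
have k'0 (x : R) : 0 < x -> 0 <= ln x + x^-1 - 1.
  move=> x0; have := ln_le_sub1 (_ : 0 < x^-1); rewrite invr_gt0 => /(_ x0).
  rewrite lnV ?posrE//; lra.
have k1 : k 1 = 0 by rewrite /k ln1; ring.
have kc (a b : R) : 0 < a -> {within `[a, b], continuous k}.
  move=> a0; apply: continuous_in_subspaceT => x; rewrite inE/= in_itv/= => /andP[ax _].
  by have [dk _] := kd x (lt_le_trans a0 ax); apply/differentiable_continuous/derivable1_diffP.
have pos (a b x : R) : 0 < a -> x \in `]a, b[ -> 0 < x by rewrite in_itv/= => a0 /andP[ax _]; lra.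
split => h.
- have [c cI] := MVT_segment h (fun x xI => kd x (pos 1 v x ltr01 xI)) (kc 1 v ltr01).
  rewrite -/(k v) k1 subr0 => ->; apply: mulr_ge0; last by rewrite subr_ge0.
  apply: k'0.
  by move: cI; rewrite in_itv/= => /andP[? _]; lra.
- have [c cI] := MVT_segment h (fun x xI => kd x (pos v 1 x v0 xI)) (kc v 1 v0).
  rewrite -/(k v) k1 sub0r => /eqP; rewrite eqr_oppLR => /eqP ->; rewrite oppr_le0.
  apply: mulr_ge0; last by rewrite subr_ge0.
  by apply: k'0; move: cI; rewrite in_itv/= => /andP[? _]; lra.
Qed.

(** The difference of the two sides vanishes at [1], and its derivative is four times the expression
    of [ln_pade_sign]; so it decreases before [1] and increases after it. *)
Lemma pinsker_pointwise v : 0 <= v -> 3 * (v - 1) ^+ 2 <= (2 * v + 4) * entropy_fun v.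
Proof.
rewrite le_eqVlt => /predU1P[<-|v0].
  by rewrite /entropy_fun mul0r; lra.
pose f (x : R) : R := (2 * x + 4) * (x * ln x - x + 1) - 3 * (x - 1) ^+ 2.
have fd (x : R) : 0 < x -> is_derive x 1 f (4 * ((x + 1) * ln x - 2 * (x - 1))).
  move=> x0; have xn : x != 0 by rewrite gt_eqF.
  have d2 := is_derive_sub (is_derive_id x 1) (is_derive_cst (1 : R) x 1).
  have d3 := is_derive_add (is_derive_scale 2 (is_derive_id x 1)) (is_derive_cst (4 : R) x 1).
  have d4 := is_derive_add (is_derive_sub (is_derive_mul (is_derive_id x 1) (is_derive_ln x0)) (is_derive_id x 1)) (is_derive_cst (1 : R) x 1).
  have E := is_derive_sub (is_derive_mul d3 d4) (is_derive_scale 3 (is_derive_sqr d2)).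
  by apply: (is_derive_eq E); rewrite /cst; field.
have f1 : f 1 = 0 by rewrite /f ln1; ring.
have fc (a b : R) : 0 < a -> {within `[a, b], continuous f}.
  move=> a0; apply: continuous_in_subspaceT => x; rewrite inE/= in_itv/= => /andP[ax _].
  by have [df _] := fd x (lt_le_trans a0 ax); apply/differentiable_continuous/derivable1_diffP.
have pos (a b x : R) : 0 < a -> x \in `]a, b[ -> 0 < x by rewrite in_itv/= => a0 /andP[ax _]; lra.
rewrite /entropy_fun -subr_ge0 -/(f v).
have [h|/ltW h] := leP 1 v.
- have [c cI] := MVT_segment h (fun x xI => fd x (pos 1 v x ltr01 xI)) (fc 1 v ltr01).
  rewrite f1 subr0 => ->; move: cI; rewrite in_itv/= => /andP[c1 _].
  have [+ _] := ln_pade_sign (lt_le_trans ltr01 c1) => /(_ c1) k0.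
  by rewrite mulr_ge0 ?subr_ge0// mulr_ge0.
- have [c cI] := MVT_segment h (fun x xI => fd x (pos v 1 x v0 xI)) (fc v 1 v0).
  rewrite f1 sub0r => /eqP; rewrite eqr_oppLR => /eqP ->; move: cI; rewrite in_itv/= => /andP[vc c1].
  have [_ +] := ln_pade_sign (lt_le_trans v0 vc) => /(_ c1) k0.
  by rewrite oppr_ge0 mulr_le0_ge0 ?subr_ge0//; lra.
Qed.

(** The square root of [pinsker_pointwise] linearized by [4 A B <= (A + B)^2]. The result is affine
    in the entropy, so that it can be integrated, and [th] is optimized afterwards. *)
Lemma pinsker_young v (th : R) : 0 <= v -> 0 < th ->
  `|v - 1| <= th * (2 * v + 4) / 6 + entropy_fun v / (2 * th).
Proof.
move=> v0 th0; have H := pinsker_pointwise v0; have h0 := entropy_fun_ge0 v.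
set A := th * (2 * v + 4) / 6; set B := _ / _.
have A0 : 0 <= A by rewrite divr_ge0// mulr_ge0 ?(ltW th0)//; lra.
have B0 : 0 <= B by rewrite divr_ge0// mulr_ge0// ltW.
rewrite -ler_sqr ?nnegrE ?addr_ge0// real_normK ?num_real//.
apply: (@le_trans _ _ (4 * (A * B))).
  have -> : 4 * (A * B) = (2 * v + 4) * entropy_fun v / 3 by rewrite /A /B; field; rewrite gt_eqF.
  by rewrite ler_pdivlMr// mulrC.
rewrite -subr_ge0 (_ : _ - _ = (A - B) ^+ 2) ?sqr_ge0//.
by ring.
Qed.

End entropy_function.

Lemma continuous_scale_fun (R : realType) (T : topologicalType) (k : R) (f : T -> R) :
  continuous f -> continuous (fun x => k * f x).
Proof. by move=> cf x; exact: (cvgM (cvg_cst k) (cf x)). Qed.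

(** * Regularized densities *)

Section regularized_entropy.
Context (R : realType) (Ld e : R) (Ld0 : 0 < Ld) (e01 : 0 < e < 1).

(* The density [(1 - e) r + e / Ld] relative to the uniform density [1 / Ld]. *)
Definition mix (r : R) : R := (1 - e) * (r * Ld) + e.

Lemma mix_ge r : 0 <= r -> e <= mix r.
Proof.
by move=> r0; have /andP[e0 e1] := e01; rewrite /mix lerDr mulr_ge0 ?mulr_ge0 ?(ltW Ld0)//; lra.
Qed.

Lemma mix_gt0 r : 0 <= r -> 0 < mix r.
Proof. by move=> /mix_ge; have /andP[e0 _] := e01; exact: lt_le_trans. Qed.

Lemma is_derive_mix (r : R) : is_derive r 1 mix ((1 - e) * Ld).
Proof.
have E := is_derive_add (is_derive_scale (1 - e) (is_derive_mul (is_derive_id r 1) (is_derive_cst Ld r 1)))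
  (is_derive_cst e r 1).
by apply: (is_derive_eq E); rewrite /cst; ring.
Qed.

Lemma is_derive_ln_mix (r : R) : 0 <= r -> is_derive r 1 (fun r : R => ln (mix r)) ((1 - e) * Ld / mix r).
Proof.
move=> r0; have E := is_derive_chainR (is_derive_ln (mix_gt0 r0)) (is_derive_mix r).
by apply: (is_derive_eq E); rewrite mulrC.
Qed.

Lemma is_derive_mix_entropy (r : R) : 0 <= r ->
  is_derive r 1 (fun r : R => Ld^-1 * (mix r * ln (mix r))) ((1 - e) * (ln (mix r) + 1)).
Proof.
move=> r0; have zn : mix r != 0 by rewrite gt_eqF// mix_gt0.
have E := is_derive_scale Ld^-1 (is_derive_mul (is_derive_mix r) (is_derive_ln_mix r0)).
apply: (is_derive_eq E); have Ldn : Ld != 0 by rewrite gt_eqF.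
by move: (mix r) zn (ln _) => z zn l; field; rewrite zn.
Qed.

Lemma is_derive_mix_entropy1 (r : R) : 0 <= r ->
  is_derive r 1 (fun r : R => (1 - e) * (ln (mix r) + 1)) ((1 - e) ^+ 2 * Ld / mix r).
Proof.
move=> r0; have E := is_derive_scale (1 - e) (is_derive_add (is_derive_ln_mix r0) (is_derive_cst (1 : R) r 1)).
by apply: (is_derive_eq E); ring.
Qed.

(** A primitive of [phi2 r * r] for the regularized entropy. The drift term of [dissipation] is
    thereby the pairing of the velocity with the gradient of a function of the density, close to the
    density itself; [velocity_pairing] applies to it. *)
Lemma is_derive_mix_flux (r : R) : 0 <= r ->
  is_derive r 1 (fun r : R => (1 - e) * r - e / Ld * ln (mix r)) ((1 - e) ^+ 2 * Ld / mix r * r).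
Proof.
move=> r0; have zn : mix r != 0 by rewrite gt_eqF// mix_gt0.
have E := is_derive_sub (is_derive_scale (1 - e) (is_derive_id r 1)) (is_derive_scale (e / Ld) (is_derive_ln_mix r0)).
apply: (is_derive_eq E); have Ldn : Ld != 0 by rewrite gt_eqF.
by move: zn; rewrite /mix => zn; field; rewrite zn.
Qed.

Lemma continuous_mix_entropy1 (r : R) : 0 <= r -> {for r, continuous (fun r : R => (1 - e) * (ln (mix r) + 1))}.
Proof.
move=> r0; have [dp _] := is_derive_mix_entropy1 r0.
by apply/differentiable_continuous/derivable1_diffP.
Qed.

Lemma continuous_mix (r : R) : {for r, continuous mix}.
Proof.
have [dp _] := is_derive_mix r.
by apply/differentiable_continuous/derivable1_diffP.
Qed.

Lemma continuous_mix_entropy2 (r : R) : 0 <= r -> {for r, continuous (fun r : R => (1 - e) ^+ 2 * Ld / mix r)}.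
Proof.
move=> r0; have zn : mix r != 0 by rewrite gt_eqF// mix_gt0.
exact: (cvgM (cvg_cst _) (cvgV zn (@continuous_mix r))).
Qed.

Lemma mix_entropy1_bound M : exists K, forall r, 0 <= r -> `|r| <= M -> `|(1 - e) * (ln (mix r) + 1)| <= K.
Proof.
have /andP[e0 e1] := e01; exists (M * Ld + 1 - ln e + 1) => r r0 rM.
have h := abs_ln_bound e01 (mix_ge r0).
rewrite normrM ger0_norm; last by lra.
have h1 : mix r <= M * Ld + 1.
  have rM' : r <= M by rewrite (le_trans (ler_norm r)).
  have : r * Ld <= M * Ld by rewrite ler_wpM2r// ltW.
  have : 0 <= r * Ld by rewrite mulr_ge0// ltW.
  by rewrite /mix; nra.
have h2 : `|ln (mix r) + 1| <= M * Ld + 1 - ln e + 1.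
  by apply: le_trans (ler_normD _ _) _; rewrite normr1 lerD2r; lra.
by apply: le_trans h2; rewrite ler_piMl//; lra.
Qed.

End regularized_entropy.

(** * Relative entropy with respect to the uniform density *)

Section relative_entropy.
Context (R : realType) (d : nat) (L : R) (L0 : 0 < L).
Local Notation dx := (@torus_measure R d L).
Local Notation Rd := 'rV[R]_d.
Local Notation Ld := (L ^+ d).

(* Equals [\int u ln (u / Ld^-1)] when [u] has mass one; the integrand is nonnegative. *)
Definition rel_entropy (u : Rd -> R) : \bar R := (\int[dx]_x (Ld^-1 * entropy_fun (u x * Ld))%:E)%E.

Let Ld0 : 0 < Ld. Proof. by rewrite exprn_gt0. Qed.

Lemma measurable_entropy_fun dT (T : measurableType dT) (f : T -> R) : measurable_fun setT f ->
  measurable_fun setT (fun x => entropy_fun (f x)).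
Proof.
move=> mf; apply: measurable_funD => //; apply: measurable_funB => //.
by apply: measurable_funM => //; exact: measurableT_comp.
Qed.

Lemma rel_entropy_ge0 u : (0 <= rel_entropy u)%E.
Proof.
apply: integral_ge0 => x _; rewrite lee_fin mulr_ge0 ?entropy_fun_ge0// invr_ge0 ltW//.
Qed.

Context (u : Rd -> R) (iu : dx.-integrable setT (EFin \o u)) (u_ge0 : {ae dx, forall x, 0 <= u x}).

Let mu_ : measurable_fun setT u. Proof. exact: Rintegrable_measurable iu. Qed.

Let ment : measurable_fun setT (fun x => Ld^-1 * entropy_fun (u x * Ld)).
Proof. by apply: measurable_funM => //; apply: measurable_entropy_fun; exact: measurable_funM. Qed.

Let icst (k : R) : dx.-integrable setT (EFin \o (fun=> k)).
Proof. by apply: (torus_integrable_continuous L0); exact: cst_continuous. Qed.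

Lemma rel_entropy_integrable : (rel_entropy u < +oo)%E ->
  dx.-integrable setT (EFin \o (fun x => Ld^-1 * entropy_fun (u x * Ld))) /\
  rel_entropy u = (\int[dx]_x (Ld^-1 * entropy_fun (u x * Ld)))%:E.
Proof.
move=> uoo; have ih : dx.-integrable setT (EFin \o (fun x => Ld^-1 * entropy_fun (u x * Ld))).
  apply/integrableP; split; first exact/measurable_EFinP.
  apply: le_lt_trans uoo; rewrite le_eqVlt; apply/orP; left; apply/eqP; apply: eq_integral => x _ /=.
  by rewrite ger0_norm// mulr_ge0 ?entropy_fun_ge0// invr_ge0 ltW.
by split => //; rewrite RintegralE.
Qed.

(** Since [ln v <= v - 1], the integrand grows at most quadratically. *)
Lemma rel_entropy_lty : u \in Lfun dx 2%:E -> (rel_entropy u < +oo)%E.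
Proof.
move=> /Lfun2P[_ iu2].
have ih : dx.-integrable setT (EFin \o (fun x => Ld^-1 * entropy_fun (u x * Ld))).
  apply: (@Rintegrable_le _ _ _ _ _ (fun x => Ld * u x ^+ 2 + Ld^-1)) => //.
    apply: filterS u_ge0 => x ux; rewrite ger0_norm; last first.
      by rewrite mulr_ge0 ?entropy_fun_ge0// invr_ge0 ltW.
    have -> : Ld * u x ^+ 2 + Ld^-1 = Ld^-1 * ((u x * Ld) ^+ 2 + 1) by field; rewrite gt_eqF.
    apply: ler_wpM2l; first by rewrite invr_ge0 ltW.
    have : 0 <= u x * Ld by rewrite mulr_ge0// ltW.
    move: (u x * Ld) => v; rewrite le_eqVlt /entropy_fun => /predU1P[<-|v0].
      by rewrite mul0r expr0n/=; lra.
    by have := ler_wpM2l (ltW v0) (ln_le_sub1 v0); rewrite expr2; nra.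
  by apply: RintegrableD => //; exact: RintegrableZ.
by case/integrableP : ih => _; apply: le_lt_trans; apply: ge0_le_integral => //;
  [move=> x _; rewrite lee_fin mulr_ge0 ?entropy_fun_ge0// invr_ge0 ltW
  |exact/measurable_EFinP|apply: measurableT_comp => //; exact/measurable_EFinP
  |move=> x _ /=; rewrite lee_fin ler_norm].
Qed.

Context (mass1 : \int[dx]_x u x = 1).

Lemma rel_entropyE : (rel_entropy u < +oo)%E ->
  (\int[dx]_x (u x * ln (u x / Ld^-1))%:E)%E = rel_entropy u.
Proof.
move=> /rel_entropy_integrable[ih ->].
rewrite (eq_integral (fun x => (Ld^-1 * entropy_fun (u x * Ld) + (u x - Ld^-1))%:E)); last first.
  by move=> x _; congr EFin; rewrite invrK /entropy_fun; field; rewrite gt_eqF.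
have i2 : dx.-integrable setT (EFin \o (fun x => u x - Ld^-1)) by exact: RintegrableB.
have i3 := RintegrableD ih i2.
rewrite -(RintegralE i3) RintegralD// RintegralB// mass1 torus_Rintegral_cst//.
by rewrite mulVf ?subrr ?addr0// gt_eqF.
Qed.

(** [pinsker_young] with [th = l / 2], half of the [L^1] distance. As [v] has mean one, the weight
    [(2 v + 4) / 6] has mean one as well, and the integrated inequality reads
    [l <= l / 2 + H / l]. *)
Lemma pinsker : (((\int[dx]_x `|u x - Ld^-1|) ^+ 2)%:E <= 2%:E * rel_entropy u)%E.
Proof.
have := rel_entropy_ge0 u; case E : (rel_entropy u) => [r| |]//; last first.
  by move=> _; rewrite gt0_muley ?lte_fin// leey.
rewrite lee_fin => r0; have [|ih] := rel_entropy_integrable; first by rewrite E ltry.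
rewrite E => -[rE]; rewrite -EFinM lee_fin.
set l := \int[dx]_x _; have l0 : 0 <= l by exact: Rintegral_ge0.
move: l0; rewrite le_eqVlt => /predU1P[<-|l0]; first by rewrite expr0n/= mulr_ge0.
have th0 : 0 < l / 2 by rewrite divr_gt0.
have iabs : dx.-integrable setT (EFin \o (fun x => `|u x - Ld^-1|)).
  by apply: Rintegrable_norm; exact: RintegrableB.
have ir : dx.-integrable setT (EFin \o (fun x => l / 2 * (2 * u x + 4 * Ld^-1) / 6)).
  rewrite (_ : (fun x => _) = (fun x => l / 6 * u x + l / 3 * Ld^-1)); last by apply/funext => x; field; rewrite gt_eqF.
  by apply: RintegrableD => //; exact: RintegrableZ.
have H : l <= l / 2 + r / l.
  have -> : l / 2 + r / l = \int[dx]_x (l / 2 * (2 * u x + 4 * Ld^-1) / 6 + l^-1 * (Ld^-1 * entropy_fun (u x * Ld))).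
    rewrite RintegralD//; last exact: RintegrableZ.
    rewrite (RintegralZl _ _ ih)// -rE; congr (_ + _); last by rewrite mulrC.
    rewrite (@eq_Rintegral _ _ _ _ _ (fun x => l / 6 * u x + l / 3 * Ld^-1)); last first.
      by move=> x _; field; rewrite gt_eqF.
    rewrite RintegralD//; last exact: RintegrableZ.
    by rewrite (RintegralZl _ _ iu)// mass1 torus_Rintegral_cst// mulfVK ?gt_eqF//; field.
  apply: ae_le_Rintegral => //.
    by apply: RintegrableD => //; exact: RintegrableZ.
  apply: filterS u_ge0 => x ux.
  have v0 : 0 <= u x * Ld by rewrite mulr_ge0// ltW.
  have := ler_wpM2l (_ : 0 <= Ld^-1) (pinsker_young v0 th0); rewrite invr_ge0 (ltW Ld0) => /(_ isT).
  have -> : Ld^-1 * `|u x * Ld - 1| = `|u x - Ld^-1|.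
    have LV : 0 <= Ld^-1 by rewrite invr_ge0 ltW.
    by rewrite -{1}(ger0_norm LV) -normrM; congr `|_|; field; rewrite gt_eqF.
  move=> h; apply: le_trans h _; rewrite le_eqVlt; apply/orP; left; apply/eqP.
  by move: (entropy_fun _) => h; field; rewrite !gt_eqF.
have := ler_wpM2r (ltW l0) H; rewrite mulrDl divfK ?gt_eqF// expr2; lra.
Qed.

End relative_entropy.

(** * The entropy balance of one curve *)

Section entropy_dissipation.
Context (R : realType) (d : nat) (L : R) (L0 : 0 < L) (d0 : (0 < d)%N).
Local Notation dx := (@torus_measure R d L).
Local Notation Rd := 'rV[R]_d.
Local Notation e_ := (unit_vec R).
Local Notation leb := (@lebesgue_measure R).
Local Notation Ld := (L ^+ d).
Context (w a : R -> Rd -> R) (D u0 : Rd -> R) (kappa : R) (kappa0 : 0 < kappa).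
Hypotheses (Hw : C1C2 L w) (HD : sobolev L 2 +oo D).
Hypothesis ia : forall t, 0 < t -> dx.-integrable setT (EFin \o a t).
Let V t i (x : Rd) : R := \int[dx]_y (wgrad L D i (x - y) * a t y).
Hypothesis flux_derivable : forall t x, 0 < t ->
  forall i, derivable (fun y => w t y * V t i y) x (e_ i).
Hypothesis equation : forall t x, 0 < t ->
  time_deriv w t x = kappa * \sum_(i < d) pderiv i (fun y => w t y * V t i y) x +
  \sum_(i < d) pderivs [:: i; i] (w t) x.
Hypotheses (u0_prob : prob_density L u0) (u0_L2 : u0 \in Lfun dx 2%:E).
Hypothesis w0 : ('N[dx]_2%:E[EFin \o (fun x => w t x - u0 x)%R])%E @[t --> 0^'+] --> 0%E.

Let Ld0 : 0 < Ld. Proof. by rewrite exprn_gt0. Qed.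

Let wpos t x : 0 < t -> 0 <= w t x.
Proof. exact: (curve_nonnegative L0 Hw HD ia flux_derivable equation u0_prob u0_L2 w0). Qed.

Let wmass t : 0 < t -> \int[dx]_x w t x = 1.
Proof. exact: (curve_mass L0 Hw HD ia flux_derivable equation u0_prob u0_L2 w0). Qed.

Let iw t : 0 < t -> dx.-integrable setT (EFin \o w t).
Proof. by move=> t0; have [_ cw] := curve_continuous Hw t0; exact: torus_integrable_continuous. Qed.

Section fixed_regularization.
Context (e : R) (e01 : 0 < e < 1).
Local Notation z := (mix Ld e).

Definition mix_entropy (u : Rd -> R) : R := \int[dx]_x (Ld^-1 * (z (u x) * ln (z (u x)))).
Let dE (t : R) : R := \int[dx]_x ((1 - e) * (ln (z (w t x)) + 1) * time_deriv w t x).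
Let c : R := 4 * pi ^+ 2 / L ^+ 2.
Let N := Linfty_norm L (wlap L D).
(** [b] is free here and becomes the value of [A (1 / L^d)] at the parameter. The term
    [e (1 - ln e)] pays for the logarithm in the regularized flux. *)
Definition entropy_source (b t : R) : R :=
  kappa * (N * (\int[dx]_x `|w t x - Ld^-1| + e * (1 - ln e)) * \int[dx]_y `|a t y - b|).

Let icst (k : R) : dx.-integrable setT (EFin \o (fun=> k)).
Proof. by apply: (torus_integrable_continuous L0); exact: cst_continuous. Qed.

Let cz t : 0 < t -> continuous (fun x => z (w t x)).
Proof.
move=> t0; have [_ cw] := curve_continuous Hw t0.
by apply: continuous_compR => // x; exact: continuous_mix.
Qed.

Let iz t : 0 < t -> dx.-integrable setT (EFin \o (fun x => z (w t x))).
Proof. by move=> t0; apply: torus_integrable_continuous => //; exact: cz. Qed.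

Let Iz t : 0 < t -> \int[dx]_x z (w t x) = Ld.
Proof.
move=> t0; have [_ cw] := curve_continuous Hw t0.
rewrite (@eq_Rintegral _ _ _ _ _ (fun x => (1 - e) * Ld * w t x + e)); last first.
  by move=> x _; rewrite /mix; ring.
rewrite RintegralD//; last exact: RintegrableZ (iw t0).
by rewrite (RintegralZl _ _ (iw t0))// wmass// torus_Rintegral_cst// mulr1; ring.
Qed.

(** [torus_logsobolev] for the positive probability density [u = z / L^d], whose gradient is
    [(1 - e)] times that of [w t]; [c] is the inverse of [(L / (2 pi))^2]. *)
Lemma entropy_logsobolev t : 0 < t ->
  c * mix_entropy (w t) <=
  \sum_(i < d) \int[dx]_x ((1 - e) ^+ 2 * Ld / z (w t x) * pderiv i (w t) x ^+ 2).
Proof.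
move=> t0; have [wL cw] := curve_continuous Hw t0; have /andP[e0 e1] := e01.
have Ldn : Ld != 0 by rewrite gt_eqF.
pose u (x : Rd) : R := Ld^-1 * z (w t x).
have z0 x : 0 < z (w t x) by apply: mix_gt0 => //; exact: wpos.
have cu : continuous u by apply: (@continuous_scale_fun R _ Ld^-1 (fun x => z (w t x))); exact: cz.
have uE x : u x = (1 - e) * w t x + e / Ld.
  by rewrite /u /mix; field.
have dw i x : derivable (w t) x (e_ i) by have [_ _ h _] := curve_torus_C1 Hw i t0; exact: h.
have ud i x : is_derive x (e_ i) u ((1 - e) * pderiv i (w t) x).
  rewrite (_ : u = fun x => (1 - e) * w t x + e / Ld); last by apply/funext.
  have dwx : is_derive x (e_ i) (w t) (pderiv i (w t) x) by split.
  have E := is_derive_add (is_derive_scale (1 - e) dwx) (is_derive_cst (e / Ld) x (e_ i)).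
  by apply: (is_derive_eq E); rewrite addr0.
have pu i : pderiv i u = fun x => (1 - e) * pderiv i (w t) x.
  by apply/funext => x; have [_] := ud i x.
have H := @torus_logsobolev R L L0 d u _ cu _ _ _.
have {}H := H _ _ _ _.
have Iu : \int[dx]_x u x = 1 by rewrite RintegralZl ?Iz ?mulVf//; exact: iz.
move: H; rewrite Iu => H.
have {H} : \int[dx]_x (u x * ln (u x)) - 1 * ln (1 / Ld) <=
    (L / (2 * pi)) ^+ 2 * \sum_(i < d) \int[dx]_x (pderiv i u x ^+ 2 / u x).
  apply: H.
  - by move=> x i; rewrite /u wL.
  - by move=> x; rewrite mulr_gt0// invr_gt0.
  - by move=> i x; have [] := ud i x.
  - move=> i; rewrite pu => x; have [_ _ _ cdw] := curve_torus_C1 Hw i t0.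
    exact: (cvgM (cvg_cst _) (cdw x)).
have -> : \int[dx]_x (u x * ln (u x)) - 1 * ln (1 / Ld) = mix_entropy (w t).
  rewrite (@eq_Rintegral _ _ _ _ _ (fun x => Ld^-1 * (z (w t x) * ln (z (w t x))) + ln (Ld^-1) * u x)); last first.
    by move=> x _; rewrite /u lnM ?posrE ?invr_gt0//; ring.
  have ie : dx.-integrable setT (EFin \o (fun x => Ld^-1 * (z (w t x) * ln (z (w t x))))).
    apply: RintegrableZ; apply: torus_integrable_continuous => //.
    exact: (continuous_xlnx (@cz t t0) z0).
  rewrite RintegralD//; last by apply: RintegrableZ; apply: RintegrableZ; exact: iz.
  have iu : dx.-integrable setT (EFin \o u) by apply: RintegrableZ; exact: iz.
  by rewrite (RintegralZl _ _ iu)// Iu mulr1 mul1r mul1r addrK.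
move=> H; have p0 : 0 < pi :> R by exact: pi_gt0.
have c0 : 0 <= c by rewrite divr_ge0 ?sqr_ge0// mulr_ge0 ?sqr_ge0.
apply: le_trans (ler_wpM2l c0 H) _; rewrite mulrA.
have -> : c * (L / (2 * pi)) ^+ 2 = 1.
  have alg (q l : R) : q != 0 -> l != 0 -> 4 * q ^+ 2 / l ^+ 2 * (l / (2 * q)) ^+ 2 = 1.
    by move=> qn ln; field; rewrite qn ln.
  by rewrite /c alg ?gt_eqF.
rewrite mul1r le_eqVlt; apply/orP; left; apply/eqP; apply: eq_bigr => i _.
apply: eq_Rintegral => x _; rewrite pu /u.
by have := z0 x; move: (z (w t x)) (pderiv i (w t) x) => y p /lt0r_neq0 yn; field; rewrite yn.
Qed.

(** The integrand is the gradient of [psi], from [is_derive_mix_flux], against the velocity.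
    Subtracting the constant [(1 - e) / L^d] leaves [(1 - e) (w - 1 / L^d)] and a logarithm; the
    latter is bounded by [z - ln e], whose integral is known because [z] has mean one. *)
Lemma entropy_flux_bound t (b : R) : 0 < t ->
  `|\sum_(i < d) \int[dx]_x (((1 - e) ^+ 2 * Ld / z (w t x) * w t x * pderiv i (w t) x) * V t i x)| <=
  N * (\int[dx]_x `|w t x - Ld^-1| + e * (1 - ln e)) * \int[dx]_y `|a t y - b|.
Proof.
move=> t0; have [wL cw] := curve_continuous Hw t0; have /andP[e0 e1] := e01.
have Ldn : Ld != 0 by rewrite gt_eqF.
pose psi (x : Rd) : R := (1 - e) * w t x - e / Ld * ln (z (w t x)).
have C i : torus_C1 L i psi /\
    pderiv i psi = (fun x => (1 - e) ^+ 2 * Ld / z (w t x) * w t x * pderiv i (w t) x).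
  apply: (@torus_C1_comp _ _ _ (w t) [set r | 0 <= r] wL cw (fun x => wpos x t0) i
    (fun r : R => (1 - e) * r - e / Ld * ln (z r)) (fun r : R => (1 - e) ^+ 2 * Ld / z r * r)).
  - exact: curve_torus_C1.
  - by move=> r r0; exact: is_derive_mix_flux.
  - move=> r r0; exact: (cvgM (continuous_mix_entropy2 Ld0 e01 r0) cvg_id).
have := @velocity_pairing _ _ _ L0 D HD (a t) (ia t0) psi b ((1 - e) / Ld) d0 (fun i => (C i).1).
rewrite (eq_bigr (fun i => \int[dx]_x (((1 - e) ^+ 2 * Ld / z (w t x) * w t x * pderiv i (w t) x) * V t i x))); last first.
  by move=> i _; rewrite (C i).2.
move=> H; apply: le_trans H _; apply: ler_wpM2r; first exact: Rintegral_ge0.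
apply: ler_wpM2l; first exact: Linfty_norm_ge0.
have i1 : dx.-integrable setT (EFin \o (fun x => `|w t x - Ld^-1|)).
  by apply: Rintegrable_norm; apply: RintegrableB => //; exact: iw.
have i3 : dx.-integrable setT (EFin \o (fun x => z (w t x) - ln e)).
  by apply: RintegrableB => //; exact: iz.
have i2 : dx.-integrable setT (EFin \o (fun x => e / Ld * (z (w t x) - ln e))) by exact: RintegrableZ.
have -> : e * (1 - ln e) = \int[dx]_x (e / Ld * (z (w t x) - ln e)).
  rewrite RintegralZl// RintegralB//; last exact: iz.
  by rewrite Iz// torus_Rintegral_cst//; field.
rewrite -RintegralD//; apply: le_Rintegral => //.
- apply: Rintegrable_norm; apply: RintegrableB => //.
  have [psiL cpsi _ _] := (C (Ordinal d0)).1; exact: torus_integrable_continuous.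
- exact: RintegrableD.
move=> x _; have zx : e <= z (w t x) by apply: mix_ge => //; exact: wpos.
have -> : psi x - (1 - e) / Ld = (1 - e) * (w t x - Ld^-1) - e / Ld * ln (z (w t x)).
  by rewrite /psi; ring.
apply: le_trans (ler_normB _ _) _; apply: lerD; rewrite normrM.
  by rewrite ler_piMl// ger0_norm; lra.
have eL0 : 0 <= e / Ld by rewrite divr_ge0// ltW.
by rewrite (ger0_norm eL0); apply: ler_wpM2l => //; exact: abs_ln_bound.
Qed.

Lemma entropy_production t b : 0 < t -> dE t + c * mix_entropy (w t) <= entropy_source b t.
Proof.
move=> t0; have H1 := entropy_logsobolev t0; have H2 := entropy_flux_bound b t0.
have -> : dE t = - \sum_(i < d) \int[dx]_x ((1 - e) ^+ 2 * Ld / z (w t x) * pderiv i (w t) x ^+ 2) -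
    kappa * \sum_(i < d) \int[dx]_x (((1 - e) ^+ 2 * Ld / z (w t x) * w t x * pderiv i (w t) x) * V t i x).
  apply: (@curve_dissipation _ _ _ L0 w a D kappa Hw HD ia flux_derivable equation t [set r | 0 <= r]
    (fun r : R => (1 - e) * (ln (z r) + 1)) (fun r : R => (1 - e) ^+ 2 * Ld / z r) t0).
  - by move=> x; exact: wpos.
  - by move=> r r0; exact: is_derive_mix_entropy1.
  - by move=> r r0; exact: continuous_mix_entropy2.
move: H1 H2; set S := \sum_(i < d) _; set S2 := \sum_(i < d) _ => H1 H2.
have : - (kappa * S2) <= entropy_source b t.
  rewrite /entropy_source -mulrN; apply: ler_wpM2l; first exact: ltW.
  by apply: le_trans H2; rewrite -normrN ler_norm.
lra.
Qed.

(** [z] integrates to [L^d], so the affine part of [entropy_fun] contributes nothing. *)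
Lemma mix_entropyE t : 0 < t ->
  mix_entropy (w t) = \int[dx]_x (Ld^-1 * entropy_fun (z (w t x))) /\
  dx.-integrable setT (EFin \o (fun x => Ld^-1 * entropy_fun (z (w t x)))) /\
  dx.-integrable setT (EFin \o (fun x => Ld^-1 * (z (w t x) * ln (z (w t x))))).
Proof.
move=> t0; have z0 x : 0 < z (w t x) by apply: mix_gt0 => //; exact: wpos.
have i1 : dx.-integrable setT (EFin \o (fun x => Ld^-1 * (z (w t x) * ln (z (w t x))))).
  apply: RintegrableZ; apply: torus_integrable_continuous => //.
  by apply: continuous_xlnx => //; exact: cz.
have iz1 := iz t0.
have i2 : dx.-integrable setT (EFin \o (fun x => Ld^-1 * (1 - z (w t x)))).
  by apply: RintegrableZ; exact: RintegrableB.
have E : (fun x => Ld^-1 * entropy_fun (z (w t x))) =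
    (fun x => Ld^-1 * (z (w t x) * ln (z (w t x))) + Ld^-1 * (1 - z (w t x))).
  by apply/funext => x; rewrite /entropy_fun; ring.
rewrite E; split; last by split => //; exact: RintegrableD.
rewrite RintegralD// (RintegralZl _ _ (RintegrableB (icst 1) iz1))//.
by rewrite RintegralB// Iz// torus_Rintegral_cst// mul1r subrr mulr0 addr0.
Qed.

Lemma mix_entropy_ge0 t : 0 < t -> 0 <= mix_entropy (w t).
Proof.
move=> t0; have [-> _] := mix_entropyE t0; apply: Rintegral_ge0 => x _.
by rewrite mulr_ge0 ?entropy_fun_ge0// invr_ge0 ltW.
Qed.

Lemma mix_entropy_le t : 0 < t -> ((mix_entropy (w t))%:E <= rel_entropy L (w t))%E.
Proof.
move=> t0; have [-> [i1 _]] := mix_entropyE t0; rewrite RintegralE//.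
have /andP[e0 e1] := e01; have LV : 0 <= Ld^-1 by rewrite invr_ge0 ltW.
have mw := Rintegrable_measurable (iw t0).
apply: ge0_le_integral => //.
- by move=> x _; rewrite lee_fin mulr_ge0// entropy_fun_ge0.
- by apply/measurable_EFinP; exact: Rintegrable_measurable i1.
- by apply/measurable_EFinP/measurable_funM => //; apply: measurable_entropy_fun; exact: measurable_funM.
move=> x _; rewrite lee_fin; apply: ler_wpM2l => //.
have v0 : 0 <= w t x * Ld by rewrite mulr_ge0 ?(ltW Ld0)//; exact: wpos.
apply: le_trans (entropy_fun_convex e01 v0) _.
by rewrite ler_piMl ?entropy_fun_ge0//; lra.
Qed.

(** With [mix_entropy_le] this encloses the regularized entropy between multiples of the true one.
    The term [(1 - e)^2 (w - 1 / L^d)] in [F] has integral zero and makes the comparison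
    pointwise. *)
Lemma mix_entropy_ge t : 0 < t ->
  (((1 - e) ^+ 2)%:E * rel_entropy L (w t) <= (mix_entropy (w t) - e * ln e)%:E)%E.
Proof.
move=> t0; have [_ [_ i1]] := mix_entropyE t0.
have /andP[e0 e1] := e01; have LV : 0 <= Ld^-1 by rewrite invr_ge0 ltW.
have mw := Rintegrable_measurable (iw t0).
pose F x := Ld^-1 * (z (w t x) * ln (z (w t x))) - Ld^-1 * (e * ln e) - (1 - e) ^+ 2 * (w t x - Ld^-1).
have iw1 : dx.-integrable setT (EFin \o (fun x => w t x - Ld^-1)) by apply: RintegrableB => //; exact: iw.
have i2 : dx.-integrable setT (EFin \o (fun x => Ld^-1 * (z (w t x) * ln (z (w t x))) - Ld^-1 * (e * ln e))).
  exact: RintegrableB.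
have iF : dx.-integrable setT (EFin \o F) by apply: RintegrableB => //; exact: RintegrableZ.
have <- : (\int[dx]_x F x)%:E = (mix_entropy (w t) - e * ln e)%:E.
  congr EFin; rewrite /F RintegralB//; last exact: RintegrableZ.
  rewrite RintegralB// (RintegralZl _ _ iw1)// RintegralB//; last exact: iw.
  rewrite wmass// !torus_Rintegral_cst// mulVf ?gt_eqF// subrr mulr0 subr0; congr (_ - _).
  by rewrite mulrAC mulVf ?mul1r// gt_eqF.
rewrite RintegralE// -ge0_integralZl_EFin//; first last.
- exact: sqr_ge0.
- by apply/measurable_EFinP/measurable_funM => //; apply: measurable_entropy_fun; exact: measurable_funM.
- by move=> x _; rewrite lee_fin mulr_ge0// entropy_fun_ge0.
have H x : (1 - e) ^+ 2 * (Ld^-1 * entropy_fun (w t x * Ld)) <= F x.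
  have v0 : 0 <= w t x * Ld by rewrite mulr_ge0 ?(ltW Ld0)//; exact: wpos.
  have := ler_wpM2l LV (entropy_interp_ge e01 v0); rewrite -/(mix Ld e (w t x)) => h.
  have E : Ld^-1 * (w t x * Ld) = w t x by rewrite mulrC mulfK// gt_eqF.
  move: h; rewrite /F /entropy_fun => h.
  rewrite -subr_ge0; move: h; rewrite -subr_ge0; congr (0 <= _).
  set zz := z (w t x); clearbody zz; move: E; move: (w t x * Ld) => v <-; move: (ln v) (ln zz) => l1 l2; ring.
apply: ge0_le_integral => //.
- move=> x _; rewrite -EFinM lee_fin; apply: mulr_ge0; first exact: sqr_ge0.
  by rewrite mulr_ge0// entropy_fun_ge0.
- apply/measurable_EFinP/measurable_funM => //; apply/measurable_funM => //.
  by apply: measurable_entropy_fun; exact: measurable_funM.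
- by apply/measurable_EFinP; exact: Rintegrable_measurable iF.
- by move=> x _; rewrite -EFinM lee_fin.
Qed.

(** The source is only known to be measurable in time and its integral may be infinite; hence the
    extended reals on the right. *)
Lemma mix_entropy_growth s t b : 0 < s -> s < t ->
  measurable_fun (`[s, t]%classic : set R) (entropy_source b) ->
  ((mix_entropy (w t) + c * \int[leb]_(r in `[s, t]) mix_entropy (w r))%:E <=
   (mix_entropy (w s))%:E + \int[leb]_(r in `[s, t]) (entropy_source b r)%:E)%E /\
  leb.-integrable `[s, t] (EFin \o (fun r => mix_entropy (w r))).
Proof.
move=> s0 st mb; have pos (r : R) : (`[s, t]%classic : set R) r -> 0 < r by rewrite /= in_itv/= => /andP[? _]; lra.
have wD (r : R) x : 0 < r -> [set r | 0 <= r] (w r x) by move=> r0; exact: wpos.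
have dphi (r : R) : [set r | 0 <= r] r -> is_derive r 1 (fun r : R => Ld^-1 * (z r * ln (z r))) ((1 - e) * (ln (z r) + 1)).
  by move=> r0; exact: is_derive_mix_entropy.
have cphi1 (r : R) : [set r | 0 <= r] r -> {for r, continuous (fun r : R => (1 - e) * (ln (z r) + 1))}.
  by move=> r0; exact: continuous_mix_entropy1.
have bphi1 := mix_entropy1_bound Ld0 e01.
have FTC := @functional_FTC _ _ _ L0 w Hw _ _ _ wD dphi cphi1 bphi1 s t s0 st.
have cE : {within `[s, t], continuous (fun r => mix_entropy (w r))}.
  apply: continuous_in_subspaceT => r; rewrite inE => /pos r0.
  have [dp _] := @functional_derive _ _ _ L0 w Hw _ _ _ wD dphi bphi1 r r0.
  by apply/differentiable_continuous/derivable1_diffP.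
have cdE : {within `[s, t], continuous dE}.
  apply: continuous_in_subspaceT => r; rewrite inE => /pos r0.
  exact: (@functional_derive_continuous _ _ _ L0 w Hw _ _ wD cphi1 bphi1 r r0).
have iE := continuous_integrable_itv cE; have idE := continuous_integrable_itv cdE.
have icE : leb.-integrable `[s, t] (EFin \o (fun r => c * mix_entropy (w r))).
  by apply: continuous_integrable_itv => r; exact: (cvgM (cvg_cst _) (cE r)).
split => //.
have -> : mix_entropy (w t) + c * \int[leb]_(r in `[s, t]) mix_entropy (w r) =
    mix_entropy (w s) + \int[leb]_(r in `[s, t]) (dE r + c * mix_entropy (w r)).
  rewrite RintegralD// RintegralZl// -FTC /mix_entropy; ring.
rewrite EFinD leeD2l//.
have isum : leb.-integrable `[s, t] (EFin \o (fun r => dE r + c * mix_entropy (w r))).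
  by apply: continuous_integrable_itv => r; exact: (cvgD (cdE r) (cvgM (cvg_cst _) (cE r))).
rewrite /Rintegral fineK; last exact: integrable_fin_num.
(* The positive part comes in between, so that the comparison with the source is one of nonnegative
   integrals and requires no integrability of the source. *)
apply: (@le_trans _ _ (\int[leb]_(r in `[s, t]) (Num.max (dE r + c * mix_entropy (w r)) 0)%:E)%E).
  apply: le_integral => //.
    apply: (@le_integrable _ _ _ leb _ (measurable_itv _) _ _ _ _ isum) => //.
      apply/measurable_EFinP; apply: measurable_maxr => //.
      by have /measurable_int/measurable_EFinP := isum.
    move=> r _; rewrite lee_fin ger0_norm; last by rewrite le_max lexx orbT.
    by rewrite ge_max ler_norm normr_ge0.
  by move=> r _; rewrite lee_fin le_max lexx.
apply: ge0_le_integral => //.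
- by move=> r _; rewrite lee_fin le_max lexx orbT.
- apply/measurable_EFinP; apply: measurable_maxr => //.
  by have /measurable_int/measurable_EFinP := isum.
- exact/measurable_EFinP.
move=> r /pos r0; rewrite lee_fin ge_max entropy_production//=.
have /andP[e0 e1] := e01; have le0 : ln e <= 0 by apply: ln_le0; exact: ltW.
rewrite /entropy_source mulr_ge0 ?(ltW kappa0)// mulr_ge0 ?Rintegral_ge0// mulr_ge0 ?Linfty_norm_ge0//.
by rewrite addr_ge0 ?Rintegral_ge0// mulr_ge0; lra.
Qed.

Let iu0 : dx.-integrable setT (EFin \o u0).
Proof. by have [/Lfun1_integrable] := u0_prob. Qed.

Let u0_ge0 : {ae dx, forall x, 0 <= u0 x}.
Proof. by have [] := u0_prob. Qed.

Lemma entropy_fun_convex2 (x y : R) : 0 <= y -> 0 < x ->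
  entropy_fun x <= entropy_fun y + ln x * (x - y).
Proof. by move=> y0 x0; have := mulr_ln_ge y0 x0; rewrite /entropy_fun; lra. Qed.

(** Upper semicontinuity at time zero from [L^2] convergence alone. By convexity the entropy at time
    [s] exceeds the initial one by at most the integral of [ln z (w s - u0)], up to a factor below
    one. Since [z >= e], the logarithm is bounded by [z - ln e], which is bounded in [L^2], and
    Young's inequality with weight [tau] makes the product small. *)
Lemma mix_entropy_initial (eta delta : R) : 0 < eta -> 0 < delta -> exists s, [/\ 0 < s, s < delta &
  ((mix_entropy (w s))%:E <= rel_entropy L u0 + eta%:E)%E].
Proof.
move=> eta0 delta0; have /andP[e0 e1] := e01; have LV : 0 <= Ld^-1 by rewrite invr_ge0 ltW.
have /Lfun2P[mu0 iu02] := u0_L2.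
(* [K] bounds the integral of [Q] as soon as the squared distance of [w s] from [u0] is at most [1],
   and [Q] bounds [(z - ln e)^2]. *)
pose K : R := 3 * (2 * Ld ^+ 2 * \int[dx]_x (u0 x ^+ 2) + (1 + ln e ^+ 2) * Ld + 2 * Ld ^+ 2).
have K0 : 0 <= K.
  rewrite /K mulr_ge0// !addr_ge0 ?mulr_ge0 ?sqr_ge0 ?(ltW Ld0)//.
    by apply: Rintegral_ge0 => x _; exact: sqr_ge0.
  by rewrite addr_ge0// sqr_ge0.
(* With these choices each of the two terms of Young's inequality is at most [eta / 2]: the first
   since [tau K <= eta], the second since the squared distance is at most [tau eta]. *)
pose tau := eta / (K + 1); have tau0 : 0 < tau by rewrite divr_gt0// ltr_wpDl.
pose eta' := Num.min 1 (tau * eta); have eta'0 : 0 < eta' by rewrite lt_min ltr01 mulr_gt0.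
have [s [s0 sd H]] := initial_L2 L0 Hw u0_prob w0 eta'0 delta0.
exists s; split => //.
have [H1 H2] : \int[dx]_x (w s x - u0 x) ^+ 2 <= 1 /\ \int[dx]_x (w s x - u0 x) ^+ 2 <= tau * eta.
  by split; apply: le_trans H _; rewrite /eta' ge_min lexx ?orbT.
have [-> [ih _]] := mix_entropyE s0; rewrite RintegralE//.
have wL2 : w s \in Lfun dx 2%:E.
  apply/Lfun2P; have [_ cw] := curve_continuous Hw s0; split; first exact: continuous_measurable_rV.
  by apply: torus_integrable_continuous => // x; exact: (cvgM (cw x) (cw x)).
have idiff : dx.-integrable setT (EFin \o (fun x => (w s x - u0 x) ^+ 2)).
  have /Lfun2P[_] := Lfun2_lin (- 1) u0_L2 wL2.
  by under eq_fun do rewrite mulN1r addrC.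
pose Q x : R := 3 * (2 * Ld ^+ 2 * u0 x ^+ 2 + (1 + ln e ^+ 2) + 2 * Ld ^+ 2 * (w s x - u0 x) ^+ 2).
have iQ1 : dx.-integrable setT (EFin \o (fun x => 2 * Ld ^+ 2 * u0 x ^+ 2 + (1 + ln e ^+ 2))).
  by apply: RintegrableD => //; exact: RintegrableZ.
have iQ2 : dx.-integrable setT (EFin \o (fun x => 2 * Ld ^+ 2 * (w s x - u0 x) ^+ 2)) by exact: RintegrableZ.
have iQ : dx.-integrable setT (EFin \o Q) by apply: RintegrableZ; exact: RintegrableD.
have IQ : \int[dx]_x Q x <= K.
  rewrite /Q RintegralZl//; last exact: RintegrableD.
  rewrite RintegralD// RintegralD//; last exact: RintegrableZ.
  rewrite (RintegralZl _ _ iu02)// (RintegralZl _ _ idiff)// torus_Rintegral_cst//.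
  rewrite /K ler_wpM2l// lerD2l -[leRHS]mulr1 ler_wpM2l// mulr_ge0 ?sqr_ge0//.
have zQ x : (z (w s x) - ln e) ^+ 2 <= Q x.
  rewrite /Q /mix; have w0' := wpos x s0.
  set y := ln e; set q := (1 - e) * (w s x * Ld).
  have q0 : 0 <= q by rewrite /q mulr_ge0 ?mulr_ge0 ?(ltW Ld0)//; lra.
  have q1 : q ^+ 2 <= (w s x * Ld) ^+ 2.
    have h : 0 <= w s x * Ld by rewrite mulr_ge0// ltW.
    by rewrite lerXn2r ?nnegrE// /q ler_piMl//; lra.
  have s1 : (w s x) ^+ 2 <= 2 * u0 x ^+ 2 + 2 * (w s x - u0 x) ^+ 2.
    by rewrite -subr_ge0 (_ : _ - _ = (w s x - 2 * u0 x) ^+ 2) ?sqr_ge0//; ring.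
  have s2 := ler_wpM2r (sqr_ge0 Ld) s1; rewrite [(w s x * Ld) ^+ 2]exprMn in q1.
  have s3 : (q + e - y) ^+ 2 <= 3 * (q ^+ 2 + e ^+ 2 + y ^+ 2).
    rewrite -subr_ge0 (_ : _ - _ = (q - e) ^+ 2 + (q + y) ^+ 2 + (e + y) ^+ 2); last by ring.
    by rewrite !addr_ge0 ?sqr_ge0.
  have e2 : e ^+ 2 <= 1 by rewrite expr2; nra.
  by apply: le_trans s3 _; rewrite ler_pM2l//; lra.
pose G x : R := tau / 2 * Q x + (2 * tau)^-1 * (w s x - u0 x) ^+ 2.
have iG : dx.-integrable setT (EFin \o G) by apply: RintegrableD; exact: RintegrableZ.
have t2 : 0 <= (2 * tau)^-1 by rewrite invr_ge0 mulr_ge0// ltW.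
have tau2 : 0 <= tau / 2 by rewrite divr_ge0// ltW.
have G0 x : 0 <= G x.
  have Q0 : 0 <= Q x by apply: le_trans (zQ x); exact: sqr_ge0.
  by apply: addr_ge0; [exact: mulr_ge0|apply: mulr_ge0 => //; exact: sqr_ge0].
have IG : \int[dx]_x G x <= eta.
  rewrite /G RintegralD//; [|exact: RintegrableZ|exact: RintegrableZ].
  rewrite (RintegralZl _ _ iQ)// (RintegralZl _ _ idiff)//.
  have h1 : tau / 2 * \int[dx]_x Q x <= eta / 2.
    apply: (@le_trans _ _ (tau / 2 * (K + 1))); first by rewrite ler_wpM2l ?divr_ge0 ?(ltW tau0)//; lra.
    by rewrite /tau mulrAC divfK// gt_eqF// ltr_wpDl.
  have h2 : (2 * tau)^-1 * \int[dx]_x (w s x - u0 x) ^+ 2 <= eta / 2.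
    apply: le_trans (ler_wpM2l t2 H2) _; rewrite le_eqVlt; apply/orP; left; apply/eqP.
    by field; rewrite gt_eqF.
  lra.
apply: (@le_trans _ _ (\int[dx]_x ((Ld^-1 * entropy_fun (u0 x * Ld))%:E + (G x)%:E))%E).
  apply: ae_ge0_le_integral => //.
  - by move=> x _; rewrite lee_fin mulr_ge0// entropy_fun_ge0.
  - by apply/measurable_EFinP; exact: Rintegrable_measurable ih.
  - by move=> x _; rewrite -EFinD lee_fin addr_ge0 ?mulr_ge0 ?entropy_fun_ge0.
  - under eq_fun do rewrite -EFinD.
    apply/measurable_EFinP/measurable_funD; last exact: Rintegrable_measurable iG.
    by apply: measurable_funM => //; apply: measurable_entropy_fun; exact: measurable_funM.
  apply: filterS u0_ge0 => x ux _; rewrite -EFinD lee_fin.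
  have v0 : 0 <= u0 x * Ld by rewrite mulr_ge0// ltW.
  have z0 : 0 < z (w s x) by apply: mix_gt0 => //; exact: wpos.
  have zu0 : 0 <= z (u0 x) by apply: ltW; exact: mix_gt0.
  have := ler_wpM2l LV (entropy_fun_convex2 zu0 z0).
  have h2 : Ld^-1 * entropy_fun (z (u0 x)) <= Ld^-1 * entropy_fun (u0 x * Ld).
    apply: ler_wpM2l => //; apply: le_trans (entropy_fun_convex e01 v0) _.
    by rewrite ler_piMl ?entropy_fun_ge0//; lra.
  have h3 : Ld^-1 * (ln (z (w s x)) * (z (w s x) - z (u0 x))) <= G x.
    have -> : Ld^-1 * (ln (z (w s x)) * (z (w s x) - z (u0 x))) = (1 - e) * (ln (z (w s x)) * (w s x - u0 x)).
      by move: (ln _) => l1; rewrite /mix; field; rewrite gt_eqF.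
    set p := ln _; set y := w s x - u0 x.
    have p2 : p ^+ 2 <= Q x.
      apply: le_trans (zQ x); rewrite -[p ^+ 2]real_normK ?num_real//.
      have := abs_ln_bound e01 (mix_ge Ld0 e01 (wpos x s0)); rewrite -/p => h.
      by rewrite lerXn2r ?nnegrE//; apply: le_trans h.
    have h4 : `|p * y| <= G x.
      apply: (@le_trans _ _ (tau / 2 * p ^+ 2 + (2 * tau)^-1 * y ^+ 2)); last first.
        by rewrite /G lerD2r ler_wpM2l// divr_ge0// ltW.
      rewrite ler_norml -subr_ge0 -[X in _ && X]subr_ge0.
      have -> : p * y - - (tau / 2 * p ^+ 2 + (2 * tau)^-1 * y ^+ 2) = (2 * tau)^-1 * (tau * p + y) ^+ 2.
        by field; rewrite gt_eqF.
      have -> : tau / 2 * p ^+ 2 + (2 * tau)^-1 * y ^+ 2 - p * y = (2 * tau)^-1 * (tau * p - y) ^+ 2.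
        by field; rewrite gt_eqF.
      by apply/andP; split; apply: mulr_ge0 => //; exact: sqr_ge0.
    apply: le_trans h4; apply: le_trans (ler_norm _) _; rewrite normrM ger0_norm; last by lra.
    by rewrite ler_piMl//; lra.
  by rewrite mulrDr; lra.
rewrite ge0_integralD//; first last.
- by apply/measurable_EFinP; exact: Rintegrable_measurable iG.
- by move=> x _; rewrite lee_fin.
- by apply/measurable_EFinP/measurable_funM => //; apply: measurable_entropy_fun; exact: measurable_funM.
- by move=> x _; rewrite lee_fin mulr_ge0// entropy_fun_ge0.
by rewrite leeD2l// -RintegralE// lee_fin.
Qed.

Lemma entropy_source_ge0 b t : 0 <= entropy_source b t.
Proof.
have /andP[e0 e1] := e01; have le0 : ln e <= 0 by apply: ln_le0; exact: ltW.
rewrite /entropy_source mulr_ge0 ?(ltW kappa0)// mulr_ge0 ?Rintegral_ge0// mulr_ge0 ?Linfty_norm_ge0//.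
by rewrite addr_ge0 ?Rintegral_ge0// mulr_ge0; lra.
Qed.

(** The regularized entropy is exchanged for the true one: by [mix_entropy_ge] at time [t] and under
    the time integral, by [mix_entropy_le] at time [s]. The lower bounds account for the factor
    [(1 - e)^2] and for the last remainder. *)
Lemma entropy_growth s t b : 0 < s -> s < t ->
  measurable_fun (`[s, t]%classic : set R) (entropy_source b) ->
  measurable_fun (`[s, t]%classic : set R) (fun r => rel_entropy L (w r)) ->
  (((1 - e) ^+ 2)%:E * (rel_entropy L (w t) + c%:E * \int[leb]_(r in `[s, t]) rel_entropy L (w r)) <=
   rel_entropy L (w s) + \int[leb]_(r in `[s, t]) (entropy_source b r)%:E +
   (- (e * ln e) * (1 + c * (t - s)))%:E)%E.
Proof.
move=> s0 st mb mH; have [G iE] := mix_entropy_growth s0 st mb.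
have t0 : 0 < t by exact: lt_trans st.
have /andP[e0 e1] := e01.
have pos (r : R) : (`[s, t]%classic : set R) r -> 0 < r by rewrite /= in_itv/= => /andP[? _]; lra.
have c0 : 0 <= c by rewrite divr_ge0 ?sqr_ge0// mulr_ge0 ?sqr_ge0.
have I0 : (0 <= \int[leb]_(r in `[s, t]) rel_entropy L (w r))%E.
  by apply: integral_ge0 => r _; exact: rel_entropy_ge0.
have sq0 : 0 <= (1 - e) ^+ 2 by exact: sqr_ge0.
have ik : leb.-integrable `[s, t] (EFin \o (fun=> - (e * ln e))).
  by apply: continuous_integrable_itv; exact: continuous_within (@cst_continuous _ _ _).
have H2 : (((1 - e) ^+ 2)%:E * \int[leb]_(r in `[s, t]) rel_entropy L (w r) <=
    (\int[leb]_(r in `[s, t]) mix_entropy (w r) - e * ln e * (t - s))%:E)%E.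
  have -> : \int[leb]_(r in `[s, t]) mix_entropy (w r) - e * ln e * (t - s) =
      \int[leb]_(r in `[s, t]) (mix_entropy (w r) + - (e * ln e)).
    have lE : leb (`[s, t]%classic : set R) = (t - s)%:E.
      by rewrite lebesgue_measure_itv/= lte_fin st.
    by rewrite RintegralD// Rintegral_cst//; have := lE => /= ->; rewrite mulNr.
  have isum : leb.-integrable `[s, t] (EFin \o (fun r => mix_entropy (w r) + - (e * ln e))).
    exact: (@integrableD _ _ _ leb _ (measurable_itv _) _ _ iE ik).
  rewrite /Rintegral fineK; last exact: integrable_fin_num.
  rewrite -ge0_integralZl_EFin//; last by move=> r _; exact: rel_entropy_ge0.
  apply: ge0_le_integral => //.
  - by move=> r _; rewrite mule_ge0 ?rel_entropy_ge0.
  - exact: measurable_funeM.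
  - by have /measurable_int := isum.
  - by move=> r /pos r0; exact: mix_entropy_ge.
have H1 := mix_entropy_ge t0.
rewrite ge0_muleDr ?rel_entropy_ge0//; last by rewrite mule_ge0.
rewrite muleCA; apply: le_trans (leeD H1 (lee_wpmul2l _ H2)) _; first by rewrite lee_fin.
apply: (@le_trans _ _ ((mix_entropy (w t) + c * \int[leb]_(r in `[s, t]) mix_entropy (w r))%:E +
   (- (e * ln e) * (1 + c * (t - s)))%:E)%E).
  by rewrite -EFinM -!EFinD lee_fin le_eqVlt; apply/orP; left; apply/eqP; ring.
rewrite leeD2r//; apply: le_trans G _; rewrite leeD2r//; exact: mix_entropy_le.
Qed.

(** The balance started from the initial datum, with the dissipation discarded. It serves for the a
    priori bound of the mean entropy. *)
Lemma entropy_growth0 t b : 0 < t ->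
  measurable_fun (`]0, t]%classic : set R) (entropy_source b) ->
  (((1 - e) ^+ 2)%:E * rel_entropy L (w t) <=
   rel_entropy L u0 + \int[leb]_(r in `]0%R, t]) (entropy_source b r)%:E + (- (e * ln e))%:E)%E.
Proof.
move=> t0 mb; apply: le_trans (mix_entropy_ge t0) _; rewrite EFinB leeD2r//.
apply/lee_addgt0Pr => eta eta0.
have [s [s0 st H]] := mix_entropy_initial eta0 t0.
have sub : `[s, t]%classic `<=` (`]0, t]%classic : set R).
  by move=> r /=; rewrite !in_itv/= => /andP[sr ->]; rewrite andbT; exact: lt_le_trans sr.
have mb' : measurable_fun (`[s, t]%classic : set R) (entropy_source b).
  exact: measurable_funS sub mb.
have [G iE] := mix_entropy_growth s0 st mb'.
have c0 : 0 <= c by rewrite divr_ge0 ?sqr_ge0// mulr_ge0 ?sqr_ge0.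
apply: (@le_trans _ _ (mix_entropy (w t) + c * \int[leb]_(r in `[s, t]) mix_entropy (w r))%:E).
  rewrite lee_fin lerDl mulr_ge0// Rintegral_ge0// => r; rewrite /= in_itv/= => /andP[sr _].
  by apply: mix_entropy_ge0; exact: lt_le_trans sr.
apply: le_trans G _; rewrite addeAC; apply: leeD => //.
apply: ge0_subset_integral => //; first exact/measurable_EFinP.
by move=> r _; rewrite lee_fin entropy_source_ge0.
Qed.

End fixed_regularization.
End entropy_dissipation.

(** * The extension of a graphop to square-integrable functions *)

Section L2_tools.
Context dT (T : measurableType dT) (R : realType) (mu : {measure set T -> \bar R}).
Implicit Types f g l : T -> R.
Local Notation L2 := (Lfun mu 2%:E).

Lemma L2_mul_integrable f g : f \in L2 -> g \in L2 -> mu.-integrable setT (EFin \o (fun x => f x * g x)).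
Proof. by move=> fL gL; have /Lfun1_integrable := Lfun2_mul_Lfun1 fL gL. Qed.

Lemma L2_normE f : f \in L2 -> ('N[mu]_2%:E[EFin \o f] = (Num.sqrt (\int[mu]_x (f x ^+ 2)))%:E)%E.
Proof.
move=> fL; have /Lfun2P[mf i2] := fL; have E := Lnorm2E mu f.
have N0 := Lnorm_ge0 mu 2%:E (EFin \o f).
have : ('N[mu]_2%:E[EFin \o f] < +oo)%E by have := sub_Lfun_finLfun fL; rewrite inE.
move: N0 E; case: ('N[mu]_2%:E[EFin \o f])%E => [r| |]//=.
rewrite lee_fin => r0 E _; congr EFin.
by rewrite /Rintegral -E /= powR_mulrn// sqrtr_sqr ger0_norm.
Qed.

Lemma cauchy_schwarz f g : f \in L2 -> g \in L2 ->
  (\int[mu]_x (f x * g x)) ^+ 2 <= \int[mu]_x (f x ^+ 2) * \int[mu]_x (g x ^+ 2).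
Proof.
move=> fL gL; have /Lfun2P[mf i2f] := fL; have /Lfun2P[mg i2g] := gL.
have ifg := L2_mul_integrable fL gL.
set F := \int[mu]_x (f x ^+ 2); set G := \int[mu]_x (g x ^+ 2); set P := \int[mu]_x (f x * g x).
have G0 : 0 <= G by apply: Rintegral_ge0 => x _; exact: sqr_ge0.
have F0 : 0 <= F by apply: Rintegral_ge0 => x _; exact: sqr_ge0.
have H la : 0 <= F + 2 * la * P + la ^+ 2 * G.
  have -> : F + 2 * la * P + la ^+ 2 * G = \int[mu]_x ((f x + la * g x) ^+ 2).
    rewrite /F /P /G -(RintegralZl _ _ ifg)// -(RintegralZl _ _ i2g)// -RintegralD//; last exact: RintegrableZ.
    rewrite -RintegralD//; [|by apply: RintegrableD => //; exact: RintegrableZ|exact: RintegrableZ].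
    by apply: eq_Rintegral => x _; ring.
  by apply: Rintegral_ge0 => x _; exact: sqr_ge0.
move: G0; rewrite le_eqVlt => /predU1P[GE|G0].
  have [->|P0] := eqVneq P 0; first by rewrite expr0n/= mulr_ge0// -GE.
  (* If [g] has norm zero, the quadratic form is affine in [la], and this value of [la] would make
     it equal to [-1]. *)
  have := H (- (F + 1) / (2 * P)); rewrite -GE mulr0 addr0.
  have -> : F + 2 * (- (F + 1) / (2 * P)) * P = -1 by field.
  by move=> h; exfalso; lra.
have := H (- P / G); have Gn : G != 0 by rewrite gt_eqF.
have -> : F + 2 * (- P / G) * P + (- P / G) ^+ 2 * G = (F * G - P ^+ 2) / G by field.
by rewrite pmulr_lge0 ?invr_gt0// subr_ge0.
Qed.

(** The test function [h / (1 + |h|)] is bounded and has the sign of [h]. *)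
Lemma ae_eq0_test h : mu.-integrable setT (EFin \o h) ->
  (forall l, l \in Lfun mu +oo -> \int[mu]_x (l x * h x) = 0) -> {ae mu, forall x, h x = 0}.
Proof.
move=> ih H; have mh := Rintegrable_measurable ih.
pose l x := h x / (1 + `|h x|).
have n0 x : 0 < 1 + `|h x| by rewrite ltr_pwDl.
have ml : measurable_fun setT l.
  have ck : continuous (fun r : R => (1 + `|r|)^-1).
    move=> r; have c1 : (fun r : R => 1 + `|r|) @ r --> 1 + `|r|.
      exact: (cvgD (cvg_cst _) (cvg_norm cvg_id)).
    have nr : 1 + `|r| != 0 by rewrite gt_eqF// ltr_pwDl.
    exact: (cvgV nr c1).
  apply: measurable_funM => //.
  exact: (measurableT_comp (continuous_measurable_fun ck) mh).
have l1 x : `|l x| <= 1.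
  by rewrite /l normrM normfV (gtr0_norm (n0 x)) ler_pdivrMr// mul1r lerDr.
have lL : l \in Lfun mu +oo by apply: (@bounded_Lfun _ _ _ _ _ 1) => //; exact: aeW.
have ilh := RintegrableM_bounded ml (aeW _ l1) ih.
have lh x : l x * h x = h x ^+ 2 / (1 + `|h x|) by rewrite /l; field; rewrite gt_eqF.
have lh0 x : 0 <= l x * h x by rewrite lh divr_ge0 ?sqr_ge0// ltW.
have I0 : (\int[mu]_x `|(EFin \o (fun x => (l x * h x)%R)) x| = 0)%E.
  rewrite (eq_integral (fun x => (l x * h x)%:E)) /=; last by move=> x _ /=; rewrite ger0_norm.
  by rewrite -RintegralE// H.
move/(ae_eq_integral_abs _ measurableT) : I0 => /(_ (measurable_int _ ilh)).
apply: filterS => x /(_ Logic.I) /= [] /eqP; rewrite lh mulf_eq0 invr_eq0 (gt_eqF (n0 x)) orbF.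
by rewrite sqrf_eq0 => /eqP.
Qed.

Lemma ae_eq_test g h : mu.-integrable setT (EFin \o g) -> mu.-integrable setT (EFin \o h) ->
  (forall l, l \in Lfun mu +oo -> \int[mu]_x (l x * g x) = \int[mu]_x (l x * h x)) ->
  {ae mu, forall x, g x = h x}.
Proof.
move=> ig ih H; suff : {ae mu, forall x, g x - h x = 0}.
  by apply: filterS => x /eqP; rewrite subr_eq0 => /eqP.
apply: ae_eq0_test; first exact: RintegrableB.
move=> l lL; have [M M0 lM] := Lfun_bounded lL; have ml := Lfun_measurable lL.
under eq_Rintegral do rewrite mulrBr.
by rewrite RintegralB ?H ?subrr//; exact: RintegrableM_bounded lM _.
Qed.

Lemma L2_dominated f g : measurable_fun setT f -> (forall x, `|f x| <= `|g x|) -> g \in L2 -> f \in L2.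
Proof.
move=> mf fg /Lfun2P[mg ig]; apply/Lfun2P; split => //.
apply: (@Rintegrable_le _ _ _ _ _ (fun x => g x ^+ 2)) => //; first exact: measurable_funX.
apply: aeW => x; rewrite ger0_norm ?sqr_ge0// -[f x ^+ 2]real_normK ?num_real//.
by rewrite -[g x ^+ 2]real_normK ?num_real// lerXn2r ?nnegrE.
Qed.

Lemma L2_norm_le C f g : 0 <= C -> f \in L2 -> g \in L2 ->
  ('N[mu]_2%:E[EFin \o f] <= C%:E * 'N[mu]_2%:E[EFin \o g])%E <->
  \int[mu]_x (f x ^+ 2) <= C ^+ 2 * \int[mu]_x (g x ^+ 2).
Proof.
move=> C0 fL gL; rewrite !L2_normE// -EFinM lee_fin.
have I0 : 0 <= \int[mu]_x (f x ^+ 2) by apply: Rintegral_ge0 => x _; exact: sqr_ge0.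
have I1 : 0 <= \int[mu]_x (g x ^+ 2) by apply: Rintegral_ge0 => x _; exact: sqr_ge0.
rewrite -[X in _ <-> is_true (X <= _)](sqr_sqrtr I0) -[X in _ <-> is_true (_ <= _ * X)](sqr_sqrtr I1) -exprMn.
have sI := sqrtr_ge0 (\int[mu]_x (f x ^+ 2)); have := mulr_ge0 C0 (sqrtr_ge0 (\int[mu]_x (g x ^+ 2))).
by move: (C * _) (Num.sqrt _) sI => b a a0 b0; rewrite ler_sqr ?nnegrE.
Qed.

Lemma norm_clamp (r N : R) : 0 <= N -> `|Num.max (- N) (Num.min r N)| <= `|r|.
Proof.
move=> N0; have n1 := ler_norm r; have n2 := ler_norm (- r); rewrite normrN in n2.
by case: (leP r N) => a; case: (leP (- N) _) => b; rewrite ler_norml; apply/andP; split; lra.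
Qed.

Definition truncate (n : nat) f x : R := Num.min (f x) n%:R.

Lemma truncate_bounds n f x : 0 <= f x -> 0 <= truncate n f x /\ truncate n f x <= f x.
Proof. by move=> fx; rewrite /truncate le_min fx ler0n ge_min lexx. Qed.

Lemma truncate_Loo n f : measurable_fun setT f -> (forall x, 0 <= f x) -> truncate n f \in Lfun mu +oo.
Proof.
move=> mf f0; apply: (@bounded_Lfun _ _ _ _ _ n%:R); first exact: measurable_minr.
apply: aeW => x; have [h _] := truncate_bounds n (f0 x).
by rewrite ger0_norm// /truncate ge_min lexx orbT.
Qed.

Lemma truncate_cvg f x : truncate n f x @[n --> \oo] --> f x.
Proof.
apply: cvg_near_cst; exists (Num.truncn `|f x|).+1 => // n /= nx.
rewrite /truncate min_l//; apply: le_trans (ler_norm _) _.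
apply: (le_trans (ltW (truncnS_gt _))); rewrite ler_nat//.
Qed.

End L2_tools.

(** * Construction and properties of the extension *)

Section graphop_extension.
Context dT (T : measurableType dT) (R : realType) (mu : probability T R).
Implicit Types f g l u v : T -> R.
Local Notation L2 := (Lfun mu 2%:E).
Local Notation Loo := (Lfun mu +oo).
Context (A : (T -> R) -> T -> R) (GA : graphop mu A) (BA : B_class mu 2%:E 2%:E A).

Lemma Loo_L2 f : f \in Loo -> f \in L2.
Proof.
move=> fo; have [M M0 fM] := Lfun_bounded fo; have mf := Lfun_measurable fo.
apply/Lfun2P; split => //; apply: (@Rintegrable_bounded _ _ _ _ _ (M ^+ 2)).
- by have := @probability_setT _ _ _ mu => /= ->; rewrite ltry.
- exact: measurable_funX.
- by apply: filterS fM => x h; rewrite normrX lerXn2r ?nnegrE.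
Qed.

Lemma L2_integrable f : f \in L2 -> mu.-integrable setT (EFin \o f).
Proof.
move=> fL; apply/Lfun1_integrable; apply: Lfun_subset12 fL.
by have := @probability_setT _ _ _ mu => /= ->.
Qed.

Lemma Loo_lin a f g : f \in Loo -> g \in Loo -> (fun x => a * f x + g x) \in Loo.
Proof.
move=> fo go; have [M M0 fM] := Lfun_bounded fo; have [N N0 gN] := Lfun_bounded go.
apply: (@bounded_Lfun _ _ _ _ _ (`|a| * M + N)).
  by apply: measurable_funD; [apply: measurable_funM => //; exact: Lfun_measurable fo|exact: Lfun_measurable go].
apply: filterS2 fM gN => x fx gx; apply: le_trans (ler_normD _ _) _.
by rewrite lerD// normrM ler_wpM2l.
Qed.

Let AL1 u : u \in Loo -> A u \in Lfun mu 1.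
Proof. by case: GA => -[[h _ _] _] _ _; exact: h. Qed.

Let Aae u v : u \in Loo -> v \in Loo -> {ae mu, forall x, u x = v x} -> {ae mu, forall x, A u x = A v x}.
Proof.
case: GA => -[[_ h _] _] _ _ uo vo uv; have : u = v %[ae mu] by apply: filterS uv => x -> .
by move=> /(h _ _ uo vo); apply: filterS => x; apply.
Qed.

Let Alin a u v : u \in Loo -> v \in Loo ->
  {ae mu, forall x, A (fun x => a * u x + v x) x = a * A u x + A v x}.
Proof.
by case: GA => -[[_ _ h] _] _ _ uo vo; have := h a u v uo vo; apply: filterS => x; apply.
Qed.

Let Asym f g : f \in Loo -> g \in Loo -> \int[mu]_x (g x * A f x) = \int[mu]_x (f x * A g x).
Proof. by case: GA => _ h _; exact: h. Qed.

Let Apos f : f \in Loo -> {ae mu, forall x, 0 <= f x} -> {ae mu, forall x, 0 <= A f x}.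
Proof. by case: GA => _ _ h; exact: h. Qed.

(** The supremum in [op_norm] runs over functions of nonzero norm. A function of norm zero vanishes
    almost everywhere, and linearity then makes its image vanish. *)
Lemma graphop_L2_bound : exists2 C, 0 <= C & forall v, v \in Loo ->
  A v \in L2 /\ \int[mu]_x (A v x ^+ 2) <= C ^+ 2 * \int[mu]_x (v x ^+ 2).
Proof.
have [_ opoo] := BA; exists (fine (op_norm mu 2%:E 2%:E A)).
  apply: fine_ge0; have [v [vL v0]] : exists v, v \in Loo /\ ('N[mu]_2%:E[EFin \o v] != 0)%E.
    have c1 : (fun=> 1 : R) \in Loo by apply: (@bounded_Lfun _ _ _ _ _ 1) => //; apply: aeW => x; rewrite normr1.
    exists (fun=> 1); split => //; rewrite L2_normE; last exact: Loo_L2.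
    rewrite eqe gt_eqF// sqrtr_gt0; under eq_Rintegral do rewrite expr1n.
    by rewrite Rintegral_cst//; have := @probability_setT _ _ _ mu => /= ->; rewrite /= mulr1.
  apply: le_trans (_ : 'N[mu]_2%:E[EFin \o A v] * ((fine 'N[mu]_2%:E[EFin \o v])^-1)%:E <= _)%E.
    by apply: mule_ge0; [exact: Lnorm_ge0|rewrite lee_fin invr_ge0; apply: fine_ge0; exact: Lnorm_ge0].
  by apply: ereal_sup_ubound; exists v.
move=> v vL; have mAv := Lfun_measurable (AL1 vL).
set K := fine _; have vL2 := Loo_L2 vL.
have I0 : 0 <= \int[mu]_x (v x ^+ 2) by apply: Rintegral_ge0 => x _; exact: sqr_ge0.
have [N0|N0] := eqVneq ('N[mu]_2%:E[EFin \o v])%E 0%E.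
  have v0 : {ae mu, forall x, v x = 0}.
    have mv : measurable_fun setT (EFin \o v) by apply/measurable_EFinP; exact: Lfun_measurable vL.
    have := Lnorm_eq0_eq0 mv _ N0; rewrite lte_fin => /(_ (ltr0Sn _ _)).
    by apply: filterS => x /(_ Logic.I) /= [].
  have z : {ae mu, forall x, A v x = 0}.
    have wo := Loo_lin (- 1) vL vL.
    have h1 : {ae mu, forall x, A v x = A (fun x => - 1 * v x + v x) x}.
      by apply: Aae => //; apply: filterS v0 => x ->; rewrite mulr0 addr0.
    by apply: filterS2 h1 (Alin (- 1) vL vL) => x -> ->; rewrite mulN1r addNr.
  have AvL : A v \in L2.
    by apply: Loo_L2; apply: (@bounded_Lfun _ _ _ _ _ 0) => //; apply: filterS z => x ->; rewrite normr0.
  split => //; rewrite (@ae_eq_Rintegral _ _ _ _ _ (fun=> 0)) //.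
  - by rewrite Rintegral_cst// mul0r mulr_ge0// sqr_ge0.
  - exact: measurable_funX.
  - by apply: filterS z => x ->; rewrite expr0n.
have ub : ('N[mu]_2%:E[EFin \o A v] * ((fine 'N[mu]_2%:E[EFin \o v])^-1)%:E <= op_norm mu 2%:E 2%:E A)%E.
  by apply: ereal_sup_ubound; exists v.
move: ub N0; rewrite (L2_normE vL2)/= eqe.
set s := Num.sqrt _ => ub s0; have {}s0 : 0 < s by rewrite lt_neqAle eq_sym s0 sqrtr_ge0.
have N0 := Lnorm_ge0 mu 2%:E (EFin \o A v).
have KE : op_norm mu 2%:E 2%:E A = K%:E.
  rewrite /K fineK// ge0_fin_numE//; apply: le_trans ub.
  by apply: mule_ge0 => //; rewrite lee_fin invr_ge0 ltW.
rewrite KE in ub.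
have AvL : A v \in L2.
  rewrite inE; apply/andP; split; rewrite inE//= /finite_norm.
  move: N0 ub; case: ('N[mu]_2%:E[EFin \o A v])%E => [r _ _|_|]//; first exact: ltry.
  by rewrite gt0_mulye ?lte_fin ?invr_gt0.
split => //; move: ub; rewrite L2_normE// -EFinM lee_fin ler_pdivrMr// => h.
have I1 : 0 <= \int[mu]_x (A v x ^+ 2) by apply: Rintegral_ge0 => x _; exact: sqr_ge0.
rewrite -(sqr_sqrtr I1) -(sqr_sqrtr I0) -/s -exprMn lerXn2r ?nnegrE ?sqrtr_ge0//.
exact: le_trans h.
Qed.

Lemma Loo_integrable l f : l \in Loo -> mu.-integrable setT (EFin \o f) ->
  mu.-integrable setT (EFin \o (fun x => l x * f x)).
Proof.
by move=> lo jf; have [M _ lM] := Lfun_bounded lo; exact: RintegrableM_bounded (Lfun_measurable lo) lM jf.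
Qed.

(* [represents f g] says that [g] is the value at [f] of the adjoint of [A], which extends [A]. *)
Definition represents f g := forall l, l \in Loo -> \int[mu]_x (l x * g x) = \int[mu]_x (f x * A l x).

Lemma represents_Loo f : f \in Loo -> represents f (A f).
Proof. by move=> fo l lo; exact: Asym. Qed.

Lemma represents_unique f g h : g \in L2 -> h \in L2 -> represents f g -> represents f h ->
  {ae mu, forall x, g x = h x}.
Proof.
move=> gL hL fg fh; apply: ae_eq_test; [exact: L2_integrable|exact: L2_integrable|].
by move=> l lo; rewrite fg// fh.
Qed.

Lemma represents_lin a f g f' g' : f \in L2 -> g \in L2 -> f' \in L2 -> g' \in L2 ->
  represents f f' -> represents g g' ->
  represents (fun x => a * f x + g x) (fun x => a * f' x + g' x).
Proof.
move=> fL gL f'L g'L hf hg l lo; have [C C0 /(_ l lo)[AlL _]] := graphop_L2_bound.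
have lL := Loo_L2 lo.
have i1 := L2_mul_integrable lL f'L; have i2 := L2_mul_integrable lL g'L.
have i3 := L2_mul_integrable fL AlL; have i4 := L2_mul_integrable gL AlL.
rewrite (@eq_Rintegral _ _ _ _ _ (fun x => a * (l x * f' x) + l x * g' x)); last by move=> x _; ring.
rewrite RintegralD//; last exact: RintegrableZ.
rewrite (RintegralZl _ _ i1)// hf// hg//.
rewrite [RHS](@eq_Rintegral _ _ _ _ _ (fun x => a * (f x * A l x) + g x * A l x)); last by move=> x _; ring.
by rewrite RintegralD// ?(RintegralZl _ _ i3)//; exact: RintegrableZ.
Qed.

(** By positivity the images of the truncations of [f] increase almost everywhere, so that they have
    a pointwise limit; Fatou's lemma bounds it in [L^2], and dominated convergence passes to the
    limit in the pairings. *)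
Lemma represents_ge0 C f : f \in L2 -> (forall x, 0 <= f x) ->
  (forall v, v \in Loo -> A v \in L2 /\ \int[mu]_x (A v x ^+ 2) <= C ^+ 2 * \int[mu]_x (v x ^+ 2)) ->
  exists g, [/\ g \in L2, forall x, 0 <= g x, represents f g & \int[mu]_x (g x ^+ 2) <= C ^+ 2 * \int[mu]_x (f x ^+ 2)].
Proof.
move=> fL f0 HC; have /Lfun2P[mf i2f] := fL.
pose fn n := truncate n f; have fo n : fn n \in Loo by exact: truncate_Loo.
pose gn n := A (fn n).
have gL n : gn n \in L2 by have [] := HC _ (fo n).
have mg n : measurable_fun setT (gn n) by exact: Lfun_measurable (gL n).
have g0 : {ae mu, forall x, forall n, 0 <= gn n x}.
  by apply: ae_foralln => n; apply: Apos => //; apply: aeW => x; have [] := truncate_bounds n (f0 x).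
have gS : {ae mu, forall x, forall n, gn n x <= gn n.+1 x}.
  apply: ae_foralln => n.
  have h1 : {ae mu, forall x, 0 <= A (fun x => - 1 * fn n x + fn n.+1 x) x}.
    apply: Apos; first exact: Loo_lin.
    apply: aeW => x; rewrite mulN1r addrC subr_ge0 /fn /truncate le_min ge_min lexx/=.
    by rewrite ge_min ler_nat leqnSn orbT.
  by apply: filterS2 h1 (Alin (- 1) (fo n) (fo n.+1)) => x h1x E; move: h1x; rewrite E mulN1r addrC subr_ge0.
have B2 n : \int[mu]_x (gn n x ^+ 2) <= C ^+ 2 * \int[mu]_x (f x ^+ 2).
  have [_ h] := HC _ (fo n); apply: le_trans h _; apply: ler_wpM2l; first exact: sqr_ge0.
  have /Lfun2P[_ i2] := Loo_L2 (fo n); apply: le_Rintegral => // x _.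
  by have [a b] := truncate_bounds n (f0 x); rewrite lerXn2r ?nnegrE.
set B := C ^+ 2 * _ in B2 *.
(* The lower limit of the squares is measurable and defined at every point; its root is the limit
   wherever the images are nonnegative and increasing and the lower limit is finite. *)
pose G x : \bar R := limn_einf (fun n => ((gn n x) ^+ 2)%:E).
have mG : measurable_fun setT G.
  apply: (@emeasurable_fun_cvg _ _ _ _ (fun n x => einfs (fun k => ((gn k x) ^+ 2)%:E) n)).
    by move=> n; apply: measurable_fun_einfs => // k; apply/measurable_EFinP; exact: measurable_funX.
  by move=> x _; rewrite /G limn_einf_lim; exact: is_cvg_einfs.
have IG : (\int[mu]_x G x <= B%:E)%E.
  have h : (\int[mu]_x G x <= limn_einf (fun n => \int[mu]_x ((gn n x) ^+ 2)%:E))%E.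
    apply: fatou => // [n|n x _]; first by apply/measurable_EFinP; exact: measurable_funX.
    by rewrite lee_fin sqr_ge0.
  apply: le_trans h _; rewrite limn_einf_lim; apply: lime_le; first exact: is_cvg_einfs.
  apply: nearW => n; apply: le_trans (_ : \int[mu]_x ((gn n x) ^+ 2)%:E <= _)%E.
    by apply: ereal_inf_lbound; exists n => /=.
  by have /Lfun2P[_ i2] := gL n; rewrite -(RintegralE i2) lee_fin; exact: B2.
have G0 x : (0 <= G x)%E.
  rewrite /G limn_einf_lim; apply: lime_ge; first exact: is_cvg_einfs.
  by apply: nearW => n; apply: le_ereal_inf_tmp => _ [k /= _ <-]; rewrite lee_fin sqr_ge0.
have iG : mu.-integrable setT G.
  apply/integrableP; split => //; apply: le_lt_trans (ltry B).
  by under eq_integral do rewrite gee0_abs//.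
have Gfin := integrable_ae measurableT iG.
pose g x := Num.sqrt (fine (G x)).
have mgm : measurable_fun setT g.
  apply: (measurableT_comp (continuous_measurable_fun (@sqrt_continuous R))).
  by have := measurableT_comp (fine_measurable measurableT) mG.
have lim : {ae mu, forall x, gn ^~ x @ \oo --> g x /\ forall n, `|gn n x| <= g x}.
  apply: filterS3 g0 gS Gfin => x g0x gSx /(_ Logic.I) Gx.
  have nd : nondecreasing_seq (fun n => ((gn n x) ^+ 2)%:E).
    by apply/nondecreasing_seqP => n; rewrite lee_fin lerXn2r ?nnegrE.
  have c := ereal_nondecreasing_is_cvgn nd.
  have GE : ((gn n x) ^+ 2)%:E @[n --> \oo] --> (fine (G x))%:E.
    by rewrite fineK// /G (is_cvg_limn_einfE c).
  have c2 : (gn n x) ^+ 2 @[n --> \oo] --> fine (G x) by have /fine_cvgP[] := GE.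
  have c3 : Num.sqrt ((gn n x) ^+ 2) @[n --> \oo] --> g x.
    exact: (cvg_comp _ _ c2 (@sqrt_continuous R _)).
  have c4 : gn ^~ x @ \oo --> g x.
    by under eq_cvg do rewrite -[gn _ x]ger0_norm// -sqrtr_sqr; exact: c3.
  split => // n; rewrite ger0_norm// -(cvg_lim _ c4)//.
  by apply: nondecreasing_cvgn_le; [exact/nondecreasing_seqP|exact: cvgP c4].
have g2 x : (g x ^+ 2)%:E = (fine (G x))%:E by rewrite /g sqr_sqrtr// fine_ge0.
have i2g : mu.-integrable setT (EFin \o (fun x => g x ^+ 2)).
  apply/integrableP; split; first by apply/measurable_EFinP; exact: measurable_funX.
  apply: le_lt_trans (ltry B); apply: le_trans IG; apply: ge0_le_integral => //=.
    by apply/measurable_EFinP; apply: measurableT_comp => //; exact: measurable_funX.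
  move=> x _; rewrite ger0_norm ?sqr_ge0// g2.
  by move: (G0 x); case: (G x) => //= _; rewrite leey.
have gL2 : g \in L2 by apply/Lfun2P.
exists g; split => //; first by move=> x; exact: sqrtr_ge0.
  move=> l lo; have [AlL _] := HC _ lo; have lL := Loo_L2 lo.
  have ml := Lfun_measurable lL; have mAl := Lfun_measurable AlL.
  have c1 : \int[mu]_x (l x * gn n x) @[n --> \oo] --> \int[mu]_x (l x * g x).
    apply: (@Rdominated_cvg _ _ _ _ _ _ (fun x => `|l x * g x|)).
    - by move=> n; exact: measurable_funM.
    - exact: measurable_funM.
    - by apply: filterS lim => x [c _]; exact: cvgMr.
    - by have /integrable_norm := L2_mul_integrable lL gL2.
    - move=> n; apply: filterS lim => x [_ h]; rewrite !normrM; apply: ler_wpM2l => //.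
      exact: le_trans (h n) (ler_norm _).
  have c2 : \int[mu]_x (l x * gn n x) @[n --> \oo] --> \int[mu]_x (f x * A l x).
    under eq_cvg do rewrite (represents_Loo (fo _) lo).
    apply: (@Rdominated_cvg _ _ _ _ _ _ (fun x => `|f x * A l x|)).
    - by move=> n; apply: measurable_funM => //; exact: Lfun_measurable (fo n).
    - exact: measurable_funM.
    - by apply: aeW => x; apply: cvgMl; exact: truncate_cvg.
    - by have /integrable_norm := L2_mul_integrable fL AlL.
    - move=> n; apply: aeW => x; rewrite !normrM; apply: ler_wpM2r => //.
      by have [a b] := truncate_bounds n (f0 x); rewrite !ger0_norm.
  exact: cvg_unique c1 c2.
rewrite -lee_fin (RintegralE i2g); apply: le_trans IG; apply: ge0_le_integral => //.
- by move=> x _; rewrite lee_fin sqr_ge0.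
- exact: measurable_int i2g.
- by move=> x _; rewrite g2; move: (G0 x); case: (G x) => //= _; rewrite leey.
Qed.

(** Positive and negative parts are represented separately. Their squares add up to [f^2], while the
    square of a difference is at most twice the sum of the squares, which [(2 C)^2] covers. *)
Lemma graphop_represented : exists2 C, 0 <= C & forall f, f \in L2 ->
  exists g, [/\ g \in L2, represents f g & \int[mu]_x (g x ^+ 2) <= C ^+ 2 * \int[mu]_x (f x ^+ 2)].
Proof.
have [C C0 HC] := graphop_L2_bound; exists (2 * C); first by rewrite mulr_ge0.
move=> f fL; have mf := Lfun_measurable fL.
pose fp x := Num.max (f x) 0; pose fm x := Num.max (- f x) 0.
have fE : f = (fun x => - 1 * fm x + fp x).
  apply/funext => x; rewrite /fp /fm; have [h|h] := leP (f x) 0.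
    by rewrite max_l ?oppr_ge0// mulN1r opprK addr0.
  by rewrite max_r ?mulr0 ?add0r// oppr_le0 ltW.
have fpL : fp \in L2.
  apply: (L2_dominated _ _ fL); first exact: measurable_maxr.
  by move=> x; rewrite /fp; case: (leP (f x) 0) => _; rewrite ?normr0.
have fmL : fm \in L2.
  apply: (L2_dominated _ _ fL); first by apply: measurable_maxr => //; exact: measurableT_comp.
  by move=> x; rewrite /fm; case: (leP (- f x) 0) => _; rewrite ?normr0 ?normrN.
have fp0 x : 0 <= fp x by rewrite /fp le_max lexx orbT.
have fm0 x : 0 <= fm x by rewrite /fm le_max lexx orbT.
have [gp [gpL _ rp bp]] := represents_ge0 fpL fp0 HC.
have [gm [gmL _ rm bm]] := represents_ge0 fmL fm0 HC.
have gL := Lfun2_lin (- 1) gmL gpL.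
exists (fun x => - 1 * gm x + gp x); split => //; first by rewrite fE; exact: represents_lin.
have /Lfun2P[mgp igp] := gpL; have /Lfun2P[mgm igm] := gmL; have /Lfun2P[_ ig] := gL.
have /Lfun2P[_ ifp] := fpL; have /Lfun2P[_ ifm] := fmL; have /Lfun2P[_ ifi] := fL.
have le1 : \int[mu]_x ((- 1 * gm x + gp x) ^+ 2) <= 2 * (\int[mu]_x (gm x ^+ 2) + \int[mu]_x (gp x ^+ 2)).
  rewrite -RintegralD// -RintegralZl//; last exact: RintegrableD.
  apply: le_Rintegral => //; first by apply: RintegrableZ; exact: RintegrableD.
  by move=> x _; have := sqr_ge0 (gm x + gp x); rewrite !sqrrD; lra.
have le2 : \int[mu]_x (fm x ^+ 2) + \int[mu]_x (fp x ^+ 2) = \int[mu]_x (f x ^+ 2).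
  rewrite -RintegralD//; apply: eq_Rintegral => x _; rewrite [in RHS]fE.
  have : fm x * fp x = 0.
    by rewrite /fm /fp; have [h|h] := leP (f x) 0; rewrite ?mulr0// max_r ?mul0r// oppr_le0 ltW.
  by move=> h; rewrite sqrrD mulN1r sqrrN mulNr h oppr0 mul0rn addr0.
apply: (le_trans le1); rewrite -le2 exprMn.
have := lerD bm bp; rewrite -mulrDr => h.
have F0 : 0 <= C ^+ 2 * (\int[mu]_x (fm x ^+ 2) + \int[mu]_x (fp x ^+ 2)).
  by apply: mulr_ge0; [exact: sqr_ge0|rewrite le2; apply: Rintegral_ge0 => x _; exact: sqr_ge0].
rewrite -mulrA; move: h F0; move: (C ^+ 2 * _) (_ + _) => a b h F0.
by rewrite expr2; lra.
Qed.

(** Representing functions are chosen for each [f]. Compatibility with equality almost everywhere,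
    linearity and agreement with [A] all follow from [represents_unique]. *)
Lemma extension_exists : exists B, is_extension mu 2%:E 2%:E A B.
Proof.
have [C C0 HC] := graphop_represented; have [K K0 HK] := graphop_L2_bound.
have /choice[B HB] : forall f, exists g, f \in L2 ->
    [/\ g \in L2, represents f g & \int[mu]_x (g x ^+ 2) <= C ^+ 2 * \int[mu]_x (f x ^+ 2)].
  by move=> f; have [/HC[g hg]|/negP fL] := boolP (f \in L2); [exists g|exists (cst 0)].
have BL u : u \in L2 -> B u \in L2 by move=> /HB[].
have BR u : u \in L2 -> represents u (B u) by move=> /HB[].
have toae (u v : T -> R) : {ae mu, forall x, u x = v x} -> u = v %[ae mu] by apply: filterS => x ->.
exists B; split.
- split => //.
  + move=> u v uL vL uv; apply: toae; apply: (represents_unique (BL _ uL) (BL _ vL) (BR _ uL)).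
    move=> l lo; rewrite (BR _ vL l lo); have [AlL _] := HK _ lo; apply: ae_eq_Rintegral.
    * by apply: measurable_funM; [exact: Lfun_measurable vL|exact: Lfun_measurable AlL].
    * by apply: measurable_funM; [exact: Lfun_measurable uL|exact: Lfun_measurable AlL].
    * by apply: filterS uv => x -> .
  + move=> a u v uL vL; have uvL := Lfun2_lin a uL vL; apply: toae.
    apply: (represents_unique (BL _ uvL) _ (BR _ uvL)); first by apply: Lfun2_lin; exact: BL.
    by apply: represents_lin => //; [exact: BL|exact: BL|exact: BR|exact: BR].
- exists C => f fL; have [gL _ h] := HB f fL; exact/L2_norm_le.
- move=> v vo; apply: toae; have vL := Loo_L2 vo; have [AvL _] := HK _ vo.
  exact: (represents_unique (BL _ vL) AvL (BR _ vL) (represents_Loo vo)).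
Qed.

Local Notation E := (extension mu 2%:E 2%:E A).

Lemma extensionP : is_extension mu 2%:E 2%:E A E.
Proof. by have [B hB] := extension_exists; have := xgetPex A (ex_intro _ B hB). Qed.

Lemma extension_L2 f : f \in L2 -> E f \in L2.
Proof. by case: extensionP => -[h _ _] _ _; exact: h. Qed.

Lemma extension_ae f g : f \in L2 -> g \in L2 -> {ae mu, forall x, f x = g x} ->
  {ae mu, forall x, E f x = E g x}.
Proof.
case: extensionP => -[_ h _] _ _ fL gL fg; have : f = g %[ae mu] by apply: filterS fg => x -> .
by move=> /(h _ _ fL gL); apply: filterS => x; apply.
Qed.

Lemma extension_lin a f g : f \in L2 -> g \in L2 ->
  {ae mu, forall x, E (fun x => a * f x + g x) x = a * E f x + E g x}.
Proof. by case: extensionP => -[_ _ h] _ _ fL gL; have := h a _ _ fL gL; apply: filterS => x; apply. Qed.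

Lemma extension_Loo f : f \in Loo -> {ae mu, forall x, E f x = A f x}.
Proof. by case: extensionP => _ _ h /h; apply: filterS => x; apply. Qed.

Lemma extension_bound : exists2 C, 0 <= C & forall f, f \in L2 ->
  \int[mu]_x (E f x ^+ 2) <= C ^+ 2 * \int[mu]_x (f x ^+ 2).
Proof.
case: extensionP => _ [C HC] _; exists `|C| => // f fL.
apply/L2_norm_le => //; first exact: extension_L2.
apply: le_trans (HC f fL) _; apply: lee_wpmul2r; first exact: Lnorm_ge0.
by rewrite lee_fin ler_norm.
Qed.

Lemma L2_clamp_cvg f : f \in L2 -> exists h : nat -> T -> R,
  [/\ forall n, h n \in Loo, forall n x, `|h n x| <= `|f x|, forall x, h n x @[n --> \oo] --> f x
    & \int[mu]_x ((f x - h n x) ^+ 2) @[n --> \oo] --> 0].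
Proof.
move=> fL; have /Lfun2P[mf i2] := fL.
pose h n x := Num.max (- n%:R) (Num.min (f x) n%:R).
have mh n : measurable_fun setT (h n) by apply: measurable_maxr => //; exact: measurable_minr.
have hn n x : `|h n x| <= n%:R.
  by rewrite ler_norml /h le_max lexx/= ge_max ge_min lexx orbT andbT (le_trans _ (ler0n _ n))// oppr_le0.
have hf n x : `|h n x| <= `|f x|.
  have n0 : 0 <= n%:R :> R by exact: ler0n.
  exact: norm_clamp.
have hcv x : h n x @[n --> \oo] --> f x.
  apply: cvg_near_cst; exists (Num.truncn `|f x|).+1 => // n /= nx.
  have : `|f x| <= n%:R by apply: (le_trans (ltW (truncnS_gt _))); rewrite ler_nat.
  by rewrite ler_norml => /andP[a b]; rewrite /h (min_l b) max_r.
exists h; split => //.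
  by move=> n; apply: (@bounded_Lfun _ _ _ _ _ n%:R) => //; exact: aeW.
have -> : 0 = \int[mu]_(x in [set: T]) (0 : R) by rewrite Rintegral_cst// mul0r.
apply: (@Rdominated_cvg _ _ _ _ _ _ (fun x => 4 * f x ^+ 2)) => //.
- by move=> n; apply: measurable_funX; exact: measurable_funB.
- apply: aeW => x; have -> : 0 = (f x - f x) ^+ 2 by rewrite subrr expr0n.
  have c : f x - h n x @[n --> \oo] --> f x - f x by apply: cvgB => //; exact: cvg_cst.
  by under eq_cvg do rewrite expr2; rewrite expr2; exact: cvgM.
- exact: RintegrableZ.
- move=> n; apply: aeW => x; rewrite ger0_norm ?sqr_ge0//.
  have -> : 4 * f x ^+ 2 = (2 * `|f x|) ^+ 2 by rewrite exprMn real_normK ?num_real//; ring.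
  rewrite -[leLHS]real_normK ?num_real// lerXn2r ?nnegrE ?mulr_ge0//.
  by apply: le_trans (ler_normB _ _) _; have := hf n x; lra.
Qed.

(** The extension selected by [xget] need not be the one constructed above. It is tied to [A] by
    density: bounded truncations converge in [L^2], and the bound in [is_extension] carries the
    identity over to the limit. *)
Lemma extension_represents f : f \in L2 -> represents f (E f).
Proof.
move=> fL l lo; have [C C0 HC] := extension_bound; have [K K0 HK] := graphop_L2_bound.
have [h [ho hf hcv hL]] := L2_clamp_cvg fL.
have [AlL _] := HK _ lo; have lL := Loo_L2 lo.
have c2 : \int[mu]_x (h n x * A l x) @[n --> \oo] --> \int[mu]_x (f x * A l x).
  apply: (@Rdominated_cvg _ _ _ _ _ _ (fun x => `|f x * A l x|)).
  - by move=> n; apply: measurable_funM; [exact: Lfun_measurable (ho n)|exact: Lfun_measurable AlL].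
  - by apply: measurable_funM; [exact: Lfun_measurable fL|exact: Lfun_measurable AlL].
  - by apply: aeW => x; apply: cvgMl.
  - by have /integrable_norm := L2_mul_integrable fL AlL.
  - by move=> n; apply: aeW => x; rewrite !normrM; apply: ler_wpM2r.
suff c1 : \int[mu]_x (h n x * A l x) @[n --> \oo] --> \int[mu]_x (l x * E f x) by exact: cvg_unique c1 c2.
pose I2 := \int[mu]_x (l x ^+ 2).
have bnd n : `|\int[mu]_x (l x * E f x) - \int[mu]_x (h n x * A l x)| <=
    Num.sqrt (I2 * (C ^+ 2 * \int[mu]_x ((f x - h n x) ^+ 2))).
  have hL2 := Loo_L2 (ho n); have fhL : (fun x => f x - h n x) \in L2.
    have -> : (fun x => f x - h n x) = (fun x => - 1 * h n x + f x) by apply/funext => x; ring.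
    exact: Lfun2_lin.
  have mEf := Lfun_measurable (extension_L2 fL); have ml := Lfun_measurable lL.
  have mEfh := Lfun_measurable (extension_L2 fhL).
  have -> : \int[mu]_x (h n x * A l x) = \int[mu]_x (l x * E (h n) x).
    rewrite -(represents_Loo (ho n) lo); apply: ae_eq_Rintegral.
    - by apply: measurable_funM => //; have [/Lfun_measurable h1 _] := HK _ (ho n).
    - by apply: measurable_funM => //; exact: Lfun_measurable (extension_L2 hL2).
    - by apply: filterS (extension_Loo (ho n)) => x ->.
  have i1 := L2_mul_integrable lL (extension_L2 fL).
  have i2 := L2_mul_integrable lL (extension_L2 hL2).
  have -> : \int[mu]_x (l x * E f x) - \int[mu]_x (l x * E (h n) x) =
      \int[mu]_x (l x * E (fun x => f x - h n x) x).
    rewrite -RintegralB//; apply: ae_eq_Rintegral.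
    - by apply: measurable_funB; [exact: Rintegrable_measurable i1|exact: Rintegrable_measurable i2].
    - exact: measurable_funM.
    - have := extension_lin (- 1) hL2 fL; have -> : (fun x => - 1 * h n x + f x) = (fun x => f x - h n x).
        by apply/funext => x; ring.
      by apply: filterS => x ->; ring.
  rewrite -sqrtr_sqr ler_sqrt; last first.
    apply: mulr_ge0; first by apply: Rintegral_ge0 => x _; exact: sqr_ge0.
    by apply: mulr_ge0; [exact: sqr_ge0|apply: Rintegral_ge0 => x _; exact: sqr_ge0].
  apply: le_trans (cauchy_schwarz lL (extension_L2 fhL)) _.
  apply: ler_wpM2l; first by apply: Rintegral_ge0 => x _; exact: sqr_ge0.
  exact: HC.
have z : Num.sqrt (I2 * (C ^+ 2 * \int[mu]_x ((f x - h n x) ^+ 2))) @[n --> \oo] --> 0.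
  have z1 : I2 * (C ^+ 2 * \int[mu]_x ((f x - h n x) ^+ 2)) @[n --> \oo] --> 0.
    by rewrite -(mulr0 I2); apply: cvgMr; rewrite -(mulr0 (C ^+ 2)); exact: cvgMr.
  have := cvg_comp _ _ z1 (@sqrt_continuous R _); rewrite sqrtr0; exact.
apply/subr_cvg0; apply/norm_cvg0P.
apply: squeeze_cvgr z; last exact: cvg_cst.
by apply: nearW => n; rewrite normr_ge0/= distrC.
Qed.

Lemma extension_adjoint l f : l \in Loo -> f \in L2 ->
  \int[mu]_x (l x * E f x) = \int[mu]_x (f x * E l x).
Proof.
move=> lo fL; rewrite extension_represents//; have [K K0 /(_ l lo)[AlL _]] := graphop_L2_bound.
have mf := Lfun_measurable fL; apply: ae_eq_Rintegral.
- by apply: measurable_funM => //; exact: Lfun_measurable AlL.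
- by apply: measurable_funM => //; exact: Lfun_measurable (extension_L2 (Loo_L2 lo)).
- by apply: filterS (extension_Loo lo) => x ->.
Qed.

(** [f] agrees almost everywhere with its positive part, and by uniqueness the image of the latter
    is the nonnegative function of [represents_ge0]. *)
Lemma extension_ge0 f : f \in L2 -> {ae mu, forall x, 0 <= f x} -> {ae mu, forall x, 0 <= E f x}.
Proof.
move=> fL f0; pose fp x := Num.max (f x) 0.
have fpL : fp \in L2.
  apply: (L2_dominated _ _ fL); first by apply: measurable_maxr => //; exact: Lfun_measurable fL.
  by move=> x; rewrite /fp; case: (leP (f x) 0) => _; rewrite ?normr0.
have fp0 x : 0 <= fp x by rewrite /fp le_max lexx orbT.
have [C C0 HC] := graphop_L2_bound.
have [g [gL g0 rg _]] := represents_ge0 fpL fp0 HC.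
have h1 : {ae mu, forall x, E f x = E fp x}.
  by apply: extension_ae => //; apply: filterS f0 => x fx; rewrite /fp max_l.
have h2 := represents_unique (extension_L2 fpL) gL (extension_represents fpL) rg.
by apply: filterS2 h1 h2 => x -> ->.
Qed.

(** Positivity applied to [|f| + f] and [|f| - f]. *)
Lemma extension_norm f : f \in L2 -> {ae mu, forall x, `|E f x| <= E (fun x => `|f x|) x}.
Proof.
move=> fL; have mf := Lfun_measurable fL; pose F x := `|f x|.
have FL : F \in L2 by apply: (L2_dominated _ _ fL) => [|x]; [exact: measurableT_comp|rewrite normr_id].
have p1 : {ae mu, forall x, 0 <= E (fun x => 1 * f x + F x) x}.
  apply: extension_ge0; first exact: Lfun2_lin.
  by apply: aeW => x; rewrite mul1r /F; have := ler_norm (- f x); rewrite normrN; lra.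
have p2 : {ae mu, forall x, 0 <= E (fun x => - 1 * f x + F x) x}.
  apply: extension_ge0; first exact: Lfun2_lin.
  by apply: aeW => x; rewrite mulN1r addrC subr_ge0 ler_norm.
apply: filterS2 (filterI p1 p2) (filterI (extension_lin 1 fL FL) (extension_lin (- 1) fL FL)).
by move=> x [a b] [c d]; rewrite c in a; rewrite d in b; rewrite ler_norml; apply/andP; split; lra.
Qed.

(** Homogeneity reduces to norm one. A real [sup] is an upper bound only for a nonempty bounded set,
    and boundedness comes from the Cauchy-Schwarz inequality and [extension_bound]; a function of
    norm zero is treated apart. *)
Lemma numerical_radius_bound f : f \in L2 ->
  \int[mu]_x (E f x * f x) <= numerical_radius mu A * \int[mu]_x (f x ^+ 2).
Proof.
move=> fL; have [C C0 HC] := extension_bound.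
have I0 : 0 <= \int[mu]_x (f x ^+ 2) by apply: Rintegral_ge0 => x _; exact: sqr_ge0.
have CS g : g \in L2 -> (\int[mu]_x (E g x * g x)) ^+ 2 <= C ^+ 2 * (\int[mu]_x (g x ^+ 2)) ^+ 2.
  move=> gL; apply: le_trans (cauchy_schwarz (extension_L2 gL) gL) _.
  rewrite [X in C ^+ 2 * X]expr2 mulrA; apply: ler_wpM2r; last exact: HC.
  by apply: Rintegral_ge0 => x _; exact: sqr_ge0.
move: I0; rewrite le_eqVlt => /predU1P[IE|I0].
  by have := CS _ fL; rewrite -IE expr0n/= !mulr0 => h; have := sqr_ge0 (\int[mu]_x (E f x * f x)); nra.
pose s := Num.sqrt (\int[mu]_x (f x ^+ 2)); have s0 : 0 < s by rewrite sqrtr_gt0.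
have sE : s ^+ 2 = \int[mu]_x (f x ^+ 2) by rewrite sqr_sqrtr// ltW.
have sn : s != 0 by rewrite gt_eqF.
pose g x := s^-1 * f x + 0.
have zL : (fun=> 0 : R) \in L2.
  by apply: Loo_L2; apply: (@bounded_Lfun _ _ _ _ _ 0) => //; apply: aeW => x; rewrite normr0.
have gL : g \in L2 by exact: Lfun2_lin.
have /Lfun2P[_ i2] := fL.
have g1 : \int[mu]_x (g x ^+ 2) = 1.
  rewrite (@eq_Rintegral _ _ _ _ _ (fun x => (s^-1) ^+ 2 * f x ^+ 2)); last by move=> x _; rewrite /g addr0 exprMn.
  by rewrite RintegralZl// -sE; field.
have iEf := L2_mul_integrable (extension_L2 fL) fL.
have Eg : \int[mu]_x (E g x * g x) = s^-1 ^+ 2 * \int[mu]_x (E f x * f x).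
  rewrite -(RintegralZl _ _ iEf)//; apply: ae_eq_Rintegral.
  - exact: Rintegrable_measurable (L2_mul_integrable (extension_L2 gL) gL).
  - exact: Rintegrable_measurable (RintegrableZ (s^-1 ^+ 2) iEf).
  - have z : {ae mu, forall x, E (fun=> 0) x = 0}.
      have := extension_lin (- 1) zL zL; have -> : (fun x : T => - 1 * 0 + 0) = (fun=> 0 : R).
        by apply/funext => x; ring.
      by apply: filterS => x h; lra.
    by apply: filterS2 z (extension_lin s^-1 fL zL) => x h; rewrite -/g => ->; rewrite h /g; ring.
have : \int[mu]_x (E g x * g x) <= numerical_radius mu A.
  apply: sup_upper_bound; last first.
    by exists g => //; split => //; rewrite L2_normE// g1 sqrtr1.
  split; first by exists (\int[mu]_x (E g x * g x)); exists g => //; split => //; rewrite L2_normE// g1 sqrtr1.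
  exists C => _ [h [hL h1] <-]; move: h1; rewrite L2_normE// => -[h1].
  have H1 : \int[mu]_x (h x ^+ 2) = 1.
    have h0 : 0 <= \int[mu]_x (h x ^+ 2) by apply: Rintegral_ge0 => x _; exact: sqr_ge0.
    by rewrite -(sqr_sqrtr h0) h1 expr1n.
  have := CS _ hL; rewrite H1 expr1n mulr1 => h2.
  by apply: le_trans (ler_norm _) _; rewrite -ler_sqr ?nnegrE// real_normK ?num_real.
rewrite Eg exprVn mulrC ler_pdivrMr ?exprn_gt0// sE.
exact.
Qed.

(** The constant function [1] has norm one and a nonnegative image. *)
Lemma numerical_radius_ge0 : 0 <= numerical_radius mu A.
Proof.
have oo : (fun=> 1 : R) \in Loo by apply: (@bounded_Lfun _ _ _ _ _ 1) => //; apply: aeW => x; rewrite normr1.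
have oL := Loo_L2 oo; have := numerical_radius_bound oL.
have -> : \int[mu]_(x in [set: T]) (1 ^+ 2 : R) = 1.
  by under eq_Rintegral do rewrite expr1n; rewrite Rintegral_cst//; have := @probability_setT _ _ _ mu => /= ->; rewrite /= mulr1.
rewrite mulr1; apply: le_trans; have /filterS : {ae mu, forall x, 0 <= E (fun=> 1) x} by apply: extension_ge0 => //; exact: aeW.
move=> h; have -> : \int[mu]_x (E (fun=> 1) x * 1) = \int[mu]_x `|E (fun=> 1) x|.
  have mE := Lfun_measurable (extension_L2 oL); apply: ae_eq_Rintegral.
  - exact: measurable_funM.
  - exact: measurableT_comp.
  - by apply: h => x e0; rewrite ger0_norm// mulr1.
by apply: Rintegral_ge0.
Qed.

End graphop_extension.

(** * Averaging over the parameter *)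

Section gronwall.
Context (R : realType).
Local Notation leb := (@lebesgue_measure R).

(** The inequality [1 + x <= exp x] at [x = - y / (1 + y)], inverted; it turns the powers of [1 + y]
    in [exponential_decay] into exponentials. *)
Lemma expR_le_1D (y : R) : 0 <= y -> expR (y / (1 + y)) <= 1 + y.
Proof.
move=> y0; have y1 : 0 < 1 + y by rewrite ltr_pwDl.
have := @expR_ge1Dx R (- (y / (1 + y))).
have -> : 1 + - (y / (1 + y)) = (1 + y)^-1 by field; rewrite gt_eqF.
by rewrite expRN lef_pV2 // posrE expR_gt0.
Qed.

(** The hypothesis is one step of the implicit Euler scheme. Over [n + 1] equal steps it gives the
    factor [(1 + x / (n + 1))^(n + 1)], and [n] tends to infinity. *)
Lemma exponential_decay (H : R -> R) (al : R) : 0 <= al ->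
  (forall t, 0 < t -> 0 <= H t) ->
  (forall s t, 0 < s -> s < t -> H t * (1 + al * (t - s)) <= H s) ->
  forall s t, 0 < s -> s < t -> H t <= H s * expR (- (al * (t - s))).
Proof.
move=> al0 H0 Hs s t s0 st; set x := al * (t - s).
have x0 : 0 <= x by rewrite mulr_ge0// subr_ge0 ltW.
have iter (de : R) n : 0 < de -> H (s + de *+ n) * (1 + al * de) ^+ n <= H s.
  move=> de0; elim: n => [|n IH]; first by rewrite mulr0n addr0 expr0 mulr1.
  apply: le_trans IH; rewrite exprS mulrA; apply: ler_wpM2r.
    by rewrite exprn_ge0// addr_ge0// mulr_ge0// ltW.
  have p : 0 < s + de *+ n by rewrite ltr_wpDr// mulrn_wge0// ltW.
  have := Hs _ _ p (_ : s + de *+ n < s + de *+ n.+1).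
  have -> : s + de *+ n.+1 - (s + de *+ n) = de by rewrite mulrS; ring.
  by apply; rewrite ltrD2l mulrS ltrDr.
have bnd n : H t <= H s * expR (- (x / (1 + x * n.+1%:R^-1))).
  set y := x * n.+1%:R^-1; have y0 : 0 <= y by rewrite mulr_ge0.
  have n0 : n.+1%:R != 0 :> R by rewrite pnatr_eq0.
  have := iter ((t - s) / n.+1%:R) n.+1; rewrite divr_gt0 ?subr_gt0// => /(_ isT).
  have -> : s + ((t - s) / n.+1%:R) *+ n.+1 = t by rewrite -mulr_natr divfK// addrC subrK.
  have -> : al * ((t - s) / n.+1%:R) = y by rewrite mulrA.
  move=> h; rewrite expRN ler_pdivlMr ?expR_gt0//; apply: le_trans h.
  apply: ler_wpM2l; first by apply: H0; exact: lt_trans st.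
  have -> : x / (1 + y) = n.+1%:R * (y / (1 + y)).
    have y1 : 1 + y != 0 by rewrite gt_eqF// ltr_pwDl.
    have -> : x = n.+1%:R * y by rewrite /y mulrC divfK.
    by rewrite mulrA.
  rewrite expRM_natl; apply: lerXn2r; rewrite ?nnegrE ?expR_ge0 ?addr_ge0//.
  exact: expR_le_1D.
have lim : H s * expR (- (x / (1 + x * n.+1%:R^-1))) @[n --> \oo] --> H s * expR (- x).
  apply: cvgMr; apply: continuous_cvg; first exact: continuous_expR.
  apply: cvgN; rewrite -[X in _ --> X]divr1.
  have c1 : 1 + x * n.+1%:R^-1 @[n --> \oo] --> (1 : R).
    rewrite -[X in _ --> X]addr0 -(mulr0 x); apply: cvgD; first exact: cvg_cst.
    by apply: cvgMr; exact: cvg_harmonic.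
  by apply: cvgMr; apply: cvgV => //; exact: oner_neq0.
by apply: (ler_cvg_to (cvg_cst (H t)) lim); exact: nearW.
Qed.

(** The linear bound makes [h] and its time integrals finite, so that they can be subtracted. Since
    [b < c], [h] then decreases, its integral over [[s, t]] is at least [(t - s) h t], and this is
    the Euler step of [exponential_decay]. The linear bound also gives the value [H0] as [s] tends
    to [0]. *)
Lemma ereal_gronwall (h : R -> \bar R) (c b C H0 : R) :
  b < c -> measurable_fun setT h -> (forall t, (0 <= h t)%E) ->
  (forall s t, 0 < s -> s < t -> (h t + c%:E * \int[leb]_(r in `[s, t]) h r <=
    h s + b%:E * \int[leb]_(r in `[s, t]) h r)%E) ->
  0 <= C -> (forall t, 0 < t -> (h t <= (H0 + C * t)%:E)%E) ->
  forall t, 0 < t -> (h t <= (expR (- (c - b) * t) * H0)%:E)%E.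
Proof.
move=> bc mh h0 Hst C0 Hb.
have al0 : 0 < c - b by rewrite subr_gt0.
pose H t := fine (h t).
have hE t : 0 < t -> h t = (H t)%:E.
  by move=> t0; rewrite fineK// ge0_fin_numE//; apply: le_lt_trans (Hb t t0) (ltry _).
have HH0 t : 0 <= H t by exact: fine_ge0.
have pos (s t r : R) : 0 < s -> (`[s, t]%classic : set R) r -> 0 < r.
  by move=> s0; rewrite /= in_itv/= => /andP[sr _]; exact: lt_le_trans sr.
have key s t : 0 < s -> s < t -> exists2 J, (\int[leb]_(r in `[s, t]) h r)%E = J%:E &
    0 <= J /\ H t + c * J <= H s + b * J.
  move=> s0 st; have t0 : 0 < t by exact: lt_trans st.
  have lE : leb (`[s, t]%classic : set R) = (t - s)%:E by rewrite lebesgue_measure_itv/= lte_fin st.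
  have I0 : (0 <= \int[leb]_(r in `[s, t]) h r)%E by apply: integral_ge0.
  have Ifin : (\int[leb]_(r in `[s, t]) h r)%E \is a fin_num.
    rewrite ge0_fin_numE//; apply: (@le_lt_trans _ _ (\int[leb]_(r in `[s, t]) (H0 + C * t)%:E)%E).
      apply: ge0_le_integral => //.
      - exact: measurable_funS mh.
      - move=> r rst; have r0 := pos _ _ _ s0 rst; apply: le_trans (Hb r r0) _.
        by move: rst; rewrite /= in_itv/= => /andP[_ rt]; rewrite lee_fin lerD2l ler_wpM2l.
    by rewrite integral_cst//; have := lE => /= ->; rewrite -EFinM ltry.
  exists (fine (\int[leb]_(r in `[s, t]) h r)%E); first by rewrite fineK.
  split; first exact: fine_ge0.
  have := Hst s t s0 st; rewrite !hE// -{1 2}(fineK Ifin) -!EFinM -!EFinD lee_fin.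
  exact.
have mono s t : 0 < s -> s < t -> H t <= H s.
  by move=> s0 st; have [J _ [J0 h1]] := key s t s0 st; nra.
have dec s t : 0 < s -> s < t -> H t * (1 + (c - b) * (t - s)) <= H s.
  move=> s0 st; have [J JE [J0 h1]] := key s t s0 st; have t0 : 0 < t by exact: lt_trans st.
  have lE : leb (`[s, t]%classic : set R) = (t - s)%:E by rewrite lebesgue_measure_itv/= lte_fin st.
  have h2 : H t * (t - s) <= J.
    rewrite -lee_fin -JE; apply: (@le_trans _ _ (\int[leb]_(r in `[s, t]) (H t)%:E)%E).
      by rewrite integral_cst//; have := lE => /= ->.
    apply: ge0_le_integral => //.
    - by move=> r _; rewrite lee_fin.
    - exact: measurable_funS mh.
    - move=> r rst; have r0 := pos _ _ _ s0 rst; rewrite hE// lee_fin.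
      move: rst; rewrite /= in_itv/= => /andP[_]; rewrite le_eqVlt => /predU1P[->//|].
      exact: mono.
  by nra.
have decay := exponential_decay (ltW al0) (fun t _ => HH0 t) dec.
move=> t t0; rewrite hE// lee_fin.
have lim : (H0 + C * s) * expR (- ((c - b) * (t - s))) @[s --> 0^'+] --> H0 * expR (- ((c - b) * t)).
  have ci : (fun s : R => s) @ 0^'+ --> (0 : R) by exact: cvg_at_right_filter cvg_id.
  have c1 : H0 + C * s @[s --> 0^'+] --> H0 + C * 0 by apply: cvgD; [exact: cvg_cst|apply: cvgMr].
  have c2 : expR (- ((c - b) * (t - s))) @[s --> 0^'+] --> expR (- ((c - b) * (t - 0))).
    apply: continuous_cvg; first exact: continuous_expR.
    by apply: cvgN; apply: cvgMr; apply: cvgB => //; exact: cvg_cst.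
  by rewrite mulr0 addr0 in c1; rewrite subr0 in c2; exact: cvgM.
rewrite mulrC mulNr; apply: (ler_cvg_to (cvg_cst (H t)) lim).
near=> s; have s0 : 0 < s by near: s; exact: nbhs_right_gt.
have st : s < t by near: s; exact: nbhs_right_lt.
apply: le_trans (decay s t s0 st) _; apply: ler_wpM2r; first exact: expR_ge0.
by rewrite -lee_fin -hE//; exact: Hb.
Unshelve. all: by end_near. Qed.

(** [e ln e] lies between [- 2 sqrt e] and [0]: with [q = sqrt e], apply
    [ln (1 / q) <= 1 / q - 1]. *)
Lemma cvg_regularization (a : R) : e * (1 - ln e) * a @[e --> 0^'+] --> (0 : R).
Proof.
have ci : (fun s : R => s) @ 0^'+ --> (0 : R) by exact: cvg_at_right_filter cvg_id.
have c1 : e * ln e @[e --> 0^'+] --> (0 : R).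
  have c2 : - (2 * Num.sqrt e) @[e --> 0^'+] --> (0 : R).
    rewrite -[X in _ --> X]oppr0 -[X in - X](mulr0 2) -[X in 2 * X]sqrtr0.
    by apply: cvgN; apply: cvgMr; apply: continuous_cvg => //; exact: sqrt_continuous.
  apply: squeeze_cvgr c2 (cvg_cst _); near=> e.
  have e0 : 0 < e by near: e; exact: nbhs_right_gt.
  have e1 : e < 1 by near: e; apply: nbhs_right_lt; exact: ltr01.
  have s0 : 0 < Num.sqrt e by rewrite sqrtr_gt0.
  have l0 : ln e <= 0 by apply: ln_le0; exact: ltW.
  apply/andP; split; last by rewrite mulr_ge0_le0// ltW.
  have eE : e = Num.sqrt e ^+ 2 by rewrite sqr_sqrtr// ltW.
  rewrite {2 3}eE lnXn//; move: (Num.sqrt e) s0 => q q0.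
  have := ln_le_sub1 (_ : 0 < q^-1); rewrite invr_gt0 => /(_ q0); rewrite lnV ?posrE// => h.
  have : q ^+ 2 * - ln q <= q ^+ 2 * (q^-1 - 1) by apply: ler_wpM2l => //; exact: sqr_ge0.
  have -> : q ^+ 2 * (q^-1 - 1) = q - q ^+ 2 by field; rewrite gt_eqF.
  have := sqr_ge0 q; rewrite -mulr_natr; lra.
have -> : (fun e : R => e * (1 - ln e) * a) = (fun e => (e - e * ln e) * a) by apply/funext => e; ring.
by rewrite -[X in _ --> X](mul0r a) -[X in X * _](subr0 (0 : R)); apply: cvgMl; exact: cvgB.
Unshelve. all: by end_near. Qed.

(** The single value [e = 1/2] settles the cases with an infinite side; for finite [X] and [Y] the
    limit is taken in the reals. *)
Lemma lee_regularization (X Y : \bar R) (a : R) :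
  (forall e, 0 < e < 1 -> (((1 - e) ^+ 2)%:E * X <= Y + (e * (1 - ln e) * a)%:E)%E) -> (X <= Y)%E.
Proof.
move=> H; have h01 : 0 < (2^-1 : R) < 1 by rewrite invr_gt0 ltr0n invf_lt1// ltr1n.
have := H _ h01; have p : 0 < (1 - 2^-1 : R) ^+ 2 by rewrite exprn_gt0// subr_gt0 invf_lt1// ltr1n.
case: X Y H => [x| |] [y| |]//= H; rewrite ?leey ?leNye// ?gt0_muley ?lte_fin//.
move=> _; rewrite lee_fin.
have l1 : (1 - e) ^+ 2 * x @[e --> 0^'+] --> x.
  have ci : (fun s : R => s) @ 0^'+ --> (0 : R) by exact: cvg_at_right_filter cvg_id.
  have c1 : 1 - e @[e --> 0^'+] --> (1 - 0 : R) by apply: cvgB => //; exact: cvg_cst.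
  have c2 : (1 - e) ^+ 2 @[e --> 0^'+] --> (1 : R).
    have c3 : (1 - e) * (1 - e) @[e --> 0^'+] --> ((1 - 0) * (1 - 0) : R) by exact: cvgM.
    by rewrite subr0 mulr1 in c3; under eq_cvg do rewrite expr2.
  by rewrite -[X in _ --> X]mul1r; exact: cvgMl.
have l2 : y + e * (1 - ln e) * a @[e --> 0^'+] --> y.
  by rewrite -[X in _ --> X]addr0; apply: cvgD; [exact: cvg_cst|exact: cvg_regularization].
apply: (ler_cvg_to l1 l2); near=> e.
have := H e; rewrite -EFinM -EFinD lee_fin; apply.
apply/andP; split; near: e; [exact: nbhs_right_gt|by apply: nbhs_right_lt; exact: ltr01].
Unshelve. all: by end_near. Qed.

End gronwall.

(** * Measurability of integrals over sections *)

Section tonelli.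
Context dX (X : measurableType dX) dY (Y : measurableType dY) (R : realType).
Context (m : {sigma_finite_measure set Y -> \bar R}).

Lemma measurable_section_integral (f : X * Y -> \bar R) : measurable_fun setT f ->
  measurable_fun setT (fun x => (\int[m]_y f (x, y))%E).
Proof.
move=> mf; under eq_fun do rewrite integralE.
apply: emeasurable_funB.
  rewrite (_ : (fun x => _) = fubini_F m f^\+%E).
    by apply: measurable_fun_fubini_tonelli_F => //; exact: measurable_funepos.
  by apply/funext => x; apply: eq_integral => y _; rewrite !funeposE.
rewrite (_ : (fun x => _) = fubini_F m f^\-%E).
  by apply: measurable_fun_fubini_tonelli_F => //; exact: measurable_funeneg.
by apply/funext => x; apply: eq_integral => y _; rewrite !funenegE.
Qed.

End tonelli.

(** * The graphop under an integral over a further variable *)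

Section graphop_pairing.
Context dX (X : measurableType dX) dT (T : measurableType dT) (R : realType).
Context (m : {sigma_finite_measure set X -> \bar R}) (mu : probability T R).
Context (A : (T -> R) -> T -> R) (GA : graphop mu A) (BA : B_class mu 2%:E 2%:E A).
Local Notation E := (extension mu 2%:E 2%:E A).
Context (F G : T * X -> R) (mF : measurable_fun setT F) (mG : measurable_fun setT G).
Hypothesis FL : forall x, (fun xi => F (xi, x)) \in Lfun mu 2%:E.
Hypothesis GE : forall x, {ae mu, forall xi, G (xi, x) = E (fun xi => F (xi, x)) xi}.

Let FLn x : (fun xi => `|F (xi, x)|) \in Lfun mu 2%:E.
Proof.
apply: (L2_dominated _ _ (FL x)) => [|xi]; last by rewrite normr_id.
by apply: measurableT_comp => //; exact: Lfun_measurable (FL x).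
Qed.

(* Tonelli, together with [|E u| <= E |u|] and the self-adjointness of [E]. *)
Lemma graphop_pairing l : l \in Lfun mu +oo -> (forall xi, 0 <= l xi) ->
  (\int[mu]_xi ((l xi)%:E * \int[m]_x `|G (xi, x)|%:E) <=
   \int[mu]_xi (`|E l xi|%:E * \int[m]_x `|F (xi, x)|%:E))%E.
Proof.
move=> lo l0; have ml := Lfun_measurable lo; have lL := Loo_L2 lo.
have EL := extension_L2 GA BA lL; have mEl := Lfun_measurable EL.
have nn (p : R) : (0 <= `|p|%:E)%E by rewrite lee_fin.
have mGn xi : measurable_fun setT (fun x => `|G (xi, x)|%:E).
  by apply/measurable_EFinP; apply: measurableT_comp => //; exact: measurable_fun_pair2.
have mFn xi : measurable_fun setT (fun x => `|F (xi, x)|%:E).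
  by apply/measurable_EFinP; apply: measurableT_comp => //; exact: measurable_fun_pair2.
pose f (p : T * X) := (l p.1 * `|G p|)%:E; pose g (p : T * X) := (`|E l p.1| * `|F p|)%:E.
have mf : measurable_fun setT f.
  apply/measurable_EFinP/measurable_funM; first exact: (measurableT_comp ml).
  exact: measurableT_comp.
have mg : measurable_fun setT g.
  apply/measurable_EFinP/measurable_funM; last exact: measurableT_comp.
  by apply: measurableT_comp => //; exact: (measurableT_comp mEl).
have f0 p : (0 <= f p)%E by rewrite lee_fin mulr_ge0.
have g0 p : (0 <= g p)%E by rewrite lee_fin mulr_ge0.
have -> : (\int[mu]_xi ((l xi)%:E * \int[m]_x `|G (xi, x)|%:E) = \int[mu]_xi \int[m]_x f (xi, x))%E.
  by apply: eq_integral => xi _; rewrite -ge0_integralZl//; rewrite lee_fin.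
have -> : (\int[mu]_xi (`|E l xi|%:E * \int[m]_x `|F (xi, x)|%:E) = \int[mu]_xi \int[m]_x g (xi, x))%E.
  by apply: eq_integral => xi _; rewrite -ge0_integralZl.
rewrite (fubini_tonelli f mf f0) (fubini_tonelli g mg g0).
have mfx x : measurable_fun setT (fun xi => f (xi, x)) by exact: measurable_fun_pair1.
have mgx x : measurable_fun setT (fun xi => g (xi, x)) by exact: measurable_fun_pair1.
apply: ge0_le_integral => //.
- by move=> x _; exact: integral_ge0.
- exact: (@measurable_fun_fubini_tonelli_G _ _ _ _ _ mu f mf f0).
- exact: (@measurable_fun_fubini_tonelli_G _ _ _ _ _ mu g mg g0).
move=> x _.
have i1 := Loo_integrable lo (L2_integrable (extension_L2 GA BA (FLn x))).
have i2 := L2_mul_integrable (FLn x) EL.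
apply: (@le_trans _ _ (\int[mu]_xi `|l xi * E (fun xi => `|F (xi, x)|) xi|%:E)%E).
  apply: ae_ge0_le_integral => //.
  - by apply/measurable_EFinP; apply: measurableT_comp => //; exact: Rintegrable_measurable i1.
  - apply: filterS2 (GE x) (extension_norm GA BA (FL x)) => xi Gx Ex _; rewrite lee_fin normrM ger0_norm//.
    by apply: ler_wpM2l => //; rewrite Gx; apply: le_trans Ex (ler_norm _).
have Ep : {ae mu, forall xi, 0 <= E (fun xi => `|F (xi, x)|) xi}.
  by apply: extension_ge0 => //; apply: aeW.
have -> : (\int[mu]_xi `|l xi * E (fun xi => `|F (xi, x)|) xi|%:E =
    (\int[mu]_xi (l xi * E (fun xi => `|F (xi, x)|) xi))%:E)%E.
  rewrite (RintegralE i1); apply: ae_eq_integral => //.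
  - by apply/measurable_EFinP; apply: measurableT_comp => //; exact: Rintegrable_measurable i1.
  - by case/integrableP: i1.
  - by apply: filterS Ep => xi h _; rewrite ger0_norm// mulr_ge0.
rewrite extension_adjoint// (RintegralE i2).
apply: (@le_trans _ _ (\int[mu]_xi `|(`|F (xi, x)| * E l xi)%:E|)%E).
  apply: le_trans (le_abse_integral _ measurableT _); last by case/integrableP: i2.
  by rewrite -(RintegralE i2) lee_fin/= ler_norm.
by rewrite le_eqVlt; apply/orP; left; apply/eqP/eq_integral => xi _; rewrite /g/= normrM normr_id mulrC.
Qed.

End graphop_pairing.

Section tonelli_in.
Context dX (X : measurableType dX) dY (Y : measurableType dY) (R : realType).
Context (m1 : {sigma_finite_measure set X -> \bar R}) (m2 : {sigma_finite_measure set Y -> \bar R}).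
Context (S : set X) (mS : measurable S) (f : X * Y -> \bar R).
Hypotheses (mf : measurable_fun setT f) (f0 : forall p, (0 <= f p)%E).

Let g : X * Y -> \bar R := f \_ (S `*` setT).

Let mg : measurable_fun setT g.
Proof.
have mST : measurable (S `*` [set: Y]) by exact: measurableX.
by apply/(measurable_restrictT f mST); exact: measurable_funS mf.
Qed.

Let g0 p : (0 <= g p)%E.
Proof. by rewrite /g /patch; case: ifP. Qed.

Let gE x y : g (x, y) = ((fun x => f (x, y)) \_ S) x.
Proof. by rewrite /g /patch in_setX in_setT andbT. Qed.

Lemma tonelli_in :
  (\int[m1]_(x in S) \int[m2]_y f (x, y) = \int[m2]_y \int[m1]_(x in S) f (x, y))%E.
Proof.
have := fubini_tonelli (m1 := m1) (m2 := m2) g mg g0.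
under [RHS]eq_integral => y _.
  by under eq_integral do rewrite gE; rewrite -integral_mkcond; over.
move=> <-; rewrite integral_mkcond; apply: eq_integral => x _.
rewrite /patch; case: ifPn => xS.
  by apply: eq_integral => y _; rewrite gE /patch xS.
by rewrite integral0_eq// => y _; rewrite gE /patch (negbTE xS).
Qed.

Lemma measurable_tonelli_in : measurable_fun setT (fun y => \int[m1]_(x in S) f (x, y))%E.
Proof.
rewrite (_ : (fun y => _) = fubini_G m1 g); first exact: (@measurable_fun_fubini_tonelli_G _ _ _ _ _ m1 g mg g0).
by apply/funext => y; rewrite integral_mkcond; apply: eq_integral => x _; rewrite gE.
Qed.

End tonelli_in.

(** Time is grouped with the parameter, so that the position becomes the last variable and is
    integrated out first; the extension by [0] outside [S] makes the function measurable on the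
    whole product. *)
Lemma measurable_restrict_time (R : realType) dX (X : measurableType dX) dT (T : measurableType dT)
    (S : set R) (F : R -> X -> T -> R) : measurable S ->
  measurable_fun [set p : measurableTypeR R * X * T | S p.1.1] (fun p => F p.1.1 p.1.2 p.2) ->
  measurable_fun setT (fun q : measurableTypeR R * T * X => if q.1.1 \in S then F q.1.1 q.2 q.1.2 else 0).
Proof.
move=> mS mF; have m1 : measurable_fun [set: measurableTypeR R * X * T] (fun p => p.1.1).
  by apply: measurableT_comp; exact: measurable_fst.
have mD : measurable [set p : measurableTypeR R * X * T | S p.1.1].
  by rewrite -[X in measurable X]setTI; exact: m1.
have mG := (measurable_restrictT _ mD).1 mF.
have ms : measurable_fun setT (fun q : measurableTypeR R * T * X => ((q.1.1, q.2), q.1.2)).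
  apply: measurable_fun_pair; last by apply: measurableT_comp; [exact: measurable_snd|exact: measurable_fst].
  apply: measurable_fun_pair; last exact: measurable_snd.
  by apply: measurableT_comp; exact: measurable_fst.
apply: eq_measurable_fun (measurableT_comp mG ms) => q _ /=.
by rewrite /patch; congr (if _ then _ else _); apply/idP/idP; rewrite !inE.
Qed.

Section entropy_of_density.
Context (R : realType) (d : nat) (L : R) (L0 : 0 < L).
Context dT (T : measurableType dT) (mu : {measure set T -> \bar R}).
Local Notation dx := (@torus_measure R d L).
Local Notation Rd := 'rV[R]_d.

Lemma measurable_rel_entropy dZ (Z : measurableType dZ) (F : Z * Rd -> R) : measurable_fun setT F ->
  measurable_fun setT (fun z => rel_entropy L (fun x => F (z, x))).
Proof.
move=> mF; apply: (@measurable_section_integral _ _ _ _ _ (@torus_fmeasure R d L)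
  (fun p => ((L ^+ d)^-1 * entropy_fun (F p * L ^+ d))%:E)).
apply/measurable_EFinP/measurable_funM => //; apply: measurable_entropy_fun.
exact: measurable_funM.
Qed.

(** At almost every parameter the integrals over the torus agree, the density having mass one and
    being square integrable; from here on only the nonnegative integrand is averaged. *)
Lemma entropyE (u : Rd -> T -> R) : measurable_fun setT (fun p : T * Rd => u p.2 p.1) ->
  {ae mu, forall xi, [/\ dx.-integrable setT (EFin \o u ^~ xi), \int[dx]_x u x xi = 1,
    {ae dx, forall x, 0 <= u x xi} & u ^~ xi \in Lfun dx 2%:E]} ->
  entropy L mu u = (\int[mu]_xi rel_entropy L (u ^~ xi))%E.
Proof.
move=> m_u Hu; apply: ae_eq_integral => //.
- apply: (@measurable_section_integral _ _ _ _ _ (@torus_fmeasure R d L)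
    (fun p : T * Rd => (u p.2 p.1 * ln (u p.2 p.1 / rho_infty d L))%:E)).
  apply/measurable_EFinP/measurable_funM => //; apply: measurableT_comp => //.
  exact: measurable_funM.
- exact: measurable_rel_entropy m_u.
- apply: filterS Hu => xi [iu mass pos u2] _.
  exact: (rel_entropyE L0 iu mass (rel_entropy_lty L0 iu pos u2)).
Qed.

End entropy_of_density.

(** * The mean entropy of a solution *)

Section graphop_solution.
Context (R : realType) (d : nat) (L : R) (L0 : 0 < L) (d0 : (0 < d)%N).
Context dT (T : measurableType dT) (mu : probability T R).
Local Notation dx := (@torus_measure R d L).
Local Notation Rd := 'rV[R]_d.
Local Notation leb := (@lebesgue_measure R).
Local Notation Ld := (L ^+ d).
Context (D : Rd -> R) (A : (T -> R) -> T -> R) (kappa : R) (kappa0 : 0 < kappa).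
Context (rho0 : Rd -> T -> R) (rho Arho : R -> Rd -> T -> R).
Hypotheses (HD : sobolev L 2 +oo D) (GA : graphop mu A) (BA : B_class mu 2%:E 2%:E A).
Hypothesis mrho0 : measurable_fun [set: Rd * T] (fun p => rho0 p.1 p.2).
Hypothesis mrho : measurable_fun [set p : measurableTypeR R * Rd * T | 0 <= p.1.1]
  (fun p => rho p.1.1 p.1.2 p.2).
Hypothesis av : action_version L mu A rho Arho.
Local Notation E := (extension mu 2%:E 2%:E A).

(** All conditions that hold at almost every parameter, gathered so that the results on a single
    curve apply outside one null set. *)
Definition regular_curve xi := [/\ C1C2 L (fun t x => rho t x xi), mv_equation L D kappa rho Arho xi,
  forall t, 0 < t -> (fun x => Arho t x xi) \in Lfun dx 1,
  prob_density L (rho0 ^~ xi) /\ rho0 ^~ xi \in Lfun dx 2%:E &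
  ('N[dx]_2%:E[EFin \o (fun x => rho t x xi - rho0 x xi)%R])%E @[t --> 0^'+] --> 0%E].

Hypothesis rho_regular : {ae mu, forall xi, regular_curve xi}.

Let c : R := 4 * pi ^+ 2 / L ^+ 2.
Let N := Linfty_norm L (wlap L D).
Let nA := numerical_radius mu A.
(** A version of [A (1 / L^d)]; with it [A rho - b] is the image of [rho - 1 / L^d]. *)
Let b xi := Ld^-1 * E (fun=> 1) xi.

Let Ld0 : 0 < Ld. Proof. by rewrite exprn_gt0. Qed.
Let Li0 : 0 <= Ld^-1. Proof. by rewrite invr_ge0 ltW. Qed.

Lemma regular_curveP xi : regular_curve xi -> forall t, 0 < t ->
  [/\ forall x, 0 <= rho t x xi, \int[dx]_x rho t x xi = 1,
      dx.-integrable setT (EFin \o (fun x => rho t x xi)) & (fun x => rho t x xi) \in Lfun dx 2%:E].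
Proof.
move=> [Hw mv Aint [u0p u02] w0] t t0.
have ia r : 0 < r -> dx.-integrable setT (EFin \o (fun x => Arho r x xi)).
  by move=> s0'; apply/Lfun1_integrable; exact: Aint.
have [per cont] := curve_continuous Hw t0.
split.
- move=> x; exact: (@curve_nonnegative R d L L0 _ _ D _ kappa Hw HD ia
    (fun s x s0 => (mv s x s0).1) (fun s x s0 => (mv s x s0).2) u0p u02 w0 t x t0).
- exact: (@curve_mass R d L L0 _ _ D _ kappa Hw HD ia
    (fun s x s0 => (mv s x s0).1) (fun s x s0 => (mv s x s0).2) u0p u02 w0 t t0).
- exact: torus_integrable_continuous.
- apply/Lfun2P; split; first exact: continuous_measurable_rV.
  apply: (torus_integrable_continuous L0) => x.
  by under eq_fun do rewrite expr2; exact: (cvgM (cont x) (cont x)).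
Qed.

Lemma regular_curve_growth xi : regular_curve xi -> forall e s t be, 0 < e < 1 -> 0 < s -> s < t ->
  measurable_fun (`[s, t]%classic : set R)
    (entropy_source L (fun t x => rho t x xi) (fun t x => Arho t x xi) D kappa e be) ->
  measurable_fun (`[s, t]%classic : set R) (fun r => rel_entropy L (fun x => rho r x xi)) ->
  (((1 - e) ^+ 2)%:E * (rel_entropy L (fun x => rho t x xi) +
      c%:E * \int[leb]_(r in `[s, t]) rel_entropy L (fun x => rho r x xi)) <=
   rel_entropy L (fun x => rho s x xi) +
   \int[leb]_(r in `[s, t])
     (entropy_source L (fun t x => rho t x xi) (fun t x => Arho t x xi) D kappa e be r)%:E +
   (- (e * ln e) * (1 + c * (t - s)))%:E)%E.
Proof.
move=> [Hw mv Aint [u0p u02] w0] e s t be e01 s0 st.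
have ia r : 0 < r -> dx.-integrable setT (EFin \o (fun x => Arho r x xi)).
  by move=> s0'; apply/Lfun1_integrable; exact: Aint.
exact: (@entropy_growth R d L L0 d0 _ _ D _ kappa kappa0 Hw HD ia
    (fun s x s0 => (mv s x s0).1) (fun s x s0 => (mv s x s0).2) u0p u02 w0 e e01 s t be s0 st).
Qed.

Lemma regular_curve_growth0 xi : regular_curve xi -> forall e t be, 0 < e < 1 -> 0 < t ->
  measurable_fun (`]0, t]%classic : set R)
    (entropy_source L (fun t x => rho t x xi) (fun t x => Arho t x xi) D kappa e be) ->
  (((1 - e) ^+ 2)%:E * rel_entropy L (fun x => rho t x xi) <=
   rel_entropy L (rho0 ^~ xi) +
   \int[leb]_(r in `]0%R, t])
     (entropy_source L (fun t x => rho t x xi) (fun t x => Arho t x xi) D kappa e be r)%:E +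
   (- (e * ln e))%:E)%E.
Proof.
move=> [Hw mv Aint [u0p u02] w0] e t be e01 t0.
have ia r : 0 < r -> dx.-integrable setT (EFin \o (fun x => Arho r x xi)).
  by move=> s0'; apply/Lfun1_integrable; exact: Aint.
exact: (@entropy_growth0 R d L L0 d0 _ _ D _ kappa kappa0 Hw HD ia
    (fun s x s0 => (mv s x s0).1) (fun s x s0 => (mv s x s0).2) u0p u02 w0 e e01 t be t0).
Qed.

(* [rho] and [Arho] extended by [0] to all times. *)
Definition rho_ext (q : measurableTypeR R * T * Rd) : R :=
  if q.1.1 \in `[0, +oo[%classic then rho q.1.1 q.2 q.1.2 else 0.

Definition Arho_ext (q : measurableTypeR R * T * Rd) : R :=
  if q.1.1 \in `]0, +oo[%classic then Arho q.1.1 q.2 q.1.2 else 0.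

Lemma rho_extE t xi : 0 <= t -> (fun x => rho_ext ((t, xi), x)) = (fun x => rho t x xi).
Proof. by move=> t0; apply/funext => x; rewrite /rho_ext mem_set//= in_itv/= andbT. Qed.

Lemma Arho_extE t xi : 0 < t -> (fun x => Arho_ext ((t, xi), x)) = (fun x => Arho t x xi).
Proof. by move=> t0; apply/funext => x; rewrite /Arho_ext mem_set//= in_itv/= andbT. Qed.

Let mrho_ext : measurable_fun setT rho_ext.
Proof.
apply: measurable_restrict_time => //.
rewrite (_ : [set p | _] = [set p : measurableTypeR R * Rd * T | 0 <= p.1.1])//.
by apply/seteqP; split => p /=; rewrite in_itv/= andbT.
Qed.

Let mArho_ext : measurable_fun setT Arho_ext.
Proof.
case: av => mA _ _ _; apply: measurable_restrict_time => //.
rewrite (_ : [set p | _] = [set p : measurableTypeR R * Rd * T | 0 < p.1.1])//.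
by apply/seteqP; split => p /=; rewrite in_itv/= andbT.
Qed.

Lemma measurable_slice t : 0 <= t -> measurable_fun setT (fun q : T * Rd => rho t q.2 q.1).
Proof.
move=> t0; have mr : measurable_fun setT (fun q : T * Rd => ((t : measurableTypeR R, q.1), q.2)).
  by apply: measurable_fun_pair => //; apply: measurable_fun_pair.
apply: eq_measurable_fun (measurableT_comp mrho_ext mr) => -[xi x] _ /=.
by have /(congr1 (@^~ x)) /= -> := rho_extE xi t0.
Qed.

Let E1L : E (fun=> 1) \in Lfun mu 2%:E.
Proof.
apply: extension_L2 => //; apply: Loo_L2; apply: (@bounded_Lfun _ _ _ _ _ 1) => //.
by apply: aeW => x; rewrite normr1.
Qed.

Let mb : measurable_fun setT b.
Proof. by apply: measurable_funM => //; exact: Lfun_measurable E1L. Qed.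

Let ell (r : R) xi := \int[dx]_x `|rho_ext ((r, xi), x) - Ld^-1|.
Let al (r : R) xi := \int[dx]_x `|Arho_ext ((r, xi), x) - b xi|.
Let Hx (r : R) xi := rel_entropy L (fun x => rho_ext ((r, xi), x)).
Let h (r : R) : \bar R := (\int[mu]_xi Hx r xi)%E.
Let ell2 (r : R) := \int[mu]_xi (ell r xi ^+ 2).
Let src e (r : R) xi := kappa * (N * (ell r xi + e * (1 - ln e)) * al r xi).
Let C1 := 2 * \int[mu]_xi `|E (fun=> 1) xi|.

Let N0 : 0 <= N. Proof. exact: Linfty_norm_ge0. Qed.
Let nA0 : 0 <= nA. Proof. exact: numerical_radius_ge0. Qed.
Let c0 : 0 <= c. Proof. by rewrite divr_ge0 ?sqr_ge0// mulr_ge0 ?sqr_ge0. Qed.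
Let C10 : 0 <= C1. Proof. by rewrite mulr_ge0// Rintegral_ge0. Qed.
Let ell0 r xi : 0 <= ell r xi. Proof. exact: Rintegral_ge0. Qed.
Let al0 r xi : 0 <= al r xi. Proof. exact: Rintegral_ge0. Qed.
Let Hx0 r xi : (0 <= Hx r xi)%E. Proof. exact: (rel_entropy_ge0 L0). Qed.
Let h0 r : (0 <= h r)%E. Proof. exact: integral_ge0. Qed.
Let ell20 r : 0 <= ell2 r. Proof. by apply: Rintegral_ge0 => x _; exact: sqr_ge0. Qed.

Let mell : measurable_fun setT (fun q : measurableTypeR R * T => ell q.1 q.2).
Proof.
have mF : measurable_fun setT (fun q => `|rho_ext q - Ld^-1|%:E).
  by apply/measurable_EFinP; apply: measurableT_comp => //; exact: measurable_funB.
have := measurable_section_integral (@torus_fmeasure R d L) mF.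
move=> /(measurableT_comp (fine_measurable measurableT)).
by apply: eq_measurable_fun => -[r xi].
Qed.

Let mal : measurable_fun setT (fun q : measurableTypeR R * T => al q.1 q.2).
Proof.
have mF : measurable_fun setT (fun q : measurableTypeR R * T * Rd => `|Arho_ext q - b q.1.2|%:E).
  apply/measurable_EFinP; apply: measurableT_comp => //; apply: measurable_funB => //.
  by apply: (measurableT_comp mb); apply: measurableT_comp; [exact: measurable_snd|exact: measurable_fst].
have := measurable_section_integral (@torus_fmeasure R d L) mF.
move=> /(measurableT_comp (fine_measurable measurableT)).
by apply: eq_measurable_fun => -[r xi].
Qed.

Let mHx : measurable_fun setT (fun q : measurableTypeR R * T => Hx q.1 q.2).
Proof.
have := @measurable_rel_entropy R d L _ _ rho_ext mrho_ext.
by apply: eq_measurable_fun => -[r xi].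
Qed.

Let msrc e : measurable_fun setT (fun q : measurableTypeR R * T => src e q.1 q.2).
Proof.
apply: measurable_funM => //; apply: measurable_funM => //; apply: measurable_funM => //.
exact: measurable_funD.
Qed.

Let mh : measurable_fun [set: R] h.
Proof.
have := measurable_fun_fubini_tonelli_F (m2 := mu) (fun q : measurableTypeR R * T => Hx q.1 q.2) mHx (fun q => Hx0 q.1 q.2).
exact.
Qed.

(** Both densities have mass one, whence the bound [2]. *)
Let ellE r xi : 0 < r -> regular_curve xi ->
  ((ell r xi)%:E = \int[dx]_x `|rho_ext ((r, xi), x) - Ld^-1|%:E)%E /\ ell r xi <= 2.
Proof.
move=> r0 /regular_curveP/(_ _ r0)[pos mass irho _].
have icst : dx.-integrable setT (EFin \o (fun=> Ld^-1)).
  by apply: (@torus_integrable_bounded R d L _ Ld^-1) => //; apply: aeW => x; rewrite ger0_norm.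
have i1 := RintegrableB irho icst; have i2 := RintegrableD irho icst.
have rE x : rho_ext ((r, xi), x) = rho r x xi by have /(congr1 (@^~ x)) := rho_extE xi (ltW r0).
have iabs : dx.-integrable setT (EFin \o (fun x => `|rho_ext ((r, xi), x) - Ld^-1|)).
  by under eq_fun do rewrite rE; have := integrable_norm i1; exact.
split; first by rewrite RintegralE.
have -> : 2 = \int[dx]_x (rho r x xi + Ld^-1).
  by rewrite RintegralD// mass torus_Rintegral_cst// mulVf ?gt_eqF//; ring.
rewrite /ell; apply: le_Rintegral => // x _.
by rewrite rE; apply: le_trans (ler_normB _ _) _; rewrite !ger0_norm.
Qed.

(** The boundedness of [ell] allows it as the weight [l] in [graphop_pairing]. *)
Let ell_Loo r : 0 < r -> ell r \in Lfun mu +oo.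
Proof.
move=> r0; apply: (@bounded_Lfun _ _ _ _ _ 2); first exact: (measurable_fun_pair2 _ mell).
by apply: filterS rho_regular => xi /(ellE r0)[_ le2]; rewrite ger0_norm.
Qed.

(** Where the integral is infinite, [al] is [0] by the convention of [fine], so this inequality
    holds at every parameter. *)
Let alE r xi : ((al r xi)%:E <= \int[dx]_x `|Arho_ext ((r, xi), x) - b xi|%:E)%E.
Proof.
have : (0 <= \int[dx]_x `|Arho_ext ((r, xi), x) - b xi|%:E)%E by apply: integral_ge0.
by rewrite /al /Rintegral; case: (\int[dx]_x _)%E => //= _; rewrite leey.
Qed.

(** [graphop_pairing] for [F = rho - 1 / L^d]. Linearity of the extension, at each fixed [x],
    identifies [Arho - b] with the image of [F] for almost every parameter. *)
Let pairing r (l : T -> R) : 0 < r -> l \in Lfun mu +oo -> (forall xi, 0 <= l xi) ->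
  (\int[mu]_xi (l xi * al r xi)%:E <= \int[mu]_xi (`|E l xi| * ell r xi)%:E)%E.
Proof.
move=> r0 lo l0; have ml := Lfun_measurable lo; have lL := Loo_L2 lo.
have mEl := Lfun_measurable (extension_L2 GA BA lL).
case: av => _ rL AE _.
have one : (fun=> 1) \in Lfun mu 2%:E.
  by apply: Loo_L2; apply: (@bounded_Lfun _ _ _ _ _ 1) => //; apply: aeW => x; rewrite normr1.
pose F (q : T * Rd) := rho_ext ((r, q.1), q.2) - Ld^-1.
pose G (q : T * Rd) := Arho_ext ((r, q.1), q.2) - b q.1.
have mr : measurable_fun setT (fun q : T * Rd => ((r : measurableTypeR R, q.1), q.2)).
  by apply: measurable_fun_pair => //; apply: measurable_fun_pair.
have mF : measurable_fun setT F by apply: measurable_funB => //; exact: (measurableT_comp mrho_ext mr).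
have mG : measurable_fun setT G.
  by apply: measurable_funB; [exact: (measurableT_comp mArho_ext mr)|exact: (measurableT_comp mb)].
have FE x : (fun xi => F (xi, x)) = (fun xi => - Ld^-1 * 1 + rho r x xi).
  by apply/funext => xi; rewrite /F mulr1 addrC; have /(congr1 (@^~ x)) /= -> := rho_extE xi (ltW r0).
have FL x : (fun xi => F (xi, x)) \in Lfun mu 2%:E by rewrite FE; apply: Lfun2_lin => //; exact: rL.
have GE x : {ae mu, forall xi, G (xi, x) = E (fun xi => F (xi, x)) xi}.
  rewrite FE; apply: filterS2 (extension_lin GA BA (- Ld^-1) one (rL r x r0)) (AE r x r0) => xi -> h1.
  rewrite /G; have /(congr1 (@^~ x)) /= -> := Arho_extE xi r0; rewrite h1// /b; ring.
have P := graphop_pairing (@torus_fmeasure R d L) GA BA mF mG FL GE lo l0.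
have mellr : measurable_fun setT (ell r) by exact: (measurable_fun_pair2 _ mell).
have malr : measurable_fun setT (al r) by exact: (measurable_fun_pair2 _ mal).
have mFn : measurable_fun setT (fun xi => (\int[dx]_x `|F (xi, x)|%:E)%E).
  apply: (@measurable_section_integral _ _ _ _ _ (@torus_fmeasure R d L) (fun q => `|F q|%:E)).
  by apply/measurable_EFinP; exact: measurableT_comp.
have mGn : measurable_fun setT (fun xi => (\int[dx]_x `|G (xi, x)|%:E)%E).
  apply: (@measurable_section_integral _ _ _ _ _ (@torus_fmeasure R d L) (fun q => `|G q|%:E)).
  by apply/measurable_EFinP; exact: measurableT_comp.
have mEln : measurable_fun setT (fun xi => `|E l xi|) by exact: measurableT_comp.
apply: (@le_trans _ _ (\int[mu]_xi ((l xi)%:E * \int[dx]_x `|G (xi, x)|%:E))%E).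
  apply: ge0_le_integral => //.
  - by move=> xi _; rewrite lee_fin mulr_ge0.
  - by apply/measurable_EFinP; exact: measurable_funM.
  - by apply: emeasurable_funM => //; exact/measurable_EFinP.
  - by move=> xi _; rewrite EFinM; apply: lee_wpmul2l; [rewrite lee_fin|exact: alE].
apply: le_trans P _; rewrite le_eqVlt; apply/orP; left; apply/eqP.
apply: ge0_ae_eq_integral => //.
- by apply: emeasurable_funM => //; exact/measurable_EFinP.
- by apply/measurable_EFinP; exact: measurable_funM.
- by move=> xi _; apply: mule_ge0; [rewrite lee_fin|exact: integral_ge0].
- by move=> xi _; rewrite lee_fin mulr_ge0.
- by apply: filterS rho_regular => xi /(ellE r0)[e1 _] _; rewrite EFinM e1.
Qed.

(** [pairing] with the weight [ell] itself. Its image is nonnegative, so the absolute value drops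
    and the quadratic form of the extension appears. *)
Let ell_al r : 0 < r -> (\int[mu]_xi (ell r xi * al r xi)%:E <= (nA * ell2 r)%:E)%E.
Proof.
move=> r0; have lo := ell_Loo r0; have lL := Loo_L2 lo; have EL := extension_L2 GA BA lL.
apply: le_trans (pairing r0 lo (ell0 r)) _.
have i1 := L2_mul_integrable EL lL.
have Ep : {ae mu, forall xi, 0 <= E (ell r) xi} by apply: extension_ge0 => //; exact: aeW.
have -> : (\int[mu]_xi (`|E (ell r) xi| * ell r xi)%:E = \int[mu]_xi (E (ell r) xi * ell r xi)%:E)%E.
  apply: ae_eq_integral => //.
  - apply/measurable_EFinP/measurable_funM; last exact: Lfun_measurable lL.
    by apply: measurableT_comp => //; exact: Lfun_measurable EL.
  - exact: measurable_int i1.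
  - by apply: filterS Ep => xi e0 _; rewrite ger0_norm.
by rewrite -(RintegralE i1) lee_fin; exact: numerical_radius_bound.
Qed.

(** [pairing] with the weight [1], and [ell <= 2]; hence the [2] in [C1]. *)
Let int_al r : 0 < r -> (\int[mu]_xi (al r xi)%:E <= C1%:E)%E.
Proof.
move=> r0; have oo : (fun=> 1) \in Lfun mu +oo.
  by apply: (@bounded_Lfun _ _ _ _ _ 1) => //; apply: aeW => x; rewrite normr1.
have := pairing r0 oo (fun=> ler01); under eq_integral do rewrite mul1r.
move=> P; apply: le_trans P _; have iE := integrable_norm (L2_integrable E1L).
have i2 := RintegrableZ 2 iE; rewrite /C1 -(RintegralZl _ _ iE)// (RintegralE i2).
have mellr := Lfun_measurable (ell_Loo r0).
apply: ae_ge0_le_integral => //.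
- by move=> xi _; rewrite lee_fin mulr_ge0.
- by apply/measurable_EFinP; apply: measurable_funM => //; exact: Rintegrable_measurable iE.
- by move=> xi _; rewrite lee_fin/= mulr_ge0.
- exact: measurable_int i2.
- by apply: filterS rho_regular => xi /(ellE r0)[_ l2] _; rewrite lee_fin mulrC ler_wpM2r.
Qed.

(** Pinsker's inequality averaged over the parameter. *)
Let ell2_entropy r : 0 < r -> ((ell2 r)%:E <= 2%:E * h r)%E.
Proof.
move=> r0; have /Lfun2P[_ i2] := Loo_L2 (ell_Loo r0); rewrite (RintegralE i2).
rewrite /h -(ge0_integralZl _ _ (measurable_fun_pair2 _ mHx))//.
apply: ae_ge0_le_integral => //.
- by move=> xi _; rewrite lee_fin sqr_ge0.
- exact: measurable_int i2.
- by move=> xi _; rewrite mule_ge0.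
- by apply: measurable_funeM; exact: (measurable_fun_pair2 _ mHx).
apply: filterS rho_regular => xi /regular_curveP/(_ _ r0)[pos mass irho _] _.
rewrite /ell /Hx/= (rho_extE xi (ltW r0)); have := pinsker L0 irho (aeW _ pos) mass.
suff -> : \int[dx]_x `|rho_ext (r, xi, x) - Ld^-1| = \int[dx]_x `|rho r x xi - Ld^-1| by [].
by apply: eq_Rintegral => x _; have /(congr1 (@^~ x)) /= -> := rho_extE xi (ltW r0).
Qed.

Let ell2_le r : 0 < r -> ell2 r <= 4.
Proof.
move=> r0; have /Lfun2P[_ i2] := Loo_L2 (ell_Loo r0).
have i4 : mu.-integrable setT (EFin \o (fun=> 4 : R)).
  by apply: (@Rintegrable_bounded _ _ _ _ _ 4) => //; [have := @probability_setT _ _ _ mu => /= ->; rewrite ltry|apply: aeW => x; rewrite ger0_norm].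
have -> : 4 = \int[mu]_(x in [set: T]) (4 : R).
  by rewrite Rintegral_cst//; have := @probability_setT _ _ _ mu => /= ->; rewrite mulr1.
rewrite -lee_fin (RintegralE i2) (RintegralE i4); apply: ae_ge0_le_integral => //.
- by move=> xi _; rewrite lee_fin sqr_ge0.
- exact: measurable_int i2.
apply: filterS rho_regular => xi /(ellE r0)[_ l2] _; rewrite lee_fin.
by have := ell0 r xi; nra.
Qed.

Let int_src e r : 0 < e < 1 -> 0 < r ->
  (\int[mu]_xi (src e r xi)%:E <= (kappa * N * (nA * ell2 r + e * (1 - ln e) * C1))%:E)%E.
Proof.
move=> /andP[e0 e1] r0; have le0 : ln e <= 0 by apply: ln_le0; exact: ltW.
have d1 : 0 <= e * (1 - ln e) by apply: mulr_ge0; lra.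
have mellr := Lfun_measurable (ell_Loo r0).
have malr : measurable_fun setT (al r) by exact: (measurable_fun_pair2 _ mal).
have kN : 0 <= kappa * N by rewrite mulr_ge0// ltW.
have -> : (\int[mu]_xi (src e r xi)%:E = (kappa * N)%:E * (\int[mu]_xi (ell r xi * al r xi)%:E +
    (e * (1 - ln e))%:E * \int[mu]_xi (al r xi)%:E))%E.
  have ma : measurable_fun setT (fun xi => (al r xi)%:E) by exact/measurable_EFinP.
  have mla : measurable_fun setT (fun xi => (ell r xi * al r xi)%:E).
    by apply/measurable_EFinP; exact: measurable_funM.
  rewrite -(ge0_integralZl _ _ ma)//; [|by move=> xi _; rewrite lee_fin].
  rewrite -ge0_integralD//; [|by move=> xi _; rewrite lee_fin mulr_ge0|by move=> xi _; rewrite -EFinM lee_fin mulr_ge0|exact: measurable_funeM].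
  rewrite -ge0_integralZl//.
  - apply: eq_integral => xi _.
    transitivity ((kappa * N * (ell r xi * al r xi + e * (1 - ln e) * al r xi))%:E) => //.
    by congr EFin; rewrite /src; ring.
  - by apply: emeasurable_funD => //; exact: measurable_funeM.
  - by move=> xi _; rewrite -EFinM -EFinD lee_fin addr_ge0// mulr_ge0.
rewrite [leRHS]EFinM; apply: lee_wpmul2l; first by rewrite lee_fin.
rewrite EFinD; apply: leeD; first exact: ell_al.
by rewrite [leRHS]EFinM; apply: lee_wpmul2l; [rewrite lee_fin|exact: int_al].
Qed.

Let entropy_sourceE e r xi : 0 < r ->
  entropy_source L (fun t x => rho t x xi) (fun t x => Arho t x xi) D kappa e (b xi) r = src e r xi.
Proof.
move=> r0; rewrite /entropy_source /src /ell /al; congr (_ * (_ * (_ + _) * _)).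
  by apply: eq_Rintegral => x _; have /(congr1 (@^~ x)) /= -> := rho_extE xi (ltW r0).
by apply: eq_Rintegral => x _; have /(congr1 (@^~ x)) /= -> := Arho_extE xi r0.
Qed.

Let HxE r xi : 0 < r -> rel_entropy L (fun x => rho r x xi) = Hx r xi.
Proof. by move=> r0; rewrite /Hx rho_extE ?ltW. Qed.

Let src_ge0 e r xi : 0 < e < 1 -> 0 <= src e r xi.
Proof.
move=> /andP[e0 e1]; have le0 : ln e <= 0 by apply: ln_le0; exact: ltW.
have d1 : 0 <= e * (1 - ln e) by apply: mulr_ge0; lra.
rewrite /src; apply: mulr_ge0; first exact: ltW.
by apply: mulr_ge0 => //; apply: mulr_ge0 => //; exact: addr_ge0.
Qed.

Let msrc_in e xi (S : set R) : measurable S -> (forall r, S r -> 0 < r) ->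
  measurable_fun S (entropy_source L (fun t x => rho t x xi) (fun t x => Arho t x xi) D kappa e (b xi)).
Proof.
move=> mS S0; apply: (@eq_measurable_fun _ _ _ _ _ (fun r => src e r xi)).
  by move=> r; rewrite inE => /S0 r0; rewrite entropy_sourceE.
by apply: measurable_funTS; have := measurable_fun_pair1 xi (msrc e).
Qed.

Let int1 (k : R) : (\int[mu]_(xi in [set: T]) k%:E = k%:E)%E.
Proof. by rewrite integral_cst//; have := @probability_setT _ _ _ mu => /= ->; rewrite mule1. Qed.

(** Brings the remainders of the balances to the form required by [lee_regularization]. *)
Let remainder_le (e k : R) : 0 < e < 1 -> 0 <= k -> - (e * ln e) * k <= e * (1 - ln e) * k.
Proof. by move=> /andP[e0 _] k0; apply: ler_wpM2r => //; lra. Qed.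

Let mHr r : measurable_fun setT (Hx r).
Proof. exact: (measurable_fun_pair2 _ mHx). Qed.

(** For fixed [e] the balances are integrated over the parameter, where [int_src] bounds the mean of
    the source at each time; [e] tends to [0] only afterwards. Tonelli's theorem exchanges time and
    parameter in both time integrals. *)
Lemma mean_entropy_growth s t : 0 < s -> s < t ->
  (h t + c%:E * \int[leb]_(r in `[s, t]) h r <=
   h s + (2 * kappa * N * nA)%:E * \int[leb]_(r in `[s, t]) h r)%E.
Proof.
move=> s0 st; have t0 : 0 < t by exact: lt_trans st.
have kN : 0 <= kappa * N by rewrite mulr_ge0// ltW.
have ts0 : 0 <= t - s by lra.
have k0 : 0 <= 1 + c * (t - s) by rewrite addr_ge0// mulr_ge0.
have pos r : (`[s, t]%classic : set R) r -> 0 < r.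
  by rewrite /= in_itv/= => /andP[sr _]; exact: lt_le_trans sr.
have lE : leb (`[s, t]%classic : set R) = (t - s)%:E by rewrite lebesgue_measure_itv/= lte_fin st.
have mst : measurable (`[s, t]%classic : set (measurableTypeR R)) by exact: measurable_itv.
have mI := measurable_tonelli_in (leb : {sigma_finite_measure set (measurableTypeR R) -> \bar R}) mst mHx (fun q => Hx0 q.1 q.2).
(* The multiplier collects the part [kappa N C1 (t - s)] due to the source and the part
   [1 + c (t - s)] of the remainder in [entropy_growth]. *)
apply: (@lee_regularization _ _ _ (kappa * N * C1 * (t - s) + (1 + c * (t - s)))) => e e01.
have /andP[e0 e1] := e01; have le0 : ln e <= 0 by apply: ln_le0; exact: ltW.
have d1 : 0 <= e * (1 - ln e) by apply: mulr_ge0; lra.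
have eln : 0 <= - (e * ln e) by rewrite oppr_ge0 mulr_ge0_le0// ltW.
have ms : measurable_fun setT (fun q : measurableTypeR R * T => (src e q.1 q.2)%:E) by exact/measurable_EFinP.
have s00 (q : measurableTypeR R * T) : (0 <= (src e q.1 q.2)%:E)%E by rewrite lee_fin src_ge0.
have mS := measurable_tonelli_in (leb : {sigma_finite_measure set (measurableTypeR R) -> \bar R}) mst ms s00.
have G : {ae mu, forall xi, (((1 - e) ^+ 2)%:E * (Hx t xi + c%:E * \int[leb]_(r in `[s, t]) Hx r xi) <=
    Hx s xi + \int[leb]_(r in `[s, t]) (src e r xi)%:E + (- (e * ln e) * (1 + c * (t - s)))%:E)%E}.
  apply: filterS rho_regular => xi /regular_curve_growth/(_ e s t (b xi) e01 s0 st (msrc_in e xi mst pos)).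
  have -> : (\int[leb]_(r in `[s, t]) rel_entropy L (fun x => rho r x xi) = \int[leb]_(r in `[s, t]) Hx r xi)%E.
    by apply: eq_integral => r; rewrite inE => /pos r0; rewrite HxE.
  have -> : (\int[leb]_(r in `[s, t]) (entropy_source L (fun t x => rho t x xi) (fun t x => Arho t x xi) D kappa e (b xi) r)%:E
      = \int[leb]_(r in `[s, t]) (src e r xi)%:E)%E.
    by apply: eq_integral => r; rewrite inE => /pos r0; rewrite entropy_sourceE.
  rewrite !HxE//; apply.
  apply: (@eq_measurable_fun _ _ _ _ _ (fun r => Hx r xi)).
    by move=> r; rewrite inE => /pos r0; rewrite HxE.
  by apply: measurable_funTS; have := measurable_fun_pair1 xi mHx.
have I0 xi : (0 <= \int[leb]_(r in `[s, t]) Hx r xi)%E by apply: integral_ge0.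
have S0 xi : (0 <= \int[leb]_(r in `[s, t]) (src e r xi)%:E)%E by apply: integral_ge0 => r _; exact: (s00 (r, xi)).
have cI : (0 <= c%:E)%E by rewrite lee_fin.
have L1 : (((1 - e) ^+ 2)%:E * (h t + c%:E * \int[leb]_(r in `[s, t]) h r) =
    \int[mu]_xi (((1 - e) ^+ 2)%:E * (Hx t xi + c%:E * \int[leb]_(r in `[s, t]) Hx r xi)))%E.
  rewrite ge0_integralZl//; last 3 first.
  - by apply: emeasurable_funD => //; exact: measurable_funeM.
  - by move=> xi _; apply: adde_ge0 => //; exact: mule_ge0.
  - by rewrite lee_fin sqr_ge0.
  rewrite ge0_integralD//; last 2 first.
  - by move=> xi _; exact: mule_ge0.
  - exact: measurable_funeM.
  rewrite ge0_integralZl//; congr (_ * (_ + _ * _))%E.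
  exact: (tonelli_in (leb : {sigma_finite_measure set (measurableTypeR R) -> \bar R}) mu mst mHx (fun q => Hx0 q.1 q.2)).
rewrite L1; apply: (@le_trans _ _ (\int[mu]_xi (Hx s xi + \int[leb]_(r in `[s, t]) (src e r xi)%:E +
    (- (e * ln e) * (1 + c * (t - s)))%:E))%E).
  apply: ae_ge0_le_integral => //.
  - move=> xi _; apply: mule_ge0; first by rewrite lee_fin sqr_ge0.
    by apply: adde_ge0 => //; exact: mule_ge0.
  - by apply: measurable_funeM; apply: emeasurable_funD => //; exact: measurable_funeM.
  - by move=> xi _; apply: adde_ge0; [exact: adde_ge0|rewrite lee_fin; exact: mulr_ge0].
  - by apply: emeasurable_funD => //; exact: emeasurable_funD.
  - by apply: filterS G => xi Gxi _.
rewrite ge0_integralD//; last 3 first.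
- by move=> xi _; exact: adde_ge0.
- exact: emeasurable_funD.
- by move=> xi _; rewrite lee_fin mulr_ge0.
rewrite int1 ge0_integralD//.
rewrite -[X in (_ + X + _)%E](tonelli_in (leb : {sigma_finite_measure set (measurableTypeR R) -> \bar R}) mu mst ms s00)/=.
(* The product term of the source becomes [nA ell2], and [ell2 <= 2 h] turns it into a multiple of
   the mean entropy; this is the origin of the factor [2 kappa N nA]. *)
have key : (\int[leb]_(r in `[s, t]) \int[mu]_xi (src e r xi)%:E <=
    (2 * kappa * N * nA)%:E * \int[leb]_(r in `[s, t]) h r + (kappa * N * C1 * (t - s) * (e * (1 - ln e)))%:E)%E.
  have q0 : 0 <= 2 * kappa * N * nA by rewrite -mulrA mulr_ge0// ?mulr_ge0// ltW.
  have p0 : 0 <= kappa * N * C1 * (e * (1 - ln e)) by apply: mulr_ge0 => //; exact: mulr_ge0.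
  have mhs : measurable_fun (`[s, t]%classic : set R) h by exact: measurable_funTS.
  apply: (@le_trans _ _ (\int[leb]_(r in `[s, t]) ((2 * kappa * N * nA)%:E * h r + (kappa * N * C1 * (e * (1 - ln e)))%:E))%E).
    apply: ge0_le_integral => //.
    - by move=> r _; apply: integral_ge0 => xi _; exact: (s00 (r, xi)).
    - apply: measurable_funTS; exact: (measurable_fun_fubini_tonelli_F (m2 := mu) _ ms s00).
    - by apply: emeasurable_funD => //; exact: measurable_funeM.
    move=> r /pos r0; apply: le_trans (int_src e01 r0) _.
    have -> : kappa * N * (nA * ell2 r + e * (1 - ln e) * C1) = kappa * N * nA * ell2 r + kappa * N * C1 * (e * (1 - ln e)) by ring.
    rewrite EFinD; apply: leeD => //.
    have -> : 2 * kappa * N * nA = kappa * N * nA * 2 by ring.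
    rewrite [(_ * ell2 r)%:E]EFinM [(_ * 2)%:E]EFinM -muleA; apply: lee_wpmul2l; last exact: ell2_entropy.
    by rewrite lee_fin mulr_ge0.
  rewrite ge0_integralD//; last 2 first.
  - by move=> r _; exact: mule_ge0.
  - exact: measurable_funeM.
  rewrite ge0_integralZl// leeD2l// integral_cst//; have := lE => /= ->.
  by rewrite -EFinM lee_fin le_eqVlt; apply/orP; left; apply/eqP; ring.
apply: le_trans (leeD (leeD (lexx _) key) (lexx _)) _.
apply: (@le_trans _ _ (h s + (2 * kappa * N * nA)%:E * \int[leb]_(r in `[s, t]) h r +
    (kappa * N * C1 * (t - s) * (e * (1 - ln e)) + - (e * ln e) * (1 + c * (t - s)))%:E)%E).
  by rewrite EFinD !addeA.
by rewrite leeD2l// lee_fin; have := remainder_le e01 k0; lra.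
Qed.

(** Here the source is bounded crudely by [ell2 <= 4], independently of the entropy; the outcome is
    the linear bound required by [ereal_gronwall]. *)
Lemma mean_entropy_growth0 t : 0 < t ->
  (h t <= \int[mu]_xi rel_entropy L (rho0 ^~ xi) + (4 * kappa * N * nA * t)%:E)%E.
Proof.
move=> t0.
have kN : 0 <= kappa * N by rewrite mulr_ge0// ltW.
have pos r : (`]0, t]%classic : set R) r -> 0 < r by rewrite /= in_itv/= => /andP[].
have lE : leb (`]0, t]%classic : set R) = t%:E by rewrite lebesgue_measure_itv/= lte_fin t0 oppr0 adde0.
have mst : measurable (`]0, t]%classic : set (measurableTypeR R)) by exact: measurable_itv.
have m0 : measurable_fun setT (fun xi => rel_entropy L (rho0 ^~ xi)).
  apply: (@measurable_rel_entropy R d L _ _ (fun q : T * Rd => rho0 q.2 q.1)).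
  have msw : measurable_fun [set: T * Rd] (fun q => (q.2, q.1)).
    by apply: measurable_fun_pair; [exact: measurable_snd|exact: measurable_fst].
  exact: (measurableT_comp mrho0 msw).
have r00 xi : (0 <= rel_entropy L (rho0 ^~ xi))%E by exact: rel_entropy_ge0.
apply: (@lee_regularization _ _ _ (kappa * N * C1 * t + 1)) => e e01.
have /andP[e0 e1] := e01; have le0 : ln e <= 0 by apply: ln_le0; exact: ltW.
have d1 : 0 <= e * (1 - ln e) by apply: mulr_ge0; lra.
have eln : 0 <= - (e * ln e) by rewrite oppr_ge0 mulr_ge0_le0// ltW.
have ms : measurable_fun setT (fun q : measurableTypeR R * T => (src e q.1 q.2)%:E) by exact/measurable_EFinP.
have s00 (q : measurableTypeR R * T) : (0 <= (src e q.1 q.2)%:E)%E by rewrite lee_fin src_ge0.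
have mS := measurable_tonelli_in (leb : {sigma_finite_measure set (measurableTypeR R) -> \bar R}) mst ms s00.
have S0 xi : (0 <= \int[leb]_(r in `]0%R, t]) (src e r xi)%:E)%E by apply: integral_ge0 => r _; exact: (s00 (r, xi)).
rewrite /h -ge0_integralZl//; last by rewrite lee_fin sqr_ge0.
apply: (@le_trans _ _ (\int[mu]_xi (rel_entropy L (rho0 ^~ xi) + \int[leb]_(r in `]0%R, t]) (src e r xi)%:E +
    (- (e * ln e))%:E))%E).
  apply: ae_ge0_le_integral => //.
  - by move=> xi _; apply: mule_ge0 => //; rewrite lee_fin sqr_ge0.
  - exact: measurable_funeM.
  - by move=> xi _; apply: adde_ge0; [exact: adde_ge0|rewrite lee_fin].
  - by apply: emeasurable_funD => //; exact: emeasurable_funD.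
  - apply: filterS rho_regular => xi /regular_curve_growth0/(_ e t (b xi) e01 t0 (msrc_in e xi mst pos)) G _.
    move: G; rewrite (@HxE t xi t0).
    suff -> : (\int[leb]_(r in `]0%R, t]) (entropy_source L (fun t x => rho t x xi) (fun t x => Arho t x xi) D kappa e (b xi) r)%:E
      = \int[leb]_(r in `]0%R, t]) (src e r xi)%:E)%E by [].
    by apply: eq_integral => r; rewrite inE => /pos r0; rewrite entropy_sourceE.
rewrite ge0_integralD//; last 2 first.
- by move=> xi _; exact: adde_ge0.
- exact: emeasurable_funD.
rewrite int1 ge0_integralD//.
rewrite -[X in (_ + X + _)%E](tonelli_in (leb : {sigma_finite_measure set (measurableTypeR R) -> \bar R}) mu mst ms s00)/=.
have key : (\int[leb]_(r in `]0%R, t]) \int[mu]_xi (src e r xi)%:E <=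
    (4 * kappa * N * nA * t + kappa * N * C1 * t * (e * (1 - ln e)))%:E)%E.
  have q0 : 0 <= 4 * kappa * N * nA + kappa * N * C1 * (e * (1 - ln e)).
    have := mulr_ge0 kN nA0; have := mulr_ge0 (mulr_ge0 kN C10) d1; lra.
  apply: (@le_trans _ _ (\int[leb]_(r in `]0%R, t]) (4 * kappa * N * nA + kappa * N * C1 * (e * (1 - ln e)))%:E)%E).
    apply: ge0_le_integral => //.
    - by move=> r _; apply: integral_ge0 => xi _; exact: (s00 (r, xi)).
    - apply: measurable_funTS; exact: (measurable_fun_fubini_tonelli_F (m2 := mu) _ ms s00).
    move=> r /pos r0; apply: le_trans (int_src e01 r0) _.
    rewrite lee_fin; have := ler_wpM2l (mulr_ge0 kN nA0) (ell2_le r0); lra.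
  rewrite integral_cst//; have := lE => /= ->.
  by rewrite -EFinM lee_fin le_eqVlt; apply/orP; left; apply/eqP; ring.
apply: le_trans (leeD (leeD (lexx _) key) (lexx _)) _.
set K := (\int[mu]_x rel_entropy L (rho0 ^~ x))%E; rewrite -(addeA K) -(addeA K) -!EFinD leeD2l// lee_fin.
by have := @remainder_le e 1 e01 ler01; lra.
Qed.

Lemma mean_entropy_decay : (\int[mu]_xi rel_entropy L (rho0 ^~ xi) < +oo)%E ->
  0 < c - 2 * kappa * N * nA -> forall t, 0 < t ->
  (\int[mu]_xi rel_entropy L (fun x => rho t x xi) <=
   (expR (- (c - 2 * kappa * N * nA) * t))%:E * \int[mu]_xi rel_entropy L (rho0 ^~ xi))%E.
Proof.
move=> Hoo; rewrite subr_gt0 => al_pos t t0.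
have r00 : (0 <= \int[mu]_xi rel_entropy L (rho0 ^~ xi))%E by apply: integral_ge0 => xi _; exact: rel_entropy_ge0.
have g0 := mean_entropy_growth0.
move: Hoo r00 g0; case: (\int[mu]_xi rel_entropy L (rho0 ^~ xi))%E => [H0| |]// _ H00 g0.
have C0 : 0 <= 4 * kappa * N * nA by rewrite -!mulrA !mulr_ge0// ltW.
have := ereal_gronwall al_pos mh h0 mean_entropy_growth C0 g0 t0.
have -> : (h t = \int[mu]_xi rel_entropy L (fun x => rho t x xi))%E.
  by apply: eq_integral => xi _; rewrite HxE.
by rewrite EFinM.
Qed.

End graphop_solution.

Theorem theorem15 (R : realType) (d : nat) (L : R)
    (Omega : ptopologicalType)
    (mu : probability (g_sigma_algebraType (@open Omega)) R)
    (D : 'rV[R]_d -> R)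
    (A : (g_sigma_algebraType (@open Omega) -> R) ->
         g_sigma_algebraType (@open Omega) -> R)
    (kappa : R)
    (rho0 : 'rV[R]_d -> g_sigma_algebraType (@open Omega) -> R)
    (rho : R -> 'rV[R]_d -> g_sigma_algebraType (@open Omega) -> R) :
  let normLap := Linfty_norm L (wlap L D) in
  let nA := numerical_radius mu A in
  let alpha := 4 * pi ^+ 2 / L ^+ 2 - 2 * kappa * normLap * nA in
  (0 < d)%N ->
  0 < L ->
  measure_support mu = setT ->
  sobolev L 2 +oo D ->
  graphop mu A ->
  B_class mu 2%:E 2%:E A ->
  admissible L mu rho0 ->
  (entropy L mu rho0 < +oo)%E ->
  0 < kappa ->
  (L ^+ 2 * normLap * nA != 0 ->
    kappa < 2 * pi ^+ 2 / (L ^+ 2 * normLap * nA)) ->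
  classical_solution L mu D A kappa rho0 rho ->
  0 < alpha /\
  forall t, 0 <= t ->
    (entropy L mu (rho t) <= (expR (- alpha * t))%:E * entropy L mu rho0)%E.
Proof.
move=> N nA alpha d0 L0 _ HD GA BA [mrho0 rho0_reg _] Hoo kappa0 kappa_lt [mrho [Arho av sol] init lim].
have N0 : 0 <= N by exact: Linfty_norm_ge0.
have nA0 : 0 <= nA by exact: numerical_radius_ge0.
have L20 : 0 < L ^+ 2 by rewrite exprn_gt0.
have al0 : 0 < alpha.
  (* A vanishing denominator stands for an infinite bound on [kappa]; the interaction term of
     [alpha] then vanishes as well. *)
  have [z|nz] := eqVneq (L ^+ 2 * N * nA) 0.
    have z' : N * nA = 0 by apply: (mulfI (lt0r_neq0 L20)); rewrite mulr0 mulrA.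
    rewrite /alpha -(mulrA _ N) z' mulr0 subr0.
    by rewrite divr_gt0// mulr_gt0// exprn_gt0// pi_gt0.
  have p : 0 < L ^+ 2 * N * nA by rewrite lt_neqAle eq_sym nz/= !mulr_ge0// ltW.
  have := kappa_lt nz; rewrite ltr_pdivlMr// => h.
  have -> : alpha = 2 * (2 * pi ^+ 2 - kappa * (L ^+ 2 * N * nA)) / L ^+ 2.
    by rewrite /alpha; field; rewrite gt_eqF.
  by rewrite divr_gt0// mulr_gt0// subr_gt0.
pose T := g_sigma_algebraType (@open Omega).
have reg : {ae mu, forall xi, regular_curve L D kappa rho0 rho Arho xi}.
  case: av => _ _ _ AL1; apply: filterS2 (filterI sol rho0_reg) (filterI lim AL1) => xi [[Hw mv] [sob prob]] [w0 A1].
  by split => //; split => //; case: sob.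
have m0 : measurable_fun setT (fun p : T * 'rV[R]_d => rho0 p.2 p.1).
  have msw : measurable_fun [set: T * 'rV[R]_d] (fun q => (q.2, q.1)).
    by apply: measurable_fun_pair; [exact: measurable_snd|exact: measurable_fst].
  exact: (measurableT_comp mrho0 msw).
have rho0_prop : {ae mu, forall xi, [/\ (torus_measure d L).-integrable setT (EFin \o rho0 ^~ xi),
    \int[torus_measure d L]_x rho0 x xi = 1, {ae torus_measure d L, forall x, 0 <= rho0 x xi} &
    rho0 ^~ xi \in Lfun (torus_measure d L) 2%:E]}.
  apply: filterS rho0_reg => xi [[_ u2 _] [u1 pos mass]]; split => //.
  exact/Lfun1_integrable.
have E0 : entropy L mu rho0 = (\int[mu]_xi rel_entropy L (rho0 ^~ xi))%E by exact: entropyE.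
(* At time [0] the solution equals its datum at almost every parameter, and the exponential is [1];
   positive times are covered by [mean_entropy_decay]. *)
split=> // t; rewrite le_eqVlt => /predU1P[<-|t0].
  rewrite mulr0 expR0 mul1e E0 le_eqVlt; apply/orP; left; apply/eqP.
  have mt := measurable_slice mrho (lexx 0).
  rewrite (entropyE L0 mt); last first.
    apply: filterS2 rho0_prop init => xi [iu mass pos u2] h.
    have -> : (fun x => rho 0 x xi) = rho0 ^~ xi by apply/funext.
    by split => //; apply: filterS pos => x; rewrite h.
  apply: ae_eq_integral => //.
  - exact: measurable_rel_entropy mt.
  - exact: measurable_rel_entropy m0.
  - by apply: filterS init => xi h _; congr rel_entropy; apply/funext.
have mt := measurable_slice mrho (ltW t0).
have Et : entropy L mu (rho t) = (\int[mu]_xi rel_entropy L (rho t ^~ xi))%E.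
  apply: entropyE => //; apply: filterS reg => xi h.
  have [pos mass irho u2] := regular_curveP L0 HD h t0.
  by split => //; exact: aeW.
rewrite Et E0; rewrite E0 in Hoo.
exact: (@mean_entropy_decay R d L L0 d0 _ _ mu D A kappa kappa0 rho0 rho Arho HD GA BA mrho0 mrho av reg Hoo al0 t t0).
Qed.
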